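(* Let $F(z)=\sum_{k=0}^\infty\zeta_k\frac{z^k}{\sqrt{k!}}$ be the Gaussian Entire Function and $X_z=\log|F(z)|-\frac12|z|^2+\frac12\gamma_{\text{Euler}}$ for $z\in\mathbb C$. Let $\sigma_X=\frac12\sqrt{\pi\zeta(3)}$. Then for every continuous compactly supported function $h:\mathbb C\to\mathbb R$, the distribution of the random variable $\frac1r\int_{\mathbb C}h\left(\frac1r z\right)X_z\,dz$ converges (weakly), as $r\to\infty$, to the normal distribution $N(0,\|h\|^2\sigma_X^2)$.
   Context: $\zeta_0,\zeta_1,\dots$ are i.i.d. complex-valued random variables, each with a two-dimensional rotation-invariant centered normal distribution with $\mathbb E|\zeta_k|^2=1$. $\gamma_{\text{Euler}}=0.577\dots$ is the Euler(-Mascheroni) constant; $\zeta(\cdot)$ in $\zeta(3)$ is Riemann's zeta-function. $dz$ denotes Lebesgue (area) measure on $\mathbb C$, and $\|h\|^2=\int_{\mathbb C}h^2(z)\,dz$. $N(0,v)$ is the normal distribution with mean $0$ and variance $v$. *)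

(* Defs.v *)
From HB Require Import structures.
From mathcomp Require Import all_boot all_order all_algebra finmap complex.
From mathcomp Require Import all_classical all_reals all_analysis measurable_realfun ring lra.
Set Implicit Arguments.
Unset Strict Implicit.
Unset Printing Implicit Defensive.
Import Order.TTheory GRing.Theory Num.Theory numFieldNormedType.Exports.
Import ComplexField.Normc.
Local Open Scope classical_set_scope.
Local Open Scope complex_scope.
Local Open Scope ring_scope.

(* [R[i]^o] is [R[i]] with the topology given by the modulus; [borelC R] is the
   same type with the Borel sigma-algebra of that topology. *)
Definition borelC (R : realType) := g_sigma_algebraType (@open R[i]^o).

Definition toC (R : realType) (p : measurableTypeR R * measurableTypeR R) : borelC R := p.1 +i* p.2.

Lemma measurable_toC (R : realType) : measurable_fun setT (@toC R).
Proof.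
refine (@measurability _ _ _ (borelC R) setT _ (@open R[i]^o) erefl _).
move=> _ [U oU <-]; rewrite setTI.
pose rect (t : rat * rat * nat) : set (R * R) :=
  ball (ratr t.1.1 : R) t.2.+1%:R^-1 `*` ball (ratr t.1.2 : R) t.2.+1%:R^-1.
suff -> : @toC R @^-1` U =
    \bigcup_(t in [set t | rect t `<=` @toC R @^-1` U]) rect t.
  rewrite bigcup_mkcond; apply: countable_bigcupT_measurable => [|t].
    exact: countableP.
  case: ifPn => // _.
  by apply: measurableX; apply: open_measurable; exact: ball_open.
apply/seteqP; split=> [[x y] Up|p [t /= tU /tU//]].
move: oU; rewrite openE => /(_ _ Up); rewrite /interior.
move=> /nbhs_ballP[[a b] /=]; rewrite ltcE/= => /andP[/eqP-> a0] aU.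
have [n na] : exists n : nat, n.+1%:R^-1 < a / 4.
  exists (Num.truncn (a / 4)^-1).
  rewrite invf_plt ?posrE ?divr_gt0// Num.Theory.truncnS_gt//.
have n0 : 0 < n.+1%:R^-1 :> R by rewrite invr_gt0.
have near (u : R) : exists q : rat, `|ratr q - u| < n.+1%:R^-1.
  have [q] : exists q, ratr q \in `]u - n.+1%:R^-1, u + n.+1%:R^-1[.
    by apply: rat_in_itvoo; rewrite ltrBlDr -addrA ltrDl addr_gt0.
  by rewrite in_itv/= => qu; exists q; rewrite ltr_distl.
have [[q qx] [q' qy]] := (near x, near y).
exists (q, q', n) => //=.
move=> [x' y'] [/=]; rewrite /ball/= => qx' qy'.
have {}qx' : `|ratr q - x'| < n.+1%:R^-1 by [].
have {}qy' : `|ratr q' - y'| < n.+1%:R^-1 by [].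
set m : R := n.+1%:R^-1 in na n0 qx qy qx' qy' *.
apply: aU => /=.
rewrite /ball/= normc_def/= ltcR.
have xx : `|x - x'| < a / 2.
  rewrite (_ : x - x' = (ratr q - x') - (ratr q - x)); last by ring.
  by apply: (le_lt_trans (ler_normB _ _)); move: qx qx' qy qy' na; lra.
have yy : `|y - y'| < a / 2.
  rewrite (_ : y - y' = (ratr q' - y') - (ratr q' - y)); last by ring.
  by apply: (le_lt_trans (ler_normB _ _)); move: qx qx' qy qy' na; lra.
rewrite -(ger0_norm (ltW a0)) -sqrtr_sqr ltr_sqrt ?exprn_gt0//.
rewrite -(real_normK (num_real (x - x'))) -(real_normK (num_real (y - y'))).
have sqr_lt (u : R) : `|u| < a / 2 -> `|u| ^+ 2 < a ^+ 2 / 4.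
  move=> ua; rewrite (_ : a ^+ 2 / 4 = (a / 2) ^+ 2); last by field.
  by rewrite ltr_pXn2r// nnegrE ltW// divr_gt0.
have a2 : 0 < a ^+ 2 by rewrite exprn_gt0.
have := sqr_lt _ xx; have := sqr_lt _ yy; lra.
Qed.

Section area.
Context {R : realType}.

Definition areaC : set (borelC R) -> \bar R :=
  pushforward (lebesgue_measure \x lebesgue_measure)%E (@toC R).

Let areaC0 : areaC set0 = 0%E.
Proof. by rewrite /areaC /pushforward preimage_set0 measure0. Qed.

Let areaC_ge0 A : (0 <= areaC A)%E.
Proof. by rewrite /areaC /pushforward measure_ge0. Qed.

Let areaC_sigma_additive : semi_sigma_additive areaC.
Proof.
have mtoC A : measurable A -> measurable (@toC R @^-1` A).
  by move=> mA; rewrite -[X in measurable X]setTI; exact: measurable_toC.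
move=> F mF tF mUF; rewrite /areaC /pushforward preimage_bigcup.
apply: measure_semi_sigma_additive.
- by move=> n; exact: mtoC.
- apply/trivIsetP => /= i j _ _ ij; rewrite -preimage_setI.
  by move/trivIsetP : tF => /(_ _ _ _ _ ij) ->//; rewrite preimage_set0.
- by rewrite -preimage_bigcup; exact: mtoC.
Qed.

HB.instance Definition _ := isMeasure.Build _ _ _ areaC
  areaC0 areaC_ge0 areaC_sigma_additive.

End area.

(* A centered normal law on the plane is the image of the standard normal law
   on R^2 under a linear map. *)
Definition centered_normalC (R : realType) (mu : set (borelC R) -> \bar R) :=
  exists a b c d : R, forall A : set (borelC R), measurable A ->
    mu A = pushforward (normal_prob (0 : R) 1 \x normal_prob (0 : R) 1)%E
             (fun p => toC (a * p.1 + b * p.2, c * p.1 + d * p.2)) A.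

Definition rotation_invariant (R : realType) (mu : set (borelC R) -> \bar R) :=
  forall (u : R[i]) (A : set (borelC R)), normc u = 1 -> measurable A ->
    pushforward mu (fun z : borelC R => (u * z : R[i]) : borelC R) A = mu A.

Section random_variables.
Context (R : realType) d (T : measurableType d) (P : probability T R).

Definition standard_normalC (X : {RV P >-> borelC R}) :=
  [/\ centered_normalC (distribution P X),
      rotation_invariant (distribution P X) &
      ('E_P[fun w => (normc (X w) ^+ 2)%R] = 1)%E].

Definition mutually_independent d' (E : measurableType d')
    (X : nat -> {RV P >-> E}) :=
  forall (J : {fset nat}) (A : nat -> set E), (forall k, measurable (A k)) ->
    P (\bigcap_(k in [set` J]) (X k @^-1` A k)) =
    (\prod_(k <- J) P (X k @^-1` A k))%E.

Definition identically_distributed d' (E : measurableType d')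
    (X : nat -> {RV P >-> E}) :=
  forall (j k : nat) (A : set E), measurable A ->
    distribution P (X j) A = distribution P (X k) A.

Definition iid d' (E : measurableType d') (X : nat -> {RV P >-> E}) :=
  mutually_independent X /\ identically_distributed X.

End random_variables.

Definition cvg_weakly (R : realType) (mu : R -> set (measurableTypeR R) -> \bar R)
    (nu : set (measurableTypeR R) -> \bar R) :=
  forall g : R -> R, continuous g -> (exists M : R, forall x, `|g x| <= M) ->
    (\int[mu r]_x (g x)%:E)%E @[r --> +oo] --> (\int[nu]_x (g x)%:E)%E.

(* [normal_prob 0 0] is not the point mass at 0, so variance 0 is separate. *)
Definition centered_normal (R : realType) (v : R) :
    set (measurableTypeR R) -> \bar R :=
  if v == 0 then \d_(0 : measurableTypeR R) else normal_prob 0 (Num.sqrt v).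

Section gaussian_entire_function.
Variable R : realType.

Definition euler_gamma : R :=
  limn (fun n => \sum_(1 <= k < n.+1) k%:R^-1 - ln n%:R : R).

Definition riemann_zeta (s : nat) : R :=
  limn (series (fun n => (n.+1%:R ^+ s)^-1 : R)).

(* [a] is a realization of the coefficients. Almost surely the series converges
   for all z and the integral in [linear_statistic] below is finite; on the
   exceptional null event [lim] and [fine] return default values. *)
Definition GEF (a : nat -> R[i]) (z : R[i]) : R[i] :=
  limn (series (fun k => a k * (z ^+ k / (Num.sqrt (k`!%:R : R))%:C) : R[i]^o)).

(* Extended-real valued: equal to -oo at the zeros of F. *)
Definition GEF_potential (a : nat -> R[i]) (z : R[i]) : \bar R :=
  (lne (normc (GEF a z))%:E - (2^-1 * normc z ^+ 2)%:E
   + (2^-1 * euler_gamma)%:E)%E.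

Definition linear_statistic (h : R[i]^o -> R) (a : nat -> R[i]) (r : R) : R :=
  r^-1 * fine (\int[areaC]_z ((h ((r^-1)%:C * z))%:E * GEF_potential a z))%E.

Definition sigmaX : R := 2^-1 * Num.sqrt (pi * riemann_zeta 3).

Definition sqnormL2 (h : R[i]^o -> R) : R := \int[areaC]_z (h z ^+ 2).

Definition compactly_supported (h : R[i]^o -> R) :=
  compact (closure [set z | h z != 0]).

End gaussian_entire_function.
Arguments sigmaX {R}.

(* Main.v *)
Require Import Defs.
From HB Require Import structures.
From mathcomp Require Import all_boot all_order all_algebra finmap complex.
From mathcomp Require Import all_classical all_reals all_analysis.
From mathcomp Require Import measurable_realfun ring lra.
Set Implicit Arguments.
Unset Strict Implicit.
Unset Printing Implicit Defensive.
Import Order.TTheory GRing.Theory Num.Theory numFieldNormedType.Exports.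
Import ComplexField.Normc.
Local Open Scope classical_set_scope.
Local Open Scope complex_scope.
Local Open Scope ring_scope.

(* Let U_z = F(z) exp(-|z|^2/2), so that X_z = (ln |U_z|^2 + gamma)/2 and
   |E (U_z conj(U_w))|^2 = exp(-|z-w|^2) =: q.
   - The logarithm is approximated by finite sums of exponentials of -s |U_z|^2.  Their
     covariances are explicit rational functions of q, whose expansion in powers of q
     tends to the covariance 1/4 sum_k q^k/k^2 of the potential.
   - Integrating exp(-k |z-w|^2) over the plane gives pi/k, hence the limiting variance
     ||h||^2 pi/4 sum_k 1/k^3 = ||h||^2 sigma_X^2.
   - A Riemann sum of approximate potentials is a finite sum f of exponentials of squared
     Gaussians.  Gaussian integration by parts turns E f psi(f) into E psi'(f) T, and the
     Poincare inequality bounds the standard deviation of T by O(1/r) because the kernel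
     exp(-|z-w|^2) is summable.  Stein's equation then compares the law of f with a normal law.
   - The L^1 distance between the linear statistic and the Riemann sum is small for a fine
     mesh and a good approximation of the logarithm, both chosen depending on r. *)

(** * Rotation invariance of the planar Gaussian law *)

(** Gaussian calculus is applied to functionals of finitely many linear forms, so identities are
    first proved for the series truncated to finitely many coefficients, where [kap i], the mean of
    |U|^2, is at most 1 instead of equal to 1, and then passed to the limit. Integration by parts
    does not act on a sum f of exponentials directly. The factor (1 + kap tau s) exp(-tau s |U|^2)
    equals 1 at tau = 0 and is proportional to the exponential in f at tau = 1; its derivative in
    tau is what integration by parts produces. Subtracting from psi a linear function with the mean
    slope makes psi'(f) centred, so that only the fluctuation of T enters. A Riemann sum has weights
    of total mass Lam = O(r) and kernel row sums eta = O(1/r); the Poincare inequality gives Var T =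
    O(Lam eta^3) = O(1/r^2). The implied constant depends on the level n at which the logarithm is
    approximated. One level is therefore frozen before r grows, another is chosen for each r so as
    to be close to the potential, and the two are compared through a Cauchy estimate uniform in
    r. *)

Section gaussian_plane.
Context {R : realType}.
Local Notation mu := (@lebesgue_measure R).
Local Notation mR := (measurableTypeR R).
Implicit Types f : mR * mR -> \bar R.

(** The Radon-Nikodym derivative of the normal law agrees with [normal_pdf] almost everywhere,
    because both have the same integral over every measurable set. *)
Lemma ge0_integral_normal_prob (m s : R) (f : mR -> \bar R) :
  measurable_fun setT f -> (forall x, 0 <= f x)%E ->
  (\int[normal_prob m s]_x f x = \int[mu]_x (f x * (normal_pdf m s x)%:E))%E.
Proof.
move=> mf f0.
have dom := normal_prob_dominates m s.
rewrite -(Radon_Nikodym_SigmaFinite.change_of_variables dom f0)//.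
apply: ae_eq_integral => //.
- apply: emeasurable_funM => //; apply: (measurable_int mu).
  exact: Radon_Nikodym_SigmaFinite.f_integrable.
- apply: emeasurable_funM => //; apply/measurable_EFinP.
  exact: measurable_normal_pdf.
- apply: ae_eqe_mul2l; apply: integral_ae_eq => //.
  + exact: Radon_Nikodym_SigmaFinite.f_integrable.
  + by apply/measurable_EFinP; exact: measurable_normal_pdf.
  + by move=> E _ mE; rewrite -Radon_Nikodym_SigmaFinite.f_integral.
Qed.

(** The translated measure gives half-open intervals their length, which characterises Lebesgue
    measure. *)
Lemma ge0_integral_translation (a : R) (f : mR -> \bar R) :
  measurable_fun setT f -> (forall x, 0 <= f x)%E ->
  (\int[mu]_x f (x + a)%R = \int[mu]_x f x)%E.
Proof.
move=> mf f0.
pose sh (x : mR) : measurableTypeR R := x + a.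
have ms : measurable_fun setT sh by exact: measurable_funD.
transitivity (\int[pushforward mu sh]_x f x)%E.
  by rewrite ge0_integral_pushforward// => y _; exact: f0.
apply: eq_measure_integral => A mA _; apply/esym.
pose g : {mfun mR >-> mR} := mfun_Sub (mem_set ms).
apply: (@lebesgue_measure_unique _ (pushforward mu g)) => //= _ [[x y]] _ <-.
rewrite /pushforward /= (_ : _ @^-1` _ = `]x - a, y - a]%classic); last first.
  by apply/seteqP; split => z /=; rewrite /sh !in_itv/= ltrBlDr lerBrDr.
rewrite !lebesgue_measure_itv/= !lte_fin ltrD2r.
by case: ifP => // _; rewrite -!EFinD; congr EFin; ring.
Qed.

Let mu2 := (mu \x mu)%E.

Let ge0_shear1 (t : R) f : measurable_fun setT f -> (forall x, 0 <= f x)%E ->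
  (\int[mu2]_p f (p.1 + t * p.2, p.2)%R = \int[mu2]_p f p)%E.
Proof.
move=> mf f0.
have mg : measurable_fun setT (fun p : mR * mR => f (p.1 + t * p.2, p.2)).
  apply: measurableT_comp => //; apply: measurable_fun_pair => //=.
  by apply: measurable_funD => //; apply: measurable_funM.
rewrite /mu2 (@fubini_tonelli2 _ _ _ _ _ mu mu _ mg)// (@fubini_tonelli2 _ _ _ _ _ mu mu _ mf)//.
apply: eq_integral => y _; rewrite /fubini_G/= (ge0_integral_translation (t * y) (f := fun x => f (x, y)))//.
by apply: measurableT_comp => //; exact: measurable_fun_pair.
Qed.

Let ge0_shear2 (t : R) f : measurable_fun setT f -> (forall x, 0 <= f x)%E ->
  (\int[mu2]_p f (p.1, p.2 + t * p.1)%R = \int[mu2]_p f p)%E.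
Proof.
move=> mf f0.
have mg : measurable_fun setT (fun p : mR * mR => f (p.1, p.2 + t * p.1)).
  apply: measurableT_comp => //; apply: measurable_fun_pair => //=.
  by apply: measurable_funD => //; apply: measurable_funM.
rewrite /mu2 (@fubini_tonelli1 _ _ _ _ _ mu mu _ mg)// (@fubini_tonelli1 _ _ _ _ _ mu mu _ mf)//.
apply: eq_integral => x _; rewrite /fubini_F/= (ge0_integral_translation (t * x) (f := fun y => f (x, y)))//.
by apply: measurableT_comp => //; exact: measurable_fun_pair.
Qed.

Definition rotation (c s : R) (p : mR * mR) : mR * mR := (c * p.1 + s * p.2, - s * p.1 + c * p.2).

Lemma measurable_rotation c s : measurable_fun setT (rotation c s).
Proof.
by apply: measurable_fun_pair => /=; apply: measurable_funD; apply: measurable_funM.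
Qed.

(* A rotation by an angle different from pi is a product of three shears. *)
Let ge0_rot_lebesgue (c s : R) f : c ^+ 2 + s ^+ 2 = 1 -> c != -1 ->
  measurable_fun setT f -> (forall x, 0 <= f x)%E ->
  (\int[mu2]_p f (rotation c s p) = \int[mu2]_p f p)%E.
Proof.
move=> cs cN1 mf f0; pose t := s / (1 + c).
have c1 : 1 + c != 0 by rewrite addrC addr_eq0.
have s2 : s ^+ 2 = (1 - c) * (1 + c) by rewrite -(addKr (c ^+ 2) (s ^+ 2)) cs; ring.
have ts : t * s = 1 - c by rewrite /t mulrAC -expr2 s2 mulfK.
have tc : t * (1 + c) = s by rewrite /t divfK.
have mS1 u : measurable_fun setT (fun p : mR * mR => (p.1 + u * p.2, p.2)).
  apply: measurable_fun_pair => //=.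
  by apply: measurable_funD => //; apply: measurable_funM.
have mS2 u : measurable_fun setT (fun p : mR * mR => (p.1, p.2 + u * p.1)).
  apply: measurable_fun_pair => //=.
  by apply: measurable_funD => //; apply: measurable_funM.
rewrite -(ge0_shear1 t mf f0).
rewrite -(@ge0_shear2 (- s) (fun p => f (p.1 + t * p.2, p.2)))//; last first.
  exact: (measurableT_comp mf (mS1 t)).
rewrite -(@ge0_shear1 t (fun p => f (p.1 + t * (p.2 + - s * p.1), p.2 + - s * p.1)))//; last first.
  exact: (measurableT_comp (measurableT_comp mf (mS1 t)) (mS2 (- s))).
apply: eq_integral => -[x y] _ /=; rewrite /rotation/=; congr (f (_, _)).
  transitivity ((1 - t * s) * x + (t * (1 + (1 - t * s))) * y); last by ring.
  by rewrite ts (_ : 1 + (1 - (1 - c)) = 1 + c) ?tc; ring.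
transitivity (- s * x + (1 - t * s) * y); last by ring.
by rewrite ts; ring.
Qed.

Local Notation N1 := (normal_prob (0 : R) 1).

Let pdf_rotation (c s x y : R) : c ^+ 2 + s ^+ 2 = 1 ->
  normal_pdf 0 1 (rotation c s (x, y)).1 * normal_pdf 0 1 (rotation c s (x, y)).2 =
  normal_pdf 0 1 x * normal_pdf 0 1 y :> R.
Proof.
move=> cs; rewrite !normal_pdfE ?oner_neq0// /normal_fun/=.
rewrite !subr0 mulrACA -expRD [RHS]mulrACA -expRD; congr (_ * expR _).
rewrite -!mulrDl; congr (_ / _).
have s2 : s ^+ 2 = 1 - c ^+ 2 by rewrite -cs; ring.
transitivity (- ((c ^+ 2 + s ^+ 2) * (x ^+ 2 + y ^+ 2))); first by ring.
by rewrite cs; ring.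
Qed.

Lemma ge0_integral_normal2 f : measurable_fun setT f -> (forall x, 0 <= f x)%E ->
  (\int[N1 \x N1]_p f p =
   \int[mu2]_p (f p * (normal_pdf 0 1 p.1 * normal_pdf 0 1 p.2)%:E))%E.
Proof.
move=> mf f0.
have mpdf : measurable_fun setT (fun x : mR => (normal_pdf (0 : R) 1 x)%:E).
  by apply/measurable_EFinP; exact: measurable_normal_pdf.
have mpdf1 : measurable_fun setT (fun p : mR * mR => (normal_pdf 0 1 p.1)%:E).
  exact: (measurableT_comp mpdf measurable_fst).
have mpdf2 : measurable_fun setT (fun p : mR * mR => (normal_pdf 0 1 p.2)%:E).
  exact: (measurableT_comp mpdf measurable_snd).
have pdf0 x : (0 <= (normal_pdf (0 : R) 1 x)%:E)%E by rewrite lee_fin normal_pdf_ge0.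
have mg : measurable_fun setT
    (fun p : mR * mR => f p * (normal_pdf 0 1 p.1 * normal_pdf 0 1 p.2)%:E)%E.
  by apply: emeasurable_funM => //; under eq_fun do rewrite EFinM; exact: emeasurable_funM.
rewrite fubini_tonelli1// ge0_integral_normal_prob; last 2 first.
- exact: measurable_fun_fubini_tonelli_F.
- by move=> x; exact: integral_ge0.
rewrite /mu2 fubini_tonelli1//; last first.
  by move=> x; rewrite mule_ge0// EFinM mule_ge0.
apply: eq_integral => x _; rewrite /fubini_F/=.
have mfx : measurable_fun setT (fun y => f (x, y)).
  by apply: measurableT_comp => //; exact: measurable_fun_pair.
rewrite ge0_integral_normal_prob// -ge0_integralZr//; last 2 first.
- exact: emeasurable_funM.
- by move=> y _; rewrite mule_ge0.
by apply: eq_integral => y _; rewrite EFinM muleA muleAC.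
Qed.

(** Shears preserve Lebesgue measure, and the joint density depends on the norm only. *)
Lemma ge0_integral_normal2_rotation (c s : R) f : c ^+ 2 + s ^+ 2 = 1 ->
  measurable_fun setT f -> (forall x, 0 <= f x)%E ->
  (\int[N1 \x N1]_p f (rotation c s p) = \int[N1 \x N1]_p f p)%E.
Proof.
have step c' s' g : c' ^+ 2 + s' ^+ 2 = 1 -> c' != -1 ->
    measurable_fun setT g -> (forall x, 0 <= g x)%E ->
    (\int[N1 \x N1]_p g (rotation c' s' p) = \int[N1 \x N1]_p g p)%E.
  move=> cs c1 mg g0.
  rewrite !ge0_integral_normal2//; last exact: (measurableT_comp mg (measurable_rotation c' s')).
  pose G (p : mR * mR) := (g p * (normal_pdf 0 1 p.1 * normal_pdf 0 1 p.2)%:E)%E.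
  rewrite -[RHS](ge0_rot_lebesgue (f := G) cs c1).
  - apply: eq_integral => -[x y] _; rewrite /G; congr (_ * _%:E)%E.
    exact/esym/pdf_rotation.
  - apply: emeasurable_funM => //; apply/measurable_EFinP; apply: measurable_funM.
      exact: (measurableT_comp (measurable_normal_pdf _ _) measurable_fst).
    exact: (measurableT_comp (measurable_normal_pdf _ _) measurable_snd).
  - by move=> p; rewrite mule_ge0// lee_fin mulr_ge0// normal_pdf_ge0.
move=> cs mf f0; have [c1|c1] := eqVneq c (-1); last exact: step.
(* The half turn, excluded from [step], is the square of the quarter turn [rotation 0 1]. *)
have s0 : s = 0.
  by apply/eqP; rewrite -sqrf_eq0; apply/eqP; move: cs; rewrite c1; lra.
have h01 : 0 ^+ 2 + 1 ^+ 2 = 1 :> R by ring.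
have n01 : (0 : R) != -1 by rewrite eq_sym oppr_eq0 oner_eq0.
rewrite -(step 0 1 f)//.
rewrite -(step 0 1 (fun p => f (rotation 0 1 p)))//; last first.
  exact: (measurableT_comp mf (measurable_rotation _ _)).
by apply: eq_integral => -[x y] _; rewrite /rotation c1 s0/=; congr (f (_, _)); ring.
Qed.

End gaussian_plane.

(** * Sequences of independent standard normal variables *)

Section sequence_space.
Context {R : realType}.
Local Notation mR := (measurableTypeR R).

Definition cylinder (n : nat) (B : nat -> set mR) : set (nat -> R) :=
  [set a | forall i, (i < n)%N -> B i (a i)].

Definition cylinders : set (set (nat -> R)) :=
  [set A | exists n (B : nat -> set mR), (forall i, measurable (B i)) /\ A = cylinder n B].

(** The Gaussian coordinates are studied through their joint law on sequence space. That law will be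
    an image of the given probability, characterised by its values on cylinders. *)
Definition seqR := g_sigma_algebraType cylinders.

Lemma measurable_cylinder n (B : nat -> set mR) : (forall i, measurable (B i)) ->
  measurable (cylinder n B : set seqR).
Proof. by move=> mB; apply: sub_sigma_algebra; exists n, B. Qed.

Lemma measurable_coord i : measurable_fun setT (fun a : seqR => (a i : mR)).
Proof.
move=> _ B mB; rewrite setTI.
have -> : (fun a : seqR => (a i : mR)) @^-1` B =
    cylinder i.+1 (fun j => if j == i then B else setT).
  apply/seteqP; split => a /=.
    by move=> Ba j _; case: eqP => [->|].
  by move=> /(_ i (ltnSn i)); rewrite eqxx.
by apply: measurable_cylinder => j; case: eqP.
Qed.

Lemma measurable_to_seqR d (T : measurableType d) (f : T -> seqR) :
  (forall i, measurable_fun setT (fun t => (f t i : mR))) -> measurable_fun setT f.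
Proof.
move=> mf.
refine (@measurability _ _ _ seqR setT _ cylinders erefl _).
move=> _ [A [n [B [mB ->]]] <-]; rewrite setTI.
have -> : f @^-1` cylinder n B =
    \bigcap_(i in `I_n) ((fun t => (f t i : mR)) @^-1` B i) by [].
apply: fin_bigcap_measurable => // i _.
by rewrite -[X in measurable X]setTI; exact: mf.
Qed.

Lemma cylinders_setI_closed : setI_closed cylinders.
Proof.
move=> _ _ [n [B [mB ->]]] [m [C [mC ->]]].
exists (maxn n m), (fun i => (if (i < n)%N then B i else setT) `&`
                             (if (i < m)%N then C i else setT)); split.
  by move=> i; apply: measurableI; case: ifP.
apply/seteqP; split => a /=.
  by move=> [aB aC] i _; split; case: ifP => // im; [exact: aB|exact: aC].
move=> h; split=> i im.
  by have [] := h i (leq_trans im (leq_maxl _ _)); rewrite im.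
by have [] := h i (leq_trans im (leq_maxr _ _)); rewrite im.
Qed.

Definition iid_normal (Q : set seqR -> \bar R) :=
  forall n (B : nat -> set mR), (forall i, measurable (B i)) ->
    Q (cylinder n B) = (\prod_(i < n) normal_prob (0 : R) 1 (B i))%E.

(** Cylinders are stable under intersection, so they determine a finite measure. *)
Lemma eq_seqR_measure (m1 m2 : {measure set seqR -> \bar R}) :
  (m1 setT < +oo)%E ->
  (forall n (B : nat -> set mR), (forall i, measurable (B i)) ->
     m1 (cylinder n B) = m2 (cylinder n B)) ->
  forall A, measurable A -> m1 A = m2 A.
Proof.
move=> m1T m12 A mA.
apply: (@measure_unique _ R seqR cylinders (fun=> setT) _ _ _ _ m1 m2) => //.
- exact: cylinders_setI_closed.
- move=> _; exists 0%N, (fun=> setT); split=> //.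
  by apply/seteqP; split.
- by rewrite bigcup_const.
- by move=> _ [n [B [mB ->]]]; exact: m12.
Qed.

Definition upd (a : nat -> R) (i : nat) (x : R) : nat -> R :=
  fun j => if j == i then x else a j.

Lemma measurable_upd i : measurable_fun setT
  (fun p : seqR * mR => (upd p.1 i p.2 : seqR)).
Proof.
apply: measurable_to_seqR => j; rewrite /upd; case: (j == i).
  exact: measurable_snd.
exact: (measurableT_comp (measurable_coord j) measurable_fst).
Qed.

End sequence_space.
Arguments seqR : clear implicits.

(** * Resampling and rotating coordinates of two independent copies *)

Section rotation.
Context {R : realType}.
Local Notation mR := (measurableTypeR R).
Variable Q : probability (seqR R) R.
Hypothesis HQ : iid_normal Q.
Local Notation N1 := (normal_prob (0 : R) 1).

(** The image of [Q \x N1] under [upd] gives every cylinder the same mass as [Q]. Integrals of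
    functions of one coordinate thereby become integrals over the line. *)
Lemma ge0_integral_resample i (f : seqR R -> \bar R) :
  measurable_fun setT f -> (forall a, 0 <= f a)%E ->
  (\int[Q]_a f a = \int[Q]_a \int[N1]_x f (upd a i x))%E.
Proof.
move=> mf f0.
pose u := (fun p : seqR R * mR => (upd p.1 i p.2 : seqR R)).
have mu : measurable_fun setT u := measurable_upd i.
pose g : {mfun (seqR R * mR)%type >-> seqR R} := mfun_Sub (mem_set mu).
have mfu : measurable_fun setT (f \o u) by exact: measurableT_comp.
transitivity (\int[Q \x N1]_p (f \o u) p)%E; last first.
  by rewrite (fubini_tonelli1 _ mfu)// => p; exact: f0.
transitivity (\int[pushforward (Q \x N1) u]_a f a)%E; last first.
  by rewrite ge0_integral_pushforward// => a _; exact: f0.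
apply: eq_measure_integral => A mA _.
apply: (@eq_seqR_measure _ Q (pushforward (Q \x N1)%E g)) => //.
  by rewrite [X in (X < _)%E](@probability_setT _ _ _ Q) ltry.
move=> n B mB; transitivity (\prod_(j < n) normal_prob (0 : R) 1 (B j))%E.
  exact: HQ.
change (\prod_(j < n) normal_prob (0 : R) 1 (B j) =
  (Q \x N1) (u @^-1` cylinder n B))%E.
have -> : u @^-1` cylinder n B =
   cylinder n (fun j => if j == i then setT else B j) `*`
   (if (i < n)%N then B i else setT).
  apply/seteqP; split => -[a x] /=; rewrite /u /upd/=.
    move=> h; split.
      by move=> j jn; have := h j jn; case: eqP.
    by case: ifP => // /h; rewrite eqxx.
  move=> [ha hx] j jn; have := ha j jn; case: eqP => [ji _|//].
  by move: hx; rewrite -ji jn.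
rewrite product_measure1E//; last 2 first.
- by apply: measurable_cylinder => j; case: ifP.
- by case: ifP.
rewrite [X in (X * _)%E]HQ; last by move=> j; case: ifP.
case: ifPn => [im|]; last first.
  rewrite -leqNgt => ni; rewrite [X in (_ * X)%E]probability_setT mule1.
  apply: eq_bigr => j _; case: eqP => // ji.
  by have := ltn_ord j; rewrite ji ltnNge ni.
rewrite (bigD1 (Ordinal im))//= [in RHS](bigD1 (Ordinal im))//= eqxx.
rewrite probability_setT mul1e muleC; congr (_ * _)%E.
by apply: eq_bigr => j; rewrite -val_eqE/= => /negPf ->.
Qed.

Definition rot_at c s i (p : (nat -> R) * (nat -> R)) : (nat -> R) * (nat -> R) :=
  let q := rotation c s (p.1 i, p.2 i) in (upd p.1 i q.1, upd p.2 i q.2).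

Lemma measurable_upd_comp d (T : measurableType d) (i : nat) (f : T -> seqR R) (g : T -> mR) :
  measurable_fun setT f -> measurable_fun setT g ->
  measurable_fun setT (fun t => (upd (f t) i (g t) : seqR R)).
Proof.
move=> mf mg; exact: (measurableT_comp (measurable_upd i) (measurable_fun_pair mf mg)).
Qed.

Lemma measurable_coord_comp d (T : measurableType d) (i : nat) (f : T -> seqR R) :
  measurable_fun setT f -> measurable_fun setT (fun t => (f t i : mR)).
Proof. exact: (measurableT_comp (measurable_coord i)). Qed.

Lemma measurable_rot_at c s i : measurable_fun setT
  (fun p : seqR R * seqR R => (rot_at c s i p : seqR R * seqR R)).
Proof.
have m1 : measurable_fun setT (fun p : seqR R * seqR R => (p.1 i : mR)).
  exact: measurable_coord_comp measurable_fst.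
have m2 : measurable_fun setT (fun p : seqR R * seqR R => (p.2 i : mR)).
  exact: measurable_coord_comp measurable_snd.
by apply: measurable_fun_pair => /=; apply: measurable_upd_comp => //=;
  apply: measurable_funD; apply: measurable_funM.
Qed.

Lemma ge0_integral_resample2 i (f : seqR R * seqR R -> \bar R) :
  measurable_fun setT f -> (forall a, 0 <= f a)%E ->
  (\int[Q \x Q]_p f p =
   \int[Q \x Q]_p \int[N1 \x N1]_q f (upd p.1 i q.1, upd p.2 i q.2))%E.
Proof.
move=> mf f0.
pose f1 (a : seqR R) (x : mR) (b : seqR R) : \bar R := f (upd a i x, b).
have muu : measurable_fun setT (fun t : (seqR R * seqR R) * (mR * mR) =>
    ((upd t.1.1 i t.2.1 : seqR R), (upd t.1.2 i t.2.2 : seqR R))).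
  apply: measurable_fun_pair; apply: measurable_upd_comp.
  - exact: (measurableT_comp measurable_fst measurable_fst).
  - exact: (measurableT_comp measurable_fst measurable_snd).
  - exact: (measurableT_comp measurable_snd measurable_fst).
  - exact: (measurableT_comp measurable_snd measurable_snd).
have mfuu := measurableT_comp mf muu.
have mG : measurable_fun setT (fun p : seqR R * seqR R =>
    \int[N1 \x N1]_q f (upd p.1 i q.1, upd p.2 i q.2))%E.
  pose N2 := [the probability _ _ of (N1 \x N1)%E].
  exact: (@measurable_fun_fubini_tonelli_F _ _ _ _ _ N2 _ mfuu (fun _ => f0 _)).
have G0 (p : seqR R * seqR R) :
    (0 <= \int[N1 \x N1]_q f (upd p.1 i q.1, upd p.2 i q.2))%E.
  by apply: integral_ge0 => q _; exact: f0.
rewrite [LHS](@fubini_tonelli1 _ _ _ _ _ Q Q _ mf f0).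
rewrite [RHS](@fubini_tonelli1 _ _ _ _ _ Q Q _ mG G0) /fubini_F.
(* resample the first copy, then the second *)
rewrite [LHS](ge0_integral_resample i); last 2 first.
- exact: (@measurable_fun_fubini_tonelli_F _ _ _ _ _ Q _ mf f0).
- by move=> a; apply: integral_ge0 => b _; exact: f0.
apply: eq_integral => a _ /=.
have mxb x : measurable_fun setT (fun b : seqR R => f (upd a i x, b)).
  apply: (measurableT_comp mf).
  by apply: measurable_fun_pair; [exact: measurable_cst|exact: measurable_id].
transitivity (\int[N1]_x \int[Q]_b \int[N1]_y f (upd a i x, upd b i y))%E.
  apply: eq_integral => x _.
  by rewrite [LHS](ge0_integral_resample i).
have mba : measurable_fun setT (fun t : mR * seqR R =>
    \int[N1]_y f (upd a i t.1, upd t.2 i y))%E.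
  suff mg : measurable_fun setT (fun t : (mR * seqR R) * mR =>
      f ((upd a i t.1.1 : seqR R), (upd t.1.2 i t.2 : seqR R))).
    pose M1 := [the probability _ _ of N1].
    exact: (@measurable_fun_fubini_tonelli_F _ _ _ _ _ M1 _ mg (fun _ => f0 _)).
  apply: (measurableT_comp mf).
  apply: measurable_fun_pair; apply: measurable_upd_comp => //=.
  - exact: (measurableT_comp measurable_fst measurable_fst).
  - exact: (measurableT_comp measurable_snd measurable_fst).
have f0' (t : mR * seqR R) : (0 <= \int[N1]_y f (upd a i t.1, upd t.2 i y))%E.
  by apply: integral_ge0 => y _; exact: f0.
rewrite [LHS](@fubini_tonelli _ _ _ _ _ N1 Q _ mba f0').
apply: eq_integral => b _ /=.
have mfab : measurable_fun setT (fun q : mR * mR =>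
    f ((upd a i q.1 : seqR R), (upd b i q.2 : seqR R))).
  apply: (measurableT_comp mf).
  by apply: measurable_fun_pair; apply: measurable_upd_comp.
by rewrite [RHS](@fubini_tonelli1 _ _ _ _ _ N1 N1 _ mfab (fun _ => f0 _)).
Qed.

(** Resampling coordinate [i] in both copies exposes an integral over a standard normal pair, which
    is rotation invariant. *)
Lemma ge0_integral_rot_at c s i (f : seqR R * seqR R -> \bar R) :
  c ^+ 2 + s ^+ 2 = 1 ->
  measurable_fun setT f -> (forall a, 0 <= f a)%E ->
  (\int[Q \x Q]_p f (rot_at c s i p) = \int[Q \x Q]_p f p)%E.
Proof.
move=> cs mf f0.
have mfr : measurable_fun setT (fun p : seqR R * seqR R => f (rot_at c s i p)).
  exact: (measurableT_comp mf (measurable_rot_at c s i)).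
rewrite [LHS](ge0_integral_resample2 i mfr (fun _ => f0 _)).
rewrite [RHS](ge0_integral_resample2 i mf f0).
apply: eq_integral => -[a b] _ /=.
have mfab : measurable_fun setT (fun q : mR * mR =>
    f ((upd a i q.1 : seqR R), (upd b i q.2 : seqR R))).
  apply: (measurableT_comp mf).
  by apply: measurable_fun_pair; apply: measurable_upd_comp.
rewrite -[RHS](ge0_integral_normal2_rotation cs mfab)//.
apply: eq_integral => -[x y] _ /=; rewrite /rot_at/= /upd !eqxx.
by congr (f (_, _)); apply/funext => j; case: (j == i).
Qed.

(** Only the first [n] coordinates are turned: invariance then follows by induction from
    [ge0_integral_rot_at], and a linear form in [n] coordinates cannot see the rest. *)
Fixpoint rotn c s n (p : (nat -> R) * (nat -> R)) : (nat -> R) * (nat -> R) :=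
  if n is m.+1 then rotn c s m (rot_at c s m p) else p.

Lemma rotnE c s n (p : (nat -> R) * (nat -> R)) i : (i < n)%N ->
  ((rotn c s n p).1 i, (rotn c s n p).2 i) = rotation c s (p.1 i, p.2 i).
Proof.
have out m q j : (m <= j)%N ->
    ((rotn c s m q).1 j, (rotn c s m q).2 j) = (q.1 j, q.2 j).
  elim: m q => [//|m ih] q mj /=; rewrite ih ?(ltnW mj)// /rot_at/= /upd.
  by rewrite gtn_eqF.
elim: n p => [//|n ih] p; rewrite ltnS leq_eqVlt => /predU1P[->|ni] /=.
  rewrite out// /rot_at /upd /= eqxx; exact/esym/surjective_pairing.
by rewrite ih// /rot_at/= /upd ltn_eqF.
Qed.

Lemma measurable_rotn c s n : measurable_fun setT
  (fun p : seqR R * seqR R => (rotn c s n p : seqR R * seqR R)).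
Proof.
elim: n => [|n ih] /=; first exact: measurable_id.
exact: (measurableT_comp ih (measurable_rot_at c s n)).
Qed.

Lemma ge0_integral_rotn c s n (f : seqR R * seqR R -> \bar R) :
  c ^+ 2 + s ^+ 2 = 1 ->
  measurable_fun setT f -> (forall a, 0 <= f a)%E ->
  (\int[Q \x Q]_p f (rotn c s n p) = \int[Q \x Q]_p f p)%E.
Proof.
move=> cs mf f0; elim: n => [//|n ih] /=; rewrite -[RHS]ih.
rewrite (ge0_integral_rot_at n (f := fun p => f (rotn c s n p)))//.
exact: (measurableT_comp mf (measurable_rotn c s n)).
Qed.

End rotation.

(** * Real-valued integrals *)

Notation Rintegrable mu f := (integrable mu setT (fun x => (f x)%:E)).

Section Rintegrable.
Context d (T : measurableType d) (R : realType).
Variable mu : {measure set T -> \bar R}.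
Implicit Types f g : T -> R.

Lemma Rintegrable_measurable f : Rintegrable mu f -> measurable_fun setT f.
Proof. by move=> /integrableP[/measurable_EFinP]. Qed.

Lemma eq_Rintegrable f g : (forall x, g x = f x) -> Rintegrable mu f -> Rintegrable mu g.
Proof. by move=> fg; rewrite (_ : g = f)//; apply/funext. Qed.

Lemma RintegrableD f g : Rintegrable mu f -> Rintegrable mu g ->
  Rintegrable mu (fun x => f x + g x).
Proof. by move=> hf hg; under eq_fun do rewrite EFinD; exact: integrableD. Qed.

Lemma RintegrableB f g : Rintegrable mu f -> Rintegrable mu g ->
  Rintegrable mu (fun x => f x - g x).
Proof. by move=> hf hg; under eq_fun do rewrite EFinB; exact: integrableB. Qed.

Lemma RintegrableZ k f : Rintegrable mu f -> Rintegrable mu (fun x => k * f x).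
Proof. by move=> hf; under eq_fun do rewrite EFinM; exact: integrableZl. Qed.

Lemma Rintegrable_sum (I : Type) (s : seq I) (F : I -> T -> R) :
  (forall i, Rintegrable mu (F i)) -> Rintegrable mu (fun x => \sum_(i <- s) F i x).
Proof.
move=> h; elim: s => [|i s ih].
  by under eq_fun do rewrite big_nil; exact: integrable0.
by under eq_fun do rewrite big_cons; exact: RintegrableD.
Qed.

Lemma Rintegrable_le f g : measurable_fun setT f -> (forall x, `|f x| <= g x) ->
  Rintegrable mu g -> Rintegrable mu f.
Proof.
move=> mf fg ig; apply: le_integrable ig => //; first exact/measurable_EFinP.
by move=> x _ /=; rewrite lee_fin; exact: le_trans (fg x) (ler_norm _).
Qed.

Lemma Rintegrable_norm f : Rintegrable mu f -> Rintegrable mu (fun x => `|f x|).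
Proof. by move=> h; exact: integrable_norm. Qed.

Lemma Rintegrable_mulb f (h : T -> R) (M : R) : measurable_fun setT h -> (forall x, `|h x| <= M) ->
  Rintegrable mu f -> Rintegrable mu (fun x => f x * h x).
Proof.
move=> mh hM hf; apply: (@Rintegrable_le _ (fun x => M * `|f x|)).
- by apply: measurable_funM => //; exact: Rintegrable_measurable.
- by move=> x; rewrite normrM mulrC ler_wpM2r.
- exact/RintegrableZ/Rintegrable_norm.
Qed.

Lemma Rintegrable_mul2 f g : measurable_fun setT f -> measurable_fun setT g ->
  Rintegrable mu (fun x => f x ^+ 2) -> Rintegrable mu (fun x => g x ^+ 2) ->
  Rintegrable mu (fun x => f x * g x).
Proof.
move=> mf mg hf hg; apply: (@Rintegrable_le _ (fun x => f x ^+ 2 + g x ^+ 2)).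
- exact: measurable_funM.
- move=> x; rewrite normrM -[f x ^+ 2]real_normK ?num_real// -[g x ^+ 2]real_normK ?num_real//.
  by have := sqr_ge0 (`|f x| - `|g x|); have := normr_ge0 (f x); have := normr_ge0 (g x); nra.
- exact: RintegrableD.
Qed.

Lemma Rintegral_sum (I : Type) (s : seq I) (F : I -> T -> R) :
  (forall i, Rintegrable mu (F i)) ->
  \int[mu]_x (\sum_(i <- s) F i x) = \sum_(i <- s) \int[mu]_x F i x.
Proof.
move=> h; elim: s => [|i s ih].
  under eq_Rintegral do rewrite big_nil.
  by rewrite big_nil /Rintegral integral0.
under eq_Rintegral do rewrite big_cons.
by rewrite big_cons RintegralD//; [rewrite ih|exact: h|exact: Rintegrable_sum].
Qed.

Lemma Rdominated_cvg (f_ : nat -> T -> R) f g :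
  (forall n, measurable_fun setT (f_ n)) -> measurable_fun setT f ->
  (forall x, f_ n x @[n --> \oo] --> f x) ->
  (forall n x, `|f_ n x| <= g x) -> Rintegrable mu g ->
  \int[mu]_x f_ n x @[n --> \oo] --> \int[mu]_x f x.
Proof.
move=> mf_ mf cf fg ig.
have mfE n : measurable_fun setT (fun x => (f_ n x)%:E) by exact/measurable_EFinP.
have mfE' : measurable_fun setT (fun x => (f x)%:E) by exact/measurable_EFinP.
have cE : {ae mu, forall x, setT x -> (fun n => (f_ n x)%:E) @ \oo --> (f x)%:E}.
  by apply: aeW => x _; apply: cvg_EFin; [exact: nearW|exact: cf].
have fgE : {ae mu, forall x n, setT x -> (`|(f_ n x)%:E| <= (g x)%:E)%E}.
  by apply: aeW => x n _; rewrite lee_fin.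
have [h1 _ h3] := @dominated_convergence _ _ _ mu _ measurableT
  (fun n x => (f_ n x)%:E) (fun x => (f x)%:E) (fun x => (g x)%:E) mfE mfE' cE ig fgE.
apply: fine_cvg; rewrite fineK//; exact: integrable_fin_num.
Qed.

Lemma Rintegral_le_norm f g : Rintegrable mu f -> Rintegrable mu g ->
  (forall x, `|f x| <= g x) -> `|\int[mu]_x f x| <= \int[mu]_x g x.
Proof.
move=> hf hg fg; apply: le_trans (le_normr_Rintegral _ _) _ => //.
by apply: le_Rintegral => //; exact: Rintegrable_norm.
Qed.

End Rintegrable.

Section Rprobability.
Context d (T : measurableType d) (R : realType).
Variable P : probability T R.
Implicit Types f g : T -> R.

Lemma Rintegrable_cst (k : R) : Rintegrable P (fun=> k).
Proof. exact: finite_measure_integrable_cst. Qed.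

Lemma Rintegral_cst1 (k : R) : \int[P]_x k = k.
Proof. by rewrite Rintegral_cst// [X in fine X](@probability_setT _ _ _ P) mulr1. Qed.

Lemma Rintegrable_bounded f (M : R) : measurable_fun setT f -> (forall x, `|f x| <= M) ->
  Rintegrable P f.
Proof. by move=> mf fM; apply: Rintegrable_le (Rintegrable_cst M). Qed.

Lemma Rintegrable_sq f : measurable_fun setT f -> Rintegrable P (fun x => f x ^+ 2) ->
  Rintegrable P f.
Proof.
move=> mf hf; apply: (@Rintegrable_le _ _ _ _ _ (fun x => f x ^+ 2 + 1)) => //.
  by move=> x; rewrite -real_normK ?num_real//; have := normr_ge0 (f x); nra.
by apply: RintegrableD => //; exact: Rintegrable_cst.
Qed.

Lemma Rintegral_sqr_le f : measurable_fun setT f -> Rintegrable P (fun x => f x ^+ 2) ->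
  (\int[P]_x f x) ^+ 2 <= \int[P]_x (f x ^+ 2).
Proof.
move=> mf hf; have h1 := Rintegrable_sq mf hf.
set m := \int[P]_x f x.
have : 0 <= \int[P]_x ((f x - m) ^+ 2) by apply: Rintegral_ge0 => x _; exact: sqr_ge0.
have -> : \int[P]_x ((f x - m) ^+ 2) = \int[P]_x (f x ^+ 2 + (m ^+ 2 - (2 * m) * f x)).
  by apply: eq_Rintegral => x _; ring.
have hc := RintegrableB (Rintegrable_cst (m ^+ 2)) (RintegrableZ (2 * m) h1).
rewrite RintegralD// RintegralB//; [|exact: Rintegrable_cst|exact: RintegrableZ].
by rewrite Rintegral_cst1 RintegralZl// -/m; nra.
Qed.

End Rprobability.

Section Rproduct.
Context d1 d2 (T1 : measurableType d1) (T2 : measurableType d2) (R : realType).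
Variables (m1 : {sigma_finite_measure set T1 -> \bar R}).
Variables (m2 : {sigma_finite_measure set T2 -> \bar R}).
Implicit Types f : T1 * T2 -> R.

Lemma RFubini f : Rintegrable (m1 \x m2)%E f ->
  (forall x, Rintegrable m2 (fun y => f (x, y))) ->
  \int[(m1 \x m2)%E]_p f p = \int[m1]_x \int[m2]_y f (x, y).
Proof.
move=> hf hf1; rewrite /Rintegral -(integral12_prod_meas1 hf); congr fine.
by apply: eq_integral => x _; rewrite fineK//; apply: integrable_fin_num.
Qed.

Lemma Rintegrable_prodM (f : T1 -> R) (g : T2 -> R) :
  Rintegrable m1 f -> Rintegrable m2 g ->
  Rintegrable (m1 \x m2)%E (fun p => f p.1 * g p.2).
Proof.
move=> hf hg.
have mfg : measurable_fun setT (fun p : T1 * T2 => (f p.1 * g p.2)%:E).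
  apply/measurable_EFinP; apply: measurable_funM.
    exact: (measurableT_comp (Rintegrable_measurable hf) measurable_fst).
  exact: (measurableT_comp (Rintegrable_measurable hg) measurable_snd).
apply/(integrable12ltyP _ _ mfg) => /=.
have [mf fi] := integrableP _ _ _ hf; have [mg gi] := integrableP _ _ _ hg.
rewrite (eq_integral (fun x => `|(f x)%:E| * \int[m2]_y `|(g y)%:E|)%E); last first.
  move=> x _; rewrite -ge0_integralZl//; last exact: measurableT_comp.
  by apply: eq_integral => y _; rewrite /= normrM EFinM.
rewrite ge0_integralZr//; [|exact: measurableT_comp|exact: integral_ge0].
by rewrite lte_mul_pinfty// ?integral_ge0// ge0_fin_numE// integral_ge0.
Qed.

Lemma Rintegral_prodM (f : T1 -> R) (g : T2 -> R) :
  Rintegrable m1 f -> Rintegrable m2 g ->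
  \int[(m1 \x m2)%E]_p (f p.1 * g p.2) = (\int[m1]_x f x) * (\int[m2]_y g y).
Proof.
move=> hf hg; rewrite (@RFubini (fun p => f p.1 * g p.2) (Rintegrable_prodM hf hg)
  (fun x => RintegrableZ (f x) hg)).
under eq_Rintegral do rewrite /= RintegralZl//.
by rewrite RintegralZr.
Qed.

End Rproduct.

(** * Difference quotients and Lipschitz bounds *)

Section calculus.
Context {R : realType}.
Implicit Types f : R -> R.

Lemma is_derive_quotient_cvg f (df : R) (t : nat -> R) : is_derive (0 : R) (1 : R) f df ->
  (forall n, t n != 0) -> t n @[n --> \oo] --> 0 ->
  (f (t n) - f 0) / t n @[n --> \oo] --> df.
Proof.
move=> [fd <-] t0 tc.
have /cvgr_dnbhsP/(_ t) := fd.
rewrite /derive; move=> /(_ (conj t0 tc)).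
under eq_fun do rewrite /= addr0 /GRing.scale/= mulr1 mulrC.
by [].
Qed.

Lemma derive_bounded_lipschitz f (f' : R -> R) (M : R) :
  (forall x : R, is_derive x (1 : R) f (f' x)) -> (forall x, `|f' x| <= M) ->
  forall x y, `|f x - f y| <= M * `|x - y|.
Proof.
move=> df f'M x y.
wlog yx : x y / y <= x => [h|].
  by have [/h//|/ltW/h] := leP y x; rewrite distrC (distrC x).
have cf : {within `[y, x], continuous f}.
  apply: derivable_within_continuous => z _; by case: (df z).
have [c _ ->] := MVT_segment yx (fun z _ => df z) cf.
by rewrite normrM ler_wpM2r.
Qed.

Lemma continuous_of_is_derive f (f' : R -> R) :
  (forall x : R, is_derive x (1 : R) f (f' x)) -> continuous f.
Proof.
move=> df x; apply: differentiable_continuous; apply/derivable1_diffP.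
by case: (df x).
Qed.

Lemma normr_sin_le (x : R) : `|sin x| <= `|x|.
Proof.
have := @derive_bounded_lipschitz sin cos 1 (@is_derive_sin R) (@cos_max R) x 0.
by rewrite sin0 !subr0 mul1r.
Qed.

Lemma normr_cosB1_le (x : R) : `|cos x - 1| <= `|x|.
Proof.
have := @derive_bounded_lipschitz cos (fun x => - sin x) 1 (@is_derive_cos R) _ x 0.
rewrite cos0 subr0 mul1r; apply => y; by rewrite normrN sin_max.
Qed.

Lemma cvg_harmonicZ (k : R) : k / n.+1%:R @[n --> \oo] --> (0 : R).
Proof.
rewrite -[X in _ --> X](mulr0 k); apply: cvgMr.
exact: cvg_harmonic.
Qed.

End calculus.

(** * Finite linear forms in the Gaussian coordinates *)

Section linear_functionals.
Context {R : realType}.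
Local Notation mR := (measurableTypeR R).
Local Notation N1 := (normal_prob (0 : R) 1).

(** Since x^2 exp(-x^2 / 4) <= 4, the integrand is dominated by a multiple of the normal density of
    variance 2. *)
Lemma integrable_normal_sqr : Rintegrable N1 (fun x : mR => x ^+ 2).
Proof.
apply/integrableP; split; first by apply/measurable_EFinP; exact: measurable_funX.
under eq_integral do rewrite /= ger0_norm ?sqr_ge0//.
rewrite ge0_integral_normal_prob; last 2 first.
- by apply/measurable_EFinP; exact: measurable_funX.
- by move=> x; rewrite lee_fin sqr_ge0.
pose s : R := Num.sqrt 2.
have s0 : s != 0 by rewrite gt_eqF// sqrtr_gt0.
have s2 : s ^+ 2 = 2 by rewrite sqr_sqrtr.
have ps0 : 0 < normal_peak s by exact: normal_peak_gt0.
pose K := 4 * normal_peak 1 / normal_peak s.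
apply: (@le_lt_trans _ _ (\int[lebesgue_measure]_x (K%:E * (normal_pdf 0 s x)%:E))%E).
  apply: ge0_le_integral => //.
  - by move=> x _; rewrite -EFinM lee_fin mulr_ge0// ?sqr_ge0// normal_pdf_ge0.
  - apply: emeasurable_funM; apply/measurable_EFinP; first exact: measurable_funX.
    exact: measurable_normal_pdf.
  - apply: emeasurable_funM; first exact: measurable_cst.
    by apply/measurable_EFinP; exact: measurable_normal_pdf.
  move=> x _; rewrite -!EFinM lee_fin.
  rewrite !normal_pdfE ?oner_eq0// /normal_fun !subr0 s2.
  rewrite [K * _]mulrA /K divfK ?gt_eqF// [leLHS]mulrCA -[leRHS]mulrA [leRHS]mulrCA.
  rewrite ler_wpM2l ?normal_peak_ge0//.
  have -> : - x ^+ 2 / (1 ^+ 2 *+ 2) = - x ^+ 2 / (2 *+ 2) - x ^+ 2 / 4 by field.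
  rewrite expRD mulrCA [leRHS]mulrC ler_wpM2l ?expR_ge0//.
  rewrite expRN ler_pdivrMr ?expR_gt0//.
  have := expR_ge1Dx (x ^+ 2 / 4); lra.
rewrite ge0_integralZl//.
- by rewrite integral_normal_pdf mule1 ltry.
- by apply/measurable_EFinP; exact: measurable_normal_pdf.
- by move=> x _; rewrite lee_fin normal_pdf_ge0.
- by rewrite lee_fin /K divr_ge0 ?mulr_ge0 ?normal_peak_ge0// ltW.
Qed.

Definition lin (N : nat) (al : nat -> R) (a : nat -> R) : R := \sum_(i < N) al i * a i.

Lemma measurable_lin N al : measurable_fun setT (fun a : seqR R => lin N al a).
Proof.
apply: measurable_sum => i; apply: measurable_funM => //.
exact: measurable_coord.
Qed.

Variable Q : probability (seqR R) R.
Hypothesis HQ : iid_normal Q.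

Lemma Rintegrable_coord_sqr i : Rintegrable Q (fun a : seqR R => a i ^+ 2).
Proof.
have mf : measurable_fun setT (fun a : seqR R => (a i : mR) ^+ 2).
  by apply: measurable_funX; exact: measurable_coord.
apply/integrableP; split; first exact/measurable_EFinP.
rewrite (ge0_integral_resample HQ i); last 2 first.
- by apply: measurableT_comp => //; exact/measurable_EFinP.
- by move=> a.
rewrite (eq_integral (fun=> (\int[N1]_x `|(x ^+ 2)%:E|)%E)); last first.
  by move=> a _; apply: eq_integral => x _; rewrite /upd eqxx.
have /integrableP[_ h] := integrable_normal_sqr.
rewrite integral_cst// [X in (_ * X)%E](@probability_setT _ _ _ Q) mule1.
exact: h.
Qed.

Lemma Rintegrable_coordM i j : Rintegrable Q (fun a : seqR R => a i * a j).
Proof.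
by apply: Rintegrable_mul2; [exact: measurable_coord|exact: measurable_coord|
  exact: Rintegrable_coord_sqr|exact: Rintegrable_coord_sqr].
Qed.

Lemma Rintegrable_linM N al N' be :
  Rintegrable Q (fun a : seqR R => lin N al a * lin N' be a).
Proof.
apply: (eq_Rintegrable (f := fun a : seqR R =>
    \sum_(i < N) \sum_(j < N') (al i * be j) * (a i * a j))) => [a|].
  rewrite /lin big_distrlr/=; apply: eq_bigr => i _; apply: eq_bigr => j _.
  by rewrite mulrACA.
apply: Rintegrable_sum => i; apply: Rintegrable_sum => j.
exact/RintegrableZ/Rintegrable_coordM.
Qed.

Lemma Rintegrable_lin_sqr N al : Rintegrable Q (fun a : seqR R => lin N al a ^+ 2).
Proof. exact: Rintegrable_linM. Qed.

Lemma Rintegrable_lin N al : Rintegrable Q (fun a : seqR R => lin N al a).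
Proof.
by apply: Rintegrable_sq; [exact: measurable_lin|exact: Rintegrable_lin_sqr].
Qed.

End linear_functionals.

(** * Gaussian integration by parts and Poincaré inequality *)

Section smooth_functionals.
Context {R : realType}.
Local Notation mR := (measurableTypeR R).
Variable Q : probability (seqR R) R.
Hypothesis HQ : iid_normal Q.
Local Notation QQ := (Q \x Q)%E.

Lemma Rintegral_rotn c s n (f : seqR R * seqR R -> R) : c ^+ 2 + s ^+ 2 = 1 ->
  measurable_fun setT f ->
  \int[QQ]_p f (rotn c s n p) = \int[QQ]_p f p.
Proof.
move=> cs mf; rewrite /Rintegral; congr fine.
have mfE : measurable_fun setT (fun p => (f p)%:E) by exact/measurable_EFinP.
rewrite integralE [RHS]integralE; congr (_ - _)%E.
  rewrite -[RHS](ge0_integral_rotn HQ n cs (measurable_funepos mfE) (fun=> funepos_ge0 _ _)).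
  by apply: eq_integral => p _; rewrite !funeposE.
rewrite -[RHS](ge0_integral_rotn HQ n cs (measurable_funeneg mfE) (fun=> funeneg_ge0 _ _)).
by apply: eq_integral => p _; rewrite !funenegE.
Qed.

Lemma Rintegral_fst (f : seqR R -> R) : Rintegrable Q f ->
  \int[QQ]_p f p.1 = \int[Q]_a f a.
Proof.
move=> hf; rewrite -[RHS]mulr1 -(Rintegral_cst1 Q 1).
rewrite -Rintegral_prodM//; last exact: Rintegrable_cst.
by apply: eq_Rintegral => p _; rewrite mulr1.
Qed.

Lemma Rintegrable_fst (f : seqR R -> R) : Rintegrable Q f ->
  Rintegrable QQ (fun p : seqR R * seqR R => f p.1).
Proof.
move=> hf; apply: eq_Rintegrable (Rintegrable_prodM hf (Rintegrable_cst Q 1)).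
by move=> p; rewrite mulr1.
Qed.

Lemma Rintegrable_snd (f : seqR R -> R) : Rintegrable Q f ->
  Rintegrable QQ (fun p : seqR R * seqR R => f p.2).
Proof.
move=> hf; apply: eq_Rintegrable (Rintegrable_prodM (Rintegrable_cst Q 1) hf).
by move=> p; rewrite mul1r.
Qed.

Variables (J : finType) (N : nat) (al : J -> nat -> R).
Local Notation X := (fun j => lin N (al j)).

Definition curve (a b : nat -> R) (t : R) : nat -> R := fun i => cos t * a i + sin t * b i.

Lemma curve0 a b : curve a b 0 = a.
Proof. by apply/funext => i; rewrite /curve cos0 sin0; ring. Qed.

Lemma lin_curve be a b t : lin N be (curve a b t) = cos t * lin N be a + sin t * lin N be b.
Proof.
rewrite /lin !mulr_sumr -big_split/=; apply: eq_bigr => i _; rewrite /curve; ring.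
Qed.

Lemma lin_rotn c s be (p : (nat -> R) * (nat -> R)) :
  (lin N be (rotn c s N p).1 = c * lin N be p.1 + s * lin N be p.2) *
  (lin N be (rotn c s N p).2 = - s * lin N be p.1 + c * lin N be p.2).
Proof.
split; rewrite /lin !mulr_sumr -big_split/=; apply: eq_bigr => i _.
  by have [-> _] := rotnE c s p (ltn_ord i); rewrite /=; ring.
by have [_ ->] := rotnE c s p (ltn_ord i); rewrite /=; ring.
Qed.

(** The Lipschitz clause forces [H] to be a function of the forms [X j] alone. As [curve a b] leaves
    [a] with velocity [b], [DH (a, b)] is the derivative of [H] at [a] in the direction [b]. *)
Record smooth (H : seqR R -> R) (DH : seqR R * seqR R -> R) : Prop := Smooth {
  smooth_meas : measurable_fun setT H;
  smooth_measD : measurable_fun setT DH;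
  smooth_lip : exists2 M, 0 <= M &
    forall a b, `|H a - H b| <= M * \sum_j `|X j a - X j b|;
  smooth_der : forall a b : nat -> R,
    is_derive (0 : R) (1 : R) (fun t => H (curve a b t)) (DH (a, b)) }.

Lemma smooth_X j : smooth (X j) (fun p => X j p.2).
Proof.
split.
- exact: measurable_lin.
- exact: (measurableT_comp (measurable_lin _ _) measurable_snd).
- exists 1 => // a b; rewrite mul1r (bigD1 j)//= lerDl; exact: sumr_ge0.
- move=> a b /=.
  rewrite (_ : (fun t => _) = (fun t => cos t * X j a + sin t * X j b)); last first.
    by apply/funext => t; rewrite lin_curve.
  apply: is_derive_eq; rewrite sin0 cos0 /GRing.scale/=; ring.
Qed.

Lemma smooth_cst k : smooth (fun=> k) (fun=> 0).
Proof.
split; [exact: measurable_cst|exact: measurable_cst| |by move=> a b; exact: is_derive_cst].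
by exists 0 => // a b; rewrite subrr normr0 mul0r.
Qed.

Lemma smoothD H DH G DG : smooth H DH -> smooth G DG ->
  smooth (fun a => H a + G a) (fun p => DH p + DG p).
Proof.
move=> [mH mDH [M M0 lH] dH] [mG mDG [L L0 lG] dG]; split.
- exact: measurable_funD.
- exact: measurable_funD.
- exists (M + L); first exact: addr_ge0.
  move=> a b; rewrite mulrDl opprD addrACA (le_trans (ler_normD _ _))//.
  exact: lerD.
- by move=> a b; exact: is_deriveD.
Qed.

Lemma smoothM H DH G DG B C : (forall a, `|H a| <= B) -> (forall a, `|G a| <= C) ->
  smooth H DH -> smooth G DG ->
  smooth (fun a => H a * G a) (fun p => H p.1 * DG p + G p.1 * DH p).
Proof.
move=> HB GC [mH mDH [M M0 lH] dH] [mG mDG [L L0 lG] dG].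
have B0 : 0 <= B := le_trans (normr_ge0 _) (HB (fun=> 0)).
have C0 : 0 <= C := le_trans (normr_ge0 _) (GC (fun=> 0)).
split.
- exact: measurable_funM.
- by apply: measurable_funD; apply: measurable_funM => //;
    apply: measurableT_comp measurable_fst.
- exists (B * L + C * M) => [|a b]; first by rewrite addr_ge0// mulr_ge0.
  have -> : H a * G a - H b * G b = H a * (G a - G b) + G b * (H a - H b) by ring.
  rewrite (le_trans (ler_normD _ _))// !normrM mulrDl -!mulrA lerD//.
    by rewrite ler_pM.
  by rewrite ler_pM.
- move=> a b; have := dH a b; have := dG a b => dG0 dH0.
  have := is_deriveM dH0 dG0; rewrite curve0 /= /GRing.scale/=.
  exact.
Qed.

Lemma smooth_comp H DH (psi psi' : R -> R) (M : R) : smooth H DH ->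
  (forall x : R, is_derive x (1 : R) psi (psi' x)) -> (forall x, `|psi' x| <= M) ->
  measurable_fun setT psi' ->
  smooth (fun a => psi (H a)) (fun p => psi' (H p.1) * DH p).
Proof.
move=> [mH mDH [L L0 lH] dH] dpsi psiM mpsi'.
have M0 : 0 <= M := le_trans (normr_ge0 _) (psiM 0).
have cpsi := continuous_of_is_derive dpsi.
split.
- apply: (measurableT_comp _ mH); exact: continuous_measurable_fun.
- apply: measurable_funM => //.
  exact: (measurableT_comp mpsi' (measurableT_comp mH measurable_fst)).
- exists (M * L); first exact: mulr_ge0.
  move=> a b; apply: (le_trans (derive_bounded_lipschitz dpsi psiM _ _)).
  by rewrite -mulrA ler_wpM2l.
- move=> a b; have dHab := dH a b.
  have := dpsi (H (curve a b 0)); rewrite [X in psi' X](_ : _ = H a) ?curve0// => d0.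
  have d0' : is_derive (H (curve a b 0)) (1 : R) psi (psi' (H a)) by rewrite curve0.
  exact: (@is_derive1_comp _ psi (fun t => H (curve a b t)) 0 _ _ d0' dHab).
Qed.

(** Up to a factor, a square integrable bound for all difference quotients of a smooth functional
    along rotations; it feeds dominated convergence. *)
Let G (p : seqR R * seqR R) : R := \sum_j (`|X j p.1| + `|X j p.2|).

Let G_ge0 p : 0 <= G p.
Proof. by apply: sumr_ge0 => j _; rewrite addr_ge0. Qed.

Let measurable_G : measurable_fun setT G.
Proof.
apply: measurable_sum => j; apply: measurable_funD; apply: measurableT_comp => //.
  exact: (measurableT_comp (measurable_lin _ _) measurable_fst).
exact: (measurableT_comp (measurable_lin _ _) measurable_snd).
Qed.

Let G_sqr : Rintegrable QQ (fun p => G p ^+ 2).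
Proof.
have m1 i : measurable_fun setT (fun p : seqR R * seqR R => `|X i p.1|).
  apply: measurableT_comp => //.
  exact: (measurableT_comp (measurable_lin _ _) measurable_fst).
have m2 i : measurable_fun setT (fun p : seqR R * seqR R => `|X i p.2|).
  apply: measurableT_comp => //.
  exact: (measurableT_comp (measurable_lin _ _) measurable_snd).
have s1 i : Rintegrable QQ (fun p : seqR R * seqR R => `|X i p.1| ^+ 2).
  apply: eq_Rintegrable (Rintegrable_fst (Rintegrable_lin_sqr HQ N (al i))) => p.
  by rewrite real_normK ?num_real.
have s2 i : Rintegrable QQ (fun p : seqR R * seqR R => `|X i p.2| ^+ 2).
  apply: eq_Rintegrable (Rintegrable_snd (Rintegrable_lin_sqr HQ N (al i))) => p.
  by rewrite real_normK ?num_real.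
apply: (eq_Rintegrable (f := fun p : seqR R * seqR R => \sum_i \sum_j
  (`|X i p.1| * `|X j p.1| + `|X i p.1| * `|X j p.2| +
  (`|X i p.2| * `|X j p.1| + `|X i p.2| * `|X j p.2|)))).
  move=> p; rewrite expr2 /G big_distrlr/=; apply: eq_bigr => i _.
  by apply: eq_bigr => j _; rewrite mulrDl !mulrDr.
apply: Rintegrable_sum => i; apply: Rintegrable_sum => j.
by apply: RintegrableD; apply: RintegrableD; exact: Rintegrable_mul2.
Qed.

Let G_int : Rintegrable QQ G.
Proof. by apply: Rintegrable_sq. Qed.

Let lip_rotn H DH : smooth H DH ->
  exists2 M, 0 <= M & forall t p, `|H (rotn (cos t) (sin t) N p).1 - H p.1| <= `|t| * (M * G p).
Proof.
move=> [_ _ [M M0 lH] _]; exists M => // u p; rewrite (le_trans (lH _ _))//.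
rewrite mulrCA ler_wpM2l// /G mulr_sumr ler_sum// => j _.
rewrite lin_rotn (_ : _ - _ = (cos u - 1) * X j p.1 + sin u * X j p.2); last by ring.
by rewrite (le_trans (ler_normD _ _))// !normrM mulrDr lerD// ler_wpM2r//
  ?normr_cosB1_le// normr_sin_le.
Qed.

(** [rotn] turns the first [N] coordinates and [curve] all of them; the Lipschitz clause of [smooth]
    makes [H] blind to the difference. *)
Let smooth_rotn_curve H DH : smooth H DH -> forall t p,
  H (rotn (cos t) (sin t) N p).1 = H (curve p.1 p.2 t).
Proof.
move=> [_ _ [M M0 lH] _] t p; apply/eqP; rewrite -subr_eq0 -normr_le0.
rewrite (le_trans (lH _ _))// big1 ?mulr0// => j _.
by rewrite lin_rotn lin_curve subrr normr0.
Qed.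

Let cs1 (t : R) : cos t ^+ 2 + sin t ^+ 2 = 1.
Proof. exact: cos2Dsin2. Qed.

(** The half turn changes the sign of the form and preserves its law. *)
Lemma Rintegral_lin be : \int[Q]_a lin N be a = 0.
Proof.
have hl := Rintegrable_lin HQ N be.
have := Rintegral_rotn N (_ : (-1) ^+ 2 + 0 ^+ 2 = 1 :> R)
  (Rintegrable_measurable (Rintegrable_fst hl)).
rewrite Rintegral_fst// => /(_ (_ : (-1) ^+ 2 + 0 ^+ 2 = 1 :> R)) h.
have : \int[QQ]_p lin N be (rotn (-1) 0 N p).1 = - \int[Q]_a lin N be a.
  rewrite -(Rintegral_fst hl) -[RHS]mulN1r -RintegralZl//; last exact: Rintegrable_fst.
  by apply: eq_Rintegral => p _; rewrite lin_rotn; ring.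
rewrite h; [lra|by ring].
Qed.

Lemma smooth_quotient_sqr_cvg H DH (t : nat -> R) : smooth H DH ->
  (forall n, t n != 0) -> t n @[n --> \oo] --> 0 ->
  \int[QQ]_p (((H (rotn (cos (t n)) (sin (t n)) N p).1 - H p.1) / t n) ^+ 2) @[n --> \oo] -->
  \int[QQ]_p (DH p ^+ 2).
Proof.
move=> sH t0 tc; have [M M0 hM] := lip_rotn sH.
apply: (@Rdominated_cvg _ _ _ _ _ _ (fun p => M ^+ 2 * G p ^+ 2)).
- move=> n; apply: measurable_funX; apply: measurable_funM => //.
  apply: measurable_funB.
    apply: (measurableT_comp (smooth_meas sH)).
    exact: (measurableT_comp measurable_fst (measurable_rotn _ _ _)).
  exact: (measurableT_comp (smooth_meas sH) measurable_fst).
- by apply: measurable_funX; exact: smooth_measD sH.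
- move=> p; have := is_derive_quotient_cvg (smooth_der sH p.1 p.2) t0 tc.
  rewrite -surjective_pairing curve0 => h.
  under eq_fun do rewrite (smooth_rotn_curve sH).
  by rewrite expr2; under eq_fun do rewrite expr2; exact: cvgM.
- move=> n p; rewrite normrX -exprMn lerXn2r ?nnegrE ?mulr_ge0//.
  by rewrite normrM normfV ler_pdivrMr ?normr_gt0// mulrC.
- exact: RintegrableZ.
Qed.

(* [0 = E[X'H(a)] = E[(- sin t X + cos t X')H(cos t a + sin t a')]] by rotation
   invariance; divide by [t] and let [t] tend to 0. *)
Theorem gaussian_ibp i H DH B : smooth H DH -> (forall a, `|H a| <= B) ->
  \int[Q]_a (X i a * H a) = \int[QQ]_p (X i p.2 * DH p).
Proof.
move=> sH HB; have [M M0 hM] := lip_rotn sH.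
have mX1 : measurable_fun setT (fun p : seqR R * seqR R => X i p.1).
  exact: (measurableT_comp (measurable_lin _ _) measurable_fst).
have mX2 : measurable_fun setT (fun p : seqR R * seqR R => X i p.2).
  exact: (measurableT_comp (measurable_lin _ _) measurable_snd).
have mH := smooth_meas sH.
have mH1 : measurable_fun setT (fun p : seqR R * seqR R => H p.1).
  exact: (measurableT_comp mH measurable_fst).
have mHr t : measurable_fun setT (fun p : seqR R * seqR R =>
    H (rotn (cos t) (sin t) N p).1).
  apply: (measurableT_comp mH).
  exact: (measurableT_comp measurable_fst (measurable_rotn _ _ _)).
have hl := Rintegrable_lin HQ N (al i).
have hl2 := Rintegrable_lin_sqr HQ N (al i).
have hH : Rintegrable Q H by exact: Rintegrable_bounded HB.
have B0 : 0 <= B := le_trans (normr_ge0 _) (HB (fun=> 0)).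
pose t n : R := n.+1%:R^-1.
have t0 n : t n != 0 by rewrite invr_neq0// pnatr_eq0.
have tc : t n @[n --> \oo] --> 0 by exact: cvg_harmonic.
pose rho n p := rotn (cos (t n)) (sin (t n)) N p.
pose A n := \int[QQ]_p (X i p.1 * H (rho n p).1).
pose C n := \int[QQ]_p (X i p.2 * ((H (rho n p).1 - H p.1) / t n)).
have iX1H n : Rintegrable QQ (fun p => X i p.1 * H (rho n p).1).
  apply: Rintegrable_mulb (mHr _) _ (Rintegrable_fst hl); by move=> p; exact: HB.
have iX2H n : Rintegrable QQ (fun p => X i p.2 * H (rho n p).1).
  apply: Rintegrable_mulb (mHr _) _ (Rintegrable_snd hl); by move=> p; exact: HB.
have iX2H1 : Rintegrable QQ (fun p => X i p.2 * H p.1).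
  apply: Rintegrable_mulb mH1 _ (Rintegrable_snd hl); by move=> p; exact: HB.
have z : \int[QQ]_p (X i p.2 * H p.1) = 0.
  transitivity (\int[QQ]_p (H p.1 * X i p.2)).
    by apply: eq_Rintegral => p _; rewrite mulrC.
  by rewrite Rintegral_prodM// Rintegral_lin mulr0.
(* [h1] is rotation invariance. Expanding the rotated form in [h2] and subtracting the term at angle
   0, which vanishes by [z], creates the difference quotient in [C n]. *)
have key n : (sin (t n) / t n) * A n = cos (t n) * C n.
  have h1 : \int[QQ]_p (X i (rho n p).2 * H (rho n p).1) = 0.
    rewrite -[RHS]z.
    exact: (Rintegral_rotn N (cs1 _) (f := fun p => X i p.2 * H p.1)
             (measurable_funM mX2 mH1)).
  have h2 : \int[QQ]_p (X i (rho n p).2 * H (rho n p).1) =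
      - sin (t n) * A n + cos (t n) * \int[QQ]_p (X i p.2 * H (rho n p).1).
    rewrite /A -(RintegralZl (- sin (t n)) measurableT (iX1H n)).
    rewrite -(RintegralZl (cos (t n)) measurableT (iX2H n)).
    rewrite -RintegralD//; [|exact: RintegrableZ|exact: RintegrableZ].
    by apply: eq_Rintegral => p _; rewrite lin_rotn; ring.
  have h3 : C n = (t n)^-1 * \int[QQ]_p (X i p.2 * H (rho n p).1).
    transitivity (\int[QQ]_p ((t n)^-1 * (X i p.2 * H (rho n p).1 - X i p.2 * H p.1))).
      by apply: eq_Rintegral => p _; ring.
    rewrite (RintegralZl (t n)^-1 measurableT (RintegrableB (iX2H n) iX2H1)).
    by rewrite (RintegralB measurableT (iX2H n) iX2H1) z subr0.
  have e : cos (t n) * \int[QQ]_p (X i p.2 * H (rho n p).1) = sin (t n) * A n.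
    by apply/eqP; rewrite -subr_eq0 addrC -mulNr -h2 h1.
  by rewrite h3 mulrAC -e mulrAC -!mulrA; congr (_ * _); rewrite mulrC.
have cA : A n @[n --> \oo] --> \int[Q]_a (X i a * H a).
  have <- : \int[QQ]_p (X i p.1 * H p.1) = \int[Q]_a (X i a * H a).
    apply: (@Rintegral_fst (fun a => X i a * H a)).
    exact: Rintegrable_mulb HB hl.
  rewrite /A; apply: (@Rdominated_cvg _ _ _ _ _ _ (fun p : seqR R * seqR R => B * `|X i p.1|)).
  - by move=> n; exact: (measurable_funM mX1 (mHr (t n))).
  - exact: (measurable_funM mX1 mH1).
  - move=> p; apply: cvgMr; apply/cvgrPdist_le => e e0.
    have tG : t n * (M * G p) @[n --> \oo] --> 0.
      by rewrite -[X in _ --> X](mul0r (M * G p)); exact: cvgMl.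
    have /cvgrPdist_le/(_ _ e0) := tG; apply: filterS => n.
    rewrite sub0r normrN => h; rewrite distrC (le_trans (hM _ _))//.
    by rewrite -[M * G p]ger0_norm ?mulr_ge0// -normrM.
  - by move=> n p; rewrite normrM mulrC ler_wpM2r.
  - exact/RintegrableZ/Rintegrable_norm/Rintegrable_fst.
have cC : C n @[n --> \oo] --> \int[QQ]_p (X i p.2 * DH p).
  rewrite /C; apply: (@Rdominated_cvg _ _ _ _ _ _ (fun p : seqR R * seqR R => M * (`|X i p.2| * G p))).
  - move=> n; apply: (measurable_funM mX2); apply: measurable_funM => //.
    exact: (measurable_funB (mHr (t n)) mH1).
  - exact: (measurable_funM mX2 (smooth_measD sH)).
  - move=> p; apply: cvgMr.
    have := is_derive_quotient_cvg (smooth_der sH p.1 p.2) t0 tc.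
    rewrite -surjective_pairing curve0.
    by rewrite /rho; under eq_fun do rewrite -(smooth_rotn_curve sH).
  - move=> n p; rewrite normrM [leRHS]mulrCA ler_wpM2l//.
    by rewrite normrM normfV ler_pdivrMr ?normr_gt0// mulrC; exact: hM.
  - apply: RintegrableZ; apply: Rintegrable_mul2 => //.
      by apply: measurableT_comp.
    apply: eq_Rintegrable (Rintegrable_snd hl2) => p.
    by rewrite real_normK ?num_real.
have cs : sin (t n) / t n @[n --> \oo] --> (1 : R).
  have := is_derive_quotient_cvg (@is_derive_sin R 0) t0 tc.
  by rewrite sin0 cos0; under eq_fun do rewrite subr0.
have cc : cos (t n) @[n --> \oo] --> (1 : R).
  by rewrite -(@cos0 R); apply: continuous_cvg => //; exact: continuous_cos.
have l1 : (sin (t n) / t n) * A n @[n --> \oo] --> 1 * \int[Q]_a (X i a * H a) by exact: cvgM.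
have l2 : cos (t n) * C n @[n --> \oo] --> 1 * \int[QQ]_p (X i p.2 * DH p) by exact: cvgM.
rewrite -[LHS]mul1r -[RHS]mul1r; apply: (cvg_unique _ l1) => //.
by rewrite (eq_fun key).
Qed.

(* Along [cos t a + sin t a'] from [a] to [a'], all increments of equal angle have
   the same law. *)
Theorem gaussian_poincare H DH B : smooth H DH -> (forall a, `|H a| <= B) ->
  \int[QQ]_p ((H p.1 - H p.2) ^+ 2) <= (pi / 2) ^+ 2 * \int[QQ]_p (DH p ^+ 2).
Proof.
move=> sH HB.
have mH := smooth_meas sH.
have B0 : 0 <= B := le_trans (normr_ge0 _) (HB (fun=> 0)).
(* A quarter turn leads from the first copy to the second; it is cut into [n.+1] equal angles. *)
pose t n : R := (pi / 2) / n.+1%:R.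
have pi20 : pi / 2 != 0 :> R by rewrite gt_eqF// divr_gt0// pi_gt0.
have t0 n : t n != 0 by rewrite mulf_neq0// invr_neq0// pnatr_eq0.
have tc : t n @[n --> \oo] --> 0 by exact: cvg_harmonicZ.
have cv := smooth_quotient_sqr_cvg sH t0 tc.
have cv2 : (pi / 2) ^+ 2 * \int[QQ]_p (((H (rotn (cos (t n)) (sin (t n)) N p).1 - H p.1) / t n) ^+ 2)
   @[n --> \oo] --> (pi / 2) ^+ 2 * \int[QQ]_p (DH p ^+ 2) by exact: cvgMr.
rewrite -(cvg_lim _ cv2)//; apply: limr_ge; first by apply/cvg_ex; eexists; exact: cv2.
apply: nearW => n.
pose rho k p := (rotn (cos (k * t n)) (sin (k * t n)) N p).
have mHr u : measurable_fun setT (fun p : seqR R * seqR R => H (rho u p).1).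
  apply: (measurableT_comp mH).
  exact: (measurableT_comp measurable_fst (measurable_rotn _ _ _)).
have ib u v : Rintegrable QQ (fun p => (H (rho u p).1 - H (rho v p).1) ^+ 2).
  pose PP := [the probability _ _ of (Q \x Q)%E].
  apply: (@Rintegrable_bounded _ _ _ PP _ ((B + B) ^+ 2)).
    by apply: measurable_funX; exact: measurable_funB.
  move=> p; rewrite normrX lerXn2r ?nnegrE ?addr_ge0//.
  by rewrite (le_trans (ler_normB _ _))// lerD.
have eqX (a b : nat -> R) : (forall be, lin N be a = lin N be b) -> H a = H b.
  have [_ _ [M M0 lH] _] := sH => ab; apply/eqP; rewrite -subr_eq0 -normr_le0.
  by rewrite (le_trans (lH _ _))// big1 ?mulr0// => j _; rewrite ab subrr normr0.
have step (k : nat) : \int[QQ]_p ((H (rho k.+1%:R p).1 - H (rho k%:R p).1) ^+ 2) =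
    \int[QQ]_p ((H (rho 1 p).1 - H p.1) ^+ 2).
  rewrite -[RHS](Rintegral_rotn N (cs1 (k%:R * t n))); last first.
    apply: measurable_funX; apply: measurable_funB => //.
    exact: (measurableT_comp mH measurable_fst).
  apply: eq_Rintegral => p _; congr ((_ - _) ^+ 2); apply: eqX => be.
  rewrite /rho !lin_rotn mul1r -natr1 mulrDl mul1r cosD sinD; ring.
have tn : n.+1%:R * t n = pi / 2 by rewrite /t mulrC divfK ?pnatr_eq0.
have -> : \int[QQ]_p ((H p.1 - H p.2) ^+ 2) =
   \int[QQ]_p ((\sum_(k < n.+1) (H (rho k.+1%:R p).1 - H (rho k%:R p).1)) ^+ 2).
  apply: eq_Rintegral => p _; rewrite -(big_mkord xpredT (fun k : nat =>
    H (rho k.+1%:R p).1 - H (rho k%:R p).1)) telescope_sumr// -[LHS]sqrrN opprB.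
  congr ((_ - _) ^+ 2); apply: eqX => be; rewrite /rho !lin_rotn.
    by rewrite tn cos_pihalf sin_pihalf; ring.
  by rewrite mul0r cos0 sin0; ring.
(* Cauchy-Schwarz over the [n.+1] increments, all of the same law, leaves the factor
   [n.+1%:R ^+ 2 = (pi / 2) ^+ 2 / t n ^+ 2]. *)
have cauchy (u : nat -> R) m : (\sum_(k < m) u k) ^+ 2 <= m%:R * \sum_(k < m) u k ^+ 2.
  elim: m => [|m ih]; first by rewrite !big_ord0 expr0n mulr0.
  rewrite !big_ord_recr/= -natr1.
  have : 0 <= \sum_(k < m) (u k - u m) ^+ 2 by apply: sumr_ge0 => k _; exact: sqr_ge0.
  have -> : \sum_(k < m) (u k - u m) ^+ 2 =
     \sum_(k < m) u k ^+ 2 - 2 * u m * \sum_(k < m) u k + m%:R * u m ^+ 2.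
    rewrite (eq_bigr (fun k : 'I_m => u k ^+ 2 + (- (2 * u m)) * u k + u m ^+ 2)); last first.
      by move=> k _; ring.
    by rewrite !big_split/= -mulr_sumr sumr_const card_ord -[_ *+ m]mulr_natl mulNr.
  by move: ih; set S := \sum_(k < m) u k; set S2 := \sum_(k < m) u k ^+ 2; nra.
apply: (@le_trans _ _ (\int[QQ]_p (n.+1%:R * \sum_(k < n.+1) (H (rho k.+1%:R p).1 - H (rho k%:R p).1) ^+ 2))).
  have i2 : Rintegrable QQ (fun p => n.+1%:R * \sum_(k < n.+1) (H (rho k.+1%:R p).1 - H (rho k%:R p).1) ^+ 2).
    by apply: RintegrableZ; apply: Rintegrable_sum.
  apply: le_Rintegral => //.
    apply: Rintegrable_le i2.
      apply: measurable_funX; apply: measurable_sum => k; exact: measurable_funB.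
    move=> p; rewrite ger0_norm ?sqr_ge0//.
    exact: (cauchy (fun k => H (rho k.+1%:R p).1 - H (rho k%:R p).1)).
  move=> p _; exact: (cauchy (fun k => H (rho k.+1%:R p).1 - H (rho k%:R p).1)).
rewrite RintegralZl//; last by apply: Rintegrable_sum.
rewrite Rintegral_sum//; under eq_bigr do rewrite step.
set I1 := \int[QQ]_p ((H (rho 1 p).1 - H p.1) ^+ 2).
have -> : \sum_(k < n.+1) I1 = n.+1%:R * I1 by rewrite sumr_const card_ord mulr_natl.
have i3 : Rintegrable QQ (fun p => (H (rho 1 p).1 - H p.1) ^+ 2).
  apply: eq_Rintegrable (ib 1 0) => p; congr ((_ - _) ^+ 2); apply: eqX => be.
  by rewrite /rho !lin_rotn mul0r cos0 sin0; ring.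
rewrite (_ : \int[QQ]_p _ = (t n)^-1 ^+ 2 * I1); last first.
  rewrite /I1 -(RintegralZl _ measurableT i3).
  by apply: eq_Rintegral => p _; rewrite /rho mul1r exprMn mulrC.
rewrite mulrA mulrA le_eqVlt; apply/orP; left; apply/eqP; congr (_ * _).
rewrite -exprMn -expr2; congr (_ ^+ 2); rewrite -tn mulfK//.
Qed.

End smooth_functionals.

(** * Stein bound for sums of exponentials *)

Section gaussian_profiles.
Context {R : realType}.
Implicit Types sg x : R.

Definition gexp sg x : R := expR (- (sg * x ^+ 2)).

(** This inequality lets an exponential absorb one factor of its exponent; the uniform bounds on the
    derivatives of the profiles rest on it. *)
Lemma expRN_mul1D_le1 (u : R) : 0 <= u -> expR (- u) * (1 + u) <= 1.
Proof.
move=> u0; rewrite expRN mulrC ler_pdivrMr ?expR_gt0// mul1r; exact: expR_ge1Dx.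
Qed.

Lemma is_derive_gexp sg x : is_derive x (1 : R) (gexp sg) (- (2 * sg * x) * gexp sg x).
Proof.
rewrite /gexp; apply: is_derive_eq; rewrite /GRing.scale/=; ring.
Qed.

Lemma gexp_gt0 sg x : 0 < gexp sg x. Proof. exact: expR_gt0. Qed.

Lemma gexp_mul_le1 sg x : 0 < sg -> gexp sg x * (1 + sg * x ^+ 2) <= 1.
Proof. by move=> s0; rewrite expRN_mul1D_le1// mulr_ge0 ?sqr_ge0// ltW. Qed.

Lemma gexp_le1 sg x : 0 < sg -> `|gexp sg x| <= 1.
Proof.
move=> s0; rewrite gtr0_norm ?gexp_gt0// /gexp -[leRHS]expR0 ler_expR oppr_le0.
by rewrite mulr_ge0 ?sqr_ge0// ltW.
Qed.

Lemma dgexp_le sg x : 0 < sg -> `|- (2 * sg * x) * gexp sg x| <= 1 + sg.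
Proof.
move=> s0; rewrite normrM (gtr0_norm (gexp_gt0 _ _)) normrN mulrC.
have h := gexp_mul_le1 x s0; have g0 := gexp_gt0 sg x.
apply: (@le_trans _ _ (gexp sg x * ((1 + sg * x ^+ 2) * (1 + sg)))).
  rewrite ler_wpM2l ?(ltW g0)// !normrM (gtr0_norm s0) ger0_norm//.
  rewrite -(real_normK (num_real x)); set n := `|x|.
  have : 0 <= sg * (n - 1) ^+ 2 by rewrite mulr_ge0 ?sqr_ge0// ltW.
  have : 0 <= (sg * n) ^+ 2 by exact: sqr_ge0.
  by rewrite !expr2; lra.
by rewrite mulrA ler_piMl// addr_ge0// ltW.
Qed.

Lemma measurable_dgexp sg : measurable_fun setT (fun x : R => - (2 * sg * x) * gexp sg x).
Proof.
apply: continuous_measurable_fun => x; apply: cvgM.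
  by apply: cvgN; apply: cvgMr; exact: cvg_id.
exact: (continuous_of_is_derive (is_derive_gexp sg)).
Qed.

Definition xexp sg x : R := x * gexp sg x.

Lemma is_derive_xexp sg x : is_derive x (1 : R) (xexp sg) ((1 - 2 * sg * x ^+ 2) * gexp sg x).
Proof.
rewrite /xexp; have := is_deriveM (is_derive_id x (1 : R)) (is_derive_gexp sg x).
by move/is_derive_eq; apply; rewrite /GRing.scale/=; ring.
Qed.

Lemma xexp_le sg x : 0 < sg -> `|xexp sg x| <= (1 + sg) / sg.
Proof.
move=> s0; have h := gexp_mul_le1 x s0; have g0 := gexp_gt0 sg x.
rewrite /xexp normrM (gtr0_norm g0) ler_pdivlMr// -mulrA mulrCA.
apply: (@le_trans _ _ (gexp sg x * ((1 + sg * x ^+ 2) * (1 + sg)))).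
  rewrite ler_wpM2l ?(ltW g0)// -(real_normK (num_real x)); set n := `|x|.
  have : 0 <= sg * (n - 1) ^+ 2 by rewrite mulr_ge0 ?sqr_ge0// ltW.
  have : 0 <= (sg * n) ^+ 2 by exact: sqr_ge0.
  by have : 0 <= sg * n by [rewrite mulr_ge0 ?normr_ge0// ltW]; rewrite !expr2; lra.
by rewrite mulrA ler_piMl// addr_ge0// ltW.
Qed.

Lemma dxexp_le sg x : 0 < sg -> `|(1 - 2 * sg * x ^+ 2) * gexp sg x| <= 2.
Proof.
move=> s0; have h := gexp_mul_le1 x s0; have g0 := gexp_gt0 sg x.
have : 0 <= sg * x ^+ 2 by rewrite mulr_ge0 ?sqr_ge0// ltW.
move: h; rewrite -mulrA; set u := sg * x ^+ 2; set g := gexp sg x => h u0.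
rewrite normrM (gtr0_norm g0).
apply: (@le_trans _ _ (2 * (g * (1 + u)))); last by rewrite ler_piMr.
rewrite [leRHS]mulrCA [leLHS]mulrC ler_wpM2l ?(ltW g0)// ler_norml; apply/andP; split; lra.
Qed.

Lemma measurable_dxexp sg :
  measurable_fun setT (fun x : R => (1 - 2 * sg * x ^+ 2) * gexp sg x).
Proof.
apply: continuous_measurable_fun => x; apply: cvgM.
  by apply: cvgB; [exact: cvg_cst|apply: cvgMr; exact: sqr_continuous].
exact: (continuous_of_is_derive (is_derive_gexp sg)).
Qed.

End gaussian_profiles.

(** * Gradients with respect to the linear forms *)

Section gradients.
Context {R : realType}.
Variable Q : probability (seqR R) R.
Hypothesis HQ : iid_normal Q.
Local Notation QQ := (Q \x Q)%E.
Variables (J : finType) (N : nat) (al : J -> nat -> R).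
Local Notation X := (fun j => lin N (al j)).
Local Notation smooth := (smooth N al).

Definition bmeas (V : seqR R -> R) : Prop :=
  measurable_fun setT V /\ exists B, forall a, `|V a| <= B.

Lemma bmeas_int V : bmeas V -> Rintegrable Q V.
Proof. by move=> [mV [B VB]]; exact: Rintegrable_bounded VB. Qed.

Lemma bmeas_cst k : bmeas (fun=> k).
Proof. by split; [exact: measurable_cst|exists `|k|]. Qed.

Lemma bmeasD V W : bmeas V -> bmeas W -> bmeas (fun a => V a + W a).
Proof.
move=> [mV [B VB]] [mW [C WC]]; split; first exact: measurable_funD.
by exists (B + C) => a; rewrite (le_trans (ler_normD _ _))// lerD.
Qed.

Lemma bmeasM V W : bmeas V -> bmeas W -> bmeas (fun a => V a * W a).
Proof.
move=> [mV [B VB]] [mW [C WC]]; split; first exact: measurable_funM.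
by exists (B * C) => a; rewrite normrM ler_pM.
Qed.

Lemma bmeas_sum (K : Type) (r : seq K) (V : K -> seqR R -> R) :
  (forall k, bmeas (V k)) -> bmeas (fun a => \sum_(k <- r) V k a).
Proof.
move=> h; elim: r => [|k r ih].
  rewrite (_ : (fun a : seqR R => _) = (fun=> 0)); first exact: bmeas_cst.
  by apply/funext => a; rewrite big_nil.
rewrite (_ : (fun a : seqR R => _) = (fun a => V k a + \sum_(k <- r) V k a)); first exact: bmeasD.
by apply/funext => a; rewrite big_cons.
Qed.

(* [V j] is the partial derivative of [H] with respect to [X j] *)
Record grad (H : seqR R -> R) (V : J -> seqR R -> R) : Prop := Grad {
  grad_smooth : smooth H (fun p => \sum_j V j p.1 * X j p.2);
  grad_bmeas : bmeas H;
  grad_bmeasV : forall j, bmeas (V j) }.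

Lemma eq_grad H V G W : (forall a, G a = H a) -> (forall j a, W j a = V j a) ->
  grad H V -> grad G W.
Proof.
move=> GH WV hV; have -> : G = H by exact/funext.
by have -> : W = V by apply/funext => j; exact/funext.
Qed.

Lemma eq_smooth H DH DG : (forall p, DG p = DH p) -> smooth H DH -> smooth H DG.
Proof. by move=> h; have -> : DG = DH by exact/funext. Qed.

Lemma grad_cst k : grad (fun=> k) (fun _ _ => 0).
Proof.
split; [|exact: bmeas_cst|by move=> j; exact: bmeas_cst].
apply: eq_smooth (smooth_cst _ _ k) => p.
by rewrite big1// => j _; rewrite mul0r.
Qed.

Lemma gradD H V G W : grad H V -> grad G W ->
  grad (fun a => H a + G a) (fun j a => V j a + W j a).
Proof.
move=> [sH bH bV] [sG bG bW]; split; [|exact: bmeasD|by move=> j; exact: bmeasD].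
apply: eq_smooth (smoothD sH sG) => p.
by rewrite -big_split/=; apply: eq_bigr => j _; rewrite mulrDl.
Qed.

Lemma grad_sum (K : Type) (r : seq K) (H : K -> seqR R -> R) V :
  (forall k, grad (H k) (V k)) ->
  grad (fun a => \sum_(k <- r) H k a) (fun j a => \sum_(k <- r) V k j a).
Proof.
move=> h; elim: r => [|k r ih].
  apply: eq_grad (grad_cst 0); first by move=> a; rewrite big_nil.
  by move=> j a; rewrite big_nil.
apply: eq_grad (gradD (h k) ih); first by move=> a; rewrite big_cons.
by move=> j a; rewrite big_cons.
Qed.

Lemma gradM H V G W : grad H V -> grad G W ->
  grad (fun a => H a * G a) (fun j a => H a * W j a + G a * V j a).
Proof.
move=> [sH bH bV] [sG bG bW]; split.
- have [_ [B HB]] := bH; have [_ [C GC]] := bG.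
  apply: eq_smooth (smoothM HB GC sH sG) => p.
  rewrite !mulr_sumr -big_split/=; apply: eq_bigr => j _; ring.
- exact: bmeasM.
- by move=> j; apply: bmeasD; exact: bmeasM.
Qed.

Lemma gradZ k H V : grad H V -> grad (fun a => k * H a) (fun j a => k * V j a).
Proof.
move=> hH; apply: eq_grad (gradM (grad_cst k) hH) => // j a.
by rewrite mulr0 addr0.
Qed.

Lemma grad_comp H V (psi psi' : R -> R) (M : R) : grad H V ->
  (forall x : R, is_derive x (1 : R) psi (psi' x)) -> (forall x, `|psi' x| <= M) ->
  measurable_fun setT psi' ->
  grad (fun a => psi (H a)) (fun j a => psi' (H a) * V j a).
Proof.
move=> [sH [mH [B HB]] bV] dpsi psiM mpsi'; split.
- apply: eq_smooth (smooth_comp sH dpsi psiM mpsi') => p.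
  by rewrite mulr_sumr; apply: eq_bigr => j _; rewrite mulrA.
- split.
    apply: (measurableT_comp _ mH); apply: continuous_measurable_fun.
    exact: continuous_of_is_derive dpsi.
  exists (`|psi 0| + M * B) => a.
  have := derive_bounded_lipschitz dpsi psiM (H a) 0; rewrite subr0 => h.
  rewrite -[psi (H a)](subrK (psi 0)) addrC (le_trans (ler_normD _ _))// lerD//.
  by rewrite (le_trans h)// ler_wpM2l// (le_trans _ (psiM 0)).
- move=> j; apply: bmeasM (bV j); split; first exact: (measurableT_comp mpsi' mH).
  by exists M.
Qed.

Lemma grad_profile j (g g' : R -> R) (B M : R) :
  (forall x : R, is_derive x (1 : R) g (g' x)) -> (forall x, `|g' x| <= M) ->
  measurable_fun setT g' -> (forall x, `|g x| <= B) ->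
  grad (fun a => g (X j a)) (fun l a => (l == j)%:R * g' (X j a)).
Proof.
move=> dg gM mg' gB.
have mgX : measurable_fun setT (fun a : seqR R => g' (X j a)).
  exact: (measurableT_comp mg' (measurable_lin _ _)).
split.
- apply: eq_smooth (smooth_comp (smooth_X _ _ j) dg gM mg') => p.
  rewrite (bigD1 j)//= eqxx mul1r big1 ?addr0// => l /negPf ->.
  by rewrite !mul0r.
- split; last by exists B.
  apply: (measurableT_comp _ (measurable_lin _ _)); apply: continuous_measurable_fun.
  exact: continuous_of_is_derive dg.
- by move=> l; apply: bmeasM; [exact: bmeas_cst|split => //; exists M].
Qed.

Definition cov j l := \int[Q]_a (X j a * X l a).

Lemma covC j l : cov j l = cov l j.
Proof. by apply: eq_Rintegral => a _; rewrite mulrC. Qed.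

(** In [gaussian_ibp] the derivative is sum_l V_l(a) X_l(b) with [a] and [b] independent, so the
    expectation factors. *)
Lemma grad_ibp j H V : grad H V ->
  \int[Q]_a (X j a * H a) = \sum_l cov j l * \int[Q]_a V l a.
Proof.
move=> [sH [mH [B HB]] bV]; rewrite (gaussian_ibp HQ j sH HB).
transitivity (\int[QQ]_p \sum_l (V l p.1 * (X j p.2 * X l p.2))).
  by apply: eq_Rintegral => p _; rewrite mulr_sumr; apply: eq_bigr => l _; ring.
rewrite Rintegral_sum; last first.
  move=> l.
  exact: (Rintegrable_prodM (bmeas_int (bV l)) (Rintegrable_linM HQ N (al j) N (al l))).
apply: eq_bigr => l _; rewrite mulrC.
apply: (@Rintegral_prodM _ _ _ _ _ Q Q (V l) (fun a => X j a * X l a)).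
  exact: bmeas_int.
exact: Rintegrable_linM.
Qed.

(** For an independent copy b, the mean of (H(a) - H(b))^2 is twice the variance, and the Poincare
    inequality bounds it by the mean square of sum_j V_j(a) X_j(b). The constant pi / 2 is the
    length of the arc from a to b. *)
Lemma grad_variance H V : grad H V ->
  \int[Q]_a ((H a - \int[Q]_b H b) ^+ 2) <=
  (pi / 2) ^+ 2 / 2 * \sum_j \sum_l cov j l * \int[Q]_a (V j a * V l a).
Proof.
move=> [sH [mH [B HB]] bV]; have h := gaussian_poincare HQ sH HB.
have iH : Rintegrable Q H by exact: Rintegrable_bounded HB.
have bH : bmeas H by split => //; exists B.
have iH2 : Rintegrable Q (fun a => H a ^+ 2) := bmeas_int (bmeasM bH bH).
set m := \int[Q]_b H b.
have -> : \int[Q]_a ((H a - m) ^+ 2) = \int[Q]_a (H a ^+ 2) - m ^+ 2.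
  transitivity (\int[Q]_a (H a ^+ 2 + (m ^+ 2 - (2 * m) * H a))).
    by apply: eq_Rintegral => a _; ring.
  have ic := RintegrableB (Rintegrable_cst Q (m ^+ 2)) (RintegrableZ (2 * m) iH).
  rewrite RintegralD// RintegralB//; [|exact: Rintegrable_cst|exact: RintegrableZ].
  by rewrite Rintegral_cst1 RintegralZl// -/m; ring.
have e1 : \int[QQ]_p ((H p.1 - H p.2) ^+ 2) = 2 * (\int[Q]_a (H a ^+ 2) - m ^+ 2).
  transitivity (\int[QQ]_p (H p.1 ^+ 2 * 1 + (1 * H p.2 ^+ 2 - 2 * (H p.1 * H p.2)))).
    by apply: eq_Rintegral => p _; ring.
  have i1 := Rintegrable_cst Q (1 : R).
  have j1 := Rintegrable_prodM iH2 i1.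
  have j2 := Rintegrable_prodM i1 iH2.
  have j3 := Rintegrable_prodM iH iH.
  have k1 : \int[QQ]_p (H p.1 ^+ 2 * 1) = \int[Q]_a (H a ^+ 2) * 1.
    by rewrite -[in RHS](Rintegral_cst1 Q 1); exact: (Rintegral_prodM iH2 i1).
  have k2 : \int[QQ]_p (1 * H p.2 ^+ 2) = 1 * \int[Q]_a (H a ^+ 2).
    by rewrite -[in RHS](Rintegral_cst1 Q 1); exact: (Rintegral_prodM i1 iH2).
  have k3 : \int[QQ]_p (H p.1 * H p.2) = m * m by exact: (Rintegral_prodM iH iH).
  rewrite (RintegralD measurableT j1 (RintegrableB j2 (RintegrableZ 2 j3))).
  rewrite (RintegralB measurableT j2 (RintegrableZ 2 j3)) (RintegralZl 2 measurableT j3).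
  rewrite k1 k2 k3; ring.
have e2 : \int[QQ]_p ((\sum_j V j p.1 * X j p.2) ^+ 2) =
   \sum_j \sum_l cov j l * \int[Q]_a (V j a * V l a).
  have ijl j l := Rintegrable_prodM (bmeas_int (bmeasM (bV j) (bV l)))
    (Rintegrable_linM HQ N (al j) N (al l)).
  transitivity (\int[QQ]_p \sum_j \sum_l ((V j p.1 * V l p.1) * (X j p.2 * X l p.2))).
    apply: eq_Rintegral => p _; rewrite expr2 big_distrlr/=.
    by apply: eq_bigr => j _; apply: eq_bigr => l _; rewrite mulrACA.
  rewrite Rintegral_sum; last by move=> j; apply: Rintegrable_sum => l; exact: ijl.
  apply: eq_bigr => j _; rewrite Rintegral_sum; last by move=> l; exact: ijl.
  apply: eq_bigr => l _; rewrite mulrC.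
  apply: (@Rintegral_prodM _ _ _ _ _ Q Q (fun a => V j a * V l a) (fun a => X j a * X l a)).
    by apply: bmeas_int; exact: bmeasM.
  exact: Rintegrable_linM.
by move: h; rewrite e1 e2; lra.
Qed.

End gradients.

Lemma is_derive_fsum {R : realType} (K : Type) (r : seq K) (F : K -> R -> R)
    (dF : K -> R) (x : R) :
  (forall k, is_derive x (1 : R) (F k) (dF k)) ->
  is_derive x (1 : R) (fun t => \sum_(k <- r) F k t) (\sum_(k <- r) dF k).
Proof.
move=> h; elim: r => [|k r ih].
  rewrite big_nil (_ : (fun t => _) = (fun=> 0)); first exact: is_derive_cst.
  by apply/funext => t; rewrite big_nil.
rewrite big_cons (_ : (fun t => _) = (fun t => F k t + \sum_(k <- r) F k t)).
  exact: is_deriveD.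
by apply/funext => t; rewrite big_cons.
Qed.

Lemma cvg_fsum {R : realType} (K : Type) (r : seq K) (F : K -> nat -> R) (l : K -> R) :
  (forall k, F k n @[n --> \oo] --> l k) ->
  \sum_(k <- r) F k n @[n --> \oo] --> \sum_(k <- r) l k.
Proof.
move=> h; elim: r => [|k r ih].
  rewrite big_nil (_ : (fun n => _) = (fun=> 0)); first exact: cvg_cst.
  by apply/funext => n; rewrite big_nil.
rewrite big_cons (_ : (fun n => _) = (fun n => F k n + \sum_(k <- r) F k n)).
  exact: cvgD.
by apply/funext => n; rewrite big_cons.
Qed.

Section stein_bound.
Context {R : realType}.
Variable Q : probability (seqR R) R.
Hypothesis HQ : iid_normal Q.
Variables (I : finType) (N : nat) (al : I * bool -> nat -> R).
Local Notation X := (fun j => lin N (al j)).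
Local Notation grad := (grad N al).
Local Notation cov := (cov Q N al).
Variables (kap : I -> R) (k : I -> I -> R).
Hypothesis cov_diag : forall i p q, cov (i, p) (i, q) = (p == q)%:R * (kap i / 2).
Hypothesis kap01 : forall i, 0 <= kap i <= 1.
Hypothesis cov_le : forall i j p q, `|cov (i, p) (j, q)| <= k i j.
Hypothesis k_sym : forall i j, k i j = k j i.

(** An index pairs a point with a flag for the real or the imaginary part of U there. Thus [Usqr i]
    is |U|^2 at the point [i], [kap i] is its mean, and [Uexp i sg] is exp(-sg |U|^2). *)
Definition Uexp i sg (a : seqR R) : R := gexp sg (X (i, true) a) * gexp sg (X (i, false) a).

Definition UX j sg (a : seqR R) : R := X j a * Uexp j.1 sg a.

Definition Usqr i (a : seqR R) : R := X (i, true) a ^+ 2 + X (i, false) a ^+ 2.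

Lemma UexpE i sg a : Uexp i sg a = expR (- (sg * Usqr i a)).
Proof. by rewrite /Uexp /gexp -expRD /Usqr -opprD -mulrDr. Qed.

Lemma Usqr_ge0 i a : 0 <= Usqr i a.
Proof. by rewrite addr_ge0// sqr_ge0. Qed.

Lemma Uexp_gt0 i sg a : 0 < Uexp i sg a.
Proof. by rewrite UexpE expR_gt0. Qed.

Lemma Uexp_mul_le1 i sg a : 0 <= sg -> Uexp i sg a * (1 + sg * Usqr i a) <= 1.
Proof. by move=> s0; rewrite UexpE expRN_mul1D_le1// mulr_ge0// Usqr_ge0. Qed.

Lemma Uexp_le1 i sg a : 0 <= sg -> Uexp i sg a <= 1.
Proof.
by move=> s0; rewrite UexpE -[leRHS]expR0 ler_expR oppr_le0 mulr_ge0// Usqr_ge0.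
Qed.

Lemma measurable_Usqr i : measurable_fun setT (Usqr i).
Proof. by apply: measurable_funD; apply: measurable_funX; exact: measurable_lin. Qed.

Lemma measurable_Uexp i sg : measurable_fun setT (Uexp i sg).
Proof.
rewrite (_ : Uexp i sg = (fun a => expR (- (sg * Usqr i a)))); last first.
  by apply/funext => a; exact: UexpE.
apply: measurableT_comp => //; apply: measurable_funN; apply: measurable_funM => //.
exact: measurable_Usqr.
Qed.

Lemma grad_Uexp i sg : 0 < sg ->
  grad (Uexp i sg) (fun l a => (l.1 == i)%:R * (- (2 * sg) * UX l sg a)).
Proof.
move=> s0.
have g b := grad_profile N al (i, b) (@is_derive_gexp R sg) (fun x => dgexp_le x s0)
  (measurable_dgexp sg) (fun x => gexp_le1 x s0).
apply: eq_grad (gradM (g true) (g false)) => //.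
move=> [i' b] a /=; rewrite /UX /Uexp/= !xpair_eqE.
by case: (eqVneq i' i) => [->|_]; case: b => /=; ring.
Qed.

Lemma grad_UX j sg : 0 < sg ->
  grad (UX j sg)
    (fun l a => (l.1 == j.1)%:R * (((l == j)%:R - 2 * sg * X j a * X l a) * Uexp j.1 sg a)).
Proof.
move=> s0; case: j => i b.
have g := grad_profile N al (i, ~~ b) (@is_derive_gexp R sg) (fun x => dgexp_le x s0)
  (measurable_dgexp sg) (fun x => gexp_le1 x s0).
have h := grad_profile N al (i, b) (@is_derive_xexp R sg) (fun x => dxexp_le x s0)
  (measurable_dxexp sg) (fun x => xexp_le x s0).
apply: eq_grad (gradM h g).
  by move=> a; rewrite /UX /Uexp /xexp/=; case: b {g h} => /=; ring.
move=> [i' b'] a /=; rewrite /UX /Uexp /xexp/= !xpair_eqE.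
by case: (eqVneq i' i) => [->|_]; case: b {g h}; case: b' => /=; ring.
Qed.

Variables (c s : I -> R) (S : R).
Hypothesis sS : forall i, 0 < s i <= S.

Let s_gt0 i : 0 < s i. Proof. by case/andP: (sS i). Qed.
Let s_leS i : s i <= S. Proof. by case/andP: (sS i). Qed.
Let kap_ge0 i : 0 <= kap i. Proof. by case/andP: (kap01 i). Qed.
Let kap_le1 i : kap i <= 1. Proof. by case/andP: (kap01 i). Qed.
Let ks_gt0 i sg : 0 <= sg -> 0 < 1 + kap i * sg.
Proof. by move=> s0; rewrite ltr_pwDl// mulr_ge0. Qed.
Let k_ge0 i j : 0 <= k i j.
Proof. exact: le_trans (normr_ge0 _) (cov_le i j true true). Qed.

(** Each term is centred: |U|^2 is exponentially distributed with mean [kap i], and the subtracted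
    constant is its Laplace transform at [s i]. *)
Definition expsum (a : seqR R) : R := \sum_i c i * (Uexp i (s i) a - (1 + kap i * s i)^-1).

Lemma grad_expsum : grad expsum (fun l a => - (2 * c l.1 * s l.1) * UX l (s l.1) a).
Proof.
apply: eq_grad (grad_sum (index_enum I) (fun i => gradZ (c i)
   (gradD (grad_Uexp i (s_gt0 i)) (grad_cst N al (- (1 + kap i * s i)^-1))))) => // l a.
rewrite (bigD1 l.1)//= eqxx big1 ?addr0; first by rewrite mul1r; ring.
by move=> i; rewrite eq_sym => /negPf ->; rewrite mul0r addr0 mulr0.
Qed.

Let bX j sg : 0 < sg -> bmeas (UX j sg).
Proof. by move=> s0; have [] := grad_UX j s0. Qed.

Let bE i sg : 0 < sg -> bmeas (Uexp i sg).
Proof. by move=> s0; have [] := grad_Uexp i s0. Qed.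

Definition Tcoef j l : R := 2 * c l.1 * s l.1 * cov j l.

Section test_function.
Variables (psi psi' : R -> R) (M : R).
Hypothesis dpsi : forall x : R, is_derive x (1 : R) psi (psi' x).
Hypothesis psiM : forall x, `|psi' x| <= M.
Hypothesis mpsi' : measurable_fun setT psi'.

Let gpsi := grad_comp grad_expsum dpsi psiM mpsi'.

Let bpsi : bmeas (fun a => psi (expsum a)). Proof. by have [] := gpsi. Qed.

Let bpsi' : bmeas (fun a => psi' (expsum a)).
Proof.
split; last by exists M.
by have [_ [m _] _] := grad_expsum; exact: (measurableT_comp mpsi' m).
Qed.

(** Integration by parts of [X j] against [UX j sg * psi (expsum a)]. At the point [j.1] itself only
    [l = j] survives, because real and imaginary parts are uncorrelated; differentiating
    [psi (expsum a)] gives the sum with [Tcoef]. *)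
Let stein_UX j sg : 0 < sg ->
  \int[Q]_a (X j a ^+ 2 * Uexp j.1 sg a * psi (expsum a)) =
  kap j.1 / 2 * \int[Q]_a ((1 - 2 * sg * X j a ^+ 2) * Uexp j.1 sg a * psi (expsum a)) -
  \sum_l Tcoef j l * \int[Q]_a (psi' (expsum a) * (UX j sg a * UX l (s l.1) a)).
Proof.
move=> s0; have gH := gradM (grad_UX j s0) gpsi.
transitivity (\int[Q]_a (X j a * (UX j sg a * psi (expsum a)))).
  by apply: eq_Rintegral => a _; rewrite /UX; ring.
rewrite (grad_ibp HQ j gH).
have b1 l : bmeas (fun a => psi' (expsum a) * (UX j sg a * UX l (s l.1) a)).
  by apply: bmeasM => //; apply: bmeasM; exact: bX.
have b2 l : bmeas (fun a => (l.1 == j.1)%:R *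
    (((l == j)%:R - 2 * sg * X j a * X l a) * Uexp j.1 sg a) * psi (expsum a)).
  by apply: bmeasM => //; have [_ _] := grad_UX j s0; exact.
transitivity (\sum_l (cov j l * \int[Q]_a ((l.1 == j.1)%:R *
    (((l == j)%:R - 2 * sg * X j a * X l a) * Uexp j.1 sg a) * psi (expsum a)) -
    Tcoef j l * \int[Q]_a (psi' (expsum a) * (UX j sg a * UX l (s l.1) a)))).
  apply: eq_bigr => l _; rewrite /Tcoef.
  transitivity (cov j l * \int[Q]_a (((l.1 == j.1)%:R *
    (((l == j)%:R - 2 * sg * X j a * X l a) * Uexp j.1 sg a) * psi (expsum a)) -
     (2 * c l.1 * s l.1) * (psi' (expsum a) * (UX j sg a * UX l (s l.1) a)))).
    by congr (_ * _); apply: eq_Rintegral => a _; ring.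
  rewrite (RintegralB measurableT (bmeas_int Q (b2 l))
    (RintegrableZ (2 * c l.1 * s l.1) (bmeas_int Q (b1 l)))).
  by rewrite (RintegralZl _ measurableT (bmeas_int Q (b1 l))); ring.
rewrite sumrB; congr (_ - _).
rewrite (bigD1 j)//= [X in _ + X]big1 ?addr0; last first.
  case: j {gH b1 b2} => i p [i' q] /=; rewrite xpair_eqE.
  case: (eqVneq i' i) => [->|ii] /=; last first.
    move=> _; rewrite (_ : \int[Q]_a _ = 0) ?mulr0//.
    rewrite -[RHS](Rintegral_cst1 Q 0); apply: eq_Rintegral => a _.
    by rewrite !mul0r.
  by move=> qp; rewrite cov_diag eq_sym (negPf qp) !mul0r.
congr (_ * _); first by case: j {gH b1 b2} => i p; rewrite cov_diag eqxx mul1r.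
by apply: eq_Rintegral => a _; rewrite !eqxx /=; ring.
Qed.

(** The factor in front of [psi] is the derivative in [sg] of (1 + kap sg) exp(-sg |U|^2). It arises
    by adding the real and imaginary instances of [stein_UX]. *)
Lemma stein_Uexp i sg : 0 < sg ->
  \int[Q]_a ((kap i - (1 + kap i * sg) * Usqr i a) * Uexp i sg a * psi (expsum a)) =
  \int[Q]_a (psi' (expsum a) *
     \sum_(p : bool) \sum_l Tcoef (i, p) l * (UX (i, p) sg a * UX l (s l.1) a)).
Proof.
move=> s0.
have b1 p l : bmeas (fun a => Tcoef (i, p) l *
    (psi' (expsum a) * (UX (i, p) sg a * UX l (s l.1) a))).
  by apply: bmeasM (bmeas_cst _) _; apply: bmeasM => //; apply: bmeasM; exact: bX.
have b0 p l : bmeas (fun a => psi' (expsum a) * (UX (i, p) sg a * UX l (s l.1) a)).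
  by apply: bmeasM => //; apply: bmeasM; exact: bX.
transitivity (\sum_(p : bool) \sum_l Tcoef (i, p) l *
    \int[Q]_a (psi' (expsum a) * (UX (i, p) sg a * UX l (s l.1) a))); last first.
  transitivity (\int[Q]_a \sum_(p : bool) \sum_l Tcoef (i, p) l *
     (psi' (expsum a) * (UX (i, p) sg a * UX l (s l.1) a))); last first.
    apply: eq_Rintegral => a _; rewrite mulr_sumr; apply: eq_bigr => p _.
    by rewrite mulr_sumr; apply: eq_bigr => l _; ring.
  rewrite Rintegral_sum; last first.
    by move=> p; apply: Rintegrable_sum => l; exact: bmeas_int.
  apply: eq_bigr => p _; rewrite Rintegral_sum; last by move=> l; exact: bmeas_int.
  by apply: eq_bigr => l _; rewrite RintegralZl//; exact: bmeas_int.
have bp : bmeas (fun a => Uexp i sg a * psi (expsum a)) by apply: bmeasM => //; exact: bE.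
have bq p : bmeas (fun a => X (i, p) a ^+ 2 * Uexp i sg a * psi (expsum a)).
  have [_ _ /(_ (i, p))] := grad_UX (i, p) s0; rewrite /= !eqxx => h.
  have h2 := bmeasM (bmeas_cst (2 * sg)^-1) (bmeasM (bmeasD (bE i s0)
     (bmeasM (bmeas_cst (-1)) h)) bpsi).
  rewrite (_ : (fun a : seqR R => _) = (fun a => (2 * sg)^-1 *
    ((Uexp i sg a + -1 * (1 * ((1 - 2 * sg * X (i, p) a * X (i, p) a) * Uexp i sg a))) * psi (expsum a)))) //.
  by apply/funext => a; field; rewrite gt_eqF.
have e p : \sum_l Tcoef (i, p) l *
    \int[Q]_a (psi' (expsum a) * (UX (i, p) sg a * UX l (s l.1) a)) =
    kap i / 2 * \int[Q]_a (Uexp i sg a * psi (expsum a)) -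
    (1 + kap i * sg) * \int[Q]_a (X (i, p) a ^+ 2 * Uexp i sg a * psi (expsum a)).
  have := stein_UX (i, p) s0; rewrite /=.
  have -> : \int[Q]_a ((1 - 2 * sg * X (i, p) a ^+ 2) * Uexp i sg a * psi (expsum a)) =
      \int[Q]_a (Uexp i sg a * psi (expsum a)) - 2 * sg *
      \int[Q]_a (X (i, p) a ^+ 2 * Uexp i sg a * psi (expsum a)).
    rewrite -(RintegralZl (2 * sg) measurableT (bmeas_int Q (bq p))).
    rewrite -(RintegralB measurableT (bmeas_int Q bp) (RintegrableZ (2 * sg) (bmeas_int Q (bq p)))).
    by apply: eq_Rintegral => a _; ring.
  set S1 := \int[Q]_a (X (i, p) a ^+ 2 * Uexp i sg a * psi (expsum a)).
  set S2 := \int[Q]_a (Uexp i sg a * psi (expsum a)); set S3 := \sum_l _ => h.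
  by rewrite -[LHS](subKr (kap i / 2 * (S2 - 2 * sg * S1))) -h; field.
rewrite big_bool/= !e.
transitivity (\int[Q]_a (kap i * (Uexp i sg a * psi (expsum a)) -
   ((1 + kap i * sg) * (X (i, true) a ^+ 2 * Uexp i sg a * psi (expsum a)) +
    (1 + kap i * sg) * (X (i, false) a ^+ 2 * Uexp i sg a * psi (expsum a))))).
  by apply: eq_Rintegral => a _; rewrite /Usqr; ring.
have i1 := RintegrableZ (kap i) (bmeas_int Q bp).
have i2 p := RintegrableZ (1 + kap i * sg) (bmeas_int Q (bq p)).
rewrite (RintegralB measurableT i1 (RintegrableD (i2 true) (i2 false))).
rewrite (RintegralD measurableT (i2 true) (i2 false)) RintegralZl//; last exact: bmeas_int.
rewrite (RintegralZl _ measurableT (bmeas_int Q (bq true))).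
rewrite (RintegralZl _ measurableT (bmeas_int Q (bq false))).
by field.
Qed.

End test_function.

Variables (eta Lam : R).
Hypothesis eta_ge0 : 0 <= eta.
Hypothesis eta_ge : forall i, \sum_j `|c j| * k i j <= eta.
Hypothesis Lam_ge : \sum_i `|c i| <= Lam.

Let sum_bool_pair (F : I * bool -> R) : \sum_l F l = \sum_i \sum_(b : bool) F (i, b).
Proof. by rewrite pair_bigA; apply: eq_bigr => -[]. Qed.

Let sum_fst (F : I -> R) : \sum_(l : I * bool) F l.1 = 2 * \sum_i F i.
Proof.
rewrite sum_bool_pair mulr_sumr; apply: eq_bigr => i _.
by rewrite big_bool/=; ring.
Qed.

Let sum_fst_eq i (F : I -> R) : \sum_(l : I * bool) (i == l.1)%:R * F l.1 = 2 * F i.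
Proof.
rewrite (sum_fst (fun j => (i == j)%:R * F j)) (bigD1 i)//= eqxx mul1r big1 ?addr0//.
by move=> j; rewrite eq_sym => /negPf ->; rewrite mul0r.
Qed.

Definition Wcoef j l : R := c j.1 * s j.1 / (1 + kap j.1 * s j.1) * Tcoef j l.

(** The statistic T at interpolation time [tau]. The exponent of the first factor is scaled by
    [tau]; that of the second is not, as it comes from differentiating [expsum]. *)
Definition Tstat tau a := \sum_j \sum_l Wcoef j l * (UX j (tau * s j.1) a * UX l (s l.1) a).

Definition dUX j sg l a : R :=
  (l.1 == j.1)%:R * (((l == j)%:R - 2 * sg * X j a * X l a) * Uexp j.1 sg a).

Definition Tgrad tau r a := \sum_j \sum_l Wcoef j l *
  (UX j (tau * s j.1) a * dUX l (s l.1) r a + UX l (s l.1) a * dUX j (tau * s j.1) r a).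

Lemma grad_Tstat tau : 0 < tau -> grad (Tstat tau) (Tgrad tau).
Proof.
move=> t0; apply: grad_sum => j; apply: grad_sum => l; apply: gradZ; apply: gradM.
  by apply: grad_UX; rewrite mulr_gt0.
exact: grad_UX.
Qed.

Let X_le_Usqr j a : `|X j a| ^+ 2 <= Usqr j.1 a.
Proof.
rewrite real_normK ?num_real// /Usqr; case: j => i [] /=.
  by rewrite lerDl sqr_ge0.
by rewrite lerDr sqr_ge0.
Qed.

Let dUX_le j sg l a : 0 <= sg -> `|dUX j sg l a| <= (l.1 == j.1)%:R * 2.
Proof.
move=> s0; rewrite /dUX normrM normr_nat; case: eqP => [lj|_]; last by rewrite !mul0r.
rewrite !mul1r normrM (gtr0_norm (Uexp_gt0 _ _ _)).
have h := Uexp_mul_le1 j.1 a s0; have E0 := Uexp_gt0 j.1 sg a.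
have hj := X_le_Usqr j a; have hl := X_le_Usqr l a; rewrite lj in hl.
apply: (@le_trans _ _ ((1 + 2 * (sg * Usqr j.1 a)) * Uexp j.1 sg a)).
  rewrite ler_wpM2r ?(ltW E0)// (le_trans (ler_normB _ _))// lerD//.
    by case: (l == j); rewrite ?normr1 ?normr0.
  rewrite -!mulrA !normrM (ger0_norm s0) ger0_norm// ler_wpM2l// ler_wpM2l//.
  have := sqr_ge0 (`|X j a| - `|X l a|); move: hj hl.
  by set x := `|X j a|; set y := `|X l a|; set u := Usqr _ _; rewrite !expr2; lra.
have : 0 <= Uexp j.1 sg a by exact: ltW.
move: h; set E := Uexp j.1 sg a; set u := sg * _; lra.
Qed.

Let UX_le j sg a : 0 <= sg -> `|UX j sg a| <= `|X j a|.
Proof.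
move=> s0; rewrite /UX normrM (gtr0_norm (Uexp_gt0 _ _ _)) ler_piMr//.
exact: Uexp_le1.
Qed.

Let S_ge0 (i : I) : 0 <= S. Proof. exact: le_trans (ltW (s_gt0 i)) (s_leS i). Qed.

Let Wcoef_le j l : `|Wcoef j l| <= 2 * S ^+ 2 * (`|c j.1| * `|c l.1| * k j.1 l.1).
Proof.
rewrite /Wcoef /Tcoef !normrM normfV (ger0_norm (ltW (s_gt0 j.1))) (ger0_norm (ltW (s_gt0 l.1))).
rewrite (ger0_norm (ltW (ks_gt0 _ (ltW (s_gt0 _))))) (@ger0_norm _ 2)//.
have h1 : s j.1 / (1 + kap j.1 * s j.1) <= S.
  rewrite ler_pdivrMr ?ks_gt0 ?(ltW (s_gt0 _))//.
  rewrite (le_trans (s_leS j.1))// ler_peMr ?(S_ge0 j.1)// lerDl.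
  by rewrite mulr_ge0// ltW.
have h2 := s_leS l.1.
have h3 : `|cov j l| <= k j.1 l.1 by case: (j) (l) => [i p] [i' q]; exact: cov_le.
rewrite [leLHS](_ : _ = 2 * (s j.1 / (1 + kap j.1 * s j.1) * s l.1) *
   (`|c j.1| * `|c l.1| * `|cov j l|)); last first.
  by set d := (1 + _)^-1; ring.
rewrite ler_pM ?mulr_ge0 ?invr_ge0 ?(ltW (ks_gt0 _ (ltW (s_gt0 _)))) ?(ltW (s_gt0 _))//.
  rewrite ler_wpM2l// expr2 ler_pM ?mulr_ge0 ?invr_ge0
   ?(ltW (ks_gt0 _ (ltW (s_gt0 _)))) ?(ltW (s_gt0 _))//.
by rewrite ler_wpM2l// mulr_ge0.
Qed.

Let u (r : I * bool) (a : seqR R) := \sum_(l : I * bool) `|c l.1| * k r.1 l.1 * `|X l a|.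

(** Differentiation with respect to [X r] keeps only the terms with an index at the point of [r].
    One of the two sums collapses and the other is bounded by the weighted row sum [u r]. *)
Let Tgrad_le tau (r : I * bool) a : 0 < tau ->
  `|Tgrad tau r a| <= 16 * S ^+ 2 * `|c r.1| * u r a.
Proof.
move=> t0; rewrite /Tgrad.
apply: (@le_trans _ _ (\sum_j \sum_l 2 * S ^+ 2 * (`|c j.1| * `|c l.1| * k j.1 l.1) *
   (`|X j a| * ((r.1 == l.1)%:R * 2) + `|X l a| * ((r.1 == j.1)%:R * 2)))).
  apply: (le_trans (ler_norm_sum _ _ _)); apply: ler_sum => j _.
  apply: (le_trans (ler_norm_sum _ _ _)); apply: ler_sum => l _.
  have sj : 0 <= tau * s j.1 by rewrite mulr_ge0 ?(ltW t0)// ltW.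
  have sl : 0 <= s l.1 by rewrite ltW.
  rewrite normrM ler_pM// (le_trans (ler_normD _ _))//.
  rewrite (normrM (UX j _ _)) (normrM (UX l _ _)).
  by apply: lerD; apply: ler_pM => //; [exact: UX_le|exact: dUX_le|exact: UX_le|exact: dUX_le].
have -> : \sum_j \sum_l 2 * S ^+ 2 * (`|c j.1| * `|c l.1| * k j.1 l.1) *
   (`|X j a| * ((r.1 == l.1)%:R * 2) + `|X l a| * ((r.1 == j.1)%:R * 2)) =
   \sum_(j : I * bool) 4 * S ^+ 2 * `|c j.1| * `|X j a| *
       (\sum_(l : I * bool) (r.1 == l.1)%:R * (`|c l.1| * k j.1 l.1)) +
   \sum_(l : I * bool) 4 * S ^+ 2 * `|c l.1| * `|X l a| *
       (\sum_(j : I * bool) (r.1 == j.1)%:R * (`|c j.1| * k j.1 l.1)).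
  transitivity (\sum_(j : I * bool) \sum_(l : I * bool)
     4 * S ^+ 2 * `|c j.1| * `|X j a| * ((r.1 == l.1)%:R * (`|c l.1| * k j.1 l.1)) +
   \sum_(j : I * bool) \sum_(l : I * bool)
     4 * S ^+ 2 * `|c l.1| * `|X l a| * ((r.1 == j.1)%:R * (`|c j.1| * k j.1 l.1))).
    rewrite -big_split/=; apply: eq_bigr => j _; rewrite -big_split/=.
    by apply: eq_bigr => l _; ring.
  congr (_ + _); first by apply: eq_bigr => j _; rewrite mulr_sumr.
  by rewrite exchange_big/=; apply: eq_bigr => l _; rewrite mulr_sumr.
under eq_bigr do rewrite (sum_fst_eq r.1 (fun i => `|c i| * k _ i)).
under [X in _ + X]eq_bigr => l _ do rewrite (sum_fst_eq r.1 (fun i => `|c i| * k i l.1)).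
rewrite /u mulr_sumr -big_split/=; apply: ler_sum => j _.
by rewrite (k_sym j.1 r.1) le_eqVlt; apply/orP; left; apply/eqP; ring.
Qed.

Let int_absXX l l' : \int[Q]_a (`|X l a| * `|X l' a|) <= 1 / 2.
Proof.
have i2 m := Rintegrable_lin_sqr HQ N (al m).
have e m : \int[Q]_a (X m a ^+ 2) <= 1 / 2.
  have -> : \int[Q]_a (X m a ^+ 2) = cov m m by apply: eq_Rintegral => a _; rewrite expr2.
  by case: m => i p; rewrite cov_diag eqxx /=; have := kap_le1 i; lra.
have mX m : measurable_fun setT (fun a : seqR R => `|X m a|).
  by apply: measurableT_comp => //; exact: measurable_lin.
have i2' m : Rintegrable Q (fun a => `|X m a| ^+ 2).
  by apply: eq_Rintegrable (i2 m) => a; rewrite real_normK ?num_real.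
apply: (@le_trans _ _ (\int[Q]_a (2^-1 * X l a ^+ 2 + 2^-1 * X l' a ^+ 2))).
  apply: le_Rintegral => //.
  - exact: Rintegrable_mul2.
  - by apply: RintegrableD; exact: RintegrableZ.
  - move=> a _; rewrite -(real_normK (num_real (X l a))) -(real_normK (num_real (X l' a))).
    have := sqr_ge0 (`|X l a| - `|X l' a|).
    by set x := `|X l a|; set y := `|X l' a|; rewrite !expr2; lra.
rewrite (RintegralD measurableT (RintegrableZ _ (i2 l)) (RintegrableZ _ (i2 l'))).
rewrite (RintegralZl _ measurableT (i2 l)) (RintegralZl _ measurableT (i2 l')).
by have := e l; have := e l'; lra.
Qed.

Let absXX_int l l' : Rintegrable Q (fun a => `|X l a| * `|X l' a|).
Proof.
have mX m : measurable_fun setT (fun a : seqR R => `|X m a|).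
  by apply: measurableT_comp => //; exact: measurable_lin.
have i2' m : Rintegrable Q (fun a => `|X m a| ^+ 2).
  apply: eq_Rintegrable (Rintegrable_lin_sqr HQ N (al m)) => a.
  by rewrite real_normK ?num_real.
exact: Rintegrable_mul2.
Qed.

Let uu_int r m : Rintegrable Q (fun a => u r a * u m a).
Proof.
apply: (eq_Rintegrable (f := fun a : seqR R => \sum_l \sum_l'
   (`|c l.1| * k r.1 l.1 * (`|c l'.1| * k m.1 l'.1)) * (`|X l a| * `|X l' a|))) => [a|].
  rewrite /u big_distrlr/=; apply: eq_bigr => l _; apply: eq_bigr => l' _; ring.
apply: Rintegrable_sum => l; apply: Rintegrable_sum => l'; exact: RintegrableZ.
Qed.

(** The weights in a row sum to at most [2 * eta], the 2 counting real and imaginary parts, and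
    [int_absXX] supplies a factor 1/2. *)
Let int_uu_le r m : \int[Q]_a (u r a * u m a) <= 2 * eta ^+ 2.
Proof.
have sumJ (r' : I * bool) : \sum_(l : I * bool) `|c l.1| * k r'.1 l.1 <= 2 * eta.
  by rewrite (sum_fst (fun i => `|c i| * k r'.1 i)) ler_wpM2l.
apply: (@le_trans _ _ (\sum_(l : I * bool) \sum_(l' : I * bool)
   (`|c l.1| * k r.1 l.1 * (`|c l'.1| * k m.1 l'.1)) * (1 / 2))); last first.
  under eq_bigr do rewrite -mulr_suml; rewrite -mulr_suml -big_distrlr/=.
  apply: (@le_trans _ _ ((2 * eta) * (2 * eta) * (1 / 2))); last by rewrite expr2; lra.
  rewrite ler_wpM2r// ler_pM//; apply: sumr_ge0 => l _; by rewrite mulr_ge0.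
have -> : \int[Q]_a (u r a * u m a) = \sum_(l : I * bool) \sum_(l' : I * bool)
   (`|c l.1| * k r.1 l.1 * (`|c l'.1| * k m.1 l'.1)) * \int[Q]_a (`|X l a| * `|X l' a|).
  transitivity (\int[Q]_a \sum_l \sum_l'
   (`|c l.1| * k r.1 l.1 * (`|c l'.1| * k m.1 l'.1)) * (`|X l a| * `|X l' a|)).
    apply: eq_Rintegral => a _; rewrite /u big_distrlr/=.
    apply: eq_bigr => l _; apply: eq_bigr => l' _; ring.
  rewrite Rintegral_sum; last by move=> l; apply: Rintegrable_sum => l'; exact: RintegrableZ.
  apply: eq_bigr => l _; rewrite Rintegral_sum; last by move=> l'; exact: RintegrableZ.
  by apply: eq_bigr => l' _; rewrite (RintegralZl _ measurableT (absXX_int l l')).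
apply: ler_sum => l _; apply: ler_sum => l' _; rewrite ler_wpM2l// !mulr_ge0//.
Qed.

(** In [grad_variance] the products of gradients cost [eta ^+ 2] by [int_uu_le]; the remaining
    double sum of |c_r| |c_m| k_rm costs [Lam * eta] up to a constant. *)
Lemma Tstat_variance tau : 0 < tau ->
  \int[Q]_a ((Tstat tau a - \int[Q]_b Tstat tau b) ^+ 2) <=
  (16 * pi * S ^+ 2) ^+ 2 * (Lam * eta ^+ 3).
Proof.
move=> t0; have gT := grad_Tstat t0; apply: (le_trans (grad_variance HQ gT)).
have bT r : bmeas (Tgrad tau r) by case: gT.
have key r m : \int[Q]_a `|Tgrad tau r a * Tgrad tau m a| <=
    512 * S ^+ 4 * eta ^+ 2 * (`|c r.1| * `|c m.1|).
  have K0 : 0 <= 256 * S ^+ 4 * (`|c r.1| * `|c m.1|).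
    by apply: mulr_ge0; [apply: mulr_ge0; [exact: ler0n|exact: exprn_even_ge0]|exact: mulr_ge0].
  apply: (@le_trans _ _ (\int[Q]_a (256 * S ^+ 4 * (`|c r.1| * `|c m.1|) * (u r a * u m a)))).
    apply: le_Rintegral => //.
    - by apply: Rintegrable_norm; apply: bmeas_int; exact: bmeasM.
    - exact: RintegrableZ.
    - move=> a _; rewrite normrM.
      apply: (le_trans (ler_pM _ _ (Tgrad_le r a t0) (Tgrad_le m a t0))) => //.
      by rewrite le_eqVlt; apply/orP; left; apply/eqP; ring.
  rewrite (RintegralZl _ measurableT (uu_int r m)); apply: (le_trans (ler_wpM2l K0 (int_uu_le r m))).
  by rewrite le_eqVlt; apply/orP; left; apply/eqP; ring.
apply: (@le_trans _ _ ((pi / 2) ^+ 2 / 2 * (2048 * S ^+ 4 * (Lam * eta ^+ 3)))); last first.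
  by rewrite le_eqVlt; apply/orP; left; apply/eqP; field.
rewrite ler_wpM2l//; first by rewrite divr_ge0// sqr_ge0.
apply: (@le_trans _ _ (\sum_r \sum_m k r.1 m.1 *
    (512 * S ^+ 4 * eta ^+ 2 * (`|c r.1| * `|c m.1|)))).
  apply: ler_sum => r _; apply: ler_sum => m _.
  apply: (le_trans (ler_norm _)); rewrite normrM ler_pM//.
    by case: (r) (m) => [i p] [i' q]; exact: cov_le.
  apply: (le_trans _ (key r m)); apply: le_normr_Rintegral => //.
  by apply: bmeas_int; exact: bmeasM.
have -> : \sum_(r : I * bool) \sum_(m : I * bool) k r.1 m.1 *
    (512 * S ^+ 4 * eta ^+ 2 * (`|c r.1| * `|c m.1|)) =
   512 * S ^+ 4 * eta ^+ 2 * \sum_(r : I * bool) `|c r.1| *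
     (\sum_(m : I * bool) `|c m.1| * k r.1 m.1).
  rewrite mulr_sumr; apply: eq_bigr => r _; rewrite !mulr_sumr.
  by apply: eq_bigr => m _; ring.
under eq_bigr do rewrite (sum_fst (fun i => `|c i| * k _ i)).
rewrite (sum_fst (fun i => `|c i| * (2 * \sum_j `|c j| * k i j))).
rewrite (_ : 2048 * S ^+ 4 * (Lam * eta ^+ 3) =
   512 * S ^+ 4 * eta ^+ 2 * (2 * (Lam * (2 * eta)))); last by ring.
have S40 : 0 <= S ^+ 4 by exact: exprn_even_ge0.
have e20 : 0 <= eta ^+ 2 by exact: exprn_even_ge0.
apply: ler_wpM2l; first exact: (mulr_ge0 (mulr_ge0 (ler0n _ _) S40) e20).
rewrite ler_wpM2l//.
apply: (@le_trans _ _ (\sum_i `|c i| * (2 * eta))).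
  by apply: ler_sum => i _; rewrite ler_wpM2l// ler_wpM2l.
by rewrite -mulr_suml ler_wpM2r// mulr_ge0.
Qed.

Section stein_identity.
Variables (psi psi' : R -> R) (M : R).
Hypothesis dpsi : forall x : R, is_derive x (1 : R) psi (psi' x).
Hypothesis psiM : forall x, `|psi' x| <= M.
Hypothesis mpsi' : measurable_fun setT psi'.

Let m := \int[Q]_a psi' (expsum a).

Let bpsi' : bmeas (fun a => psi' (expsum a)).
Proof.
split; last by exists M.
by have [_ [mf _] _] := grad_expsum; exact: (measurableT_comp mpsi' mf).
Qed.

Let m_le : `|m| <= M.
Proof.
rewrite -(Rintegral_cst1 Q M); apply: Rintegral_le_norm => //.
  exact: bmeas_int.
exact: Rintegrable_cst.
Qed.

Let M_ge0 : 0 <= M. Proof. exact: le_trans (normr_ge0 _) m_le. Qed.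

(** The linear correction makes [W' (expsum a)] centred. It also accounts for the product of E
    psi'(f) and E f^2 in the final estimate. *)
Let W x : R := psi x - m * x.
Let W' x : R := psi' x - m.

Let dW : forall x : R, is_derive x (1 : R) W (W' x).
Proof.
move=> x; have h1 := is_deriveB (dpsi x) (is_deriveZ m (is_derive_id x (1 : R))).
apply: (is_derive_eq h1); by rewrite /W' /GRing.scale/= mulr1.
Qed.

Let WM x : `|W' x| <= 2 * M.
Proof.
by rewrite (le_trans (ler_normB _ _))//; have := psiM x; have := m_le; lra.
Qed.

Let mW : measurable_fun setT W'. Proof. exact: measurable_funB. Qed.

Let bW : bmeas (fun a => W (expsum a)).
Proof. by have [] := grad_comp grad_expsum dW WM mW. Qed.

Let Wint0 : \int[Q]_a W' (expsum a) = 0.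
Proof.
rewrite /W' RintegralB//; [|exact: bmeas_int|exact: Rintegrable_cst].
by rewrite Rintegral_cst1 subrr.
Qed.

Definition stein_err : R := 2 * M * (16 * pi * S ^+ 2 * Num.sqrt (Lam * eta ^+ 3)).

Let Lam_ge0 : 0 <= Lam. Proof. by apply: le_trans Lam_ge; apply: sumr_ge0. Qed.

Let ftau tau := \sum_i c i * s i / (1 + kap i * s i) *
  \int[Q]_a ((kap i - (1 + kap i * (tau * s i)) * Usqr i a) * Uexp i (tau * s i) a *
              W (expsum a)).

(** [stein_Uexp] turns [ftau] into the mean of [W' (expsum a)] times [Tstat tau a]. As the first
    factor is centred, T may be centred too; with |W'| <= 2 M only the standard deviation of T is
    left. *)
Let ftau_le tau : 0 < tau -> `|ftau tau| <= stein_err.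
Proof.
move=> t0; have ts i : 0 < tau * s i by rewrite mulr_gt0.
have bUU p i l : bmeas (fun a => UX (i, p) (tau * s i) a * UX l (s l.1) a).
  by apply: bmeasM; exact: bX.
have bT : bmeas (Tstat tau) by have [] := grad_Tstat t0.
have bW' : bmeas (fun a => W' (expsum a)) by apply: bmeasD => //; exact: bmeas_cst.
have -> : ftau tau = \int[Q]_a (W' (expsum a) * Tstat tau a).
  rewrite /ftau; under eq_bigr => i _ do rewrite (stein_Uexp dW WM mW i (ts i)).
  have bs i : bmeas (fun a => W' (expsum a) *
      \sum_(p : bool) \sum_l Tcoef (i, p) l * (UX (i, p) (tau * s i) a * UX l (s l.1) a)).
    apply: bmeasM => //; apply: bmeas_sum => p; apply: bmeas_sum => l.
    exact: bmeasM (bmeas_cst _) _.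
  under eq_bigr => i _ do rewrite -(RintegralZl _ measurableT (bmeas_int Q (bs i))).
  rewrite -Rintegral_sum; last by move=> i; apply: RintegrableZ; exact: bmeas_int.
  apply: eq_Rintegral => a _; rewrite /Tstat sum_bool_pair mulr_sumr.
  apply: eq_bigr => i _; rewrite mulrCA; congr (_ * _); rewrite mulr_sumr.
  apply: eq_bigr => p _; rewrite mulr_sumr; apply: eq_bigr => l _.
  by rewrite /Wcoef -[RHS]mulrA.
set mT := \int[Q]_b Tstat tau b.
have bTm : bmeas (fun a => Tstat tau a - mT) by apply: bmeasD => //; exact: bmeas_cst.
have -> : \int[Q]_a (W' (expsum a) * Tstat tau a) =
    \int[Q]_a (W' (expsum a) * (Tstat tau a - mT)).
  transitivity (\int[Q]_a (W' (expsum a) * (Tstat tau a - mT) + mT * W' (expsum a))).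
    by apply: eq_Rintegral => a _; ring.
  rewrite (RintegralD measurableT (bmeas_int Q (bmeasM bW' bTm))
     (RintegrableZ mT (bmeas_int Q bW'))).
  by rewrite (RintegralZl _ measurableT (bmeas_int Q bW')) Wint0 mulr0 addr0.
have babs : bmeas (fun a => `|Tstat tau a - mT|).
  have [mf [B hB]] := bTm; split; first exact: measurableT_comp.
  by exists B => a; rewrite normr_id.
apply: (@le_trans _ _ (\int[Q]_a (2 * M * `|Tstat tau a - mT|))).
  apply: Rintegral_le_norm.
  - by apply: bmeas_int; exact: bmeasM.
  - by apply: RintegrableZ; exact: bmeas_int.
  - by move=> a; rewrite normrM ler_wpM2r.
rewrite (RintegralZl _ measurableT (bmeas_int Q babs)) ler_wpM2l ?mulr_ge0//.
have h := Rintegral_sqr_le babs.1 (bmeas_int Q (bmeasM babs babs)).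
rewrite -[leLHS]ger0_norm; last by apply: Rintegral_ge0.
rewrite -sqrtr_sqr.
have -> : 16 * pi * S ^+ 2 * Num.sqrt (Lam * eta ^+ 3) =
    Num.sqrt ((16 * pi * S ^+ 2) ^+ 2 * (Lam * eta ^+ 3)) :> R.
  rewrite [RHS]sqrtrM ?sqr_ge0// sqrtr_sqr ger0_norm//.
  by apply: mulr_ge0; [apply: mulr_ge0; [exact: ler0n|exact: pi_ge0]|exact: sqr_ge0].
apply: ler_wsqrtr; apply: (le_trans h); apply: le_trans (Tstat_variance t0).
rewrite le_eqVlt; apply/orP; left; apply/eqP; apply: eq_Rintegral => a _.
by rewrite real_normK ?num_real.
Qed.

(** Interpolates between [W (expsum a)] at [tau = 0] and [1 + kap i * s i] times
    [Uexp i (s i) a * W (expsum a)] at [tau = 1]; the divisors in [hsum] cancel that factor. *)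
Let kern i (tau : R) a := (1 + kap i * (tau * s i)) * Uexp i (tau * s i) a * W (expsum a).

Let dkern i a (tau : R) : is_derive tau (1 : R) (fun tau => kern i tau a)
  (s i * ((kap i - (1 + kap i * (tau * s i)) * Usqr i a) * Uexp i (tau * s i) a *
              W (expsum a))).
Proof.
rewrite /kern (_ : (fun tau => _) = (fun tau =>
  (1 + kap i * s i * tau) * expR (- (s i * Usqr i a) * tau) * W (expsum a))); last first.
  apply/funext => t; rewrite UexpE; congr (_ * expR _ * _); ring.
rewrite UexpE (_ : - (tau * s i * Usqr i a) = - (s i * Usqr i a) * tau); last by ring.
set w := W _; set A := - _; set C := kap i * s i.
apply: is_derive_eq; rewrite /GRing.scale/= /A /C; ring.
Qed.

Let Usqr_int i : Rintegrable Q (Usqr i).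
Proof. by apply: RintegrableD; exact: Rintegrable_lin_sqr. Qed.

Let kern_bmeas i tau : 0 < tau -> bmeas (kern i tau).
Proof.
move=> t0; apply: bmeasM bW; apply: bmeasM (bmeas_cst _) _; apply: bE.
by rewrite mulr_gt0.
Qed.

Let hsum tau := \sum_i c i / (1 + kap i * s i) * \int[Q]_a kern i tau a.

(** Differentiation under the integral. The bound 2 puts the endpoint [tau = 1] in the interior, and
    the derivative is dominated by an affine function of |U|^2. *)
Let dkern_int i (tau : R) : 0 < tau < 2 ->
  is_derive tau (1 : R) (fun t => \int[Q]_a kern i t a)
   (s i * \int[Q]_a ((kap i - (1 + kap i * (tau * s i)) * Usqr i a) * Uexp i (tau * s i) a *
              W (expsum a))).
Proof.
move=> t02; have [mW0 [B WB]] := bW.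
have B0 : 0 <= B := le_trans (normr_ge0 _) (WB (fun=> 0)).
have tI : (`]0, 2[%classic : set R) tau by rewrite /= in_itv.
have ik (x : R) : (`]0, 2[%classic : set R) x -> Rintegrable Q (kern i x).
  by rewrite /= in_itv/= => /andP[x0 _]; apply: bmeas_int; exact: kern_bmeas.
have dk (x : R) a : (`]0, 2[%classic : set R) x -> [set: seqR R] a ->
   derivable (fun t => kern i t a) x 1.
  by move=> _ _; case: (dkern i a x).
pose G a := S * (1 + (1 + 2 * S) * Usqr i a) * B.
have S0 := S_ge0 i.
have G0 a : 0 <= G a.
  by rewrite mulr_ge0// mulr_ge0// addr_ge0// mulr_ge0 ?Usqr_ge0// addr_ge0// mulr_ge0.
have iG : Rintegrable Q G.
  apply: (eq_Rintegrable (f := fun a => S * B + S * B * (1 + 2 * S) * Usqr i a)).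
    by move=> a; rewrite /G; ring.
  by apply: RintegrableD; [exact: Rintegrable_cst|exact: RintegrableZ].
have p1 x a : partial1of2 (kern i) x a =
   s i * ((kap i - (1 + kap i * (x * s i)) * Usqr i a) * Uexp i (x * s i) a * W (expsum a)).
  by rewrite partial1of2E; have dd := dkern i a x; exact: derive_val.
have Gub (x : R) a : (`]0, 2[%classic : set R) x -> [set: seqR R] a ->
    `|partial1of2 (kern i) x a| <= G a.
  rewrite /= in_itv/= => /andP[x0 x2] _; rewrite p1 /G.
  have sx : 0 < x * s i by rewrite mulr_gt0.
  have si := s_leS i; have s0 := s_gt0 i; have k0 := kap_ge0 i; have k1 := kap_le1 i.
  have u0 := Usqr_ge0 i a.
  rewrite normrM (ger0_norm (ltW s0)) [X in _ * X]normrM -[leRHS]mulrA.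
  apply: ler_pM => //; [exact: ltW|apply: ler_pM => //].
  rewrite normrM (gtr0_norm (Uexp_gt0 _ _ _)).
  apply: (@le_trans _ _ `|kap i - (1 + kap i * (x * s i)) * Usqr i a|).
    by rewrite ler_piMr// Uexp_le1// ltW.
  rewrite (le_trans (ler_normB _ _))// lerD//; first by rewrite ger0_norm.
  rewrite ger0_norm; last by apply: mulr_ge0 => //; rewrite addr_ge0// mulr_ge0// ltW.
  rewrite ler_wpM2r// lerD2l -[leRHS]mul1r ler_pM ?mulr_ge0 ?(ltW x0) ?(ltW s0)//.
  by rewrite ler_pM ?(ltW x0) ?(ltW s0) ?(ltW x2).
have d1 := derivable_under_integral measurableT tI ik dk G0 iG Gub.
have d2 := differentiation_under_integral measurableT tI ik dk G0 iG Gub.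
apply: DeriveDef => //; rewrite -derive1E d2.
have ts0 : 0 < tau * s i by case/andP: t02 => t0 _; rewrite mulr_gt0.
have bq : bmeas (fun a => (kap i - (1 + kap i * (tau * s i)) * Usqr i a) *
    Uexp i (tau * s i) a * W (expsum a)).
  apply: bmeasM bW.
  rewrite (_ : (fun a : seqR R => _) = (fun a => kap i * Uexp i (tau * s i) a +
    - (1 + kap i * (tau * s i)) * (Usqr i a * Uexp i (tau * s i) a))); last first.
    by apply/funext => a; ring.
  apply: bmeasD; apply: bmeasM (bmeas_cst _) _; first exact: bE.
  split; first by apply: measurable_funM; [exact: measurable_Usqr|exact: measurable_Uexp].
  exists (tau * s i)^-1 => a; rewrite ger0_norm; last exact: (mulr_ge0 (Usqr_ge0 _ _) (ltW (Uexp_gt0 _ _ _))).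
  rewrite -[leRHS]mul1r ler_pdivlMr// (le_trans _ (Uexp_mul_le1 i a (ltW ts0)))//.
  rewrite mulrDr mulr1 -[leLHS]add0r; apply: lerD; first exact: (ltW (Uexp_gt0 _ _ _)).
  by rewrite le_eqVlt; apply/orP; left; apply/eqP; ring.
rewrite -(RintegralZl (s i) measurableT (bmeas_int Q bq)).
by apply: eq_Rintegral => a _; rewrite p1.
Qed.

Let dhsum (tau : R) : 0 < tau < 2 -> is_derive tau (1 : R) hsum (ftau tau).
Proof.
move=> t02.
have d i := is_deriveZ (c i / (1 + kap i * s i)) (dkern_int i t02).
apply: (is_derive_eq (is_derive_fsum (index_enum I) d)).
apply: eq_bigr => i _; rewrite /GRing.scale/=; set I0 := Rintegral _ _ _; set e := (1 + _)^-1.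
ring.
Qed.

(** The left side is the mean of f W(f), that is [hsum 1] minus its limit at 0. The derivative of
    [hsum] is [ftau], which [ftau_le] bounds uniformly. *)
Lemma stein_expsum :
  `|\int[Q]_a (expsum a * psi (expsum a)) - m * \int[Q]_a (expsum a ^+ 2)| <= stein_err.
Proof.
have bF : bmeas expsum by have [] := grad_expsum.
have bpsi : bmeas (fun a => psi (expsum a)) by have [] := grad_comp grad_expsum dpsi psiM mpsi'.
have -> : \int[Q]_a (expsum a * psi (expsum a)) - m * \int[Q]_a (expsum a ^+ 2) =
    \int[Q]_a (expsum a * W (expsum a)).
  rewrite -(RintegralZl m measurableT (bmeas_int Q (bmeasM bF bF))).
  rewrite -(RintegralB measurableT (bmeas_int Q (bmeasM bF bpsi))
    (RintegrableZ m (bmeas_int Q (bmeasM bF bF)))).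
  by apply: eq_Rintegral => a _; rewrite /W; ring.
pose t n : R := n.+1%:R^-1.
have t0 n : 0 < t n by rewrite invr_gt0.
have t1 n : t n <= 1 by rewrite invf_le1// ler1n.
pose h0 := \sum_i c i / (1 + kap i * s i) * \int[Q]_a W (expsum a).
have hc : hsum (t n) @[n --> \oo] --> h0.
  apply: cvg_fsum => i; apply: cvgMr.
  have [mW0 [B WB]] := bW; have [mE _] := bE i ltr01.
  have B0 : 0 <= B := le_trans (normr_ge0 _) (WB (fun=> 0)).
  apply: (@Rdominated_cvg _ _ _ _ _ _ (fun=> (1 + kap i * s i) * B)).
  - by move=> n; case: (kern_bmeas i (t0 n)).
  - exact: mW0.
  - move=> a; have d0 := dkern i a 0.
    have cK : {for 0, continuous (fun tau => kern i tau a)}.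
      by apply: differentiable_continuous; apply/derivable1_diffP; case: d0.
    have e0 : kern i 0 a = W (expsum a).
      by rewrite /kern UexpE !mul0r oppr0 expR0 mulr0 addr0 !mul1r.
    rewrite -e0.
    exact: (cvg_comp t (fun tau => kern i tau a) (@cvg_harmonic R) cK).
  - move=> n a; rewrite /kern normrM ler_pM//.
    have tn := t0 n; have ts : 0 <= t n * s i by rewrite mulr_ge0 ?ltW.
    rewrite normrM (gtr0_norm (Uexp_gt0 _ _ _)) -[leRHS]mulr1 ler_pM//; last exact: Uexp_le1.
      by rewrite ltW// Uexp_gt0.
    rewrite gtr0_norm ?ks_gt0// lerD2l ler_wpM2l// ler_piMl// ltW//.
  - exact: Rintegrable_cst.
have bU i : bmeas (Uexp i (s i)) by exact: bE.
have h1 : hsum 1 - h0 = \int[Q]_a (expsum a * W (expsum a)).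
  have bi i : bmeas (fun a => (Uexp i (s i) a - (1 + kap i * s i)^-1) * W (expsum a)).
    by apply: bmeasM => //; apply: bmeasD => //; exact: bmeas_cst.
  transitivity (\int[Q]_a \sum_i c i *
      ((Uexp i (s i) a - (1 + kap i * s i)^-1) * W (expsum a))); last first.
    apply: eq_Rintegral => a _; rewrite /expsum mulr_suml; apply: eq_bigr => i _.
    by rewrite mulrA.
  rewrite Rintegral_sum; last by move=> i; apply: RintegrableZ; exact: bmeas_int.
  rewrite /hsum /h0 -sumrB; apply: eq_bigr => i _.
  rewrite (RintegralZl _ measurableT (bmeas_int Q (bi i))).
  have bk : bmeas (kern i 1) by exact: kern_bmeas.
  rewrite -mulrBr -(RintegralB measurableT (bmeas_int Q bk) (bmeas_int Q bW)).
  rewrite -mulrA; congr (_ * _).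
  have k0 : 1 + kap i * s i != 0 by rewrite gt_eqF// ks_gt0// ltW.
  rewrite -(RintegralZl _ measurableT (RintegrableB (bmeas_int Q bk) (bmeas_int Q bW))).
  by apply: eq_Rintegral => a _; rewrite /kern mul1r; field.
rewrite -h1.
(* The mean value theorem is used on [[t n, 1]], since [ftau_le] asks for positive [tau]; the
   endpoint 0 is reached through [hc]. *)
have hn n : `|hsum 1 - hsum (t n)| <= stein_err.
  have e0 : 0 <= stein_err by exact: le_trans (normr_ge0 _) (ftau_le (ltr01)).
  have dh x : x \in `]t n, 1[ -> is_derive x (1 : R) hsum (ftau x).
    rewrite in_itv/= => /andP[x0 x1]; apply: dhsum; rewrite (lt_trans (t0 n) x0)/=.
    by rewrite (lt_trans x1)// ltr1n.
  have ch : {within `[t n, 1], continuous hsum}.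
    apply: derivable_within_continuous => x; rewrite in_itv/= => /andP[x0 x1].
    have x02 : 0 < x < 2 by rewrite (lt_le_trans (t0 n) x0)/= (le_lt_trans x1)// ltr1n.
    by case: (dhsum x02).
  have [x] := MVT_segment (t1 n) dh ch; rewrite in_itv/= => /andP[x0 x1] ->.
  rewrite normrM -[leRHS]mulr1 ler_pM//.
    by rewrite ftau_le// (lt_le_trans (t0 n)).
  by rewrite ger0_norm ?subr_ge0// lerBlDl lerDr ltW.
have hl : `|hsum 1 - hsum (t n)| @[n --> \oo] --> `|hsum 1 - h0|.
  by apply: cvg_norm; apply: cvgB => //; exact: cvg_cst.
rewrite -(cvg_lim _ hl)//; apply: limr_le; first by apply/cvg_ex; eexists; exact: hl.
exact: nearW.
Qed.

End stein_identity.

End stein_bound.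

(** * Laplace transforms of pairs *)

Section two_point.
Context {R : realType}.
Variable Q : probability (seqR R) R.
Hypothesis HQ : iid_normal Q.
Variables (I : finType) (N : nat) (al : I * bool -> nat -> R).
Local Notation X := (fun j => lin N (al j)).
Local Notation cov := (cov Q N al).
Local Notation Uexp := (Uexp N al).
Local Notation UX := (UX N al).
Local Notation Usqr := (Usqr N al).
Variables (kap : I -> R) (i j : I) (rho : R).
Hypothesis kap_ge0 : forall i, 0 <= kap i.
Hypothesis cov_diag : forall i p q, cov (i, p) (i, q) = (p == q)%:R * (kap i / 2).
Hypothesis cov_cross : forall q q' : bool,
  \sum_(p : bool) cov (i, p) (j, q) * cov (i, p) (j, q') = (q == q')%:R * (rho / 4).

Let sum_fst_eq l0 (F : I * bool -> R) :
  \sum_l (l.1 == l0)%:R * F l = \sum_(b : bool) F (l0, b).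
Proof.
transitivity (\sum_m \sum_(b : bool) (m == l0)%:R * F (m, b)).
  by rewrite pair_bigA; apply: eq_bigr => -[].
rewrite (bigD1 l0)//= eqxx [X in _ + X]big1 ?addr0; last first.
  by move=> m ml; rewrite big1// => b _; rewrite (negbTE ml) mul0r.
by apply: eq_bigr => b _; rewrite mul1r.
Qed.

Let eq_bmeas (V W : seqR R -> R) : (forall a, W a = V a) -> bmeas V -> bmeas W.
Proof. by move=> VW; have -> : W = V by exact/funext. Qed.

Section moments.
Variables (sg ta : R).
Hypotheses (sg0 : 0 < sg) (ta0 : 0 < ta).

Let e a := Uexp i sg a * Uexp j ta a.

Let be : bmeas e.
Proof. by apply: bmeasM; [case: (grad_Uexp N al i sg0)|case: (grad_Uexp N al j ta0)]. Qed.

Let bXXe1 p q : bmeas (fun a => X (i, p) a * X (i, q) a * e a).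
Proof.
have [_ _ /(_ (i, q))] := grad_UX N al (i, p) sg0; rewrite /= ?xpair_eqE !eqxx /= => h.
have b1 := (grad_Uexp N al i sg0).(grad_bmeas).
have b2 := (grad_Uexp N al j ta0).(grad_bmeas).
have h2 := bmeasM (bmeasM (bmeas_cst (2 * sg)^-1) (bmeasD
  (bmeasM (bmeas_cst (q == p)%:R) b1) (bmeasM (bmeas_cst (-1)) h))) b2.
apply: eq_bmeas h2 => a; rewrite /e.
by field; rewrite gt_eqF.
Qed.

Let bXXe2 p q : bmeas (fun a => X (j, p) a * X (j, q) a * e a).
Proof.
have [_ _ /(_ (j, q))] := grad_UX N al (j, p) ta0; rewrite /= ?xpair_eqE !eqxx /= => h.
have b1 := (grad_Uexp N al j ta0).(grad_bmeas).
have b2 := (grad_Uexp N al i sg0).(grad_bmeas).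
have h2 := bmeasM (bmeasM (bmeas_cst (2 * ta)^-1) (bmeasD
  (bmeasM (bmeas_cst (q == p)%:R) b1) (bmeasM (bmeas_cst (-1)) h))) b2.
apply: eq_bmeas h2 => a; rewrite /e.
by field; rewrite gt_eqF.
Qed.

Let bXXe p q : bmeas (fun a => X (i, p) a * X (j, q) a * e a).
Proof.
have b1 := (grad_UX N al (i, p) sg0).(grad_bmeas).
have b2 := (grad_UX N al (j, q) ta0).(grad_bmeas).
by apply: eq_bmeas (bmeasM b1 b2) => a; rewrite /UX /e/=; ring.
Qed.

Let D := \int[Q]_a e a.
Let Mij p q := \int[Q]_a (X (i, p) a * X (j, q) a * e a).
Let Mii p q := \int[Q]_a (X (i, p) a * X (i, q) a * e a).
Let Mjj p q := \int[Q]_a (X (j, p) a * X (j, q) a * e a).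

Let ibp_ii p : Mii p p = kap i / 2 * (D - 2 * sg * Mii p p) -
  2 * ta * \sum_(q : bool) cov (i, p) (j, q) * Mij p q.
Proof.
have g := gradM (grad_UX N al (i, p) sg0) (grad_Uexp N al j ta0).
transitivity (\int[Q]_a (X (i, p) a * (UX (i, p) sg a * Uexp j ta a))).
  by apply: eq_Rintegral => a _; rewrite /UX /e/=; ring.
rewrite (grad_ibp HQ (i, p) g).
have bA l : bmeas (fun a => UX (i, p) sg a * ((l.1 == j)%:R * (- (2 * ta) * UX l ta a))).
  apply: bmeasM (grad_UX N al (i, p) sg0).(grad_bmeas) _; apply: bmeasM (bmeas_cst _) _.
  exact: bmeasM (bmeas_cst _) (grad_UX N al l ta0).(grad_bmeas).
have bB l : bmeas (fun a => Uexp j ta a * ((l.1 == i)%:R *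
    (((l == (i, p))%:R - 2 * sg * X (i, p) a * X l a) * Uexp i sg a))).
  apply: bmeasM (grad_Uexp N al j ta0).(grad_bmeas) _.
  exact: (grad_UX N al (i, p) sg0).(grad_bmeasV) l.
transitivity (\sum_l ((l.1 == j)%:R * (cov (i, p) l * (- (2 * ta) * Mij p l.2)) +
   (l.1 == i)%:R * (cov (i, p) l * ((l == (i, p))%:R * D - 2 * sg * Mii p l.2)))).
  apply: eq_bigr => l _.
  rewrite (RintegralD measurableT (bmeas_int Q (bA l)) (bmeas_int Q (bB l))) mulrDr.
  rewrite -(mulrCA (cov (i, p) l)) -(mulrCA (cov (i, p) l)); congr (_ * _ + _ * _).
    case: l {bA bB} => m q /=; have [->|mj] := eqVneq m j; last first.
      by rewrite mul0r -[RHS](Rintegral_cst1 Q 0); apply: eq_Rintegral => a _; rewrite mul0r mulr0.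
    rewrite mul1r -(RintegralZl _ measurableT (bmeas_int Q (bXXe p q))).
    by apply: eq_Rintegral => a _; rewrite /UX /e/=; ring.
  case: l {bA bB} => m q /=; have [->|mi] := eqVneq m i; last first.
    by rewrite mul0r -[RHS](Rintegral_cst1 Q 0); apply: eq_Rintegral => a _; rewrite mul0r mulr0.
  rewrite mul1r -(RintegralZl (2 * sg) measurableT (bmeas_int Q (bXXe1 p q))).
  rewrite -(RintegralZl _ measurableT (bmeas_int Q be)).
  rewrite -(RintegralB measurableT (RintegrableZ _ (bmeas_int Q be))
    (RintegrableZ _ (bmeas_int Q (bXXe1 p q)))).
  by apply: eq_Rintegral => a _; rewrite /e/=; ring.
rewrite big_split/= (sum_fst_eq j (fun l => cov (i, p) l * (- (2 * ta) * Mij p l.2))).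
rewrite (sum_fst_eq i (fun l => cov (i, p) l * ((l == (i, p))%:R * D - 2 * sg * Mii p l.2))).
rewrite !big_bool/= !cov_diag !xpair_eqE !eqxx /=.
by case: p {g bA bB} => /=; ring.
Qed.

Let ibp_ij p q : Mij p q = cov (i, p) (j, q) * D -
  2 * ta * (\sum_(q' : bool) cov (i, p) (j, q') * Mjj q q') - kap i * sg * Mij p q.
Proof.
have g := gradM (grad_UX N al (j, q) ta0) (grad_Uexp N al i sg0).
transitivity (\int[Q]_a (X (i, p) a * (UX (j, q) ta a * Uexp i sg a))).
  by apply: eq_Rintegral => a _; rewrite /UX /e/=; ring.
rewrite (grad_ibp HQ (i, p) g).
have bA l : bmeas (fun a => UX (j, q) ta a * ((l.1 == i)%:R * (- (2 * sg) * UX l sg a))).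
  apply: bmeasM (grad_UX N al (j, q) ta0).(grad_bmeas) _; apply: bmeasM (bmeas_cst _) _.
  exact: bmeasM (bmeas_cst _) (grad_UX N al l sg0).(grad_bmeas).
have bB l : bmeas (fun a => Uexp i sg a * ((l.1 == j)%:R *
    (((l == (j, q))%:R - 2 * ta * X (j, q) a * X l a) * Uexp j ta a))).
  apply: bmeasM (grad_Uexp N al i sg0).(grad_bmeas) _.
  exact: (grad_UX N al (j, q) ta0).(grad_bmeasV) l.
transitivity (\sum_l ((l.1 == i)%:R * (cov (i, p) l * (- (2 * sg) * Mij l.2 q)) +
   (l.1 == j)%:R * (cov (i, p) l * ((l == (j, q))%:R * D - 2 * ta * Mjj q l.2)))).
  apply: eq_bigr => l _.
  rewrite (RintegralD measurableT (bmeas_int Q (bA l)) (bmeas_int Q (bB l))) mulrDr.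
  rewrite -(mulrCA (cov (i, p) l)) -(mulrCA (cov (i, p) l)); congr (_ * _ + _ * _).
    case: l {bA bB} => m q' /=; have [->|mj] := eqVneq m i; last first.
      by rewrite mul0r -[RHS](Rintegral_cst1 Q 0); apply: eq_Rintegral => a _; rewrite mul0r mulr0.
    rewrite mul1r -(RintegralZl _ measurableT (bmeas_int Q (bXXe q' q))).
    by apply: eq_Rintegral => a _; rewrite /UX /e/=; ring.
  case: l {bA bB} => m q' /=; have [->|mi] := eqVneq m j; last first.
    by rewrite mul0r -[RHS](Rintegral_cst1 Q 0); apply: eq_Rintegral => a _; rewrite mul0r mulr0.
  rewrite mul1r -(RintegralZl (2 * ta) measurableT (bmeas_int Q (bXXe2 q q'))).
  rewrite -(RintegralZl _ measurableT (bmeas_int Q be)).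
  rewrite -(RintegralB measurableT (RintegrableZ _ (bmeas_int Q be))
    (RintegrableZ _ (bmeas_int Q (bXXe2 q q')))).
  by apply: eq_Rintegral => a _; rewrite /e/=; ring.
rewrite big_split/= (sum_fst_eq i (fun l => cov (i, p) l * (- (2 * sg) * Mij l.2 q))).
rewrite (sum_fst_eq j (fun l => cov (i, p) l * ((l == (j, q))%:R * D - 2 * ta * Mjj q l.2))).
rewrite !big_bool/= !cov_diag !xpair_eqE !eqxx /=.
by case: p {g bA bB}; case: q => /=; field.
Qed.

Definition Dexp := D.
Definition Mi := \int[Q]_a (Usqr i a * e a).
Definition Mj := \int[Q]_a (Usqr j a * e a).
(** The one combination of the mixed moments that enters the relations for [Mi] and [Mj]; together
    with [moment_ij] these form a closed linear system. *)
Let c := 2 * \sum_(p : bool) \sum_(q : bool) cov (i, p) (j, q) * Mij p q.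

Lemma moment_i : Mi * (1 + kap i * sg) = kap i * D - ta * c.
Proof.
have -> : Mi = Mii true true + Mii false false.
  rewrite -(RintegralD measurableT (bmeas_int Q (bXXe1 true true)) (bmeas_int Q (bXXe1 false false))).
  by apply: eq_Rintegral => a _; rewrite /Usqr; ring.
have h1 := ibp_ii true; have h2 := ibp_ii false.
rewrite /c big_bool/=.
set S1 := \sum_q _ in h1 *; set S2 := \sum_q _ in h2 *.
have e1 : Mii true true * (1 + kap i * sg) = kap i / 2 * D - 2 * ta * S1.
  by rewrite mulrDr mulr1 [X in X + _]h1; field.
have e2 : Mii false false * (1 + kap i * sg) = kap i / 2 * D - 2 * ta * S2.
  by rewrite mulrDr mulr1 [X in X + _]h2; field.
by rewrite mulrDl e1 e2; field.
Qed.

(** By [cov_cross] the two columns of cross covariances are orthogonal and of equal norm, so the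
    second moments at [j] enter only through their sum [Mj]. *)
Lemma moment_ij : c * (1 + kap i * sg) = rho * (D - ta * Mj).
Proof.
have -> : Mj = Mjj true true + Mjj false false.
  rewrite -(RintegralD measurableT (bmeas_int Q (bXXe2 true true)) (bmeas_int Q (bXXe2 false false))).
  by apply: eq_Rintegral => a _; rewrite /Usqr; ring.
have sym : Mjj true false = Mjj false true.
  by apply: eq_Rintegral => a _; rewrite (mulrC (X (j, true) a)).
have h p q : Mij p q * (1 + kap i * sg) = cov (i, p) (j, q) * D -
  2 * ta * (cov (i, p) (j, true) * Mjj q true + cov (i, p) (j, false) * Mjj q false).
  by have := ibp_ij p q; rewrite big_bool/= => h; rewrite mulrDr mulr1 [X in X + _]h; ring.
have := cov_cross true true; have := cov_cross true false; have := cov_cross false false.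
rewrite !big_bool/= => c1 c2 c3.
have -> : c * (1 + kap i * sg) = 2 * (cov (i, true) (j, true) * (Mij true true * (1 + kap i * sg)) +
   cov (i, true) (j, false) * (Mij true false * (1 + kap i * sg)) +
   (cov (i, false) (j, true) * (Mij false true * (1 + kap i * sg)) +
   cov (i, false) (j, false) * (Mij false false * (1 + kap i * sg)))).
  by rewrite /c !big_bool/=; ring.
have alg (k1 k2 k3 k4 A B C : R) : k1 * k1 + k3 * k3 = rho / 4 ->
    k2 * k2 + k4 * k4 = rho / 4 -> k1 * k2 + k3 * k4 = 0 ->
  2 * (k1 * (k1 * D - 2 * ta * (k1 * A + k2 * B)) + k2 * (k2 * D - 2 * ta * (k1 * B + k2 * C)) +
      (k3 * (k3 * D - 2 * ta * (k3 * A + k4 * B)) + k4 * (k4 * D - 2 * ta * (k3 * B + k4 * C)))) =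
  rho * (D - ta * (A + C)).
  move=> e1 e2 e3; transitivity (2 * D * (k1 * k1 + k3 * k3 + (k2 * k2 + k4 * k4)) -
  4 * ta * (A * (k1 * k1 + k3 * k3) + C * (k2 * k2 + k4 * k4) + 2 * B * (k1 * k2 + k3 * k4))).
    by ring.
  by rewrite e1 e2 e3; field.
rewrite (h true true) (h true false) (h false true) (h false false) sym.
apply: alg; rewrite ?c1 ?c2 ?c3 /=; ring.
Qed.

Let ibp_jj p : Mjj p p = kap j / 2 * (D - 2 * ta * Mjj p p) -
  2 * sg * \sum_(q : bool) cov (i, q) (j, p) * Mij q p.
Proof.
have g := gradM (grad_UX N al (j, p) ta0) (grad_Uexp N al i sg0).
transitivity (\int[Q]_a (X (j, p) a * (UX (j, p) ta a * Uexp i sg a))).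
  by apply: eq_Rintegral => a _; rewrite /UX /e/=; ring.
rewrite (grad_ibp HQ (j, p) g).
have bA l : bmeas (fun a => UX (j, p) ta a * ((l.1 == i)%:R * (- (2 * sg) * UX l sg a))).
  apply: bmeasM (grad_UX N al (j, p) ta0).(grad_bmeas) _; apply: bmeasM (bmeas_cst _) _.
  exact: bmeasM (bmeas_cst _) (grad_UX N al l sg0).(grad_bmeas).
have bB l : bmeas (fun a => Uexp i sg a * ((l.1 == j)%:R *
    (((l == (j, p))%:R - 2 * ta * X (j, p) a * X l a) * Uexp j ta a))).
  apply: bmeasM (grad_Uexp N al i sg0).(grad_bmeas) _.
  exact: (grad_UX N al (j, p) ta0).(grad_bmeasV) l.
transitivity (\sum_l ((l.1 == i)%:R * (cov (j, p) l * (- (2 * sg) * Mij l.2 p)) +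
   (l.1 == j)%:R * (cov (j, p) l * ((l == (j, p))%:R * D - 2 * ta * Mjj p l.2)))).
  apply: eq_bigr => l _.
  rewrite (RintegralD measurableT (bmeas_int Q (bA l)) (bmeas_int Q (bB l))) mulrDr.
  rewrite -(mulrCA (cov (j, p) l)) -(mulrCA (cov (j, p) l)); congr (_ * _ + _ * _).
    case: l {bA bB} => m q /=; have [->|mj] := eqVneq m i; last first.
      by rewrite mul0r -[RHS](Rintegral_cst1 Q 0); apply: eq_Rintegral => a _; rewrite mul0r mulr0.
    rewrite mul1r -(RintegralZl _ measurableT (bmeas_int Q (bXXe q p))).
    by apply: eq_Rintegral => a _; rewrite /UX /e/=; ring.
  case: l {bA bB} => m q /=; have [->|mi] := eqVneq m j; last first.
    by rewrite mul0r -[RHS](Rintegral_cst1 Q 0); apply: eq_Rintegral => a _; rewrite mul0r mulr0.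
  rewrite mul1r -(RintegralZl (2 * ta) measurableT (bmeas_int Q (bXXe2 p q))).
  rewrite -(RintegralZl _ measurableT (bmeas_int Q be)).
  rewrite -(RintegralB measurableT (RintegrableZ _ (bmeas_int Q be))
    (RintegrableZ _ (bmeas_int Q (bXXe2 p q)))).
  by apply: eq_Rintegral => a _; rewrite /e/=; ring.
rewrite big_split/= (sum_fst_eq i (fun l => cov (j, p) l * (- (2 * sg) * Mij l.2 p))).
rewrite (sum_fst_eq j (fun l => cov (j, p) l * ((l == (j, p))%:R * D - 2 * ta * Mjj p l.2))).
rewrite !big_bool/= !cov_diag !xpair_eqE !eqxx /= !(covC Q N al (j, p)).
by case: p {g bA bB} => /=; ring.
Qed.

Lemma moment_j : Mj * (1 + kap j * ta) = kap j * D - sg * c.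
Proof.
have -> : Mj = Mjj true true + Mjj false false.
  rewrite -(RintegralD measurableT (bmeas_int Q (bXXe2 true true)) (bmeas_int Q (bXXe2 false false))).
  by apply: eq_Rintegral => a _; rewrite /Usqr; ring.
have h1 := ibp_jj true; have h2 := ibp_jj false.
have -> : c = 2 * (\sum_(q : bool) cov (i, q) (j, true) * Mij q true) +
   2 * (\sum_(q : bool) cov (i, q) (j, false) * Mij q false).
  by rewrite /c !big_bool/=; ring.
set S1 := \sum_q _ in h1 *; set S2 := \sum_q _ in h2 *.
have e1 : Mjj true true * (1 + kap j * ta) = kap j / 2 * D - 2 * sg * S1.
  by rewrite mulrDr mulr1 [X in X + _]h1; field.
have e2 : Mjj false false * (1 + kap j * ta) = kap j / 2 * D - 2 * sg * S2.
  by rewrite mulrDr mulr1 [X in X + _]h2; field.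
by rewrite mulrDl e1 e2; field.
Qed.

Lemma moment_integral :
  \int[Q]_a ((sg * Usqr i a + ta * Usqr j a) * e a) = sg * Mi + ta * Mj.
Proof.
have iMi : Rintegrable Q (fun a => Usqr i a * e a).
  apply: eq_Rintegrable (RintegrableD (bmeas_int Q (bXXe1 true true))
    (bmeas_int Q (bXXe1 false false))) => a.
  by rewrite /Usqr; ring.
have iMj : Rintegrable Q (fun a => Usqr j a * e a).
  apply: eq_Rintegrable (RintegrableD (bmeas_int Q (bXXe2 true true))
    (bmeas_int Q (bXXe2 false false))) => a.
  by rewrite /Usqr; ring.
rewrite -(RintegralZl sg measurableT iMi) -(RintegralZl ta measurableT iMj).
rewrite -(RintegralD measurableT (RintegrableZ sg iMi) (RintegrableZ ta iMj)).
by apply: eq_Rintegral => a _; ring.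
Qed.

(** Elimination of [c] from the three moment relations. The last factor is the radial derivative in
    (sg, ta) of the denominator of the Laplace transform. *)
Lemma moment_sum : (sg * Mi + ta * Mj) *
    ((1 + kap i * sg) * (1 + kap j * ta) - rho * (sg * ta)) =
  D * (sg * kap i * (1 + kap j * ta) + ta * kap j * (1 + kap i * sg) - 2 * rho * (sg * ta)).
Proof.
have A0 : 1 + kap i * sg != 0 by rewrite gt_eqF// ltr_pwDl// mulr_ge0// ltW.
have B0 : 1 + kap j * ta != 0 by rewrite gt_eqF// ltr_pwDl// mulr_ge0// ltW.
have := moment_i; have := moment_ij; have := moment_j.
move: Mi Mj c D; move=> mi mj cc dd hj hij hi.
have hc : cc * ((1 + kap i * sg) * (1 + kap j * ta) - rho * (sg * ta)) = rho * dd.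
  transitivity (cc * (1 + kap i * sg) * (1 + kap j * ta) - rho * (sg * ta) * cc); first by ring.
  rewrite hij.
  transitivity (rho * (dd * (1 + kap j * ta) - ta * (mj * (1 + kap j * ta))) - rho * (sg * ta) * cc).
    by ring.
  by rewrite hj; ring.
rewrite mulrDl; move: hc; set De := _ - _ => hc.
have -> : sg * mi * De = dd * (sg * (kap i * (1 + kap j * ta) - rho * ta)).
  apply: (mulIf A0); transitivity (sg * (mi * (1 + kap i * sg)) * De); first by ring.
  rewrite hi; transitivity (sg * (kap i * dd * De - ta * (cc * De))); first by ring.
  by rewrite hc /De; ring.
have -> : ta * mj * De = dd * (ta * (kap j * (1 + kap i * sg) - rho * sg)).
  apply: (mulIf B0); transitivity (ta * (mj * (1 + kap j * ta)) * De); first by ring.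
  rewrite hj; transitivity (ta * (kap j * dd * De - sg * (cc * De))); first by ring.
  by rewrite hc /De; ring.
ring.
Qed.

End moments.
(** Along the ray (e^t sg, e^t ta) the product has derivative 0 by [moment_sum]. As t tends to -oo
    the exponents vanish and both factors tend to 1. *)
Lemma two_point_laplace sg ta : 0 < sg -> 0 < ta ->
  (\int[Q]_a (Uexp i sg a * Uexp j ta a)) *
  ((1 + kap i * sg) * (1 + kap j * ta) - rho * (sg * ta)) = 1.
Proof.
move=> sg0 ta0.
pose Y a := sg * Usqr i a + ta * Usqr j a.
have Y0 a : 0 <= Y a by rewrite addr_ge0// mulr_ge0 ?Usqr_ge0// ltW.
have mY : measurable_fun setT Y.
  by apply: measurable_funD; apply: measurable_funM => //; exact: measurable_Usqr.
pose f (t : R) a := expR (- (expR t * Y a)).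
pose Del (t : R) := (1 + kap i * (expR t * sg)) * (1 + kap j * (expR t * ta)) -
  rho * ((expR t * sg) * (expR t * ta)).
have fE t a : f t a = Uexp i (expR t * sg) a * Uexp j (expR t * ta) a.
  by rewrite !UexpE -expRD /f /Y; congr expR; ring.
have df t a : is_derive t (1 : R) (fun t => f t a) (- (expR t * Y a) * f t a).
  by rewrite /f; apply: is_derive_eq; rewrite /GRing.scale/=; ring.
have f01 t a : 0 <= f t a <= 1.
  by rewrite /f expR_ge0 -[leRHS]expR0 ler_expR oppr_le0 mulr_ge0// expR_ge0.
have mf t : measurable_fun setT (f t).
  by apply: measurableT_comp => //; apply: measurable_funN; apply: measurable_funM.
have if_ t : Rintegrable Q (f t).
  apply: (@Rintegrable_bounded _ _ _ Q (f t) 1) => // a.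
  by have /andP[h1 h2] := f01 t a; rewrite ger0_norm.
have dfle (x : R) a : `|- (expR x * Y a) * f x a| <= 1.
  rewrite normrM normrN.
  have u0 : 0 <= expR x * Y a by rewrite mulr_ge0// expR_ge0.
  have := expRN_mul1D_le1 u0; have /andP[h1 _] := f01 x a.
  rewrite (ger0_norm u0) (ger0_norm h1) -/(f x a); set u := expR x * Y a => h.
  by move: h; rewrite mulrDr mulr1 (mulrC _ u); lra.
have dF (t : R) : is_derive t (1 : R) (fun t => \int[Q]_a f t a)
    (\int[Q]_a (- (expR t * Y a) * f t a)).
  have tI : (`]t - 1, t + 1[%classic : set R) t by rewrite /= in_itv/=; lra.
  have p1 x a : partial1of2 f x a = - (expR x * Y a) * f x a.
    by rewrite partial1of2E; have dd := df x a; exact: derive_val.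
  have Gub (x : R) a : (`]t - 1, t + 1[%classic : set R) x -> [set: seqR R] a ->
      `|partial1of2 f x a| <= 1.
    by move=> _ _; rewrite p1; exact: dfle.
  have dk (x : R) a : (`]t - 1, t + 1[%classic : set R) x -> [set: seqR R] a ->
     derivable (fun t => f t a) x 1 by move=> _ _; case: (df x a).
  have d1 := derivable_under_integral measurableT tI (fun x _ => if_ x) dk
    (fun=> ler01) (Rintegrable_cst Q 1) Gub.
  have d2 := differentiation_under_integral measurableT tI (fun x _ => if_ x) dk
    (fun=> ler01) (Rintegrable_cst Q 1) Gub.
  apply: DeriveDef => //; rewrite -derive1E d2.
  by apply: eq_Rintegral => a _; rewrite p1.
have dDel (t : R) : is_derive t (1 : R) Del
   (expR t * sg * kap i * (1 + kap j * (expR t * ta)) + expR t * ta * kap j * (1 + kap i * (expR t * sg))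
    - 2 * rho * ((expR t * sg) * (expR t * ta))).
  have dq (u v w : R) : is_derive t (1 : R)
      (fun t => (1 + u * expR t) * (1 + v * expR t) - w * (expR t * expR t))
      (expR t * u * (1 + v * expR t) + expR t * v * (1 + u * expR t) - 2 * w * (expR t * expR t)).
    have du (b : R) : is_derive t (1 : R) (fun t => 1 + b * expR t) (b * expR t).
      apply: (is_derive_eq (is_deriveD (is_derive_cst (1 : R) t (1 : R))
        (is_deriveZ b (is_derive_expR t)))).
      by rewrite add0r.
    apply: (is_derive_eq (is_deriveB (is_deriveM (du u) (du v))
       (is_deriveZ w (is_deriveM (is_derive_expR t) (is_derive_expR t))))).
    by rewrite /GRing.scale/=; ring.
  have := dq (kap i * sg) (kap j * ta) (rho * (sg * ta)).
  move=> /is_derive_eq h.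
  rewrite (_ : Del = fun t => (1 + kap i * sg * expR t) * (1 + kap j * ta * expR t) -
    rho * (sg * ta) * (expR t * expR t)); first by apply: h; ring.
  by apply/funext => x; rewrite /Del; ring.
have d0 (t : R) : is_derive t (1 : R) (fun t => (\int[Q]_a f t a) * Del t) 0.
  apply: (is_derive_eq (is_deriveM (dF t) (dDel t))); rewrite /GRing.scale/=.
  have sg' : 0 < expR t * sg by rewrite mulr_gt0// expR_gt0.
  have ta' : 0 < expR t * ta by rewrite mulr_gt0// expR_gt0.
  have -> : \int[Q]_a (- (expR t * Y a) * f t a) = - \int[Q]_a
     ((expR t * sg * Usqr i a + expR t * ta * Usqr j a) *
      (Uexp i (expR t * sg) a * Uexp j (expR t * ta) a)).
    have iYf : Rintegrable Q (fun a => - (expR t * Y a) * f t a).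
      apply: (@Rintegrable_bounded _ _ _ Q _ 1) => [|a].
        by apply: measurable_funM => //; apply: measurable_funN; apply: measurable_funM.
      exact: dfle.
    rewrite -[LHS]opprK; congr (- _).
    transitivity (-1 * \int[Q]_a (- (expR t * Y a) * f t a)); first by rewrite mulN1r.
    rewrite -(RintegralZl (-1) measurableT iYf); apply: eq_Rintegral => a _.
    by rewrite -fE /Y; ring.
  rewrite (moment_integral sg' ta').
  have := moment_sum sg' ta'; rewrite -/(Del t) /Dexp.
  have -> : \int[Q]_a (Uexp i (expR t * sg) a * Uexp j (expR t * ta) a) = \int[Q]_a f t a.
    by apply: eq_Rintegral => a _; rewrite fE.
  by move=> <-; ring.
have c0 : expR (- n%:R : R) @[n --> \oo] --> (0 : R) by exact: cvgn_expR.
have hl : (\int[Q]_a f (- n%:R) a) * Del (- n%:R) @[n --> \oo] --> (1 : R).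
  rewrite -[X in _ --> X](mulr1 1); apply: cvgM.
    rewrite -[X in _ --> X](Rintegral_cst1 Q 1).
    apply: (@Rdominated_cvg _ _ _ _ (fun n : nat => f (- n%:R)) (fun=> 1) (fun=> 1)) => //.
    - move=> a; rewrite -[X in _ --> X]expR0; apply: (cvg_comp _ expR); last exact: continuous_expR.
      by rewrite -oppr0; apply: cvgN; rewrite -[X in _ --> X](mul0r (Y a)); apply: cvgMl.
    - by move=> n a; have /andP[h1 h2] := f01 (- n%:R) a; rewrite ger0_norm.
    - exact: Rintegrable_cst.
  have cs (u : R) : expR (- n%:R) * u @[n --> \oo] --> 0 * u by exact: cvgMl.
  have cA (k u : R) : 1 + k * (expR (- n%:R) * u) @[n --> \oo] --> 1 + k * (0 * u).
    by apply: cvgD; [exact: cvg_cst|apply: cvgMr; exact: cs].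
  have h1 : (1 + kap i * (expR (- n%:R) * sg)) * (1 + kap j * (expR (- n%:R) * ta)) @[n --> \oo]
      --> (1 + kap i * (0 * sg)) * (1 + kap j * (0 * ta)).
    by exact: (cvgM (cA (kap i) sg) (cA (kap j) ta)).
  have h2 : rho * ((expR (- n%:R) * sg) * (expR (- n%:R) * ta)) @[n --> \oo] -->
      rho * ((0 * sg) * (0 * ta)) by apply: cvgMr; exact: (cvgM (cs sg) (cs ta)).
  have : Del (- n%:R) @[n --> \oo] --> (1 + kap i * (0 * sg)) * (1 + kap j * (0 * ta)) -
      rho * ((0 * sg) * (0 * ta)) by exact: (cvgB h1 h2).
  rewrite (_ : (1 + kap i * (0 * sg)) * (1 + kap j * (0 * ta)) - rho * ((0 * sg) * (0 * ta)) = 1).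
    by [].
  by ring.
have hc : (fun n : nat => (\int[Q]_a f (- n%:R) a) * Del (- n%:R)) =
    (fun=> (\int[Q]_a f 0 a) * Del 0).
  by apply/funext => n; have := @is_derive_0_is_cst R _ (- n%:R) 0 d0.
rewrite hc in hl.
transitivity ((\int[Q]_a f 0 a) * Del 0).
  rewrite /Del expR0 !mul1r; congr (_ * _); apply: eq_Rintegral => a _.
  by rewrite fE expR0 !mul1r.
by apply: (cvg_unique _ _ hl) => //; exact: cvg_cst.
Qed.

End two_point.

(** * Stein's equation *)

Section stein_equation.
Context {R : realType}.
Local Notation mR := (measurableTypeR R).
Local Notation leb := (@lebesgue_measure R).
Variable s : R.
Hypothesis s0 : 0 < s.
Local Notation phi := (normal_pdf (0 : R) s).

Let sn0 : s != 0. Proof. by rewrite gt_eqF. Qed.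

Let phiE x : phi x = normal_peak s * expR (- ((2 * s ^+ 2)^-1 * x ^+ 2)).
Proof.
rewrite normal_pdfE// /normal_fun subr0; congr (_ * expR _).
by rewrite mulNr mulrC -mulr_natl.
Qed.

Lemma normal_pdf_gt0 x : 0 < phi x.
Proof. by rewrite phiE mulr_gt0 ?normal_peak_gt0 ?expR_gt0. Qed.

Lemma is_derive_normal_pdf x : is_derive x (1 : R) phi (- (x / s ^+ 2) * phi x).
Proof.
rewrite (_ : phi = fun x => normal_peak s * expR (- ((2 * s ^+ 2)^-1 * x ^+ 2))); last first.
  by apply/funext => y; exact: phiE.
set c := (2 * s ^+ 2)^-1; have -> : x / s ^+ 2 = 2 * c * x by rewrite /c; field.
apply: is_derive_eq; rewrite /GRing.scale/=; ring.
Qed.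

Lemma normal_pdf_cvg0 : phi x @[x --> +oo] --> 0.
Proof.
have c0 : 0 < (2 * s ^+ 2)^-1 by rewrite invr_gt0 mulr_gt0// exprn_gt0.
rewrite (_ : phi = fun x => normal_peak s * expR (- ((2 * s ^+ 2)^-1 * x ^+ 2))); last first.
  by apply/funext => y; exact: phiE.
rewrite -[X in _ --> X](mulr0 (normal_peak s)); apply: cvgMr.
apply: (cvg_comp (fun x => (2 * s ^+ 2)^-1 * x ^+ 2) (fun y => expR (- y))); last exact: cvgr_expR.
apply/cvgryPge => A; near=> t.
have t1 : 1 <= t by near: t; apply: nbhs_pinfty_ge; exact: num_real.
have tA : A / (2 * s ^+ 2)^-1 <= t by near: t; apply: nbhs_pinfty_ge; exact: num_real.
have : A <= t * (2 * s ^+ 2)^-1 by rewrite -ler_pdivrMr.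
move/le_trans; apply; rewrite mulrC ler_wpM2l ?(ltW c0)//.
have t0 : 0 <= t := le_trans ler01 t1.
by rewrite expr2 ler_peMr.
Unshelve. all: by end_near. Qed.

Let iphi D : measurable D -> leb.-integrable D (EFin \o phi).
Proof.
move=> mD; apply: integrableS (integrable_normal_pdf 0 s) => //; exact: measurableT.
Qed.

Let cphi : continuous phi.
Proof. exact: continuous_normal_pdf. Qed.

(* Mills' bound: [t phi t] is the derivative of [- s ^+ 2 * phi t] *)
Lemma normal_pdf_right_tail x : 0 <= x ->
  x * \int[leb]_(t in `[x, +oo[) phi t <= s ^+ 2 * phi x.
Proof.
move=> x0; have mI : measurable (`[x, +oo[%classic : set R) by [].
rewrite -RintegralZl//; last exact: iphi.
have cF : continuous (fun t => - (s ^+ 2 * phi t)).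
  by move=> t; apply: cvgN; apply: cvgMr; exact: cphi.
have dF (t : R) : is_derive t (1 : R) (fun t => - (s ^+ 2 * phi t)) (t * phi t).
  apply: (is_derive_eq (is_deriveN (is_deriveZ (s ^+ 2) (is_derive_normal_pdf t)))).
  by rewrite /GRing.scale/=; field.
have h : (\int[leb]_(t in `[x, +oo[) (t * phi t)%:E = 0%:E - (- (s ^+ 2 * phi x))%:E)%E.
  apply: (@ge0_continuous_FTC2y R (fun t => t * phi t) (fun t => - (s ^+ 2 * phi t))).
  - by move=> t xt; apply: mulr_ge0; [exact: le_trans xt|exact: normal_pdf_ge0].
  - apply: continuous_subspaceT => t; apply: cvgM; [exact: cvg_id|exact: cphi].
  - rewrite -[X in _ --> X]oppr0; apply: cvgN; rewrite -[X in _ --> X](mulr0 (s ^+ 2)).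
    apply: cvgMr. exact: normal_pdf_cvg0.
  - by move=> t _; case: (dF t).
  - exact/cvg_at_right_filter/cF.
  - by move=> t _; rewrite derive1E; case: (dF t).
rewrite -EFinB sub0r opprK in h.
rewrite (_ : s ^+ 2 * phi x = fine (\int[leb]_(t in `[x, +oo[) (t * phi t)%:E)%E); last by rewrite h.
apply: fine_le.
- have ix : leb.-integrable `[x, +oo[ (EFin \o (fun t => x * phi t)).
    rewrite (_ : EFin \o _ = fun t => (x%:E * (EFin \o phi) t)%E); last by apply/funext.
    by apply: integrableZl => //; exact: iphi.
  exact: integrable_fin_num.
- by rewrite h.
apply: ge0_le_integral => //.
- by move=> t xt; rewrite lee_fin mulr_ge0// normal_pdf_ge0.
- apply/measurable_EFinP; apply: measurable_funM => //.
  exact: measurable_funTS (measurable_normal_pdf _ _).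
- apply/measurable_EFinP; apply: measurable_funM => //.
  exact: measurable_funTS (measurable_normal_pdf _ _).
- by move=> t /=; rewrite in_itv/= andbT => xt; rewrite lee_fin ler_wpM2r// normal_pdf_ge0.
Qed.

Lemma normal_pdf_left_tail x : 0 <= x ->
  x * \int[leb]_(t in `]-oo, (- x)]) phi t <= s ^+ 2 * phi x.
Proof.
move=> x0; apply: le_trans (normal_pdf_right_tail x0); rewrite ler_wpM2l//.
rewrite /Rintegral ge0_integration_by_substitutionNy.
- rewrite (_ : (fun t => ((phi \o -%R) t)%:E) = EFin \o phi)//.
  by apply/funext => t /=; rewrite !phiE sqrrN.
- exact: continuous_subspaceT.
- by move=> t _; exact: normal_pdf_ge0.
Qed.

(** Adding [M] reduces to a nonnegative integrand, covered by [ge0_integral_normal_prob]. *)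
Lemma Rintegral_normal_prob (g : mR -> R) (M : R) : measurable_fun setT g ->
  (forall x, `|g x| <= M) ->
  \int[normal_prob 0 s]_x g x = \int[leb]_x (g x * phi x).
Proof.
move=> mg gM.
have M0 : 0 <= M := le_trans (normr_ge0 _) (gM 0).
have ig : Rintegrable leb (fun x : mR => g x * phi x).
  apply: (@Rintegrable_le _ mR R leb (fun x => g x * phi x) (fun x => M * phi x)).
  - by apply: measurable_funM => //; exact: measurable_normal_pdf.
  - by move=> x; rewrite normrM (gtr0_norm (normal_pdf_gt0 x)) ler_wpM2r// normal_pdf_ge0.
  - by apply: RintegrableZ; exact: iphi.
have ip : leb.-integrable setT (fun x => (phi x)%:E) by exact: iphi.
have e : \int[normal_prob 0 s]_x (g x + M) = \int[leb]_x ((g x + M) * phi x).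
  rewrite /Rintegral ge0_integral_normal_prob.
  - by congr fine; apply: eq_integral => x _; rewrite -EFinM.
  - by apply/measurable_EFinP; exact: measurable_funD.
  - by move=> x; rewrite lee_fin; have := gM x; rewrite ler_norml; lra.
have ig' : Rintegrable (normal_prob 0 s) g by exact: Rintegrable_bounded gM.
rewrite (RintegralD measurableT ig' (Rintegrable_cst _ M)) Rintegral_cst1 in e.
have e2 : \int[leb]_x ((g x + M) * phi x) = \int[leb]_x (g x * phi x) + M.
  transitivity (\int[leb]_x (g x * phi x + M * phi x)).
    by apply: eq_Rintegral => x _; rewrite mulrDl.
  rewrite (RintegralD measurableT ig (RintegrableZ M ip)); congr (_ + _).
  rewrite (RintegralZl M measurableT ip).
  by rewrite /Rintegral integral_normal_pdf mulr1.
by apply: (addIr M); rewrite e e2.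
Qed.

Variables (g : R -> R) (M : R).
Hypothesis cg : continuous g.
Hypothesis gM : forall x, `|g x| <= M.

Let m := \int[normal_prob 0 s]_x g x.

Let mg : measurable_fun setT g. Proof. exact: continuous_measurable_fun. Qed.

Let M0 : 0 <= M. Proof. exact: le_trans (normr_ge0 _) (gM 0). Qed.

Let m_le : `|m| <= M.
Proof.
rewrite -(Rintegral_cst1 (normal_prob 0 s) M); apply: (@Rintegral_le_norm _ mR R (normal_prob 0 s) g (fun=> M)) => //.
- exact: (@Rintegrable_bounded _ mR R (normal_prob 0 s) g M mg gM).
- exact: Rintegrable_cst.
Qed.

Let w t := (g t - m) * phi t.

Let w_le t : `|w t| <= 2 * M * phi t.
Proof.
rewrite normrM (gtr0_norm (normal_pdf_gt0 t)) ler_wpM2r ?(ltW (normal_pdf_gt0 t))//.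
by rewrite (le_trans (ler_normB _ _))//; have := gM t; have := m_le; lra.
Qed.

Let cw : continuous w.
Proof.
move=> t; apply: cvgM; last exact: cphi.
by apply: cvgB; [exact: cg|exact: cvg_cst].
Qed.

Let iw D : measurable D -> leb.-integrable D (EFin \o w).
Proof.
move=> mD; have h : Rintegrable leb (fun x : mR => w x).
  apply: (@Rintegrable_le _ mR R leb w (fun x => 2 * M * phi x)) => //.
  - exact: continuous_measurable_fun.
  - by apply: RintegrableZ; exact: iphi.
by apply: integrableS h => //; exact: measurableT.
Qed.

Let G x := \int[leb]_(t in `]-oo, x]) w t.

Let dG (x : R) : is_derive x (1 : R) G (w x).
Proof.
have [] := @continuous_FTC1 R w -oo%O x (x + 1) _ _ _ (cw (x := x)).
- by rewrite ltrDl.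
- exact: iw.
- by rewrite ltNyr.
- move=> dGx Gw; apply: DeriveDef; first exact: dGx.
  by rewrite -derive1E; exact: Gw.
Qed.

Let w_tail D : measurable D -> `|\int[leb]_(t in D) w t| <= 2 * M * \int[leb]_(t in D) phi t.
Proof.
move=> mD; rewrite -RintegralZl//; last exact: iphi.
apply: le_trans (le_normr_Rintegral mD (iw mD)) _.
apply: le_Rintegral => //.
- by have := iw mD; exact: integrable_norm.
- rewrite (_ : EFin \o _ = fun t => ((2 * M)%:E * (EFin \o phi) t)%E); last by apply/funext.
  by apply: integrableZl => //; exact: iphi.
Qed.

Let w0 : \int[leb]_t w t = 0.
Proof.
rewrite -(Rintegral_normal_prob (g := fun t => g t - m) (M := 2 * M)).
- rewrite RintegralB//; [|exact: (@Rintegrable_bounded _ mR R (normal_prob 0 s) g M mg gM)|exact: Rintegrable_cst].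
  by rewrite Rintegral_cst1 subrr.
- exact: measurable_funB.
- by move=> t; rewrite (le_trans (ler_normB _ _))//; have := gM t; have := m_le; lra.
Qed.

(** The total integral of [w] is zero, so for [0 <= x] the left tail can be exchanged for the right
    one; in both cases the tail bound of Mills applies. *)
Let G_le x : `|x * G x| <= 2 * M * s ^+ 2 * phi x.
Proof.
have [x0|x0] := leP 0 x.
- have -> : G x = - \int[leb]_(t in `]x, +oo[) w t.
    apply/eqP; rewrite -addr_eq0 -w0 -(setUv (`]-oo, x]%classic : set R)) setCitvl.
    rewrite Rintegral_setU//; last 2 first.
    + by apply: iw; exact: measurableU.
    + by rewrite -setCitvl; apply/disj_setPCl.
  rewrite mulrN normrN normrM (ger0_norm x0).
  apply: le_trans (ler_wpM2l x0 (w_tail _)) _ => //.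
  rewrite Rintegral_itv_obnd_cbnd; last exact: iphi.
  by rewrite mulrCA -[leRHS]mulrA ler_wpM2l ?mulr_ge0//; exact: normal_pdf_right_tail.
- have x0' : 0 <= - x by rewrite oppr_ge0 ltW.
  rewrite normrM (ltr0_norm x0); apply: le_trans (ler_wpM2l x0' (w_tail _)) _ => //.
  rewrite mulrCA -[leRHS]mulrA ler_wpM2l ?mulr_ge0//.
  have := normal_pdf_left_tail x0'; rewrite opprK => /le_trans; apply.
  by rewrite !phiE sqrrN.
Qed.

(** The solution is the integral of (g - m) phi up to x, divided by s^2 phi(x). Both |g - m| and |x
    psi(x)| are at most 2 M, hence the bound 4 M / s^2. *)
Lemma stein_equation : exists psi psi' : R -> R,
  [/\ forall x : R, is_derive x (1 : R) psi (psi' x),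
      forall x, `|psi' x| <= 4 * M / s ^+ 2, continuous psi' &
      forall x, s ^+ 2 * psi' x - x * psi x = g x - \int[normal_prob 0 s]_x g x].
Proof.
have s2 : 0 < s ^+ 2 by rewrite exprn_gt0.
pose psi x := G x / (s ^+ 2 * phi x).
pose psi' x := (g x - m + x * psi x) / s ^+ 2.
have pn0 x : phi x != 0 by rewrite gt_eqF// normal_pdf_gt0.
have dpsi (x : R) : is_derive x (1 : R) psi (psi' x).
  have sp : s ^+ 2 * phi x != 0 by rewrite mulf_neq0// gt_eqF.
  have hZ : is_derive x (1 : R) (fun y => s ^+ 2 * phi y) (s ^+ 2 * (- (x / s ^+ 2) * phi x)).
    exact: is_deriveZ (is_derive_normal_pdf x).
  have hV := @is_deriveV R (fun y => s ^+ 2 * phi y) x _ 1 sp hZ.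
  have h := is_deriveM (dG x) hV.
  apply: (is_derive_eq h); rewrite /GRing.scale/= /psi' /psi /w.
  have := pn0 x; set p := phi x => p0.
  by field; rewrite ?p0 ?sn0.
exists psi, psi'; split => //.
- move=> x; rewrite /psi' normrM normfV (gtr0_norm s2) ler_wpM2r ?invr_ge0 ?(ltW s2)//.
  have h : `|x * psi x| <= 2 * M.
    rewrite /psi mulrA normrM normfV (@gtr0_norm _ (s ^+ 2 * phi x)) ?mulr_gt0 ?normal_pdf_gt0//.
    by rewrite ler_pdivrMr ?mulr_gt0 ?normal_pdf_gt0// mulrA G_le.
  rewrite (le_trans (ler_normD _ _))// (le_trans (lerD (ler_normB _ _) (lexx _)))//.
  by have := gM x; have := m_le; lra.
- have cpsi := continuous_of_is_derive dpsi.
  move=> x; apply: cvgMl; apply: cvgD; first by apply: cvgB; [exact: cg|exact: cvg_cst].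
  by apply: cvgM; [exact: cvg_id|exact: cpsi].
- by move=> x; rewrite /psi' -/m mulrC divfK ?gt_eqF// addrK.
Qed.

End stein_equation.

(** * Approximation of the logarithm by exponentials *)

Section euler_gamma.
Context {R : realType}.

Definition harm n : R := \sum_(k < n) k.+1%:R^-1.

Lemma harmE n : \sum_(1 <= k < n.+1) k%:R^-1 = harm n.
Proof. by rewrite big_add1/= big_mkord. Qed.

Lemma harmD (a b : nat) : harm (a + b)%N = harm a + \sum_(i < b) (a + i)%N.+1%:R^-1.
Proof.
elim: b => [|b ih]; first by rewrite addn0 big_ord0 addr0.
by rewrite addnS big_ord_recr/= addrA -ih /harm big_ord_recr.
Qed.

Lemma lnB_le (x : R) : 0 < x -> 1 - x^-1 <= ln x.
Proof.
move=> x0; have := @le_ln1Dx R (x^-1 - 1); rewrite addrCA subrr addr0 lnV ?posrE//.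
by move=> /(_ _); rewrite ltrBrDl subrr invr_gt0 => /(_ x0); lra.
Qed.

(** The sequence decreases and is nonnegative, both by 1 - 1/x <= ln x; the shift of the index
    avoids ln 0. *)
Lemma euler_gamma_cvg : harm n.+1 - ln n.+1%:R @[n --> \oo] --> euler_gamma R.
Proof.
have key n : ln n.+1%:R <= harm n.
  elim: n => [|n ih]; first by rewrite ln1 /harm big_ord0.
  rewrite /harm big_ord_recr/= -/(harm n).
  have h := @lnB_le (n.+1%:R / n.+2%:R) _.
  have := h (divr_gt0 (ltr0Sn _ _) (ltr0Sn _ _)).
  rewrite ln_div ?posrE// invf_div.
  have -> : 1 - n.+2%:R / n.+1%:R = - n.+1%:R^-1 :> R.
    by rewrite -[n.+2]addn1 natrD mulrDl divff// mul1r opprD addrA subrr sub0r.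
  by move: ih; set a := ln n.+1%:R; set b := ln n.+2%:R; set c := n.+1%:R^-1; lra.
pose u n : R := harm n.+1 - ln n.+1%:R.
have ud : {homo u : n m / (n <= m)%N >-> n >= m}.
  apply/nonincreasing_seqP => n; rewrite /u /harm [in leLHS]big_ord_recr/=.
  have h := @lnB_le (n.+2%:R / n.+1%:R) _.
  have := h (divr_gt0 (ltr0Sn _ _) (ltr0Sn _ _)).
  rewrite ln_div ?posrE// invf_div.
  have -> : 1 - n.+1%:R / n.+2%:R = n.+2%:R^-1 :> R.
    rewrite -[X in X - _](@divff _ n.+2%:R)// -mulrBl -natrB// subSn// subnn.
    by rewrite mul1r.
  by set a := ln n.+1%:R; set b := ln n.+2%:R; set c := n.+2%:R^-1; lra.
have uc : cvgn u.
  apply: nonincreasing_is_cvgn => //; exists 0 => _ [n _ <-].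
  rewrite /u subr_ge0 (le_trans _ (key n.+1))// ler_ln ?posrE// ler_nat//.
suff -> : euler_gamma R = limn u by [].
apply/cvg_lim => //; rewrite -cvg_shiftS.
rewrite (_ : (fun n => _) = u); first exact: uc.
by apply/funext => n; rewrite /u harmE.
Qed.

End euler_gamma.

(** * Exponential sums converging to the logarithm *)

Section log_series.
Context {R : realType}.

(** The remainder vanishes at 0 and has derivative t^J / (1 - t), which increases with t. *)
Lemma log_series_bound (J : nat) (x : R) : 0 <= x < 1 ->
  `|- ln (1 - x) - \sum_(j < J) x ^+ j.+1 / j.+1%:R| <= x ^+ J / (1 - x).
Proof.
move=> /andP[x0 x1].
pose f (t : R) := - ln (1 - t) - \sum_(j < J) t ^+ j.+1 / j.+1%:R.
have df (t : R) : t < 1 -> is_derive t (1 : R) f (t ^+ J / (1 - t)).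
  move=> t1; have t1' : 0 < 1 - t by rewrite subr_gt0.
  have d1 : is_derive t (1 : R) (fun t => 1 - t) (-1).
    apply: (is_derive_eq (is_deriveB (is_derive_cst (1 : R) t (1 : R)) (is_derive_id t (1 : R)))).
    by rewrite sub0r.
  have d2 : is_derive t (1 : R) (fun t => ln (1 - t)) (- (1 - t)^-1).
    have := @is_derive1_comp R (@ln R) (fun t => 1 - t) t _ _ (is_derive1_ln t1') d1.
    by rewrite mulrN1.
  have d3 (j : nat) : is_derive t (1 : R) (fun t => t ^+ j.+1 / j.+1%:R) (t ^+ j).
    have hX : is_derive t (1 : R) (fun t => t ^+ j.+1) (j.+1%:R * t ^+ j).
      rewrite (_ : (fun t => _) = (@id R) ^+ j.+1); last first.
        by apply/funext => y; rewrite exprfctE.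
      by apply: is_derive_eq; rewrite /GRing.scale/= mulr1.
    have hZ : is_derive t (1 : R) (fun t => j.+1%:R^-1 * t ^+ j.+1) (j.+1%:R^-1 * (j.+1%:R * t ^+ j)).
      exact: is_deriveZ hX.
    rewrite (_ : (fun t => _) = (fun t => j.+1%:R^-1 * t ^+ j.+1)); last first.
      by apply/funext => y; rewrite mulrC.
    by apply: (is_derive_eq hZ); rewrite mulrA mulVf ?mul1r.
  have h := is_deriveB (is_deriveN d2) (is_derive_fsum (index_enum 'I_J) (fun j : 'I_J => d3 j)).
  apply: (is_derive_eq h).
  have := subrX1 t J => e.
  have -> : \sum_(i < J) t ^+ i = (1 - t ^+ J) / (1 - t).
    have t1n : 1 - t != 0 by rewrite gt_eqF.
    by apply: (mulfI t1n); rewrite mulrCA divff// mulr1 -[RHS]opprB e -mulNr opprB.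
  by rewrite opprK; field; rewrite gt_eqF.
have f0 : f 0 = 0.
  rewrite /f subr0 ln1 oppr0 sub0r big1 ?oppr0// => j _; by rewrite expr0n mul0r.
rewrite -/(f x) -[f x]subr0 -f0.
have dd (t : R) : t \in `]0, x[ -> is_derive t (1 : R) f (t ^+ J / (1 - t)).
  by rewrite in_itv/= => /andP[_ tx]; apply: df; exact: lt_trans x1.
have cf : {within `[0, x], continuous f}.
  apply: derivable_within_continuous => t; rewrite in_itv/= => /andP[_ tx].
  by have [] := df t (le_lt_trans tx x1).
have [t] := MVT_segment x0 dd cf; rewrite in_itv/= subr0 => /andP[t0 tx] ->.
have t1 : 0 < 1 - t by rewrite subr_gt0 (le_lt_trans tx).
have x1' : 0 < 1 - x by rewrite subr_gt0.
rewrite ger0_norm ?mulr_ge0 ?exprn_ge0 ?invr_ge0 ?(ltW t1)//.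
rewrite -[leRHS]mulr1 ler_pM ?mulr_ge0 ?exprn_ge0 ?invr_ge0 ?(ltW t1) ?(ltW x1)//.
rewrite ler_pM ?exprn_ge0 ?invr_ge0 ?(ltW t1)//; first by rewrite lerXn2r ?nnegrE.
by rewrite lef_pV2 ?posrE// lerB.
Qed.

(** With x = exp(-y / (n+1)), the expansion of ln (1 - x) turns ln ((n+1)(1 - x)), which tends to ln
    y, into exponentials exp(-s y) at these nodes s. Taking (n+1)^2 terms leaves the remainder
    factor exp(-(n+1) y). *)
Definition sgrid n j : R := j.+1%:R / n.+1%:R.

Definition Jgrid n := (n.+1 ^ 2)%N.

Lemma sgrid_gt0 n j : 0 < sgrid n j.
Proof. by rewrite divr_gt0. Qed.

Lemma sgrid_le n (j : 'I_(Jgrid n)) : sgrid n j <= n.+1%:R.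
Proof.
rewrite ler_pdivrMr// -natrM ler_nat; apply: (leq_trans (ltn_ord j)).
by rewrite /Jgrid expnS expn1.
Qed.

Lemma log_approx (y : R) : 0 < y ->
  ln n.+1%:R - \sum_(j < Jgrid n) expR (- (sgrid n j * y)) / j.+1%:R @[n --> \oo] --> ln y.
Proof.
move=> y0; pose u n : R := y / n.+1%:R; pose x n := expR (- u n).
have u0 n : 0 < u n by rewrite divr_gt0.
have uc : u n @[n --> \oo] --> 0 := cvg_harmonicZ y.
have x01 n : 0 <= x n < 1.
  by rewrite expR_ge0/= -[ltRHS]expR0 ltr_expR oppr_lt0.
have x1 n : u n / (1 + u n) <= 1 - x n.
  have u1 : 0 < 1 + u n by rewrite addr_gt0.
  have : x n <= (1 + u n)^-1.
    by rewrite /x expRN lef_pV2 ?posrE ?expR_gt0//; exact: expR_ge1Dx.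
  have -> : u n / (1 + u n) = 1 - (1 + u n)^-1 by field; rewrite gt_eqF.
  lra.
have x2 n : 1 - x n <= u n by have := expR_ge1Dx (- u n); rewrite -/(x n); lra.
have xp n : 0 < 1 - x n by have := x01 n; lra.
have c1 : ln (n.+1%:R * (1 - x n)) @[n --> \oo] --> ln y.
  apply: (cvg_comp (fun n => n.+1%:R * (1 - x n)) (@ln R)); last exact: continuous_ln.
  apply: (@squeeze_cvgr _ _ _ _ (fun n => y / (1 + u n)) (fun=> y)).
  - apply: nearW => n; apply/andP; split.
      have := ler_wpM2l (ler0n R n.+1) (x1 n); apply: le_trans.
      by rewrite mulrA /u mulrCA divff// mulr1.
    by have := ler_wpM2l (ler0n R n.+1) (x2 n); rewrite /u mulrCA divff// mulr1.
  - rewrite -[X in _ --> X]divr1; apply: cvgMr; apply: cvgV => //.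
    by rewrite -[X in _ --> X]addr0; apply: cvgD => //; exact: cvg_cst.
  - exact: cvg_cst.
have e n : ln n.+1%:R - \sum_(j < Jgrid n) expR (- (sgrid n j * y)) / j.+1%:R =
   ln (n.+1%:R * (1 - x n)) + (- ln (1 - x n) - \sum_(j < Jgrid n) x n ^+ j.+1 / j.+1%:R).
  rewrite lnM ?posrE// addrA addrK; congr (_ - _); apply: eq_bigr => j _.
  by congr (_ / _); rewrite /x -expRM_natl; congr expR; rewrite /u /sgrid mulrN; ring.
rewrite (funext e).
rewrite -[X in _ --> X]addr0; apply: cvgD => //.
apply/norm_cvg0P.
(* The first factor bounds 1 / (1 - x) through [x1]. The second bounds x^J = exp(-v)^2 by v^-2 with
   v = y (n+1) / 2. *)
pose B n := (y^-1 * n.+1%:R + 1) * (4 / (y ^+ 2 * n.+1%:R ^+ 2)) : R.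
apply: (@squeeze_cvgr _ _ _ _ (fun=> 0) B).
- apply: nearW => n; rewrite normr_ge0/=; apply: (le_trans (log_series_bound _ (x01 n))).
  rewrite mulrC ler_pM ?invr_ge0 ?exprn_ge0 ?(ltW (xp n)) ?expR_ge0//.
    apply: (@le_trans _ _ (u n / (1 + u n))^-1).
      rewrite lef_pV2 ?posrE; [|exact: xp|by rewrite divr_gt0// addr_gt0]. exact: x1.
    rewrite invf_div mulrDl divff ?gt_eqF// mul1r /u invf_div.
    by rewrite mulrC.
  have -> : x n ^+ Jgrid n = expR (- (y * n.+1%:R / 2)) ^+ 2.
    rewrite /x -!expRM_natl /Jgrid natrX /u; congr expR; field.
    by rewrite addrC natr1 pnatr_eq0.
  have -> : 4 / (y ^+ 2 * n.+1%:R ^+ 2) = ((y * n.+1%:R / 2)^-1) ^+ 2.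
    by field; rewrite (gt_eqF y0) addrC natr1 pnatr_eq0.
  have v0 : 0 < y * n.+1%:R / 2 by rewrite !mulr_gt0.
  rewrite lerXn2r ?nnegrE ?expR_ge0 ?invr_ge0 ?(ltW v0)//.
  rewrite expRN lef_pV2 ?posrE ?expR_gt0//; have := expR_ge1Dx (y * n.+1%:R / 2); lra.
- exact: cvg_cst.
- rewrite (_ : B = fun n => 4 / y ^+ 3 * n.+1%:R^-1 + 4 / y ^+ 2 * (n.+1%:R^-1 * n.+1%:R^-1)); last first.
    by apply/funext => n; rewrite /B; field; rewrite (gt_eqF y0) addrC natr1 pnatr_eq0.
  have h := @cvg_harmonic R.
  rewrite -[X in _ --> X](_ : 4 / y ^+ 3 * 0 + 4 / y ^+ 2 * (0 * 0) = 0); last by ring.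
  apply: cvgD; apply: cvgMr; first exact: h.
  by apply: cvgM; exact: h.
Qed.

(** The constants [(1 + sgrid n j)^-1] are the means of exp(-s |U|^2) when |U|^2 is exponential of
    mean 1, so [gapprox n] of |U|^2 is centred for every [n]. *)
Definition gapprox n (y : R) : R :=
  - 2^-1 * \sum_(j < Jgrid n) j.+1%:R^-1 * (expR (- (sgrid n j * y)) - (1 + sgrid n j)^-1).

(** Partial fractions make the sum of the subtracted constants a difference of harmonic sums: it
    equals [harm n.+1] up to a term at most 1/(n+1). Compared with ln (n+1) it produces Euler's
    constant. *)
Lemma gapprox_cvg (y : R) : 0 < y ->
  gapprox n y @[n --> \oo] --> 2^-1 * (ln y + euler_gamma R).
Proof.
move=> y0.
pose m n : R := ln n.+1%:R - \sum_(j < Jgrid n) j.+1%:R^-1 * (1 + sgrid n j)^-1.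
have mE n : m n = - (harm n.+1 - ln n.+1%:R) + \sum_(i < n.+1) (Jgrid n + i)%N.+1%:R^-1.
  rewrite /m; have -> : \sum_(j < Jgrid n) j.+1%:R^-1 * (1 + sgrid n j)^-1 =
      harm (Jgrid n) - \sum_(j < Jgrid n) (n.+1 + j)%N.+1%:R^-1.
    rewrite /harm -sumrB; apply: eq_bigr => j _.
    have h : (n.+1 + j)%N.+1%:R = n.+1%:R + j.+1%:R :> R by rewrite -addnS natrD.
    rewrite h /sgrid; field.
    have p0 (i : nat) : 0 < 1 + i%:R :> R by rewrite ltr_pwDl.
    by rewrite !gt_eqF ?p0// addr_gt0.
  have h1 : harm (n.+1 + Jgrid n)%N = harm n.+1 + \sum_(j < Jgrid n) (n.+1 + j)%N.+1%:R^-1 :> R.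
    exact: harmD.
  have h2 : harm (Jgrid n + n.+1)%N = harm (Jgrid n) + \sum_(i < n.+1) (Jgrid n + i)%N.+1%:R^-1 :> R.
    exact: harmD.
  by rewrite addnC h1 in h2; lra.
have mc : m n @[n --> \oo] --> - euler_gamma R.
  rewrite (funext mE); rewrite -[X in _ --> X]addr0; apply: cvgD.
    by apply: cvgN; exact: euler_gamma_cvg.
  apply: (@squeeze_cvgr _ _ _ _ (fun=> 0) (fun n => n.+1%:R^-1)); last 2 first.
  - exact: cvg_cst.
  - exact: cvg_harmonic.
  apply: nearW => n; apply/andP; split; first by apply: sumr_ge0.
  apply: (@le_trans _ _ (\sum_(i < n.+1) (Jgrid n)%:R^-1)).
    apply: ler_sum => i _; rewrite lef_pV2 ?posrE// ?ltr0n ?expn_gt0// ler_nat.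
    by rewrite leqW// leq_addr.
  rewrite sumr_const card_ord -mulr_natr /Jgrid natrX.
  by rewrite le_eqVlt; apply/orP; left; apply/eqP; field.
have e n : gapprox n y = 2^-1 * ((ln n.+1%:R -
    \sum_(j < Jgrid n) expR (- (sgrid n j * y)) / j.+1%:R) - m n).
  rewrite /gapprox /m mulNr -mulrN; congr (_ * _).
  under eq_bigr do rewrite mulrBr; rewrite sumrB.
  under eq_bigr do rewrite mulrC.
  by ring.
rewrite (funext e).
apply: cvgMr; rewrite -[X in _ --> ln y + X]opprK; apply: cvgB => //.
exact: log_approx.
Qed.

End log_series.

(** * Power series coefficients of the approximate covariance *)

Section log_coefficients.
Context {R : realType}.

Lemma powB_le (a b : R) k : 0 <= a <= b ->
  k.+1%:R * a ^+ k * (b - a) <= b ^+ k.+1 - a ^+ k.+1 <= k.+1%:R * b ^+ k * (b - a).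
Proof.
move=> /andP[a0 ab]; have b0 := le_trans a0 ab; rewrite subrXX mulrC (mulrC _ (b - a)).
have h0 : 0 <= b - a by rewrite subr_ge0.
have e (x : R) : k.+1%:R * x ^+ k = \sum_(i < k.+1) x ^+ (k - i) * x ^+ i.
  transitivity (\sum_(i < k.+1) x ^+ k); first by rewrite sumr_const card_ord mulr_natl.
  by apply: eq_bigr => i _; rewrite -exprD subnK// -ltnS.
rewrite !e; apply/andP; split; rewrite ler_wpM2l//; apply: ler_sum => i _.
  by rewrite /= ler_pM ?exprn_ge0// lerXn2r ?nnegrE.
by rewrite /= ler_pM ?exprn_ge0// lerXn2r ?nnegrE.
Qed.

Definition xgrid n j : R := sgrid n j / (1 + sgrid n j).

Definition xfrac n (i : nat) : R := i%:R / (n.+1 + i)%:R.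

Lemma xgridE n j : xgrid n j = xfrac n j.+1.
Proof.
have p0 (m : nat) : 0 < 1 + m%:R :> R by rewrite ltr_pwDl.
rewrite /xgrid /sgrid /xfrac natrD; field.
by rewrite !gt_eqF ?p0// addr_gt0.
Qed.

(** With x = s / (1 + s) one has ds / s = dx / (x (1 - x)), so this is a Riemann sum for the
    integral of x^(k-1) over [0, 1], that is 1/k when k > 0. *)
Definition logcoef n k : R := \sum_(j < Jgrid n) j.+1%:R^-1 * (1 - xgrid n j) * xgrid n j ^+ k.

Lemma xfrac01 n i : 0 <= xfrac n i < 1.
Proof.
rewrite /xfrac divr_ge0//= ltr_pdivrMr ?mul1r ?ltr_nat//.
by rewrite addSn ltnS leq_addl.
Qed.

Lemma xfracS n i : xfrac n i.+1 - xfrac n i = n.+1%:R / ((n.+1 + i)%:R * (n.+1 + i.+1)%:R).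
Proof.
have p0 (m : nat) : 0 < 1 + m%:R :> R by rewrite ltr_pwDl.
rewrite /xfrac !natrD; field.
by apply/andP; split; rewrite gt_eqF// ?addr_gt0// ltr_pwDl// p0.
Qed.

Lemma logcoef_termE n j k : j.+1%:R^-1 * (1 - xgrid n j) * xgrid n j ^+ k.+1 =
  n.+1%:R / (n.+1 + j.+1)%:R ^+ 2 * xfrac n j.+1 ^+ k.
Proof.
have p0 (m : nat) : 0 < 1 + m%:R :> R by rewrite ltr_pwDl.
rewrite xgridE exprS mulrA; congr (_ * _); rewrite /xfrac natrD; field.
by rewrite !gt_eqF ?p0// addr_gt0.
Qed.

(** By [powB_le] the term is compared with the increment of x^(k+1) to the right of its node, where
    the derivative is larger; the lower bound below uses the increment to the left. Both sums
    telescope. *)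
Lemma logcoef_term_le n j k :
  k.+1%:R * (j.+1%:R^-1 * (1 - xgrid n j) * xgrid n j ^+ k.+1) <=
  (1 + n.+1%:R^-1) * (xfrac n j.+2 ^+ k.+1 - xfrac n j.+1 ^+ k.+1).
Proof.
have /andP[x0 x1] := xfrac01 n j.+1; rewrite logcoef_termE.
have d := xfracS n j.+1.
have ab : 0 <= xfrac n j.+1 <= xfrac n j.+2.
  by rewrite x0/= -subr_ge0 d divr_ge0// mulr_ge0.
have /andP[h _] := powB_le k ab.
apply: le_trans (ler_wpM2l _ h); last by rewrite addr_ge0.
rewrite d; set x := xfrac n j.+1 ^+ k.
have xk0 : 0 <= x by rewrite exprn_ge0.
rewrite [leLHS](_ : _ = k.+1%:R * x * (n.+1%:R / (n.+1 + j.+1)%:R ^+ 2)); last by ring.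
rewrite [leRHS]mulrCA ler_wpM2l ?mulr_ge0//.
rewrite [leRHS](_ : _ = n.+1%:R / (n.+1 + j.+1)%:R * ((1 + n.+1%:R^-1) / (n.+1 + j.+2)%:R)); last first.
  by rewrite invfM; set u := _^-1; set v := _^-1; ring.
rewrite expr2 invfM [leLHS]mulrA ler_wpM2l ?divr_ge0//.
rewrite ler_pdivlMr// ?ltr0n// mulrC ler_pdivrMr ?ltr0n//.
rewrite mulrDl mul1r [(n.+1 + j.+2)%N]addnS -natr1 lerD2l ler_pdivlMl// mulr1 ler_nat.
by rewrite leq_addr.
Qed.

Lemma logcoef_term_ge n j k :
  (1 - n.+1%:R^-1) * (xfrac n j.+1 ^+ k.+1 - xfrac n j ^+ k.+1) <=
  k.+1%:R * (j.+1%:R^-1 * (1 - xgrid n j) * xgrid n j ^+ k.+1).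
Proof.
have /andP[x0 x1] := xfrac01 n j; have /andP[x0' _] := xfrac01 n j.+1; rewrite logcoef_termE.
have d := xfracS n j.
have ab : 0 <= xfrac n j <= xfrac n j.+1.
  by rewrite x0/= -subr_ge0 d divr_ge0// mulr_ge0.
have /andP[_ h] := powB_le k ab.
apply: le_trans (ler_wpM2l _ h) _; first by rewrite subr_ge0 invf_le1// ler1n.
rewrite d; set x := xfrac n j.+1 ^+ k.
have xk0 : 0 <= x by rewrite exprn_ge0.
rewrite [leRHS](_ : _ = k.+1%:R * x * (n.+1%:R / (n.+1 + j.+1)%:R ^+ 2)); last by ring.
rewrite [leLHS]mulrCA ler_wpM2l ?mulr_ge0//.
rewrite [leLHS](_ : _ = n.+1%:R / (n.+1 + j.+1)%:R * ((1 - n.+1%:R^-1) / (n.+1 + j)%:R)); last first.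
  by rewrite invfM; set u := _^-1; set v := _^-1; ring.
rewrite expr2 invfM [leRHS]mulrA ler_wpM2l ?divr_ge0//.
rewrite ler_pdivrMr ?ltr0n// mulrC ler_pdivlMr ?ltr0n//.
rewrite mulrBl mul1r addnS -natr1 lerBlDr lerD2l ler_pdivlMl// mulr1.
by rewrite natr1 ler_nat; apply: leqW; exact: leq_addr.
Qed.

Lemma logcoef_ge0 n k : 0 <= logcoef n k.
Proof.
apply: sumr_ge0 => j _; have /andP[x0 x1] := xfrac01 n j.+1.
by rewrite xgridE mulr_ge0 ?exprn_ge0// mulr_ge0// subr_ge0 ltW.
Qed.

Lemma logcoef_le n k : k.+1%:R * logcoef n k.+1 <= 1 + n.+1%:R^-1.
Proof.
rewrite mulr_sumr; apply: (@le_trans _ _ (\sum_(j < Jgrid n) (1 + n.+1%:R^-1) *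
  (xfrac n j.+2 ^+ k.+1 - xfrac n j.+1 ^+ k.+1))).
  by apply: ler_sum => j _; exact: logcoef_term_le.
rewrite -mulr_sumr -[leRHS]mulr1 ler_wpM2l ?addr_ge0//.
rewrite -(big_mkord xpredT (fun j => xfrac n j.+2 ^+ k.+1 - xfrac n j.+1 ^+ k.+1)).
rewrite (telescope_sumr (fun j => xfrac n j.+1 ^+ k.+1))//.
have /andP[x0 x1] := xfrac01 n (Jgrid n).+1; have /andP[y0 _] := xfrac01 n 1.
rewrite lerBlDr; apply: (@le_trans _ _ 1); first by rewrite exprn_ile1// ltW.
by rewrite lerDl exprn_ge0.
Qed.

Lemma logcoef_ge n k :
  (1 - n.+1%:R^-1) * (n.+1%:R / n.+2%:R) ^+ k.+1 <= k.+1%:R * logcoef n k.+1.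
Proof.
rewrite mulr_sumr; apply: (@le_trans _ _ (\sum_(j < Jgrid n) (1 - n.+1%:R^-1) *
  (xfrac n j.+1 ^+ k.+1 - xfrac n j ^+ k.+1))); last first.
  by apply: ler_sum => j _; exact: logcoef_term_ge.
rewrite -mulr_sumr.
rewrite -(big_mkord xpredT (fun j => xfrac n j.+1 ^+ k.+1 - xfrac n j ^+ k.+1)).
rewrite (telescope_sumr (fun j => xfrac n j ^+ k.+1))//.
have -> : xfrac n 0 = 0 by rewrite /xfrac mul0r.
rewrite expr0n subr0 (_ : xfrac n (Jgrid n) = n.+1%:R / n.+2%:R)//.
have p0 (m : nat) : 0 < 1 + m%:R :> R by rewrite ltr_pwDl.
rewrite /xfrac /Jgrid natrD natrX; field.
by apply/andP; split; rewrite gt_eqF// addr_gt0// exprn_gt0.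
Qed.

Lemma logcoef_cvg k : logcoef n k.+1 @[n --> \oo] --> (k.+1%:R^-1 : R).
Proof.
have h := @cvg_harmonic R.
suff : k.+1%:R * logcoef n k.+1 @[n --> \oo] --> (1 : R).
  move=> c; have c' : k.+1%:R^-1 * (k.+1%:R * logcoef n k.+1) @[n --> \oo] --> k.+1%:R^-1 * (1 : R).
    exact: cvgMr.
  rewrite mulr1 in c'; rewrite (_ : (fun n => _) = (fun n => k.+1%:R^-1 * (k.+1%:R * logcoef n k.+1)))//.
  by apply/funext => n; rewrite mulrA mulVf// mul1r.
apply: (@squeeze_cvgr _ _ _ _ (fun n => (1 - n.+1%:R^-1) * (n.+1%:R / n.+2%:R) ^+ k.+1)
  (fun n => 1 + n.+1%:R^-1)).
- by apply: nearW => n; rewrite logcoef_ge logcoef_le.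
- rewrite -[X in _ --> X](_ : (1 - 0) * (1 - 0) ^+ k.+1 = 1); last by rewrite subr0 expr1n mul1r.
  apply: cvgM; first by apply: cvgB; [exact: cvg_cst|exact: h].
  apply: (cvg_comp (fun n => n.+1%:R / n.+2%:R) (fun x => x ^+ k.+1)); last exact: exprn_continuous.
  rewrite (_ : (fun n => _) = (fun n => 1 - n.+2%:R^-1)); last first.
    apply/funext => n; have e : n.+2%:R = n.+1%:R + 1 :> R by rewrite natr1.
    by rewrite e; field; rewrite gt_eqF// ltr_pwDl.
  apply: cvgB; first exact: cvg_cst.
  by have := h; rewrite -cvg_shiftS.
- rewrite -[X in _ --> X]addr0; apply: cvgD; [exact: cvg_cst|exact: h].
Qed.

Lemma logcoef_le2 n k : logcoef n k.+1 <= 2 / k.+1%:R.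
Proof.
rewrite ler_pdivlMr// mulrC (le_trans (logcoef_le n k))//.
have : n.+1%:R^-1 <= 1 :> R by rewrite invf_le1// ler1n.
by set u := _^-1; lra.
Qed.

Lemma invsqr_tail (K K' : nat) : (K <= K')%N ->
  \sum_(K <= k < K') (k.+1%:R^-1 ^+ 2) <= 2 / K.+1%:R :> R.
Proof.
move=> KK'; pose u k : R := - (2 / k.+1%:R).
apply: (@le_trans _ _ (\sum_(K <= k < K') (u k.+1 - u k))).
  apply: ler_sum => k _; rewrite /u opprK addrC.
  have -> : 2 / k.+1%:R - 2 / k.+2%:R = k.+1%:R^-1 * (2 / k.+2%:R) :> R.
    have p0 (m : nat) : 0 < 1 + m%:R :> R by rewrite ltr_pwDl.
    rewrite -[k.+2]addn1 natrD; field.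
    by rewrite !gt_eqF ?p0// addr_gt0.
  rewrite expr2 ler_wpM2l// ler_pdivlMr// mulrC ler_pdivrMr//.
  by rewrite -natrM ler_nat mul2n -addnn addSn addnS !ltnS leq_addr.
rewrite telescope_sumr// /u opprK addrC gerDl oppr_le0 divr_ge0//.
Qed.

Lemma zeta3_cvg : \sum_(k < K) (k.+1%:R ^+ 3)^-1 @[K --> \oo] --> riemann_zeta R 3.
Proof.
pose u K : R := \sum_(k < K) (k.+1%:R ^+ 3)^-1.
have uc : cvgn u.
  apply: nondecreasing_is_cvgn.
    by apply/nondecreasing_seqP => n; rewrite /u big_ord_recr/= lerDl invr_ge0 exprn_ge0.
  exists 2 => _ [n _ <-]; apply: (@le_trans _ _ (\sum_(0 <= k < n) (k.+1%:R^-1 ^+ 2))).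
    rewrite big_mkord; apply: ler_sum => k _.
    rewrite -exprVn exprS ler_piMl ?exprn_ge0// invf_le1// ler1n//.
  by rewrite (le_trans (invsqr_tail (leq0n n)))// divr1.
rewrite (_ : riemann_zeta R 3 = limn u); first exact: uc.
congr (lim (_ @ \oo)); apply/funext => n.
by rewrite /series/= /u big_mkord.
Qed.

(** The covariance of exp(-s |U|^2) and exp(-t |V|^2) when |E (U conj(V))|^2 = q, as [laplace2] and
    [laplace1] will show. *)
Definition expcov (s t q : R) : R := ((1 + s) * (1 + t) - s * t * q)^-1 - ((1 + s) * (1 + t))^-1.

(** A geometric series in x x' q with x = s / (1 + s) and x' = t / (1 + t). The dependence on s and
    on t factors in each term, which is what makes [logcov] a series of products of [logcoef]. *)
Lemma expcov_cvg (s t q : R) : 0 < s -> 0 < t -> 0 <= q <= 1 ->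
  \sum_(k < K) (1 - s / (1 + s)) * (1 - t / (1 + t)) *
    ((s / (1 + s)) ^+ k.+1 * (t / (1 + t)) ^+ k.+1 * q ^+ k.+1) @[K --> \oo] --> expcov s t q.
Proof.
move=> s0 t0 /andP[q0 q1]; set x := s / (1 + s); set x' := t / (1 + t).
have s1 : 0 < 1 + s by rewrite addr_gt0.
have t1 : 0 < 1 + t by rewrite addr_gt0.
have x01 : 0 <= x < 1 by rewrite /x divr_ge0 ?ltW//= ltr_pdivrMr// mul1r ltrDr.
have x01' : 0 <= x' < 1 by rewrite /x' divr_ge0 ?ltW//= ltr_pdivrMr// mul1r ltrDr.
have [/andP[a0 a1] /andP[b0 b1]] := (x01, x01').
set y := x * x' * q.
have y0 : 0 <= y by apply: mulr_ge0 => //; exact: mulr_ge0.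
have y1 : y < 1.
  apply: (@le_lt_trans _ _ x) => //; rewrite /y -mulrA ler_piMr// mulr_ile1// ltW//.
have e K : \sum_(k < K) (1 - x) * (1 - x') * (x ^+ k.+1 * x' ^+ k.+1 * q ^+ k.+1) =
   (1 - x) * (1 - x') * (y * ((1 - y ^+ K) / (1 - y))).
  have -> : (1 - y ^+ K) / (1 - y) = \sum_(k < K) y ^+ k.
    have yn : 1 - y != 0 by rewrite gt_eqF// subr_gt0.
    by apply: (mulIf yn); rewrite divfK// mulrC -[LHS]opprB subrX1 -mulNr opprB.
  rewrite mulr_sumr mulr_sumr; apply: eq_bigr => k _.
  by rewrite -exprS /y !exprMn.
rewrite (funext e).
have -> : expcov s t q = (1 - x) * (1 - x') * (y * ((1 - 0) / (1 - y))).
  have d0 : 0 < (1 + s) * (1 + t) - s * t * q.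
    rewrite subr_gt0 (@le_lt_trans _ _ (s * t))//.
      by rewrite ler_piMr// mulr_ge0 ?ltW.
    by rewrite mulrDl mulrDr mul1r; have := mulr_gt0 s0 t0; lra.
  have d1 : 1 - y = ((1 + s) * (1 + t) - s * t * q) / ((1 + s) * (1 + t)).
    by rewrite /y /x /x'; field; rewrite !gt_eqF.
  rewrite d1 /y /x /x' /expcov; field.
  by rewrite !gt_eqF.
apply: cvgMr; apply: cvgMr; apply: cvgMl; apply: cvgB; first exact: cvg_cst.
by apply: cvg_expr; rewrite ger0_norm.
Qed.

(** The covariance of the approximate potentials of levels [n] and [n'] at two points with kernel
    [q]; 1/4 is the product of the two factors -1/2 in [gapprox]. *)
Definition logcov n n' (q : R) : R := 4^-1 * \sum_(i < Jgrid n) \sum_(j < Jgrid n')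
  i.+1%:R^-1 * j.+1%:R^-1 * expcov (sgrid n i) (sgrid n' j) q.

Lemma logcov_cvg n n' (q : R) : 0 <= q <= 1 ->
  \sum_(k < K) 4^-1 * (logcoef n k.+1 * logcoef n' k.+1 * q ^+ k.+1) @[K --> \oo] -->
  logcov n n' q.
Proof.
move=> q01.
have e K : \sum_(k < K) 4^-1 * (logcoef n k.+1 * logcoef n' k.+1 * q ^+ k.+1) =
  4^-1 * \sum_(i < Jgrid n) \sum_(j < Jgrid n') i.+1%:R^-1 * j.+1%:R^-1 *
  (\sum_(k < K) (1 - xgrid n i) * (1 - xgrid n' j) *
    (xgrid n i ^+ k.+1 * xgrid n' j ^+ k.+1 * q ^+ k.+1)).
  rewrite -mulr_sumr; congr (_ * _).
  under [RHS]eq_bigr do under eq_bigr do rewrite mulr_sumr.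
  under [RHS]eq_bigr do rewrite exchange_big/=.
  rewrite exchange_big/=; apply: eq_bigr => k _.
  rewrite /logcoef big_distrlr/= mulr_suml; apply: eq_bigr => i _.
  by rewrite mulr_suml; apply: eq_bigr => j _; ring.
rewrite (funext e); apply: cvgMr; apply: cvg_fsum => i; apply: cvg_fsum => j; apply: cvgMr.
by apply: expcov_cvg => //; exact: sgrid_gt0.
Qed.

(* [logcov n n - 2 logcov n n' + logcov n' n'] at [q] is the squared distance of the two approximations *)
Definition logdist n n' (q : R) : R := logcov n n q - 2 * logcov n n' q + logcov n' n' q.

(** The expansion starts at q^1, so one factor [q] can be kept while the other powers are bounded by
    1. This factor makes the estimate summable over pairs of grid points. *)
Lemma logdist_le n n' (q ep : R) : 0 <= q <= 1 ->
  (forall K, \sum_(k < K) 4^-1 * (logcoef n k.+1 - logcoef n' k.+1) ^+ 2 <= ep) ->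
  `|logdist n n' q| <= ep * q.
Proof.
move=> q01 hep; have /andP[q0 q1] := q01.
have c : \sum_(k < K) 4^-1 * ((logcoef n k.+1 - logcoef n' k.+1) ^+ 2 * q ^+ k.+1) @[K --> \oo]
    --> logdist n n' q.
  pose S m m' K := \sum_(k < K) 4^-1 * (logcoef m k.+1 * logcoef m' k.+1 * q ^+ k.+1).
  rewrite (_ : (fun K => _) = (fun K => S n n K - 2 * S n n' K + S n' n' K)); last first.
    apply/funext => K; rewrite /S mulr_sumr -sumrB -big_split/=.
    by apply: eq_bigr => k _; ring.
  apply: cvgD; last exact: logcov_cvg.
  by apply: cvgB; [exact: logcov_cvg|apply: cvgMr; exact: logcov_cvg].
have c' : `|\sum_(k < K) 4^-1 * ((logcoef n k.+1 - logcoef n' k.+1) ^+ 2 * q ^+ k.+1)| @[K --> \oo]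
    --> `|logdist n n' q| by exact: cvg_norm.
rewrite -(cvg_lim _ c')//; apply: limr_le.
  by apply/cvg_ex; eexists; exact: c'.
apply: nearW => K; rewrite ger0_norm; last first.
  by apply: sumr_ge0 => k _; apply: mulr_ge0 => //; apply: mulr_ge0; [exact: sqr_ge0|exact: exprn_ge0].
apply: le_trans (ler_wpM2r q0 (hep K)); rewrite mulr_suml; apply: ler_sum => k _.
rewrite -[leRHS]mulrA ler_wpM2l// ler_wpM2l ?sqr_ge0// exprS ler_piMr// exprn_ile1//.
Qed.

(** By [logcoef_le2] the k-th term is at most q / k^2, uniformly in the level; the factor [q] is
    again kept for the sum over the grid. *)
Lemma logcov_trunc n (q : R) (K : nat) : 0 <= q <= 1 ->
  `|logcov n n q - \sum_(k < K) 4^-1 * (logcoef n k.+1 ^+ 2 * q ^+ k.+1)| <= 2 / K.+1%:R * q.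
Proof.
move=> q01; have /andP[q0 q1] := q01.
have c : `|\sum_(k < K') 4^-1 * (logcoef n k.+1 * logcoef n k.+1 * q ^+ k.+1) -
   \sum_(k < K) 4^-1 * (logcoef n k.+1 ^+ 2 * q ^+ k.+1)| @[K' --> \oo] -->
   `|logcov n n q - \sum_(k < K) 4^-1 * (logcoef n k.+1 ^+ 2 * q ^+ k.+1)|.
  by apply: cvg_norm; apply: cvgB; [exact: logcov_cvg|exact: cvg_cst].
rewrite -(cvg_lim _ c)//; apply: limr_le; first by apply/cvg_ex; eexists; exact: c.
exists K => // K' /= KK'.
rewrite -!(big_mkord xpredT (fun k => 4^-1 * (logcoef n k.+1 * logcoef n k.+1 * q ^+ k.+1))).
rewrite (big_cat_nat _ KK')//= addrAC subrr add0r ger0_norm; last first.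
  by apply: sumr_ge0 => k _; rewrite !mulr_ge0 ?logcoef_ge0 ?exprn_ge0.
apply: le_trans (ler_wpM2r q0 (invsqr_tail KK')); rewrite mulr_suml; apply: ler_sum => k _.
rewrite mulrA ler_pM ?mulr_ge0 ?logcoef_ge0 ?exprn_ge0//; last first.
  by rewrite exprS ler_piMr// exprn_ile1.
have h := logcoef_le2 n k; have h0 := logcoef_ge0 n k.+1.
have := ler_pM h0 h0 h h; rewrite expr2; set u := logcoef n k.+1; set v := k.+1%:R^-1.
by move: (u * u) => w; lra.
Qed.

(** The tails are controlled uniformly in the level by [logcoef_le2] and [invsqr_tail]; each of the
    finitely many remaining coefficients converges. *)
Lemma logcoef_cauchy (ep : R) : 0 < ep -> exists n0 : nat, forall n n', (n0 <= n)%N -> (n0 <= n')%N ->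
  forall K, \sum_(k < K) 4^-1 * (logcoef n k.+1 - logcoef n' k.+1) ^+ 2 <= ep.
Proof.
move=> ep0.
have [K0 hK0] : exists K0 : nat, 2 / K0.+1%:R <= ep / 2 :> R.
  exists (Num.truncn (4 / ep)); rewrite ler_pdivrMr// -ler_pdivrMl ?divr_gt0//.
  by rewrite (_ : (ep / 2)^-1 * 2 = 4 / ep) ?ltW ?truncnS_gt//; field; rewrite gt_eqF.
have c : \sum_(k < K0) 4^-1 * (2 * (logcoef n k.+1 - k.+1%:R^-1) ^+ 2) @[n --> \oo] --> (0 : R).
  rewrite -[X in _ --> X](_ : \sum_(k < K0) 4^-1 * (2 * (k.+1%:R^-1 - k.+1%:R^-1) ^+ 2) = 0); last first.
    by rewrite big1// => k _; rewrite subrr expr0n /= !mulr0.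
  apply: cvg_fsum => k; apply: cvgMr; apply: cvgMr.
  have d : logcoef n k.+1 - k.+1%:R^-1 @[n --> \oo] --> (k.+1%:R^-1 - k.+1%:R^-1 : R).
    by apply: cvgB; [exact: logcoef_cvg|exact: cvg_cst].
  by rewrite expr2; apply: cvgM; exact: d.
have e4 : 0 < ep / 4 by rewrite divr_gt0.
have /cvgrPdist_lt/(_ _ e4)[n0 _ hn0] := c.
exists n0 => n n' hn hn' K.
have tl k : 4^-1 * (logcoef n k.+1 - logcoef n' k.+1) ^+ 2 <= (k.+1%:R^-1) ^+ 2.
  have := logcoef_le2 n k; have := logcoef_le2 n' k.
  have := logcoef_ge0 n k.+1; have := logcoef_ge0 n' k.+1.
  set u := logcoef n k.+1; set u' := logcoef n' k.+1; set v := k.+1%:R^-1 => u0 u0' h h'.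
  have hh : `|u - u'| <= 2 * v by rewrite ler_norml; apply/andP; split; lra.
  have v0 : 0 <= 2 * v by exact: le_trans (normr_ge0 _) hh.
  have : `|u - u'| ^+ 2 <= (2 * v) ^+ 2 by rewrite lerXn2r ?nnegrE.
  by rewrite real_normK ?num_real// exprMn; lra.
have nn i : (n0 <= i)%N -> \sum_(k < K0) 4^-1 * (2 * (logcoef i k.+1 - k.+1%:R^-1) ^+ 2) <= ep / 4.
  move=> /hn0; rewrite sub0r normrN ger0_norm; first by move/ltW.
  by apply: sumr_ge0 => k _; apply: mulr_ge0 => //; apply: mulr_ge0 => //; exact: sqr_ge0.
apply: (@le_trans _ _ (\sum_(k < K0 + K) 4^-1 * (logcoef n k.+1 - logcoef n' k.+1) ^+ 2)).
  rewrite [in leRHS]addnC big_split_ord/= lerDl; apply: sumr_ge0 => k _.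
  by rewrite mulr_ge0// sqr_ge0.
rewrite -(big_mkord xpredT (fun k => 4^-1 * (logcoef n k.+1 - logcoef n' k.+1) ^+ 2)).
rewrite (big_cat_nat _ (leq_addr K K0))//= (_ : ep = ep / 2 + ep / 2); last by field.
apply: lerD; last first.
  apply: le_trans hK0; apply: le_trans (invsqr_tail (leq_addr K K0)).
  by apply: ler_sum => k _; exact: tl.
rewrite big_mkord; apply: (@le_trans _ _ (ep / 4 + ep / 4)); last by lra.
apply: le_trans (lerD (nn _ hn) (nn _ hn')); rewrite -big_split/=; apply: ler_sum => k _.
set u := logcoef n k.+1; set u' := logcoef n' k.+1; set v := k.+1%:R^-1.
by have := sqr_ge0 ((u - v) + (u' - v)); rewrite !expr2; nra.
Qed.

End log_coefficients.

(** * Measurability of the linear statistics *)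

Section complex_limits.
Context {R : realType}.

Lemma normc_le_sum (z : R[i]) : normc z <= `|complex.Re z| + `|complex.Im z|.
Proof.
case: z => x y /=; rewrite -(ger0_norm (addr_ge0 (normr_ge0 x) (normr_ge0 y))) -sqrtr_sqr.
apply: ler_wsqrtr; rewrite -(real_normK (num_real x)) -(real_normK (num_real y)).
by rewrite sqrrD lerD2r lerDl mulrn_wge0// mulr_ge0.
Qed.

Lemma Re_le_normc (z : R[i]) : `|complex.Re z| <= normc z.
Proof. by case: z => x y /=; rewrite -sqrtr_sqr ler_wsqrtr// lerDl sqr_ge0. Qed.

Lemma Im_le_normc (z : R[i]) : `|complex.Im z| <= normc z.
Proof. by case: z => x y /=; rewrite -sqrtr_sqr ler_wsqrtr// lerDr sqr_ge0. Qed.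

Lemma cvgC_P (u : nat -> R[i]^o) (l : R[i]^o) :
  u n @[n --> \oo] --> l <->
  (complex.Re (u n) @[n --> \oo] --> complex.Re l /\
   complex.Im (u n) @[n --> \oo] --> complex.Im l).
Proof.
split=> [ul|[ux uy]].
- have h (e : R) : 0 < e -> \forall n \near \oo, normc (l - u n : R[i]) < e.
    move=> e0; have e0' : 0 < e%:C :> R[i] by rewrite ltcR.
    have /cvgrPdist_lt/(_ _ e0') := ul; apply: filterS => n.
    by rewrite normc_def ltcR; case: (l - u n).
  split; apply/cvgrPdist_lt => e /h; apply: filterS => n; apply: le_lt_trans.
    by apply: le_trans (Re_le_normc _); rewrite raddfB.
  by apply: le_trans (Im_le_normc _); rewrite raddfB.
- apply/cvgrPdist_lt => -[e f]; rewrite ltcE/= => /andP[/eqP-> e0].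
  have e2 : 0 < e / 2 by rewrite divr_gt0.
  have /cvgrPdist_lt/(_ _ e2) hx := ux; have /cvgrPdist_lt/(_ _ e2) hy := uy.
  near=> n.
  have nx : `|complex.Re l - complex.Re (u n)| < e / 2 by near: n.
  have ny : `|complex.Im l - complex.Im (u n)| < e / 2 by near: n.
  have := normc_le_sum (l - u n : R[i]); rewrite !raddfB => h.
  have : normc (l - u n : R[i]) < e by lra.
  by rewrite normc_def ltcR; case: (l - u n : R[i]).
Unshelve. all: by end_near. Qed.

Lemma limC_E (u : nat -> R[i]^o) (x y : R) :
  complex.Re (u n) @[n --> \oo] --> x -> complex.Im (u n) @[n --> \oo] --> y ->
  limn u = (x +i* y : R[i]^o).
Proof.
move=> ux uy; have h : u n @[n --> \oo] --> (x +i* y : R[i]^o) by apply/cvgC_P.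
exact: (cvg_lim (@norm_hausdorff _ _) h).
Qed.

End complex_limits.

(** * Measurability of limits of real and complex sequences *)

Section measurable_limits.
Context d (X : measurableType d) {R : realType}.

(** Upper and lower limits are measurable in the parameter, so this description makes the set of
    convergence measurable. *)
Let cvgnE (f : nat -> X -> R) x : cvgn (f ^~ x) <->
  (limn_esup (fun n => (f n x)%:E) = limn_einf (fun n => (f n x)%:E) /\
   limn_esup (fun n => (f n x)%:E) \is a fin_num).
Proof.
split=> [/cvg_ex[l fl]|[e ef]].
  have fl' : (f n x)%:E @[n --> \oo] --> l%:E by apply: cvg_EFin => //; exact: nearW.
  have c : cvgn (fun n => (f n x)%:E) by apply/cvg_ex; exists l%:E.
  by rewrite is_cvg_limn_esupE// is_cvg_limn_einfE// (cvg_lim _ fl').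
have e' := is_cvg_esups (u := fun n => (f n x)%:E).
have e'' := is_cvg_einfs (u := fun n => (f n x)%:E).
have h : (f n x)%:E @[n --> \oo] --> limn_esup (fun n => (f n x)%:E).
  apply: (@squeeze_cvge _ _ _ _ (einfs (fun n => (f n x)%:E)) _ (esups (fun n => (f n x)%:E))).
  - apply: nearW => n; apply/andP; split.
      by apply: ereal_inf_lbound; exists n => //=.
    by apply: ereal_sup_ubound; exists n => //=.
  - by rewrite e limn_einf_lim.
  - by rewrite limn_esup_lim.
move: h; rewrite -(fineK ef) => /fine_cvgP[_ h].
by apply/cvg_ex; eexists; exact: h.
Qed.

Lemma measurable_cvgn_set (f : nat -> X -> R) : (forall n, measurable_fun setT (f n)) ->
  measurable_fun setT (fun x => `[< cvgn (f ^~ x) >]).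
Proof.
move=> mf.
have m1 : measurable_fun setT (fun x => limn_esup (fun n => (f n x)%:E)).
  by apply: measurable_fun_limn_esup => n; exact/measurable_EFinP.
have m2 : measurable_fun setT (fun x => limn_einf (fun n => (f n x)%:E)).
  rewrite (_ : (fun x => _) = (fun x => - limn_esup (fun n => - (f n x)%:E))%E).
    apply: measurableT_comp => //; apply: measurable_fun_limn_esup => n.
    by apply: measurableT_comp => //; exact/measurable_EFinP.
  apply/funext => x; rewrite -limn_einfN; congr limn_einf; apply/funext => n /=.
  by rewrite opprK.
rewrite (_ : (fun x => _) = (fun x => (limn_esup (fun n => (f n x)%:E) == limn_einf (fun n => (f n x)%:E)) &&
   ((fine (limn_esup (fun n => (f n x)%:E)))%:E == limn_esup (fun n => (f n x)%:E)))).
  apply: measurable_and; first exact: measurable_fun_eqe.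
  apply: measurable_fun_eqe => //; apply/measurable_EFinP; apply: measurableT_comp => //.
apply/funext => x; apply/asboolP/idP => [/cvgnE[-> h]|/andP[/eqP h /eqP h']].
  by rewrite eqxx fineK ?eqxx.
by apply/cvgnE; split => //; rewrite -h'.
Qed.

Lemma measurable_limn_if (f : nat -> X -> R) : (forall n, measurable_fun setT (f n)) ->
  measurable_fun setT (fun x => if `[< cvgn (f ^~ x) >] then limn (f ^~ x) else 0).
Proof.
move=> mf.
have m1 : measurable_fun setT (fun x => fine (limn_esup (fun n => (f n x)%:E))).
  apply: measurableT_comp => //.
  by apply: measurable_fun_limn_esup => n; exact/measurable_EFinP.
rewrite (_ : (fun x => _) = (fun x => if `[< cvgn (f ^~ x) >] then
    fine (limn_esup (fun n => (f n x)%:E)) else 0)).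
  by apply: measurable_fun_ifT => //; exact: measurable_cvgn_set.
apply/funext => x; case: asboolP => // c.
have fl' : (f n x)%:E @[n --> \oo] --> (limn (f ^~ x))%:E by apply: cvg_EFin => //; exact: nearW.
have c' : cvgn (fun n => (f n x)%:E) by apply/cvg_ex; eexists; exact: fl'.
by rewrite is_cvg_limn_esupE// (cvg_lim _ fl').
Qed.

Definition cmeas (f : X -> R[i]) := measurable_fun setT (fun x => complex.Re (f x)) /\
  measurable_fun setT (fun x => complex.Im (f x)).

Lemma cmeas_cst z : cmeas (fun=> z). Proof. by split; exact: measurable_cst. Qed.

Lemma cmeasD f g : cmeas f -> cmeas g -> cmeas (fun x => f x + g x).
Proof.
move=> [f1 f2] [g1 g2]; split.
  under eq_fun do rewrite raddfD; exact: measurable_funD.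
by under eq_fun do rewrite raddfD; exact: measurable_funD.
Qed.

Lemma ReMc (z w : R[i]) : complex.Re (z * w) = complex.Re z * complex.Re w - complex.Im z * complex.Im w.
Proof. by case: z w => [a b] [c e]. Qed.

Lemma ImMc (z w : R[i]) : complex.Im (z * w) = complex.Re z * complex.Im w + complex.Im z * complex.Re w.
Proof. by case: z w => [a b] [c e]. Qed.

Lemma cmeasM f g : cmeas f -> cmeas g -> cmeas (fun x => f x * g x).
Proof.
move=> [f1 f2] [g1 g2]; split.
  under eq_fun do rewrite ReMc.
  by apply: measurable_funB; apply: measurable_funM.
under eq_fun do rewrite ImMc.
by apply: measurable_funD; apply: measurable_funM.
Qed.

Lemma cmeasX f n : cmeas f -> cmeas (fun x => f x ^+ n).
Proof.
move=> mf; elim: n => [|n ih]; first exact: cmeas_cst.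
by under eq_fun do rewrite exprS; exact: cmeasM.
Qed.

Lemma cmeas_sum (s : seq nat) (f : nat -> X -> R[i]) : (forall k, cmeas (f k)) ->
  cmeas (fun x => \sum_(k <- s) f k x).
Proof.
move=> mf; elim: s => [|k s ih].
  by under eq_fun do rewrite big_nil; exact: cmeas_cst.
by under eq_fun do rewrite big_cons; exact: cmeasD.
Qed.

Lemma measurable_normc f : cmeas f -> measurable_fun setT (fun x => normc (f x)).
Proof.
move=> [f1 f2]; rewrite (_ : (fun x => _) = (fun x => Num.sqrt (complex.Re (f x) ^+ 2 + complex.Im (f x) ^+ 2))).
  apply: (measurableT_comp (continuous_measurable_fun (@sqrt_continuous R))).
  by apply: measurable_funD; apply: measurable_funX.
by apply/funext => x; case: (f x).
Qed.

(* off the set of convergence [limn] is the arbitrary default point *)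
Lemma cmeas_limn (f : nat -> X -> R[i]) : (forall n, cmeas (f n)) ->
  cmeas (fun x => limn (fun n => f n x : R[i]^o)).
Proof.
move=> mf; have m1 n := (mf n).1; have m2 n := (mf n).2.
pose C x := `[< cvgn (fun n => complex.Re (f n x)) >] && `[< cvgn (fun n => complex.Im (f n x)) >].
have mC : measurable_fun setT C.
  apply: measurable_and; first exact: (measurable_cvgn_set m1).
  exact: (measurable_cvgn_set m2).
have E : (fun x => limn (fun n => f n x : R[i]^o)) = (fun x => if C x then
    (if `[< cvgn (fun n => complex.Re (f n x)) >] then limn (fun n => complex.Re (f n x)) else 0) +i*
    (if `[< cvgn (fun n => complex.Im (f n x)) >] then limn (fun n => complex.Im (f n x)) else 0)
   else (point : R[i]^o)).
  apply/funext => x; rewrite /C; case: asboolP => [c1|c1]; case: asboolP => [c2|c2] /=.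
  - by apply: limC_E.
  - by apply: dvgP => /cvg_ex[l /cvgC_P[_ h]]; apply: c2; apply/cvg_ex; eexists; exact: h.
  - by apply: dvgP => /cvg_ex[l /cvgC_P[h _]]; apply: c1; apply/cvg_ex; eexists; exact: h.
  - by apply: dvgP => /cvg_ex[l /cvgC_P[h _]]; apply: c1; apply/cvg_ex; eexists; exact: h.
rewrite E; split.
  rewrite (_ : (fun x => _) = (fun x => if C x then
    (if `[< cvgn (fun n => complex.Re (f n x)) >] then limn (fun n => complex.Re (f n x)) else 0)
    else complex.Re (point : R[i]^o))); last by apply/funext => x; case: (C x).
  by apply: measurable_fun_ifT => //; exact: (measurable_limn_if m1).
rewrite (_ : (fun x => _) = (fun x => if C x then
    (if `[< cvgn (fun n => complex.Im (f n x)) >] then limn (fun n => complex.Im (f n x)) else 0)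
    else complex.Im (point : R[i]^o))); last by apply/funext => x; case: (C x).
by apply: measurable_fun_ifT => //; exact: (measurable_limn_if m2).
Qed.

Lemma measurable_lne_EFin (f : X -> R) : measurable_fun setT f ->
  measurable_fun setT (fun x => lne (f x)%:E).
Proof.
move=> mf; rewrite (_ : (fun x => _) = (fun x => if f x <= 0 then -oo%E else (ln (f x))%:E)).
  apply: measurable_fun_ifT => //; first exact: measurable_fun_ler.
  by apply/measurable_EFinP; exact: measurableT_comp.
by apply/funext.
Qed.

End measurable_limits.

(** * Area measure in real coordinates *)

Section plane.
Context {R : realType}.
Local Notation mR := (measurableTypeR R).
Local Notation leb := (@lebesgue_measure R).
Local Notation leb2 := (leb \x leb)%E.

(** A named copy of planar Lebesgue measure that carries a sigma-finite structure, as Tonelli's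
    theorem against [Q] requires. *)
Definition area2 : set (mR * mR) -> \bar R := leb2.

HB.instance Definition _ := isMeasure.Build _ _ _ area2
  (measure0 leb2) (measure_ge0 leb2) (@measure_semi_sigma_additive _ _ _ leb2).

Lemma area2X (A B : set mR) : measurable A -> measurable B -> area2 (A `*` B) = (leb A * leb B)%E.
Proof. by move=> mA mB; rewrite /area2; apply: product_measure1E. Qed.

Let sigma_finite_area2 : sigma_finite setT area2.
Proof.
pose F (n : nat) : set (mR * mR) := `[- n%:R, n%:R]%classic `*` `[- n%:R, n%:R]%classic.
exists F.
  apply/seteqP; split => // -[x y] _; exists (Num.truncn (`|x| + `|y|)).+1 => //.
  rewrite /F /=; have := Num.Theory.truncnS_gt (`|x| + `|y|); set n := (Num.truncn _).+1 => h.
  have hx : `|x| <= n%:R by rewrite (le_trans _ (ltW h))// lerDl.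
  have hy : `|y| <= n%:R by rewrite (le_trans _ (ltW h))// lerDr.
  by rewrite !in_itv/= -!ler_norml.
move=> n; split; first exact: measurableX.
rewrite area2X// lebesgue_measure_itv/=.
by case: ifP => _; rewrite ?mul0e// -EFinD -EFinM ltry.
Qed.

HB.instance Definition _ := Measure_isSigmaFinite.Build _ _ _ area2 sigma_finite_area2.

Definition ofC (z : borelC R) : mR * mR := (complex.Re (z : R[i]), complex.Im (z : R[i])).

Lemma toCK : cancel (@toC R) (@ofC). Proof. by case. Qed.

Lemma ofCK : cancel (@ofC) (@toC R). Proof. by case. Qed.

Let measurable_part (g : R[i] -> R) : {morph g : z w / z - w} -> (forall z, `|g z| <= normc z) ->
  measurable_fun setT (fun z : borelC R => g z : mR).
Proof.
move=> gB gle; refine (@measurability _ _ _ mR setT _ _ (@RGenOInfty.measurableE R) _).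
move=> _ [_ [x ->] <-]; rewrite setTI.
apply: sub_sigma_algebra => /=; rewrite openE => z /=; rewrite in_itv/= andbT => xz.
apply/nbhs_ballP; exists ((g z - x)%:C) => /=; first by rewrite ltcR subr_gt0.
move=> w /=; rewrite /ball/= normc_def ltcR in_itv/= andbT => h.
have : `|g z - g w| < g z - x.
  by rewrite -gB; apply: le_lt_trans h; apply: (le_trans (gle _)); case: (z - w : R[i]).
by rewrite ltr_norml => /andP[_]; lra.
Qed.

Lemma measurable_ofC : measurable_fun setT (@ofC).
Proof.
apply/measurable_fun_pairP; split.
  by apply: measurable_part; [exact: raddfB|exact: Re_le_normc].
by apply: measurable_part; [exact: raddfB|exact: Im_le_normc].
Qed.

Lemma ge0_integral_areaC (F : mR * mR -> \bar R) : measurable_fun setT F -> (forall p, 0 <= F p)%E ->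
  (\int[areaC]_z F (ofC z) = \int[area2]_p F p)%E.
Proof.
move=> mF F0; rewrite /areaC ge0_integral_pushforward.
- by rewrite preimage_setT; apply: eq_integral => p _ /=; rewrite toCK.
- exact: measurable_toC.
- by [].
- exact: measurableT_comp mF measurable_ofC.
- by move=> z _; exact: F0.
Qed.

Lemma integral_areaC (F : mR * mR -> \bar R) : measurable_fun setT F ->
  (\int[areaC]_z F (ofC z) = \int[area2]_p F p)%E.
Proof.
move=> mF; rewrite integralE [RHS]integralE; congr (_ - _)%E.
  rewrite -ge0_integral_areaC//; last exact: measurable_funepos.
  by apply: eq_integral => z _; rewrite !funeposE.
rewrite -ge0_integral_areaC//; last exact: measurable_funeneg.
by apply: eq_integral => z _; rewrite !funenegE.
Qed.

Lemma measurable_integral_param d (X : measurableType d) (F : X * (mR * mR) -> \bar R) :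
  measurable_fun setT F -> measurable_fun setT (fun x => \int[area2]_p F (x, p))%E.
Proof.
move=> mF; under eq_fun do rewrite integralE.
apply: emeasurable_funB.
  rewrite (_ : (fun x => _) = (fun x => \int[area2]_p (F^\+)%E (x, p))%E).
    exact: (@measurable_fun_fubini_tonelli_F _ _ _ _ _ area2 _ (measurable_funepos mF) (funepos_ge0 F)).
  by apply/funext => x; apply: eq_integral => p _; rewrite !funeposE.
rewrite (_ : (fun x => _) = (fun x => \int[area2]_p (F^\-)%E (x, p))%E).
  exact: (@measurable_fun_fubini_tonelli_F _ _ _ _ _ area2 _ (measurable_funeneg mF) (funeneg_ge0 F)).
by apply/funext => x; apply: eq_integral => p _; rewrite !funenegE.
Qed.

End plane.

(** * The entire function in Gaussian coordinates *)

Section gef.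
Context {R : realType}.
Local Notation mR := (measurableTypeR R).
Local Notation leb := (@lebesgue_measure R).
Variables (a b c e : R).

(** The k-th coefficient is a fixed linear image of the k-th pair of real coordinates, which sits at
    the positions 2k and 2k + 1. *)
Definition gcoef (w : seqR R) (k : nat) : R[i] :=
  (a * w k.*2 + b * w k.*2.+1) +i* (c * w k.*2 + e * w k.*2.+1).

Definition gefat (w : seqR R) (p : mR * mR) : R[i] := GEF (gcoef w) (toC p).

Lemma cmeas_gefat : cmeas (fun t : seqR R * (mR * mR) => gefat t.1 t.2).
Proof.
apply: cmeas_limn => n; apply: cmeas_sum => k; apply: cmeasM.
  have mc i : measurable_fun setT (fun t : seqR R * (mR * mR) => t.1 i : mR).
    exact: measurableT_comp (measurable_coord i) measurable_fst.
  by split; apply: measurable_funD; apply: measurable_funM => //; exact: mc.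
apply: cmeasM; last exact: cmeas_cst.
apply: cmeasX; split.
  exact: measurableT_comp measurable_fst measurable_snd.
exact: measurableT_comp measurable_snd measurable_snd.
Qed.

Variables (h : R[i]^o -> R).
Hypothesis h_cont : continuous h.

Definition potat (w : seqR R) (p : mR * mR) : \bar R := GEF_potential (gcoef w) (toC p).

Lemma normc_toC (p : mR * mR) : normc (toC p : R[i]) = Num.sqrt (p.1 ^+ 2 + p.2 ^+ 2).
Proof. by []. Qed.

Lemma measurable_potat : measurable_fun setT (fun t : seqR R * (mR * mR) => potat t.1 t.2).
Proof.
apply: emeasurable_funD; last exact: measurable_cst.
apply: emeasurable_funB.
  by apply: measurable_lne_EFin; apply: measurable_normc; exact: cmeas_gefat.
apply/measurable_EFinP; apply: measurable_funM => //; apply: measurable_funX.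
rewrite (_ : (fun t => _) = (fun t : seqR R * (mR * mR) =>
  Num.sqrt (t.2.1 ^+ 2 + t.2.2 ^+ 2))); last by apply/funext.
apply: (measurableT_comp (continuous_measurable_fun (@sqrt_continuous R))).
apply: measurable_funD; apply: measurable_funX.
  exact: measurableT_comp measurable_fst measurable_snd.
exact: measurableT_comp measurable_snd measurable_snd.
Qed.

Lemma measurable_hscaled (r : R) : measurable_fun setT
  (fun p : mR * mR => h ((r^-1)%:C * (toC p : R[i]))).
Proof.
have mh : measurable_fun setT (h : borelC R -> mR).
  refine (@measurability _ _ _ mR setT _ _ (@RGenOInfty.measurableE R) _).
  move=> _ [_ [x ->] <-]; rewrite setTI; apply: sub_sigma_algebra => /=.
  apply: (@open_comp _ _ h) => [z _|]; first exact: h_cont.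
  exact: interval_open.
rewrite (_ : (fun p => _) = (fun p : mR * mR => h (toC (r^-1 * p.1, r^-1 * p.2)))).
  apply: (measurableT_comp mh); apply: (measurableT_comp (@measurable_toC R)).
  by apply/measurable_fun_pairP; split; apply: measurable_funM.
by apply/funext => -[x y]; congr h; rewrite /toC /=; simpc.
Qed.

Lemma linear_statisticE (w : seqR R) (r : R) : linear_statistic h (gcoef w) r =
  r^-1 * fine (\int[area2]_p ((h ((r^-1)%:C * (toC p : R[i])))%:E * potat w p))%E.
Proof.
rewrite /linear_statistic; congr (_ * fine _).
rewrite -integral_areaC.
  by apply: eq_integral => z _; rewrite /potat ofCK.
apply: emeasurable_funM; first by apply/measurable_EFinP; exact: measurable_hscaled.
exact: (measurableT_comp measurable_potat (measurable_pair1 w)).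
Qed.

Lemma measurable_linear_statistic (r : R) :
  measurable_fun setT (fun w : seqR R => linear_statistic h (gcoef w) r).
Proof.
rewrite (funext (fun w => linear_statisticE w r)).
apply: measurable_funM => //; apply: measurableT_comp => //.
apply: (measurable_integral_param (F := fun t => ((h ((r^-1)%:C * (toC t.2 : R[i])))%:E * potat t.1 t.2)%E)).
apply: emeasurable_funM; last exact: measurable_potat.
apply/measurable_EFinP; exact: (measurableT_comp (measurable_hscaled r) measurable_snd).
Qed.

End gef.

(** * Covariance of the normalized entire function *)

Section exponential_modulus.
Context {R : realType}.
Variable t : R[i].

Definition cpow (f : R[i]) (k : nat) : R := complex.Re (f * t ^+ k) / k`!%:R.

Lemma normcX (z : R[i]) k : normc (z ^+ k) = normc z ^+ k.
Proof. by elim: k => [|k ih]; rewrite ?expr0 ?normc1// !exprS normcM ih. Qed.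

Let normc_ge0 (z : R[i]) : 0 <= normc z.
Proof. by case: z => x y; exact: sqrtr_ge0. Qed.

Lemma cpow_le f k : `|cpow f k| <= normc f * (normc t ^+ k / k`!%:R).
Proof.
rewrite /cpow normrM normfV (ger0_norm (ler0n R _)) mulrA ler_wpM2r ?invr_ge0//.
by rewrite -normcX -normcM Re_le_normc.
Qed.

Lemma cpow_diffs f : pseries_diffs (cpow f) = cpow (f * t).
Proof.
apply/funext => k; rewrite /pseries_diffs /cpow factS natrM invfM exprS -mulrA.
by rewrite mulrCA (mulrA k.+1%:R) divff// mul1r.
Qed.

Lemma cvg_cpow f (K : R) : cvgn (pseries (cpow f) K).
Proof.
apply: normed_cvg; apply: (@series_le_cvg _ _ (fun k => normc f * exp_coeff (normc t * `|K|) k)).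
- by move=> k; exact: normr_ge0.
- by move=> k; rewrite mulr_ge0// /exp_coeff/= divr_ge0// exprn_ge0// mulr_ge0.
- move=> k /=; rewrite normrM /exp_coeff/= exprMn.
  rewrite (_ : _ * (_ * _ / _) = normc f * (normc t ^+ k / k`!%:R) * `|K| ^+ k); last by ring.
  by rewrite normrX ler_wpM2r ?exprn_ge0// cpow_le.
- exact: is_cvg_seriesZ (is_cvg_series_exp_coeff _).
Qed.

(** The real part of f exp(s t), as a real power series in [s]; by [cpow_diffs], differentiation in
    [s] multiplies [f] by [t]. *)
Definition cexp (f : R[i]) (s : R) : R := limn (pseries (cpow f) s).

Lemma cexp_lin f g h (x y s : R) : (forall z, complex.Re (h * z) = x * complex.Re (f * z) + y * complex.Re (g * z)) ->
  cexp h s = x * cexp f s + y * cexp g s.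
Proof.
move=> hfg; apply/cvg_lim => //.
rewrite (_ : pseries (cpow h) s = (fun n => x * pseries (cpow f) s n + y * pseries (cpow g) s n)).
  by apply: cvgD; apply: cvgMr; exact: cvg_cpow.
apply/funext => n; rewrite /pseries /series/= !mulr_sumr -big_split/=.
by apply: eq_bigr => k _; rewrite /cpow hfg; ring.
Qed.

Lemma is_derive_cexp f (s : R) : is_derive s (1 : R) (cexp f) (cexp (f * t) s).
Proof.
have h := @pseries_snd_diffs R (cpow f) (`|s| + 1) s.
rewrite !cpow_diffs in h.
apply: h; [exact: cvg_cpow|exact: cvg_cpow|exact: cvg_cpow|].
by rewrite [ltRHS]ger0_norm ?addr_ge0// ltrDl.
Qed.

Lemma cexp0 f : cexp f 0 = complex.Re f.
Proof.
apply/cvg_lim => //; rewrite -cvg_shiftS.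
rewrite (_ : (fun n => _) = (fun=> complex.Re f)); first exact: cvg_cst.
apply/funext => n; rewrite /pseries /series/= big_nat_recl//= big1 ?addr0.
  by rewrite /cpow expr0 mulr1 fact0 divr1 expr0 mulr1.
by move=> k _; rewrite expr0n mulr0.
Qed.

(** [cexp 1] and [cexp 'i] are the real part and minus the imaginary part of exp(s t). They solve a
    linear system whose squared norm grows at the rate 2 Re t. *)
Lemma cexp_modulus : cexp 1 1 ^+ 2 + cexp 'i 1 ^+ 2 = expR (2 * complex.Re t).
Proof.
set x := complex.Re t; pose y := complex.Im t.
pose F s := (cexp 1 s ^+ 2 + cexp 'i s ^+ 2) * expR (- (2 * x) * s).
have e1 s : cexp (1 * t) s = x * cexp 1 s + y * cexp 'i s.
  by apply: cexp_lin => -[a b]; rewrite /x /y; case: (t) => u v /=; simpc => /=; ring.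
have e2 s : cexp ('i * t) s = x * cexp 'i s + (- y) * cexp 1 s.
  by apply: cexp_lin => -[a b]; rewrite /x /y; case: (t) => u v /=; simpc => /=; ring.
have dF (s : R) : is_derive s (1 : R) F 0.
  have d1 := is_derive_cexp 1 s; have d2 := is_derive_cexp 'i s.
  have d3 : is_derive s (1 : R) (fun s => expR (- (2 * x) * s)) (- (2 * x) * expR (- (2 * x) * s)).
    by apply: is_derive_eq; rewrite /GRing.scale/= mulr1; ring.
  have h := is_deriveM (is_deriveD (is_deriveM d1 d1) (is_deriveM d2 d2)) d3.
  rewrite (_ : F = fun s => (cexp 1 s * cexp 1 s + cexp 'i s * cexp 'i s) * expR (- (2 * x) * s)); last first.
    by apply/funext => r; rewrite /F !expr2.
  apply: (is_derive_eq h); rewrite /GRing.scale/= e1 e2 !fctE/=; move: (cexp 1 s) (cexp 'i s) (expR _) => u v w; ring.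
have := is_derive_0_is_cst 1 0 dF; rewrite /F !cexp0 mulr0 expR0 mulr1 mulr1 /= => h.
have : (cexp 1 1 ^+ 2 + cexp 'i 1 ^+ 2) * expR (- (2 * x)) * expR (2 * x) = expR (2 * x).
  by rewrite h; ring.
by rewrite -mulrA -expRD addNr expR0 mulr1.
Qed.

End exponential_modulus.

(** * Covariances of the truncated series *)

Section coordinates.
Context {R : realType}.
Local Notation mR := (measurableTypeR R).
Local Notation N1 := (normal_prob (0 : R) 1).
Variable Q : probability (seqR R) R.
Hypothesis HQ : iid_normal Q.

(** Kept symbolic: it occurs in products such as [m2 * (a ^+ 2 + b ^+ 2)], whose values follow from
    the law of the coefficients. *)
Definition m2 : R := \int[N1]_(x in setT) ((x : R) ^+ 2).

Let coord_sqr i : \int[Q]_a (a i ^+ 2) = m2.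
Proof.
rewrite /Rintegral /m2; congr fine.
have mf : measurable_fun setT (fun a : seqR R => (a i ^+ 2)%:E).
  by apply/measurable_EFinP; apply: measurable_funX; exact: measurable_coord.
rewrite (ge0_integral_resample HQ i mf); last by move=> a; rewrite lee_fin sqr_ge0.
transitivity (\int[Q]_a (\int[N1]_x (x ^+ 2)%:E))%E.
  by apply: eq_integral => a _; apply: eq_integral => x _; rewrite /upd eqxx.
by rewrite integral_cst// [X in (_ * X)%E](@probability_setT _ _ _ Q) mule1.
Qed.

(** A half turn of coordinate [i] alone changes its sign, so a_i + a_j and -a_i + a_j have the same
    second moment. *)
Let coord_cross i j : i != j -> \int[Q]_a (a i * a j) = 0.
Proof.
move=> ij.
have iij := Rintegrable_coordM HQ i j.
have i1 := Rintegrable_coord_sqr HQ i; have i2 := Rintegrable_coord_sqr HQ j.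
have ep (s : R) : \int[Q]_a ((s * a i + a j) ^+ 2) =
    s ^+ 2 * m2 + m2 + 2 * s * \int[Q]_a (a i * a j).
  transitivity (\int[Q]_a ((s ^+ 2 * a i ^+ 2 + a j ^+ 2) + 2 * s * (a i * a j))).
    by apply: eq_Rintegral => a _; ring.
  rewrite (RintegralD measurableT (RintegrableD (RintegrableZ _ i1) i2) (RintegrableZ _ iij)).
  rewrite (RintegralD measurableT (RintegrableZ _ i1) i2).
  by rewrite (RintegralZl _ measurableT i1) (RintegralZl _ measurableT iij) !coord_sqr.
have int (s : R) : Rintegrable Q (fun a : seqR R => (s * a i + a j) ^+ 2).
  apply: (eq_Rintegrable (f := fun a : seqR R => (s ^+ 2 * a i ^+ 2 + a j ^+ 2) + 2 * s * (a i * a j))).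
    by move=> a; ring.
  by apply: RintegrableD; [apply: RintegrableD => //; exact: RintegrableZ|exact: RintegrableZ].
have e : \int[Q]_a ((1 * a i + a j) ^+ 2) = \int[Q]_a ((-1 * a i + a j) ^+ 2).
  rewrite -(Rintegral_fst (int 1)) -(Rintegral_fst (int (-1))) /Rintegral; congr fine.
  have mf (s : R) : measurable_fun setT (fun p : seqR R * seqR R => ((s * p.1 i + p.1 j) ^+ 2)%:E).
    apply/measurable_EFinP; apply: measurable_funX; apply: measurable_funD.
      by apply: measurable_funM => //; exact: measurable_coord_comp measurable_fst.
    exact: measurable_coord_comp measurable_fst.
  have := ge0_integral_rot_at HQ i (_ : (-1) ^+ 2 + 0 ^+ 2 = 1 :> R) (mf 1).
  rewrite sqrrN expr1n expr0n addr0 => /(_ erefl) <-; last by move=> p; rewrite lee_fin sqr_ge0.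
  apply: eq_integral => p _; congr (_%:E); rewrite /rot_at /rotation/= /upd eqxx.
  by rewrite eq_sym (negPf ij) mul0r addr0 mul1r.
by move: e; rewrite !ep; lra.
Qed.

Lemma cov_linE N (al be : nat -> R) :
  \int[Q]_a (lin N al a * lin N be a) = m2 * \sum_(i < N) al i * be i.
Proof.
transitivity (\int[Q]_a \sum_(i < N) \sum_(j < N) (al i * be j) * (a i * a j)).
  apply: eq_Rintegral => a _; rewrite /lin big_distrlr/=.
  by apply: eq_bigr => i _; apply: eq_bigr => j _; rewrite mulrACA.
rewrite Rintegral_sum; last first.
  by move=> i; apply: Rintegrable_sum => j; apply: RintegrableZ; exact: Rintegrable_coordM.
rewrite mulr_sumr; apply: eq_bigr => i _; rewrite Rintegral_sum; last first.
  by move=> j; apply: RintegrableZ; exact: Rintegrable_coordM.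
rewrite (bigD1 i)//= [X in _ + X]big1 ?addr0; last first.
  move=> j ji; rewrite (RintegralZl _ measurableT (Rintegrable_coordM HQ i j)).
  by rewrite coord_cross ?mulr0// eq_sym.
rewrite (RintegralZl _ measurableT (Rintegrable_coordM HQ i i)) mulrC; congr (_ * _).
by rewrite -(coord_sqr i); apply: eq_Rintegral => a _; rewrite expr2.
Qed.

Variables (a b c e : R).
Hypotheses (Hab : m2 * (a ^+ 2 + b ^+ 2) = 2^-1) (Hce : m2 * (c ^+ 2 + e ^+ 2) = 2^-1)
  (Hac : a * c + b * e = 0).

Definition nsq (z : R[i]) : R := complex.Re z ^+ 2 + complex.Im z ^+ 2.

Definition cweight (z : R[i]) (k : nat) : R := (Num.sqrt k`!%:R)^-1 * expR (- (nsq z / 2)).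

Definition repow z k : R := complex.Re (z ^+ k) * cweight z k.

Definition impow z k : R := complex.Im (z ^+ k) * cweight z k.

(* coefficients of the real and imaginary parts of [F z * expR (- |z|^2 / 2)] with respect to the
   standard normal coordinates *)
Definition alpha (z : R[i]) (p : bool) (m : nat) : R :=
  let k := m./2 in
  if p then (if odd m then b * repow z k - e * impow z k else a * repow z k - c * impow z k)
  else (if odd m then b * impow z k + e * repow z k else a * impow z k + c * repow z k).

Lemma sum_double (f : nat -> R) N : \sum_(m < N.*2) f m = \sum_(k < N) (f k.*2 + f k.*2.+1).
Proof.
elim: N => [|N ih]; first by rewrite !big_ord0.
by rewrite doubleS !big_ord_recr/= ih addrA.
Qed.

(** [kerRe] and [kerIm] are the real and imaginary parts of exp(-(|z|^2 + |w|^2)/2) sum_k (z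
    conj(w))^k / k!, the covariance kernel of U truncated to N terms. *)
Definition kerRe N z w : R := \sum_(k < N) (repow z k * repow w k + impow z k * impow w k).

Definition kerIm N z w : R := \sum_(k < N) (impow z k * repow w k - repow z k * impow w k).

Lemma alpha_even z p k : alpha z p k.*2 =
  if p then a * repow z k - c * impow z k else a * impow z k + c * repow z k.
Proof. by rewrite /alpha odd_double doubleK. Qed.

Lemma alpha_odd z p k : alpha z p k.*2.+1 =
  if p then b * repow z k - e * impow z k else b * impow z k + e * repow z k.
Proof. by rewrite /alpha /= odd_double /= uphalf_double. Qed.

Lemma cov_alpha N z w p q : m2 * \sum_(m < N.*2) alpha z p m * alpha w q m =
  2^-1 * (if p == q then kerRe N z w else if p then - kerIm N z w else kerIm N z w).
Proof.
rewrite (sum_double (fun m => alpha z p m * alpha w q m)).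
have hs (x y : R) : m2 * (a ^+ 2 + b ^+ 2) * x + m2 * (c ^+ 2 + e ^+ 2) * y = 2^-1 * (x + y).
  by rewrite Hab Hce mulrDr.
have step (f g : 'I_N -> R) : (forall k, m2 * f k = 2^-1 * g k) ->
    m2 * \sum_(k < N) f k = 2^-1 * \sum_(k < N) g k.
  by move=> fg; rewrite !mulr_sumr; apply: eq_bigr => k _.
under eq_bigr do rewrite !alpha_even !alpha_odd.
rewrite /kerRe /kerIm; case: p; case: q => /=; rewrite -?sumrN; apply: step => k /=; rewrite ?opprB.
- rewrite -hs; set u := repow z k; set v := impow z k; set u' := repow w k; set v' := impow w k.
  transitivity (m2 * (a ^+ 2 + b ^+ 2) * (u * u') + m2 * (c ^+ 2 + e ^+ 2) * (v * v') -
    m2 * (a * c + b * e) * (u * v' + v * u')); first by ring.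
  by rewrite Hac; ring.
- rewrite -hs; set u := repow z k; set v := impow z k; set u' := repow w k; set v' := impow w k.
  transitivity (m2 * (a ^+ 2 + b ^+ 2) * (u * v') + m2 * (c ^+ 2 + e ^+ 2) * (- (v * u')) +
    m2 * (a * c + b * e) * (u * u' - v * v')); first by ring.
  by rewrite Hac; ring.
- rewrite -hs; set u := repow z k; set v := impow z k; set u' := repow w k; set v' := impow w k.
  transitivity (m2 * (a ^+ 2 + b ^+ 2) * (v * u') + m2 * (c ^+ 2 + e ^+ 2) * (- (u * v')) +
    m2 * (a * c + b * e) * (u * u' - v * v')); first by ring.
  by rewrite Hac; ring.
- rewrite [in RHS]addrC -hs.
  set u := repow z k; set v := impow z k; set u' := repow w k; set v' := impow w k.
  transitivity (m2 * (a ^+ 2 + b ^+ 2) * (v * v') + m2 * (c ^+ 2 + e ^+ 2) * (u * u') +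
    m2 * (a * c + b * e) * (v * u' + u * v')); first by ring.
  by rewrite Hac; ring.
Qed.

Lemma kerIm_diag N z : kerIm N z z = 0.
Proof. by rewrite /kerIm big1// => k _; ring. Qed.

Let cweight2 z w k : cweight z k * cweight w k = expR (- ((nsq z + nsq w) / 2)) / k`!%:R.
Proof.
rewrite /cweight mulrACA -expRD -invfM -expr2 sqr_sqrtr// mulrC; congr (expR _ / _).
by field.
Qed.

Let conjX (w : R[i]) k : (complex.Re ((conjc w) ^+ k) = complex.Re (w ^+ k)) *
  (complex.Im ((conjc w) ^+ k) = - complex.Im (w ^+ k)).
Proof. by rewrite -rmorphXn/=; case: (w ^+ k). Qed.

Lemma kerReE N z w : kerRe N z w = expR (- ((nsq z + nsq w) / 2)) *
  pseries (cpow (z * conjc w) 1) 1 N.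
Proof.
rewrite /kerRe /pseries /series/= big_mkord mulr_sumr; apply: eq_bigr => k _.
rewrite /cpow mul1r expr1n mulr1 exprMn ReMc !conjX /repow /impow.
transitivity ((complex.Re (z ^+ k) * complex.Re (w ^+ k) + complex.Im (z ^+ k) * complex.Im (w ^+ k)) *
  (cweight z k * cweight w k)); first by ring.
by rewrite cweight2; ring.
Qed.

Lemma kerImE N z w : kerIm N z w = - (expR (- ((nsq z + nsq w) / 2)) *
  pseries (cpow (z * conjc w) 'i) 1 N).
Proof.
rewrite /kerIm /pseries /series/= big_mkord mulr_sumr -sumrN; apply: eq_bigr => k _.
rewrite /cpow expr1n mulr1 exprMn.
have -> x : complex.Re ('i * x) = - complex.Im x by case: x => x y /=; simpc.
rewrite ImMc !conjX /repow /impow.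
transitivity ((complex.Im (z ^+ k) * complex.Re (w ^+ k) - complex.Re (z ^+ k) * complex.Im (w ^+ k)) *
  (cweight z k * cweight w k)); first by ring.
by rewrite cweight2; ring.
Qed.

(** By [cexp_modulus], |exp(z conj(w))|^2 exp(-|z|^2 - |w|^2) = exp(-|z - w|^2). *)
Lemma kernel_cvg z w :
  kerRe N z w ^+ 2 + kerIm N z w ^+ 2 @[N --> \oo] --> expR (- nsq (z - w)).
Proof.
set g := expR (- ((nsq z + nsq w) / 2)).
have c1 := cvg_cpow (t := z * conjc w) (f := 1) (K := 1).
have c2 := cvg_cpow (t := z * conjc w) (f := 'i) (K := 1).
rewrite (_ : (fun N => _) = (fun N => g ^+ 2 * (pseries (cpow (z * conjc w) 1) 1 N *
  pseries (cpow (z * conjc w) 1) 1 N + pseries (cpow (z * conjc w) 'i) 1 N *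
  pseries (cpow (z * conjc w) 'i) 1 N))); last first.
  by apply/funext => N; rewrite kerReE kerImE -/g; ring.
have -> : expR (- nsq (z - w)) = g ^+ 2 * (cexp (z * conjc w) 1 1 * cexp (z * conjc w) 1 1 +
   cexp (z * conjc w) 'i 1 * cexp (z * conjc w) 'i 1).
  rewrite -!expr2 cexp_modulus /g -expRM_natl -expRD; congr expR.
  by case: (z) (w) => [x y] [x' y']; rewrite /nsq /=; field.
by apply: cvgMr; apply: cvgD; apply: cvgM.
Qed.

Lemma kerRe_diag_cvg z : kerRe N z z @[N --> \oo] --> (1 : R).
Proof.
have k0 N : 0 <= kerRe N z z.
  by apply: sumr_ge0 => k _; rewrite -!expr2 addr_ge0// sqr_ge0.
have h := @kernel_cvg z z; rewrite subrr /nsq/= expr0n addr0 oppr0 expR0 in h.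
rewrite (_ : (fun N => _) = (fun N => Num.sqrt (kerRe N z z ^+ 2 + kerIm N z z ^+ 2))); last first.
  by apply/funext => N; rewrite kerIm_diag expr0n addr0 sqrtr_sqr ger0_norm.
by rewrite -[X in _ --> X]sqrtr1; apply: (cvg_comp _ (@Num.sqrt R)) h _; exact: sqrt_continuous.
Qed.

(** Partial sums of squares that increase to 1; this gives the range of [kap] in the Stein bound. *)
Lemma kerRe_diag01 N z : 0 <= kerRe N z z <= 1.
Proof.
have nd : nondecreasing_seq (fun N => kerRe N z z).
  apply/nondecreasing_seqP => n; rewrite /kerRe big_ord_recr/= lerDl.
  by rewrite -!expr2 addr_ge0// sqr_ge0.
apply/andP; split.
  by apply: sumr_ge0 => k _; rewrite -!expr2 addr_ge0// sqr_ge0.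
have h := kerRe_diag_cvg z; rewrite -(cvg_lim _ h)//.
by apply: nondecreasing_cvgn_le => //; apply/cvg_ex; eexists; exact: h.
Qed.

Section family.
Variables (I : finType) (z : I -> R[i]).

Definition al (j : I * bool) : nat -> R := alpha (z j.1) j.2.

Lemma cov_alE N i j p q : cov Q N.*2 al (i, p) (j, q) =
  2^-1 * (if p == q then kerRe N (z i) (z j) else if p then - kerIm N (z i) (z j) else kerIm N (z i) (z j)).
Proof. by rewrite /cov cov_linE cov_alpha. Qed.

Lemma cov_al_diag N i p q : cov Q N.*2 al (i, p) (i, q) = (p == q)%:R * (kerRe N (z i) (z i) / 2).
Proof. by rewrite cov_alE kerIm_diag; case: p; case: q => /=; ring. Qed.

Lemma cov_al_cross N i j (q q' : bool) :
  \sum_(p : bool) cov Q N.*2 al (i, p) (j, q) * cov Q N.*2 al (i, p) (j, q') =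
  (q == q')%:R * ((kerRe N (z i) (z j) ^+ 2 + kerIm N (z i) (z j) ^+ 2) / 4).
Proof. by rewrite big_bool/= !cov_alE; case: q; case: q' => /=; field. Qed.

Lemma cov_al_le N i j p q : `|cov Q N.*2 al (i, p) (j, q)| <=
  2^-1 * Num.sqrt (kerRe N (z i) (z j) ^+ 2 + kerIm N (z i) (z j) ^+ 2).
Proof.
rewrite cov_alE normrM ger0_norm// ler_wpM2l//.
have h1 : `|kerRe N (z i) (z j)| <= Num.sqrt (kerRe N (z i) (z j) ^+ 2 + kerIm N (z i) (z j) ^+ 2).
  by rewrite -sqrtr_sqr ler_wsqrtr// lerDl sqr_ge0.
have h2 : `|kerIm N (z i) (z j)| <= Num.sqrt (kerRe N (z i) (z j) ^+ 2 + kerIm N (z i) (z j) ^+ 2).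
  by rewrite -sqrtr_sqr ler_wsqrtr// lerDr sqr_ge0.
by case: p; case: q => //=; rewrite normrN.
Qed.

End family.

End coordinates.

Lemma Rdominated_cvg_ae d (T : measurableType d) (R : realType) (mu : {measure set T -> \bar R})
  (f_ : nat -> T -> R) (f g : T -> R) :
  (forall n, measurable_fun setT (f_ n)) -> measurable_fun setT f ->
  {ae mu, forall x, f_ n x @[n --> \oo] --> f x} ->
  (forall n x, `|f_ n x| <= g x) -> Rintegrable mu g ->
  \int[mu]_x f_ n x @[n --> \oo] --> \int[mu]_x f x.
Proof.
move=> mf_ mf cf fg ig.
have mfE n : measurable_fun setT (fun x => (f_ n x)%:E) by exact/measurable_EFinP.
have mfE' : measurable_fun setT (fun x => (f x)%:E) by exact/measurable_EFinP.
have cE : {ae mu, forall x, setT x -> (fun n => (f_ n x)%:E) @ \oo --> (f x)%:E}.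
  by apply: filterS cf => x cfx _; apply: cvg_EFin; [exact: nearW|exact: cfx].
have fgE : {ae mu, forall x n, setT x -> (`|(f_ n x)%:E| <= (g x)%:E)%E}.
  by apply: aeW => x n _; rewrite lee_fin.
have [h1 _ h3] := @dominated_convergence _ _ _ mu _ measurableT
  (fun n x => (f_ n x)%:E) (fun x => (f x)%:E) (fun x => (g x)%:E) mfE mfE' cE ig fgE.
apply: fine_cvg; rewrite fineK//; exact: integrable_fin_num.
Qed.

(** * Removal of the truncation *)

Section entire_limit.
Context {R : realType}.
Local Notation mR := (measurableTypeR R).
Local Notation N1 := (normal_prob (0 : R) 1).
Variable Q : probability (seqR R) R.
Hypothesis HQ : iid_normal Q.
Variables (a b c e : R).
Hypotheses (Hab : m2 * (a ^+ 2 + b ^+ 2) = 2^-1) (Hce : m2 * (c ^+ 2 + e ^+ 2) = 2^-1)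
  (Hac : a * c + b * e = 0).
Local Notation alpha := (alpha a b c e).
Local Notation al := (al a b c e).

(* on this event of full probability the series converges on the whole plane *)
Definition good (w : seqR R) : Prop := cvgn (series (fun m => w m ^+ 2 / 2 ^+ m)).

Let half_sum n : \sum_(m < n) (2 ^+ m)^-1 <= 2 :> R.
Proof.
have e2 : \sum_(m < n) (2 ^+ m)^-1 = 2 - 2 / 2 ^+ n :> R.
  elim: n => [|n ih]; first by rewrite big_ord0 expr0 divr1 subrr.
  by rewrite big_ord_recr/= ih exprS; field; rewrite expf_neq0.
by rewrite e2 lerBlDr lerDl divr_ge0// exprn_ge0.
Qed.

(** The expectations of the terms sum to at most [m2 * 2], so the series is finite almost surely. *)
Lemma ae_good : {ae Q, forall w, good w}.
Proof.
pose u m (w : seqR R) := (w m ^+ 2 / 2 ^+ m)%:E.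
have mu_ m : measurable_fun setT (u m).
  apply/measurable_EFinP; apply: measurable_funM => //; apply: measurable_funX.
  exact: measurable_coord.
have u0 m w : (0 <= u m w)%E by rewrite lee_fin divr_ge0 ?sqr_ge0// exprn_ge0.
have iu m : (\int[Q]_w u m w)%E = (m2 / 2 ^+ m)%:E.
  have i2 := Rintegrable_coord_sqr HQ m.
  have e1 : \int[Q]_w (w m ^+ 2 / 2 ^+ m) = m2 / 2 ^+ m.
    transitivity (\int[Q]_w ((2 ^+ m)^-1 * w m ^+ 2)); first by apply: eq_Rintegral => w _; rewrite mulrC.
    rewrite (RintegralZl _ measurableT i2) mulrC; congr (_ * _).
    have := cov_linE HQ m.+1 (fun k => (k == m)%:R) (fun k => (k == m)%:R).
    rewrite (bigD1 (Ordinal (ltnSn m)))//= eqxx big1 ?addr0; last first.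
      by move=> k /negPf; rewrite -val_eqE/= => ->; rewrite mulr0.
    rewrite !mulr1 => <-; apply: eq_Rintegral => w _.
    rewrite /lin (bigD1 (Ordinal (ltnSn m)))//= eqxx big1 ?addr0; last first.
      by move=> k /negPf; rewrite -val_eqE/= => ->; rewrite mul0r.
    by rewrite !mul1r expr2.
  rewrite -e1 /Rintegral fineK//.
  apply: integrable_fin_num => //.
  apply: (eq_Rintegrable (f := fun w : seqR R => (2 ^+ m)^-1 * w m ^+ 2)); last exact: RintegrableZ.
  by move=> w; rewrite mulrC.
pose F w := (\sum_(m <oo) u m w)%E.
have iF : Q.-integrable setT F.
  apply/integrableP; split; first by apply: ge0_emeasurable_sum.
  under eq_integral do rewrite gee0_abs ?nneseries_ge0//.
  rewrite integral_nneseries//.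
  apply: (@le_lt_trans _ _ (m2 * 2)%:E); last exact: ltry.
  apply: lime_le.
    by apply: is_cvg_nneseries => n _ _; apply: integral_ge0.
  apply: nearW => n; rewrite big_mkord.
  under eq_bigr do rewrite iu.
  rewrite sumEFin lee_fin -mulr_sumr ler_wpM2l//.
  by rewrite /m2 Rintegral_ge0// => x _; exact: sqr_ge0.
have := integrable_ae measurableT iF; apply: filterS => w /(_ I) Ffin.
have c1 : cvgn (fun n => \sum_(0 <= m < n) u m w)%E by apply: is_cvg_nneseries.
have : (fun n => \sum_(0 <= m < n) u m w)%E @ \oo --> F w by exact: c1.
rewrite -(fineK Ffin) => /fine_cvgP[_ h]; apply/cvg_ex; eexists.
rewrite (_ : series _ = fine \o (fun n => \sum_(0 <= m < n) u m w)%E); first exact: h.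
by apply/funext => n; rewrite /= sumEFin.
Qed.

Lemma nsqM (z w : R[i]) : nsq (z * w) = nsq z * nsq w.
Proof. by rewrite /nsq ReMc ImMc; ring. Qed.

Lemma nsqX (z : R[i]) k : nsq (z ^+ k) = nsq z ^+ k.
Proof.
elim: k => [|k ih]; last by rewrite !exprS nsqM ih.
by rewrite !expr0 /nsq/=; ring.
Qed.

Lemma nsq_ge0 (z : R[i]) : 0 <= nsq z. Proof. by rewrite addr_ge0// sqr_ge0. Qed.

(** The factorial in [alpha] outweighs the factor 2^m: coordinate m belongs to the power k = m/2, so
    2^m is at most 2 * 4^k. *)
Lemma alpha_sqr_le z p m : 2 ^+ m * alpha z p m ^+ 2 <=
  4 * (a ^+ 2 + b ^+ 2 + c ^+ 2 + e ^+ 2) * exp_coeff (4 * nsq z) m./2.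
Proof.
set C := a ^+ 2 + b ^+ 2 + c ^+ 2 + e ^+ 2; set k := m./2.
have C0 : 0 <= C by rewrite !addr_ge0// sqr_ge0.
have h1 : alpha z p m ^+ 2 <= 2 * C * (repow z k ^+ 2 + impow z k ^+ 2).
  rewrite /alpha -/k; set u := repow z k; set v := impow z k.
  have key (s t s' t' : R) : s ^+ 2 <= C -> t ^+ 2 <= C -> (s * s' + t * t') ^+ 2 <= 2 * C * (s' ^+ 2 + t' ^+ 2).
    move=> sC tC; have q1 := sqr_ge0 (s * s' - t * t'); have q2 := sqr_ge0 s'; have q3 := sqr_ge0 t'.
    have := ler_wpM2r q2 sC; have := ler_wpM2r q3 tC; move: q1; rewrite -!exprMn !expr2; lra.
  have [q1 q2] := (sqr_ge0 a, sqr_ge0 b); have [q3 q4] := (sqr_ge0 c, sqr_ge0 e).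
  case: p; case: (odd m).
  - by rewrite -mulNr; apply: key; rewrite ?sqrrN /C; lra.
  - by rewrite -mulNr; apply: key; rewrite ?sqrrN /C; lra.
  - by rewrite (addrC (u ^+ 2)); apply: key; rewrite /C; lra.
  - by rewrite (addrC (u ^+ 2)); apply: key; rewrite /C; lra.
have h2 : repow z k ^+ 2 + impow z k ^+ 2 <= nsq z ^+ k / k`!%:R.
  rewrite /repow /impow /cweight !exprMn -mulrDl -/(nsq (z ^+ k)) nsqX ler_wpM2l ?exprn_ge0 ?nsq_ge0//.
  rewrite exprVn sqr_sqrtr// -[leRHS]mulr1 ler_wpM2l ?invr_ge0//.
  by rewrite -expRM_natl -[leRHS]expR0 ler_expR mulrN oppr_le0 mulr_ge0// divr_ge0// nsq_ge0.
have h3 : 2 ^+ m <= 2 * 4 ^+ k :> R.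
  rewrite -[m]odd_double_half exprD -/k -mul2n exprM (_ : 2 ^+ 2 = 4 :> R); last by rewrite expr2; ring.
  by rewrite ler_wpM2r ?exprn_ge0//; case: (odd m); rewrite ?expr1 ?expr0 ?ler1n.
have h12 := le_trans h1 (ler_wpM2l (mulr_ge0 (ler0n R 2) C0) h2).
apply: le_trans (ler_pM (exprn_ge0 _ (ler0n R 2)) (sqr_ge0 _) h3 h12) _.
rewrite /exp_coeff/= exprMn le_eqVlt; apply/orP; left; apply/eqP.
by set F := _^-1; ring.
Qed.

(** The inequality |alpha w| <= w^2 / 2^m + 2^m alpha^2 separates the random part, summable on
    [good], from the deterministic one. *)
Lemma cvg_alpha z p (w : seqR R) : good w -> cvgn (series (fun m => alpha z p m * w m)).
Proof.
move=> gw; apply: normed_cvg.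
set C := 4 * (a ^+ 2 + b ^+ 2 + c ^+ 2 + e ^+ 2).
have C0 : 0 <= C by rewrite mulr_ge0// !addr_ge0// sqr_ge0.
pose E := limn (series (exp_coeff (4 * nsq z))).
pose W := limn (series (fun m => w m ^+ 2 / 2 ^+ m)).
have x0 : 0 <= 4 * nsq z by rewrite mulr_ge0// nsq_ge0.
have hE n : \sum_(k < n) exp_coeff (4 * nsq z) k <= E.
  have := @nondecreasing_cvgn_le _ (series (exp_coeff (4 * nsq z))) _ (is_cvg_series_exp_coeff _) n.
  rewrite /series/= big_mkord; apply; apply/nondecreasing_seqP => m.
  by rewrite /series/= big_nat_recr//= lerDl /exp_coeff/= divr_ge0// exprn_ge0.
have hW n : \sum_(m < n) w m ^+ 2 / 2 ^+ m <= W.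
  have := @nondecreasing_cvgn_le _ (series (fun m => w m ^+ 2 / 2 ^+ m)) _ gw n.
  rewrite /series/= big_mkord; apply; apply/nondecreasing_seqP => m.
  by rewrite /series/= big_nat_recr//= lerDl divr_ge0 ?sqr_ge0// exprn_ge0.
apply: nondecreasing_is_cvgn.
  by apply/nondecreasing_seqP => m; rewrite /= /series/= big_nat_recr//= lerDl.
exists (W + 2 * C * E) => _ [n _ <-]; rewrite /= /series/= big_mkord.
apply: (@le_trans _ _ (\sum_(m < n) (w m ^+ 2 / 2 ^+ m + 2 ^+ m * alpha z p m ^+ 2))).
  apply: ler_sum => m _; rewrite normrM.
  have t0 : 0 < 2 ^+ m :> R by rewrite exprn_gt0.
  rewrite -(real_normK (num_real (w m))) -(real_normK (num_real (alpha z p m))).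
  set x := `|alpha z p m|; set y := `|w m|; set t := 2 ^+ m in t0 *.
  have x0' : 0 <= x by exact: normr_ge0.
  have y0' : 0 <= y by exact: normr_ge0.
  have -> : y ^+ 2 / t + t * x ^+ 2 = (y ^+ 2 + (t * x) ^+ 2) / t by field; rewrite gt_eqF.
  rewrite ler_pdivlMr//.
  have := sqr_ge0 (y - t * x); have := mulr_ge0 (mulr_ge0 (ltW t0) x0') y0'; rewrite !expr2; nra.
rewrite big_split/= lerD ?hW//.
apply: (@le_trans _ _ (\sum_(m < n.*2) 2 ^+ m * alpha z p m ^+ 2)).
  rewrite -addnn big_split_ord/= lerDl; apply: sumr_ge0 => m _.
  by apply: mulr_ge0; [exact: exprn_ge0|exact: sqr_ge0].
rewrite (sum_double (fun m => 2 ^+ m * alpha z p m ^+ 2)).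
apply: (@le_trans _ _ (\sum_(k < n) 2 * C * exp_coeff (4 * nsq z) k)).
  apply: ler_sum => k _.
  have h1 := alpha_sqr_le z p k.*2; have h2 := alpha_sqr_le z p k.*2.+1.
  rewrite doubleK in h1; rewrite /= uphalf_double in h2.
  by rewrite -mulrA [leRHS]mulrDl !mul1r; exact: lerD.
by rewrite -mulr_sumr ler_wpM2l// mulr_ge0.
Qed.

(** This is |U_z|^2 for the full series. *)
Definition ysq (z : R[i]) (w : seqR R) : R :=
  normc (GEF (gcoef a b c e w) z) ^+ 2 * expR (- nsq z).

Lemma ysq_ge0 z w : 0 <= ysq z w.
Proof. by rewrite mulr_ge0 ?sqr_ge0 ?expR_ge0. Qed.

Lemma measurable_ysq z : measurable_fun setT (ysq z).
Proof.
apply: measurable_funM => //; apply: measurable_funX.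
have h := measurable_normc (cmeas_gefat a b c e).
rewrite (_ : (fun w => _) = (fun w => normc (gefat a b c e w (ofC z)))).
  exact: (measurableT_comp h (measurable_pair2 (ofC z : mR * mR))).
by apply/funext => w; rewrite /gefat ofCK.
Qed.

Lemma measurable_ysq2 : measurable_fun setT
  (fun t : seqR R * (mR * mR) => ysq (toC t.2) t.1).
Proof.
apply: measurable_funM; first by apply: measurable_funX; exact: (measurable_normc (cmeas_gefat a b c e)).
apply: measurableT_comp => //; apply: measurable_funN.
apply: measurable_funD; apply: measurable_funX.
  exact: measurableT_comp measurable_fst measurable_snd.
exact: measurableT_comp measurable_snd measurable_snd.
Qed.

Lemma ysq_cvg (w : seqR R) (z : R[i]) : good w ->
  lin n.*2 (alpha z true) w ^+ 2 + lin n.*2 (alpha z false) w ^+ 2 @[n --> \oo] --> ysq z w.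
Proof.
move=> gw; set g := expR (- (nsq z / 2)).
have g0 : g != 0 by rewrite gt_eqF// expR_gt0.
pose L p := limn (series (fun m => alpha z p m * w m)).
have hL p : lin n.*2 (alpha z p) w @[n --> \oo] --> L p.
  have h := @cvg_alpha z p w gw.
  rewrite (_ : (fun n => _) = (fun n => series (fun m => alpha z p m * w m) n.*2)); last first.
    by apply/funext => n; rewrite /lin /series/= big_mkord.
  apply: (cvg_comp (fun n => n.*2) _ _ h).
  move=> A [M _ MA]; exists M => // n /= Mn; apply: MA => /=.
  by rewrite (leq_trans Mn)// -addnn leq_addr.
pose P n : R[i] := series (fun k => gcoef a b c e w k * (z ^+ k / (Num.sqrt (k`!%:R : R))%:C)) n.
have VC (x : R) : (x%:C)^-1 = (x^-1)%:C by rewrite fmorphV.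
have reP n : complex.Re (P n) = g^-1 * lin n.*2 (alpha z true) w.
  rewrite /P /series/= big_mkord raddf_sum/= /lin (sum_double (fun m => alpha z true m * w m)) mulr_sumr.
  apply: eq_bigr => k _; rewrite alpha_even alpha_odd VC !ReMc !ImMc /gcoef /repow /impow /cweight -/g/=.
  by set q := (Num.sqrt _)^-1; field; exact: g0.
have imP n : complex.Im (P n) = g^-1 * lin n.*2 (alpha z false) w.
  rewrite /P /series/= big_mkord raddf_sum/= /lin (sum_double (fun m => alpha z false m * w m)) mulr_sumr.
  apply: eq_bigr => k _; rewrite alpha_even alpha_odd VC !ImMc !ReMc /gcoef /repow /impow /cweight -/g/=.
  by set q := (Num.sqrt _)^-1; field; exact: g0.
have -> : ysq z w = L true ^+ 2 + L false ^+ 2.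
  rewrite /ysq; have -> : GEF (gcoef a b c e w) z = (g^-1 * L true) +i* (g^-1 * L false).
    apply: limC_E.
      by rewrite -/P (funext reP); apply: cvgMr; exact: hL.
    by rewrite -/P (funext imP); apply: cvgMr; exact: hL.
  rewrite /normc sqr_sqrtr ?addr_ge0 ?sqr_ge0//.
  have -> : expR (- nsq z) = g ^+ 2 by rewrite /g -expRM_natl; congr expR; field.
  by rewrite !exprMn exprVn; field; exact: g0.
by apply: cvgD; rewrite expr2; apply: cvgM; exact: hL.
Qed.

Section family.
Variables (I : finType) (z : I -> R[i]).

Lemma Usqr_ysq_cvg w i : good w -> Usqr n.*2 (al z) i w @[n --> \oo] --> ysq (z i) w.
Proof. by move=> gw; exact: ysq_cvg. Qed.

Lemma Uexp_ysq_cvg w i (s : R) : good w ->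
  Uexp n.*2 (al z) i s w @[n --> \oo] --> expR (- (s * ysq (z i) w)).
Proof.
move=> gw; rewrite (_ : (fun n => _) = (fun n => expR (- (s * Usqr n.*2 (al z) i w)))); last first.
  by apply/funext => n; exact: UexpE.
apply: (cvg_comp _ expR); last exact: continuous_expR.
by apply: cvgN; apply: cvgMr; exact: Usqr_ysq_cvg.
Qed.

End family.

Lemma measurable_expysq z (s : R) : measurable_fun setT (fun w => expR (- (s * ysq z w))).
Proof.
apply: measurableT_comp => //; apply: measurable_funN; apply: measurable_funM => //.
exact: measurable_ysq.
Qed.

Lemma expysq01 z (s : R) w : 0 <= s -> 0 <= expR (- (s * ysq z w)) <= 1.
Proof. by move=> s0; rewrite expR_ge0 -[leRHS]expR0 ler_expR oppr_le0 mulr_ge0// ysq_ge0. Qed.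

(** The limit of [two_point_laplace]: the truncated variances tend to 1, [rho] tends to exp(-|z -
    w|^2), and the exponentials are bounded by 1. *)
Lemma laplace2 z w (s t : R) : 0 < s -> 0 < t ->
  \int[Q]_x (expR (- (s * ysq z x)) * expR (- (t * ysq w x))) =
  ((1 + s) * (1 + t) - s * t * expR (- nsq (z - w)))^-1.
Proof.
move=> s0 t0; pose zz (i : bool) := if i then z else w.
pose D n := \int[Q]_x (Uexp n.*2 (al zz) true s x * Uexp n.*2 (al zz) false t x).
pose De n := (1 + kerRe n z z * s) * (1 + kerRe n w w * t) -
  (kerRe n z w ^+ 2 + kerIm n z w ^+ 2) * (s * t).
have DDe n : D n * De n = 1.
  have k0 (i : bool) : 0 <= kerRe n (zz i) (zz i) by have /andP[] := kerRe_diag01 n (zz i).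
  exact: (two_point_laplace HQ k0 (cov_al_diag HQ Hab Hce Hac zz n)
    (cov_al_cross HQ Hab Hce Hac zz n true false) s0 t0).
have cD : D n @[n --> \oo] --> \int[Q]_x (expR (- (s * ysq z x)) * expR (- (t * ysq w x))).
  apply: (@Rdominated_cvg_ae _ _ _ _ _ _ (fun=> 1)).
  - by move=> n; apply: measurable_funM; exact: measurable_Uexp.
  - by apply: measurable_funM; exact: measurable_expysq.
  - apply: filterS ae_good => x gx.
    by apply: cvgM; [exact: (@Uexp_ysq_cvg _ zz x true s gx)|exact: (@Uexp_ysq_cvg _ zz x false t gx)].
  - move=> n x.
    have q1 : Uexp n.*2 (al zz) true s x <= 1 by apply: Uexp_le1; exact: ltW.
    have q2 : Uexp n.*2 (al zz) false t x <= 1 by apply: Uexp_le1; exact: ltW.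
    have p1 := ltW (Uexp_gt0 n.*2 (al zz) true s x).
    have p2 := ltW (Uexp_gt0 n.*2 (al zz) false t x).
    move: (Uexp n.*2 (al zz) true s x) (Uexp n.*2 (al zz) false t x) q1 q2 p1 p2 => u v q1 q2 p1 p2.
    by rewrite ger0_norm; [exact: mulr_ile1|exact: mulr_ge0].
  - exact: Rintegrable_cst.
have cDe : De n @[n --> \oo] --> (1 + 1 * s) * (1 + 1 * t) - expR (- nsq (z - w)) * (s * t).
  apply: cvgB; last by apply: cvgMl; exact: kernel_cvg.
  by apply: cvgM; apply: cvgD; [exact: cvg_cst|apply: cvgMl; exact: kerRe_diag_cvg|
    exact: cvg_cst|apply: cvgMl; exact: kerRe_diag_cvg].
have h : D n * De n @[n --> \oo] --> (\int[Q]_x (expR (- (s * ysq z x)) * expR (- (t * ysq w x)))) *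
  ((1 + 1 * s) * (1 + 1 * t) - expR (- nsq (z - w)) * (s * t)) by exact: (cvgM cD cDe).
have h1 : (fun n => D n * De n) @ \oo --> (1 : R).
  by rewrite (funext DDe); exact: cvg_cst.
have h2 := cvg_unique (@Rhausdorff R) h h1.
have d0 : (1 + s) * (1 + t) - s * t * expR (- nsq (z - w)) != 0.
  rewrite gt_eqF// subr_gt0 (@le_lt_trans _ _ (s * t))//.
    rewrite ler_piMr ?mulr_ge0 ?(ltW s0) ?(ltW t0)//.
    by rewrite -[leRHS]expR0 ler_expR oppr_le0 nsq_ge0.
  by have := mulr_gt0 s0 t0; rewrite mulrDl mulrDr; lra.
apply: (mulIf d0); rewrite mulVf//.
have {}h2 : \int[Q]_x (expR (- (s * ysq z x)) * expR (- (t * ysq w x))) *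
  ((1 + 1 * s) * (1 + 1 * t) - expR (- nsq (z - w)) * (s * t)) = 1 by exact: h2.
by rewrite -[RHS]h2; congr (_ * _); ring.
Qed.

(** [laplace2] at twice the same point with exponents s/2, as (1 + s/2)^2 - (s/2)^2 = 1 + s. *)
Lemma laplace1 z (s : R) : 0 < s -> \int[Q]_x expR (- (s * ysq z x)) = (1 + s)^-1.
Proof.
move=> s0; have s2 : 0 < s / 2 by rewrite divr_gt0.
transitivity (\int[Q]_x (expR (- (s / 2 * ysq z x)) * expR (- (s / 2 * ysq z x)))).
  by apply: eq_Rintegral => x _; rewrite -expRD; congr expR; field.
by rewrite laplace2// subrr /nsq/= expr0n addr0 oppr0 expR0; congr (_^-1); field.
Qed.

(** The probability of a zero at [z] is at most the Laplace transform (1 + s)^-1, for every s; the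
    choice s = 1/ep makes this smaller than ep. *)
Lemma ae_ysq_gt0 z : {ae Q, forall w, 0 < ysq z w}.
Proof.
pose A := [set w | ysq z w = 0].
have mA : measurable A.
  by have := measurable_ysq z measurableT (@measurable_set1 R 0); rewrite setTI.
exists A; split => //; last first.
  by move=> w /= /negP; rewrite -leNgt => h; apply/eqP; rewrite eq_le h ysq_ge0.
apply/eqP; rewrite eq_le measure_ge0 andbT.
have fA : Q A \is a fin_num by exact: fin_num_measure.
rewrite -(fineK fA) lee_fin; apply/ler_addgt0Pr => ep ep0; rewrite add0r.
pose s := ep^-1.
have s0 : 0 < s by rewrite invr_gt0.
apply: (@le_trans _ _ (1 + s)^-1); last first.
  by rewrite -[leRHS]invrK lef_pV2 ?posrE ?addr_gt0// lerDr.
rewrite -(laplace1 z s0) -lee_fin fineK// /Rintegral fineK; last first.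
  apply: integrable_fin_num => //; apply: (@Rintegrable_bounded _ _ _ Q _ 1).
    exact: measurable_expysq.
  by move=> w; have /andP[h1 h2] := expysq01 z w (ltW s0); rewrite ger0_norm.
rewrite -(setIT A) -integral_indic//; apply: ge0_le_integral => //.
- by apply/measurable_EFinP; exact: measurable_indic.
- by apply/measurable_EFinP; exact: measurable_expysq.
- move=> w _; rewrite lee_fin indicE; case: (boolP (w \in A)) => [|_]; last exact: expR_ge0.
  by rewrite inE => Aw; rewrite Aw mulr0 oppr0 expR0.
Qed.

Section sums.
Variables (I : finType) (z : I -> R[i]) (cc s : I -> R).
Hypothesis s0 : forall i, 0 < s i.

Definition fsum (w : seqR R) : R := \sum_i cc i * (expR (- (s i * ysq (z i) w)) - (1 + s i)^-1).

Lemma fsum_le w : `|fsum w| <= \sum_i `|cc i|.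
Proof.
apply: (le_trans (ler_norm_sum _ _ _)); apply: ler_sum => i _.
rewrite normrM ler_piMr//; have /andP[h1 h2] := expysq01 (z i) w (ltW (s0 i)).
have : 0 <= (1 + s i)^-1 by rewrite invr_ge0 addr_ge0// ltW.
have : (1 + s i)^-1 <= 1 by rewrite invf_le1 ?addr_gt0// lerDl ltW.
by rewrite ler_norml; lra.
Qed.

Lemma measurable_fsum : measurable_fun setT fsum.
Proof.
apply: measurable_sum => i; apply: measurable_funM => //; apply: measurable_funB => //.
exact: measurable_expysq.
Qed.

End sums.

Lemma fsumM (I J : finType) (z : I -> R[i]) (w : J -> R[i]) cc s cc' s' :
  (forall i, 0 < s i) -> (forall j, 0 < s' j) ->
  \int[Q]_x (fsum z cc s x * fsum w cc' s' x) =
  \sum_i \sum_j cc i * cc' j * expcov (s i) (s' j) (expR (- nsq (z i - w j))).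
Proof.
move=> s0 s0'.
have b1 (u : R[i]) (r : R) : 0 < r -> bmeas (fun x => expR (- (r * ysq u x)) - (1 + r)^-1).
  move=> r0; apply: bmeasD; last exact: bmeas_cst.
  split; first exact: measurable_expysq.
  by exists 1 => x; have /andP[h1 h2] := expysq01 u x (ltW r0); rewrite ger0_norm.
have b0 (u : R[i]) (r : R) : 0 < r -> bmeas (fun x => expR (- (r * ysq u x))).
  move=> r0; split; first exact: measurable_expysq.
  by exists 1 => x; have /andP[h1 h2] := expysq01 u x (ltW r0); rewrite ger0_norm.
transitivity (\int[Q]_x \sum_i \sum_j cc i * cc' j *
   ((expR (- (s i * ysq (z i) x)) - (1 + s i)^-1) * (expR (- (s' j * ysq (w j) x)) - (1 + s' j)^-1))).
  apply: eq_Rintegral => x _; rewrite /fsum big_distrlr/=.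
  by apply: eq_bigr => i _; apply: eq_bigr => j _; rewrite mulrACA.
have bb i j := bmeasM (b1 (z i) _ (s0 i)) (b1 (w j) _ (s0' j)).
rewrite Rintegral_sum; last first.
  by move=> i; apply: Rintegrable_sum => j; apply: RintegrableZ; exact: (bmeas_int Q (bb i j)).
apply: eq_bigr => i _; rewrite Rintegral_sum; last first.
  by move=> j; apply: RintegrableZ; exact: (bmeas_int Q (bb i j)).
apply: eq_bigr => j _; rewrite (RintegralZl _ measurableT (bmeas_int Q (bb i j))); congr (_ * _).
set r := s i; set r' := s' j.
have ra : 0 < r by exact: s0. have ra' : 0 < r' by exact: s0'.
have i1 := bmeas_int Q (b0 (z i) _ ra); have i2 := bmeas_int Q (b0 (w j) _ ra').
have i12 := bmeas_int Q (bmeasM (b0 (z i) _ ra) (b0 (w j) _ ra')).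
transitivity (\int[Q]_x ((expR (- (r * ysq (z i) x)) * expR (- (r' * ysq (w j) x)) -
   (1 + r')^-1 * expR (- (r * ysq (z i) x))) - ((1 + r)^-1 * expR (- (r' * ysq (w j) x)) - (1 + r)^-1 * (1 + r')^-1))).
  by apply: eq_Rintegral => x _; ring.
rewrite (RintegralB measurableT (RintegrableB i12 (RintegrableZ _ i1))
  (RintegrableB (RintegrableZ _ i2) (Rintegrable_cst Q _))).
rewrite (RintegralB measurableT i12 (RintegrableZ _ i1)).
rewrite (RintegralB measurableT (RintegrableZ _ i2) (Rintegrable_cst Q _)).
rewrite (RintegralZl _ measurableT i1) (RintegralZl _ measurableT i2) Rintegral_cst1.
rewrite laplace2// !laplace1// /expcov invfM.
by set u := (1 + r)^-1; set v := (1 + r')^-1; ring.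
Qed.

End entire_limit.

(** * Normal approximation of sums of approximate potentials *)

Section gaussian_approximation.
Context {R : realType}.
Local Notation mR := (measurableTypeR R).
Variable Q : probability (seqR R) R.
Hypothesis HQ : iid_normal Q.
Variables (a b c e : R).
Hypotheses (Hab : m2 * (a ^+ 2 + b ^+ 2) = 2^-1) (Hce : m2 * (c ^+ 2 + e ^+ 2) = 2^-1)
  (Hac : a * c + b * e = 0).
Local Notation al := (al a b c e).
Local Notation ysq := (ysq a b c e).
Local Notation fsum := (fsum a b c e).

Section stein.
Variables (I : finType) (z : I -> R[i]) (cc s : I -> R) (S eta Lam : R).
Hypothesis sS : forall i, 0 < s i <= S.
Hypothesis eta_gt0 : 0 < eta.
Hypothesis eta_ge : forall i, \sum_j `|cc j| * expR (- (nsq (z i - z j) / 2)) <= eta.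
Hypothesis Lam_ge : \sum_i `|cc i| <= Lam.
Local Notation f := (fsum z cc s).

Let s0 i : 0 < s i. Proof. by case/andP: (sS i). Qed.

(** The limit of [stein_expsum]: on [good] the truncated sums converge, and all of them are bounded
    by [Lam]. *)
Lemma stein_fsum (psi psi' : R -> R) (M : R) :
  (forall x : R, is_derive x (1 : R) psi (psi' x)) -> (forall x, `|psi' x| <= M) ->
  continuous psi' ->
  `|\int[Q]_x (f x * psi (f x)) - (\int[Q]_x psi' (f x)) * \int[Q]_x (f x ^+ 2)| <=
  stein_err S eta Lam M.
Proof.
move=> dpsi psiM cpsi'; have mpsi' := continuous_measurable_fun cpsi'.
have cpsi := continuous_of_is_derive dpsi; have mpsi := continuous_measurable_fun cpsi.
pose kap n i := kerRe n (z i) (z i).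
pose fN n := expsum n.*2 (al z) (kap n) cc s.
pose k n i j := 2^-1 * Num.sqrt (kerRe n (z i) (z j) ^+ 2 + kerIm n (z i) (z j) ^+ 2).
have k_sym n i j : k n i j = k n j i.
  rewrite /k; congr (_ * Num.sqrt (_ + _)).
    by congr (_ ^+ 2); apply: eq_bigr => l _; ring.
  rewrite -[RHS]sqrrN; congr (_ ^+ 2); rewrite /kerIm -sumrN; apply: eq_bigr => l _; ring.
have kc i : \sum_j `|cc j| * k n i j @[n --> \oo] -->
    \sum_j `|cc j| * (2^-1 * expR (- (nsq (z i - z j) / 2))).
  apply: cvg_fsum => j; apply: cvgMr; apply: cvgMr.
  have -> : expR (- (nsq (z i - z j) / 2)) = Num.sqrt (expR (- nsq (z i - z j))).
    rewrite -[LHS]ger0_norm ?expR_ge0// -sqrtr_sqr; congr Num.sqrt.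
    by rewrite -expRM_natl; congr expR; field.
  apply: (cvg_comp _ (@Num.sqrt R)); last exact: sqrt_continuous.
  exact: kernel_cvg.
(* The limiting row sums are at most eta/2, since covariances of real and imaginary parts carry a
   factor 1/2. As eta > 0 there is room for the truncated ones, eventually and for all of the
   finitely many [i]. *)
have keta : \forall n \near \oo, forall i, \sum_j `|cc j| * k n i j <= eta.
  have h i : \forall n \near \oo, \sum_j `|cc j| * k n i j <= eta.
    have lt : \sum_j `|cc j| * (2^-1 * expR (- (nsq (z i - z j) / 2))) < eta.
      have := eta_ge i; have -> : \sum_j `|cc j| * (2^-1 * expR (- (nsq (z i - z j) / 2))) =
        2^-1 * \sum_j `|cc j| * expR (- (nsq (z i - z j) / 2)).
        by rewrite mulr_sumr; apply: eq_bigr => j _; ring.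
      by move: eta_gt0; lra.
    by near=> n; apply: ltW; near: n; exact: (cvgr_lt _ (kc i)).
  have h' : \forall n \near \oo, forall i, i \in enum I -> \sum_j `|cc j| * k n i j <= eta.
    elim: (enum I) => [|i l ih]; first by apply: nearW => n i; rewrite in_nil.
    near=> n => j; rewrite in_cons => /orP[/eqP->|jl]; first by near: n; exact: h.
    by move: j jl; near: n; exact: ih.
  by apply: filterS h' => n hn i; apply: hn; rewrite mem_enum.
have cf x : good x -> fN n x @[n --> \oo] --> f x.
  move=> gx; apply: cvg_fsum => i; apply: cvgMr; apply: cvgB.
    by apply: Uexp_ysq_cvg.
  rewrite -[X in (1 + X)^-1]mul1r; apply: cvgV.
    by rewrite gt_eqF// mul1r addr_gt0.
  by apply: cvgD; [exact: cvg_cst|apply: cvgMl; exact: kerRe_diag_cvg].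
have mfN n : measurable_fun setT (fN n).
  apply: measurable_sum => i; apply: measurable_funM => //; apply: measurable_funB => //.
  exact: measurable_Uexp.
have mf : measurable_fun setT f by exact: measurable_fsum.
have bfN n x : `|fN n x| <= Lam.
  apply: (le_trans (ler_norm_sum _ _ _)); apply: le_trans Lam_ge; apply: ler_sum => i _.
  rewrite normrM ler_piMr//.
  have p1 := ltW (Uexp_gt0 n.*2 (al z) i (s i) x).
  have q1 : Uexp n.*2 (al z) i (s i) x <= 1 by apply: Uexp_le1; exact: ltW.
  have /andP[k0 _] := kerRe_diag01 n (z i).
  have k1 : 1 <= 1 + kap n i * s i by rewrite lerDl mulr_ge0// ltW.
  have : 0 <= (1 + kap n i * s i)^-1 by rewrite invr_ge0 (le_trans ler01).
  have : (1 + kap n i * s i)^-1 <= 1 by rewrite invf_le1// (lt_le_trans ltr01).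
  by rewrite ler_norml; move: p1 q1; set U := Uexp _ _ _ _ _; lra.
have Lam0 : 0 <= Lam by apply: le_trans Lam_ge; apply: sumr_ge0.
have bpsi x : `|x| <= Lam -> `|psi x| <= `|psi 0| + M * Lam.
  move=> xL; have := derive_bounded_lipschitz dpsi psiM x 0; rewrite subr0 => h.
  rewrite -[psi x](subrK (psi 0)) addrC (le_trans (ler_normD _ _))// lerD//.
  by rewrite (le_trans h)// ler_wpM2l// (le_trans _ (psiM 0)).
have lim (g : R -> R) (B : R) : continuous g -> (forall x, `|x| <= Lam -> `|g x| <= B) ->
    \int[Q]_x g (fN n x) @[n --> \oo] --> \int[Q]_x g (f x).
  move=> cg gB; have mg := continuous_measurable_fun cg.
  apply: (@Rdominated_cvg_ae _ _ _ _ _ _ (fun=> B)).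
  - by move=> n; exact: measurableT_comp mg (mfN n).
  - exact: measurableT_comp mg mf.
  - apply: filterS (ae_good HQ) => x gx; apply: (cvg_comp _ g); first exact: (cf x gx).
    exact: cg.
  - by move=> n x; exact: gB.
  - exact: Rintegrable_cst.
have l1 : \int[Q]_x (fN n x * psi (fN n x)) @[n --> \oo] --> \int[Q]_x (f x * psi (f x)).
  apply: (lim (fun x => x * psi x) (Lam * (`|psi 0| + M * Lam))).
    by move=> x; apply: cvgM; [exact: cvg_id|exact: cpsi].
  by move=> x xL; rewrite normrM ler_pM// bpsi.
have l2 : \int[Q]_x psi' (fN n x) @[n --> \oo] --> \int[Q]_x psi' (f x).
  by apply: (lim psi' M).
have l3 : \int[Q]_x (fN n x ^+ 2) @[n --> \oo] --> \int[Q]_x (f x ^+ 2).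
  apply: (lim (fun x => x ^+ 2) (Lam ^+ 2)); first exact: sqr_continuous.
  by move=> x xL; rewrite normrX lerXn2r ?nnegrE.
have l4 : (\int[Q]_x psi' (fN n x)) * (\int[Q]_x (fN n x ^+ 2)) @[n --> \oo] -->
  (\int[Q]_x psi' (f x)) * \int[Q]_x (f x ^+ 2) by exact: (cvgM l2 l3).
have l5 : `|\int[Q]_x (fN n x * psi (fN n x)) - (\int[Q]_x psi' (fN n x)) * \int[Q]_x (fN n x ^+ 2)|
   @[n --> \oo] --> `|\int[Q]_x (f x * psi (f x)) - (\int[Q]_x psi' (f x)) * \int[Q]_x (f x ^+ 2)|.
  by apply: cvg_norm; exact: (cvgB l1 l4).
rewrite -(cvg_lim _ l5)//; apply: limr_le; first by apply/cvg_ex; eexists; exact: l5.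
apply: filterS keta => n hn.
exact: (stein_expsum HQ (cov_al_diag HQ Hab Hce Hac z n) (fun i => kerRe_diag01 n (z i))
  (cov_al_le HQ Hab Hce Hac z n) (k_sym n) sS (ltW eta_gt0) hn Lam_ge dpsi psiM mpsi').
Unshelve. all: by end_near. Qed.

(** Stein's equation gives sd^2 E psi'(f) - E f psi(f). Inserting the product of E psi'(f) and E f^2
    separates the error in the variance from the error bounded by [stein_fsum]. *)
Lemma normal_approx_fsum (sd : R) (g : R -> R) (M : R) : 0 < sd -> continuous g ->
  (forall x, `|g x| <= M) ->
  `|\int[Q]_x g (f x) - \int[normal_prob 0 sd]_x g x| <=
  4 * M / sd ^+ 2 * `|\int[Q]_x (f x ^+ 2) - sd ^+ 2| + stein_err S eta Lam (4 * M / sd ^+ 2).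
Proof.
move=> sd0 cg gM; have [psi [psi' [dpsi psiM cpsi' eqn]]] := stein_equation sd0 cg gM.
set m := \int[normal_prob 0 sd]_x g x; set K := 4 * M / sd ^+ 2 in psiM *.
have h := stein_fsum dpsi psiM cpsi'.
have mf : measurable_fun setT f by exact: measurable_fsum.
have bf : forall x, `|f x| <= \sum_i `|cc i| by move=> x; exact: fsum_le.
have bm (g' : R -> R) (B : R) : continuous g' -> (forall x, `|g' (f x)| <= B) ->
    bmeas (fun x => g' (f x)).
  move=> cg' gB; split; first exact: (measurableT_comp (continuous_measurable_fun cg') mf).
  by exists B.
have b1 : bmeas (fun x => g (f x)) by apply: (bm g M) => // x.
have b2 : bmeas (fun x => psi' (f x)) by apply: (bm psi' K) => // x.
have b3 : bmeas f by split => //; eexists; exact: bf.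
have b4 : bmeas (fun x => psi (f x)).
  apply: (bm psi (`|psi 0| + K * \sum_i `|cc i|)); first exact: continuous_of_is_derive dpsi.
  move=> x; have := derive_bounded_lipschitz dpsi psiM (f x) 0; rewrite subr0 => h'.
  rewrite -[psi _](subrK (psi 0)) addrC (le_trans (ler_normD _ _))// lerD//.
  by rewrite (le_trans h')// ler_wpM2l// (le_trans _ (psiM 0)).
have b5 := bmeasM b3 b4.
have e1 : \int[Q]_x g (f x) - m = sd ^+ 2 * \int[Q]_x psi' (f x) - \int[Q]_x (f x * psi (f x)).
  rewrite -(RintegralZl _ measurableT (bmeas_int Q b2)).
  rewrite -(RintegralB measurableT (RintegrableZ _ (bmeas_int Q b2)) (bmeas_int Q b5)).
  rewrite -[m in LHS](Rintegral_cst1 Q m).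
  rewrite -(RintegralB measurableT (bmeas_int Q b1) (Rintegrable_cst Q m)).
  by apply: eq_Rintegral => x _; rewrite eqn.
have P1 : `|\int[Q]_x psi' (f x)| <= K.
  rewrite -(Rintegral_cst1 Q K); apply: Rintegral_le_norm => //.
    exact: bmeas_int.
  exact: Rintegrable_cst.
rewrite e1; set p := \int[Q]_x psi' (f x) in h P1 *; set v := \int[Q]_x (f x ^+ 2) in h *.
set q := \int[Q]_x (f x * psi (f x)) in h *.
have -> : sd ^+ 2 * p - q = - (p * (v - sd ^+ 2)) - (q - p * v) by ring.
apply: (le_trans (ler_normB _ _)); rewrite normrN; apply: lerD => //.
by rewrite normrM ler_wpM2r.
Qed.

End stein.

Section gsums.
Variables (I : finType) (z : I -> R[i]) (hh : I -> R).

Definition gsum n (w : seqR R) : R := \sum_i hh i * gapprox n (ysq (z i) w).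

(** Merging points and exponents into one index presents [gsum] as an [fsum], with each point
    repeated once per exponent. *)
Definition gcc n (l : I * 'I_(Jgrid n)) : R := hh l.1 * (- 2^-1 * l.2.+1%:R^-1).

Lemma gsumE n w : gsum n w = fsum (fun l : I * 'I_(Jgrid n) => z l.1) (@gcc n) (fun l => sgrid n l.2) w.
Proof.
rewrite /fsum -(pair_bigA _ (fun i (j : 'I_(Jgrid n)) => hh i * (- 2^-1 * j.+1%:R^-1) *
  (expR (- (sgrid n j * ysq (z i) w)) - (1 + sgrid n j)^-1)))/=.
apply: eq_bigr => i _; rewrite /gapprox mulr_sumr mulr_sumr; apply: eq_bigr => j _.
ring.
Qed.

Lemma bmeas_gsum n : bmeas (gsum n).
Proof.
rewrite (funext (gsumE n)); split; first exact: measurable_fsum.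
by eexists => w; apply: fsum_le => l; exact: sgrid_gt0.
Qed.

Lemma gsumM n n' : \int[Q]_w (gsum n w * gsum n' w) =
  \sum_i \sum_j hh i * hh j * logcov n n' (expR (- nsq (z i - z j))).
Proof.
transitivity (\int[Q]_w (fsum (fun l : I * 'I_(Jgrid n) => z l.1) (@gcc n) (fun l => sgrid n l.2) w *
  fsum (fun l : I * 'I_(Jgrid n') => z l.1) (@gcc n') (fun l => sgrid n' l.2) w)).
  by apply: eq_Rintegral => w _; rewrite !gsumE.
rewrite (fsumM HQ Hab Hce Hac); [|by move=> l; exact: sgrid_gt0|by move=> l; exact: sgrid_gt0].
rewrite -(pair_bigA _ (fun i (k : 'I_(Jgrid n)) => \sum_(l : I * 'I_(Jgrid n'))
  (@gcc n) (i, k) * (@gcc n') l * expcov (sgrid n k) (sgrid n' l.2) (expR (- nsq (z i - z l.1)))))/=.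
apply: eq_bigr => i _.
under eq_bigr => k _ do rewrite -(pair_bigA _ (fun j (l : 'I_(Jgrid n')) =>
  (@gcc n) (i, k) * (@gcc n') (j, l) * expcov (sgrid n k) (sgrid n' l) (expR (- nsq (z i - z j)))))/=.
rewrite exchange_big/=; apply: eq_bigr => j _; rewrite /logcov mulrA mulr_sumr.
apply: eq_bigr => k _; rewrite mulr_sumr; apply: eq_bigr => l _; rewrite /gcc/=.
set E := expcov _ _ _; set u := k.+1%:R^-1; set v := l.+1%:R^-1; by field.
Qed.

Lemma gsum_dist n n' : \int[Q]_w ((gsum n w - gsum n' w) ^+ 2) =
  \sum_i \sum_j hh i * hh j * logdist n n' (expR (- nsq (z i - z j))).
Proof.
have i1 := bmeas_int Q (bmeasM (bmeas_gsum n) (bmeas_gsum n)).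
have i2 := bmeas_int Q (bmeasM (bmeas_gsum n) (bmeas_gsum n')).
have i3 := bmeas_int Q (bmeasM (bmeas_gsum n') (bmeas_gsum n')).
transitivity (\int[Q]_w ((gsum n w * gsum n w - 2 * (gsum n w * gsum n' w)) + gsum n' w * gsum n' w)).
  by apply: eq_Rintegral => w _; ring.
rewrite (RintegralD measurableT (RintegrableB i1 (RintegrableZ 2 i2)) i3).
rewrite (RintegralB measurableT i1 (RintegrableZ 2 i2)) (RintegralZl 2 measurableT i2).
rewrite !gsumM mulr_sumr -sumrB -big_split/=; apply: eq_bigr => i _.
rewrite mulr_sumr -sumrB -big_split/=; apply: eq_bigr => j _.
by rewrite /logdist; ring.
Qed.

Lemma gsum_dist_le n n' (ep : R) :
  (forall K, \sum_(k < K) 4^-1 * (logcoef n k.+1 - logcoef n' k.+1) ^+ 2 <= ep) ->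
  \int[Q]_w ((gsum n w - gsum n' w) ^+ 2) <=
  ep * \sum_i \sum_j `|hh i| * `|hh j| * expR (- nsq (z i - z j)).
Proof.
move=> hep; rewrite gsum_dist mulr_sumr; apply: ler_sum => i _; rewrite mulr_sumr.
apply: ler_sum => j _; apply: (le_trans (ler_norm _)); rewrite !normrM [leRHS]mulrCA.
rewrite ler_wpM2l ?mulr_ge0//; apply: logdist_le => //.
by rewrite expR_ge0/= -[leRHS]expR0 ler_expR oppr_le0 nsq_ge0.
Qed.

End gsums.

Lemma L1_le_L2 (f : seqR R -> R) : bmeas f ->
  \int[Q]_w `|f w| <= Num.sqrt (\int[Q]_w (f w ^+ 2)).
Proof.
move=> bf; have [mf [B fB]] := bf.
have mf' : measurable_fun setT (fun w => `|f w|) by exact: measurableT_comp.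
have i2 : Rintegrable Q (fun w => `|f w| ^+ 2).
  apply: (eq_Rintegrable (f := fun w => f w * f w)); last by apply: bmeas_int; exact: bmeasM.
  by move=> w; rewrite real_normK ?num_real.
rewrite -[leLHS]ger0_norm; last by apply: Rintegral_ge0.
rewrite -sqrtr_sqr; apply: ler_wsqrtr; apply: (le_trans (Rintegral_sqr_le mf' i2)).
rewrite le_eqVlt; apply/orP; left; apply/eqP; apply: eq_Rintegral => w _.
by rewrite real_normK ?num_real.
Qed.

Lemma gapproxE n z w : gapprox n (ysq z w) = gsum (fun _ : 'I_1 => z) (fun=> 1) n w.
Proof. by rewrite /gsum big_ord1 mul1r. Qed.

Lemma bmeas_gapprox n z : bmeas (fun w => gapprox n (ysq z w)).
Proof. by rewrite (funext (gapproxE n z)); exact: bmeas_gsum. Qed.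

Lemma gapprox_dist n n' z (ep : R) :
  (forall K, \sum_(k < K) 4^-1 * (logcoef n k.+1 - logcoef n' k.+1) ^+ 2 <= ep) ->
  \int[Q]_w `|gapprox n (ysq z w) - gapprox n' (ysq z w)| <= Num.sqrt ep.
Proof.
move=> hep; have bb : bmeas (fun w => gapprox n (ysq z w) - gapprox n' (ysq z w)).
  have [m1 [B1 h1]] := bmeas_gapprox n z; have [m' [B2 h2]] := bmeas_gapprox n' z.
  split; first exact: measurable_funB.
  by exists (B1 + B2) => w; rewrite (le_trans (ler_normB _ _))// lerD.
apply: (le_trans (L1_le_L2 bb)); apply: ler_wsqrtr.
have h := gsum_dist_le (fun _ : 'I_1 => z) (fun=> 1) hep.
rewrite !big_ord1 normr1 !mul1r subrr /nsq/= expr0n addr0 oppr0 expR0 mulr1 in h.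
apply: le_trans h; rewrite le_eqVlt; apply/orP; left; apply/eqP; apply: eq_Rintegral => w _.
by rewrite !gapproxE.
Qed.

(** A Lipschitz constant of [logcov n n] at q = 1: both denominators in [expcov] are at least 1, so
    their reciprocals differ by at most s t (1 - q). *)
Definition meshL n : R := 4^-1 * \sum_(i < Jgrid n) \sum_(j < Jgrid n)
  i.+1%:R^-1 * j.+1%:R^-1 * (sgrid n i * sgrid n j).

Lemma logcov_lip n (q : R) : 0 <= q <= 1 -> logcov n n 1 - logcov n n q <= meshL n * (1 - q).
Proof.
move=> /andP[q0 q1]; rewrite /logcov /meshL -mulrBr -mulrA ler_wpM2l// -sumrB mulr_suml.
apply: ler_sum => i _; rewrite -sumrB mulr_suml; apply: ler_sum => j _.
rewrite -mulrBr -[leRHS]mulrA ler_wpM2l ?mulr_ge0 ?invr_ge0//.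
have s0 := sgrid_gt0 (R := R) n i; have t0 := sgrid_gt0 (R := R) n j.
set s := sgrid n i in s0 *; set t := sgrid n j in t0 *.
rewrite /expcov opprB addrA subrK mulr1.
have st0 : 0 < s * t by exact: mulr_gt0.
have stq : s * t * q <= s * t by rewrite ler_piMr// ltW.
have A1 : 1 <= (1 + s) * (1 + t) - s * t by rewrite mulrDl mulrDr; lra.
have A2 : 1 <= (1 + s) * (1 + t) - s * t * q by lra.
set A := (1 + s) * (1 + t) in A1 A2 *.
have p1 : 0 < A - s * t by exact: lt_le_trans A1.
have p2 : 0 < A - s * t * q by exact: lt_le_trans A2.
have -> : (A - s * t)^-1 - (A - s * t * q)^-1 = s * t * (1 - q) / ((A - s * t) * (A - s * t * q)).
  by field; rewrite !gt_eqF.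
have D1 : 1 <= (A - s * t) * (A - s * t * q) by rewrite -[leLHS]mulr1 ler_pM.
have N0 : 0 <= s * t * (1 - q) by apply: mulr_ge0; [exact: ltW|rewrite subr_ge0].
by rewrite ler_pdivrMr ?mulr_gt0// ler_peMr.
Qed.

(** The difference is a [gsum] over two points with weights 1 and -1. Its second moment is twice
    [logcov n n 1 - logcov n n q], and 1 - q <= |z - w|^2. *)
Lemma gapprox_mesh n z w :
  \int[Q]_x `|gapprox n (ysq z x) - gapprox n (ysq w x)| <= Num.sqrt (2 * meshL n * nsq (z - w)).
Proof.
pose zz (i : bool) := if i then z else w. pose hh (i : bool) : R := if i then 1 else -1.
have eg x : gapprox n (ysq z x) - gapprox n (ysq w x) = gsum zz hh n x.
  by rewrite /gsum big_bool/= mul1r mulN1r.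
have mesh0 : 0 <= meshL n.
  apply: mulr_ge0 => //; apply: sumr_ge0 => i _; apply: sumr_ge0 => j _.
  by rewrite !mulr_ge0 ?invr_ge0// ltW// sgrid_gt0.
apply: (@le_trans _ _ (\int[Q]_x `|gsum zz hh n x|)).
  by rewrite le_eqVlt; apply/orP; left; apply/eqP; apply: eq_Rintegral => x _; rewrite eg.
apply: (le_trans (L1_le_L2 (bmeas_gsum zz hh n))); apply: ler_wsqrtr.
apply: (@le_trans _ _ (\int[Q]_x (gsum zz hh n x * gsum zz hh n x))).
  by rewrite le_eqVlt; apply/orP; left; apply/eqP; apply: eq_Rintegral => x _; rewrite expr2.
rewrite gsumM !big_bool/= !subrr /nsq/= expr0n addr0 oppr0 expR0.
rewrite -!/(nsq _) -[w - z]opprB; have -> : nsq (- (z - w)) = nsq (z - w).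
  by rewrite /nsq !raddfN !sqrrN.
set q := expR _.
have q01 : 0 <= q <= 1 by rewrite expR_ge0/= -[leRHS]expR0 ler_expR oppr_le0 nsq_ge0.
have h := logcov_lip n q01.
have q1 : 1 - q <= nsq (z - w) by have := expR_ge1Dx (- nsq (z - w)); rewrite -/q; lra.
have := ler_wpM2l mesh0 q1; move: h; set u := logcov _ _ _; set v := logcov _ _ _.
by rewrite !mulr1 !mulrN1 !mulN1r opprK; lra.
Qed.

Definition gbound n : R := \sum_(j < Jgrid n) 2^-1 * j.+1%:R^-1.

Lemma gapprox_le n z w : `|gapprox n (ysq z w)| <= gbound n.
Proof.
have -> : gbound n = 2^-1 * \sum_(j < Jgrid n) j.+1%:R^-1 by rewrite /gbound mulr_sumr.
rewrite /gapprox normrM normrN (ger0_norm (_ : 0 <= 2^-1))// ler_wpM2l//.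
apply: (le_trans (ler_norm_sum _ _ _)); apply: ler_sum => j _.
rewrite normrM (ger0_norm (_ : 0 <= j.+1%:R^-1))// ler_piMr//.
have s0 := sgrid_gt0 (R := R) n j; have /andP[h1 h2] := expysq01 a b c e z w (ltW s0).
have : 0 <= (1 + sgrid n j)^-1 :> R by rewrite invr_ge0 addr_ge0// ltW.
have : (1 + sgrid n j)^-1 <= 1 :> R by rewrite invf_le1 ?addr_gt0// lerDl ltW.
by rewrite ler_norml; lra.
Qed.

(** Real-valued version of [GEF_potential], equal to it wherever the function does not vanish. *)
Definition Xpot z (w : seqR R) : R := 2^-1 * (ln (ysq z w) + euler_gamma R).

Lemma measurable_Xpot z : measurable_fun setT (Xpot z).
Proof.
apply: measurable_funM => //; apply: measurable_funD => //.
by apply: measurableT_comp => //; exact: measurable_ysq.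
Qed.

(** Fatou's lemma along the levels [n + k], whose L^1 distance to level [n] is at most sqrt ep. The
    integral is kept extended-valued because integrability of [Xpot] is a consequence. *)
Lemma Xpot_dist n z (ep : R) :
  (forall n', (n <= n')%N -> forall K, \sum_(k < K) 4^-1 * (logcoef n k.+1 - logcoef n' k.+1) ^+ 2 <= ep) ->
  (\int[Q]_w (`|Xpot z w - gapprox n (ysq z w)|)%:E <= (Num.sqrt ep)%:E)%E.
Proof.
move=> hep.
pose F k w := (`|gapprox (n + k) (ysq z w) - gapprox n (ysq z w)|)%:E.
have mg m : measurable_fun setT (fun w => gapprox m (ysq z w)) := (bmeas_gapprox m z).1.
have mF k : measurable_fun setT (F k).
  by apply/measurable_EFinP; apply: measurableT_comp => //; exact: measurable_funB.
have mX : measurable_fun setT (fun w => (`|Xpot z w - gapprox n (ysq z w)|)%:E).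
  apply/measurable_EFinP; apply: measurableT_comp => //; apply: measurable_funB => //.
  exact: measurable_Xpot.
have -> : (\int[Q]_w (`|Xpot z w - gapprox n (ysq z w)|)%:E = \int[Q]_w limn_einf (F^~ w))%E.
  apply: ae_eq_integral => //.
    rewrite (_ : (fun w => _) = (fun w => - limn_esup (fun k => - F k w))%E).
      apply: measurableT_comp => //; apply: measurable_fun_limn_esup => k.
      exact: measurableT_comp.
    by apply/funext => w; rewrite -limn_einfN; congr limn_einf; apply/funext => k; rewrite /F/= opprK.
  apply: filterS (ae_ysq_gt0 HQ Hab Hce Hac z) => w y0 _.
  have h : F k w @[k --> \oo] --> (`|Xpot z w - gapprox n (ysq z w)|)%:E.
    apply: cvg_EFin; first exact: nearW.
    rewrite (_ : fine \o _ = fun k => `|gapprox (n + k) (ysq z w) - gapprox n (ysq z w)|)//.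
    apply: cvg_norm; apply: cvgB; last exact: cvg_cst.
    have := gapprox_cvg y0; rewrite -(cvg_shiftn n).
    by under eq_fun do rewrite addnC.
  rewrite is_cvg_limn_einfE; last by apply/cvg_ex; eexists; exact: h.
  by rewrite (cvg_lim _ h).
apply: (le_trans (fatou Q measurableT mF _)); first by move=> k w _; rewrite lee_fin.
rewrite limn_einf_lim; apply: lime_le; first exact: is_cvg_einfs.
apply: nearW => k; apply: (@le_trans _ _ (\int[Q]_w F k w)%E).
  by apply: ereal_inf_lbound; exists k => //=.
have h : (\int[Q]_w F k w)%E = (\int[Q]_w `|gapprox (n + k) (ysq z w) - gapprox n (ysq z w)|)%:E.
  rewrite /Rintegral fineK//; apply: integrable_fin_num => //; apply: Rintegrable_norm.
  by apply: RintegrableB; apply: bmeas_int; exact: bmeas_gapprox.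
rewrite h lee_fin.
have h2 := gapprox_dist z (hep (n + k)%N (leq_addr k n)).
apply: le_trans h2; rewrite le_eqVlt; apply/orP; left; apply/eqP; apply: eq_Rintegral => w _.
by rewrite distrC.
Qed.

End gaussian_approximation.

(** * Riemann sums on the plane *)

Section plane_integrals.
Context {R : realType}.
Local Notation mR := (measurableTypeR R).
Local Notation leb := (@lebesgue_measure R).
Local Notation area2 := (@area2 R).
Implicit Types p q : mR * mR.

Definition dist2 p q : R := (p.1 - q.1) ^+ 2 + (p.2 - q.2) ^+ 2.

Lemma dist2_ge0 p q : 0 <= dist2 p q.
Proof. by rewrite addr_ge0// sqr_ge0. Qed.

Lemma dist2C p q : dist2 p q = dist2 q p.
Proof. by rewrite /dist2 -(opprB q.1) -(opprB q.2) !sqrrN. Qed.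

Lemma measurable_dist2 p : measurable_fun setT (dist2 p).
Proof. by apply: measurable_funD; apply: measurable_funX; apply: measurable_funB. Qed.

Lemma measurable_gauss p (k : R) : measurable_fun setT (fun q => expR (- (k * dist2 p q))).
Proof.
apply: measurableT_comp => //; apply: measurable_funN; apply: measurable_funM => //.
exact: measurable_dist2.
Qed.

(** Up to a constant the integrand is the density of two independent normal variables of variance 1
    / (2k). *)
Lemma ge0_integral_gauss p (k : R) : 0 < k ->
  (\int[area2]_q (expR (- (k * dist2 p q)))%:E = (pi / k)%:E)%E.
Proof.
move=> k0; pose s : R := Num.sqrt (2 * k)^-1.
have k2 : 0 < (2 * k)^-1 by rewrite invr_gt0 mulr_gt0.
have s0 : s != 0 by rewrite gt_eqF// sqrtr_gt0.
have s2 : s ^+ 2 = (2 * k)^-1 by rewrite sqr_sqrtr// ltW.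
pose c := normal_peak s.
have c2 : c ^+ 2 = k / pi.
  rewrite /c /normal_peak exprVn sqr_sqrtr; last first.
    by rewrite mulrn_wge0// mulr_ge0 ?sqr_ge0// pi_ge0.
  rewrite s2 -mulr_natl; move: (@pi R) (pi_gt0 R) => P P0; field.
  by rewrite !gt_eqF.
have c0 : 0 < c by exact: normal_peak_gt0.
have e q : (expR (- (k * dist2 p q)))%:E =
    ((c ^- 2)%:E * ((normal_pdf p.1 s q.1)%:E * (normal_pdf p.2 s q.2)%:E))%E.
  rewrite -!EFinM; congr (_%:E); rewrite !normal_pdfE// /normal_fun -/c.
  transitivity (c ^- 2 * (c ^+ 2 * (expR (- (q.1 - p.1) ^+ 2 / (s ^+ 2 *+ 2)) *
    expR (- (q.2 - p.2) ^+ 2 / (s ^+ 2 *+ 2))))); last by ring.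
  rewrite mulrA mulVf ?mul1r ?expf_neq0 ?gt_eqF// -expRD; congr expR.
  rewrite s2 /dist2 -mulr_natl -(opprB q.1) -(opprB q.2) !sqrrN; field.
  by rewrite gt_eqF.
under eq_integral do rewrite e.
have mp (u : R) : measurable_fun setT (fun x : mR => (normal_pdf u s x)%:E).
  by apply/measurable_EFinP; exact: measurable_normal_pdf.
have mpp : measurable_fun setT (fun q : mR * mR => ((normal_pdf p.1 s q.1)%:E * (normal_pdf p.2 s q.2)%:E)%E).
  apply: emeasurable_funM; first exact: (measurableT_comp (mp _) measurable_fst).
  exact: (measurableT_comp (mp _) measurable_snd).
have pp0 q : (0 <= (normal_pdf p.1 s q.1)%:E * (normal_pdf p.2 s q.2)%:E)%E.
  by rewrite mule_ge0// lee_fin normal_pdf_ge0.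
rewrite ge0_integralZl//; last by rewrite lee_fin invr_ge0 exprn_ge0// ltW.
rewrite (@fubini_tonelli1 _ _ _ _ _ leb leb _ mpp pp0) /fubini_F/=.
have -> : (\int[leb]_x \int[leb]_y ((normal_pdf p.1 s x)%:E * (normal_pdf p.2 s y)%:E) = 1)%E.
  rewrite -[RHS](integral_normal_pdf p.1 s); apply: eq_integral => x _.
  rewrite ge0_integralZl//.
  - by rewrite integral_normal_pdf mule1.
  - by move=> y _; rewrite lee_fin normal_pdf_ge0.
  - by rewrite lee_fin normal_pdf_ge0.
by rewrite mule1 c2 invf_div.
Qed.

Lemma Rintegrable_gauss p (k : R) : 0 < k -> Rintegrable area2 (fun q => expR (- (k * dist2 p q))).
Proof.
move=> k0; apply/integrableP; split; first by apply/measurable_EFinP; exact: measurable_gauss.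
under eq_integral do rewrite gee0_abs ?lee_fin ?expR_ge0//.
by rewrite ge0_integral_gauss// ltry.
Qed.

Lemma Rintegral_gauss p (k : R) : 0 < k ->
  \int[area2]_q expR (- (k * dist2 p q)) = pi / k.
Proof. by move=> k0; rewrite /Rintegral ge0_integral_gauss. Qed.

Section grid.
Variables (B m : nat).

Definition gnode (i : nat) : R := i%:R / m.+1%:R - B%:R.

Definition gidx := 'I_(2 * B * m.+1).

Definition gnode2 (l : gidx * gidx) : mR * mR := (gnode l.1, gnode l.2).

(** Half-open, so that the cells are disjoint and tile [box] exactly. *)
Definition cell1 (i : nat) : set mR := `[gnode i, gnode i.+1[%classic.

Definition cell (l : gidx * gidx) : set (mR * mR) := cell1 l.1 `*` cell1 l.2.

Definition box : set (mR * mR) := [set q | (- B%:R <= q.1 < B%:R) && (- B%:R <= q.2 < B%:R)].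

Lemma cell1E (i : nat) (x : R) : cell1 i x <-> i%:R <= (x + B%:R) * m.+1%:R < i.+1%:R.
Proof.
rewrite /cell1 /= in_itv/= /gnode !lerBlDr !ltrBrDr ler_pdivrMr// ltr_pdivlMr//.
Qed.

Lemma measurable_cell1 i : measurable (cell1 i).
Proof. by rewrite /cell1; exact: measurable_itv. Qed.

Lemma measurable_cell l : measurable (cell l).
Proof. by apply: measurableX; exact: measurable_cell1. Qed.

Lemma area2_cell l : area2 (cell l) = (m.+1%:R ^- 2)%:E.
Proof.
rewrite /cell area2X; [|exact: measurable_cell1|exact: measurable_cell1].
have h (i : nat) : gnode i.+1 - gnode i = m.+1%:R^-1.
  by rewrite /gnode -[in LHS]natr1; field; rewrite addrC natr1 pnatr_eq0.
have h' (i : nat) : gnode i < gnode i.+1 by rewrite -subr_gt0 h invr_gt0.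
have hl (i : nat) : leb (cell1 i) = (m.+1%:R^-1)%:E.
  by rewrite /cell1 lebesgue_measure_itv/= lte_fin h' -EFinD h.
by rewrite !hl -EFinM expr2 invfM.
Qed.

Lemma cell_uniq l l' q : cell l q -> cell l' q -> l = l'.
Proof.
have u (i j : gidx) (x : R) : cell1 i x -> cell1 j x -> i = j.
  move=> /cell1E/andP[h1 h2] /cell1E/andP[h3 h4]; apply/val_inj/eqP; rewrite eqn_leq.
  have := le_lt_trans h1 h4; rewrite ltr_nat ltnS => ij.
  by have := le_lt_trans h3 h2; rewrite ltr_nat ltnS => ji; apply/andP.
by move=> [a1 a2] [b1 b2]; rewrite [l]surjective_pairing [l']surjective_pairing
  (u _ _ _ a1 b1) (u _ _ _ a2 b2).
Qed.

Lemma box_cell q : box q -> exists l, cell l q.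
Proof.
have ex (x : R) : - B%:R <= x < B%:R -> exists i : gidx, cell1 i x.
  move=> /andP[x1 x2]; have u0 : 0 <= (x + B%:R) * m.+1%:R by rewrite mulr_ge0// -lerBlDr sub0r.
  have tl := Num.Theory.truncn_itv u0; set n := Num.truncn _ in tl.
  have nK : (n < 2 * B * m.+1)%N.
    have /andP[t1 _] := tl; rewrite -(ltr_nat R) (le_lt_trans t1)// natrM ltr_pM2r//.
    by rewrite natrM mulr_natl mulr2n ltrD2r.
  by exists (Ordinal nK); apply/cell1E.
by move=> /andP[/ex[i hi] /ex[j hj]]; exists (i, j).
Qed.

Lemma cell_dist l q : cell l q -> dist2 q (gnode2 l) <= 2 / m.+1%:R ^+ 2.
Proof.
have d (i : nat) (x : R) : cell1 i x -> (x - gnode i) ^+ 2 <= (m.+1%:R^-1) ^+ 2.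
  rewrite /cell1/= in_itv/= => /andP[h1 h2].
  have h : gnode i.+1 - gnode i = m.+1%:R^-1.
    by rewrite /gnode -[in LHS]natr1; field; rewrite addrC natr1 pnatr_eq0.
  by rewrite lerXn2r ?nnegrE ?subr_ge0// ?invr_ge0// -h lerB// ltW.
move=> [/= h1 h2]; apply: (le_trans (lerD (d _ _ h1) (d _ _ h2))).
by rewrite exprVn mulr_natl mulr2n.
Qed.

Definition step (G : gidx * gidx -> R) (q : mR * mR) : R := \sum_l G l * \1_(cell l) q.

Lemma step_in G l q : cell l q -> step G q = G l.
Proof.
move=> lq; rewrite /step (bigD1 l)//= indicE mem_set// mulr1 big1 ?addr0// => l' l'l.
rewrite indicE; case: (boolP (q \in cell l')) => [|_]; last by rewrite mulr0.
by rewrite inE => l'q; rewrite (cell_uniq l'q lq) eqxx in l'l.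
Qed.

Lemma step_out G q : ~ (exists l, cell l q) -> step G q = 0.
Proof.
move=> nq; rewrite /step big1// => l _; rewrite indicE memNset ?mulr0// => lq.
by apply: nq; exists l.
Qed.

Lemma measurable_step G : measurable_fun setT (step G).
Proof.
apply: measurable_sum => l; apply: measurable_funM => //.
by apply: measurable_indic; exact: measurable_cell.
Qed.

Let int_cell l : Rintegrable area2 (\1_(cell l)).
Proof.
apply/integrableP; split.
  by apply/measurable_EFinP; apply: measurable_indic; exact: measurable_cell.
under eq_integral do rewrite gee0_abs ?lee_fin//.
rewrite integral_indic//; last exact: measurable_cell.
by rewrite setIT [ltLHS](area2_cell l) ltry.
Qed.

Lemma Rintegrable_step G : Rintegrable area2 (step G).
Proof. by apply: Rintegrable_sum => l; apply: RintegrableZ; exact: int_cell. Qed.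

Lemma Rintegral_step G : \int[area2]_q step G q = m.+1%:R ^- 2 * \sum_l G l.
Proof.
rewrite Rintegral_sum; last by move=> l; apply: RintegrableZ; exact: int_cell.
rewrite mulr_sumr; apply: eq_bigr => l _.
rewrite (RintegralZl _ measurableT (int_cell l)) mulrC; congr (_ * _).
rewrite /Rintegral integral_indic//; last exact: measurable_cell.
by rewrite setIT [X in fine X](area2_cell l).
Qed.

(** For q in the cell of a node x, |p - q|^2 <= 2 |p - x|^2 + 4, so exp(-|p - x|^2 / 2) is at most e
    exp(-|p - q|^2 / 4). Integration over q gives a bound free of the mesh and of the box. *)
Lemma lattice_bound p : m.+1%:R ^- 2 * \sum_l expR (- (dist2 p (gnode2 l) / 2)) <= expR 1 * (4 * pi).
Proof.
rewrite -(Rintegral_step (fun l => expR (- (dist2 p (gnode2 l) / 2)))).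
have ig := Rintegrable_gauss p (_ : 0 < 4^-1 :> R).
have -> : expR 1 * (4 * pi) = \int[area2]_q (expR 1 * expR (- (4^-1 * dist2 p q))).
  rewrite (RintegralZl _ measurableT (ig _))// Rintegral_gauss// invrK.
  by rewrite (mulrC pi).
apply: le_Rintegral => //; [exact: Rintegrable_step|by apply: RintegrableZ; exact: ig|].
move=> q _; case: (pselect (exists l, cell l q)) => [[l lq]|nq]; last first.
  by rewrite step_out// mulr_ge0 ?expR_ge0.
rewrite (step_in _ lq) -expRD ler_expR.
have h := cell_dist lq.
have h1 : 2 / m.+1%:R ^+ 2 <= 2 :> R.
  by rewrite ler_pdivrMr ?exprn_gt0// ler_peMr// exprn_ege1// ler1n.
have h2 := le_trans h h1; move: h2; rewrite /dist2.
set x := p.1; set y := p.2; set u := q.1; set v := q.2; set xl := (gnode2 l).1; set yl := (gnode2 l).2.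
have := sqr_ge0 ((x - xl) + (u - xl) * 2^-1 * 2); rewrite !expr2 => _.
have k1 := sqr_ge0 ((x - xl) + (u - xl)); have k2 := sqr_ge0 ((y - yl) + (v - yl)).
by move: k1 k2; rewrite !expr2; nra.
Qed.

End grid.

Section box.
Variable B : nat.

Lemma boxE : box B = `[- B%:R, B%:R[%classic `*` `[- B%:R, B%:R[%classic :> set (mR * mR).
Proof. by apply/seteqP; split => -[x y] /=; rewrite /box/= !in_itv/= => /andP. Qed.

Lemma measurable_box : measurable (box B).
Proof. by rewrite boxE; exact: measurableX. Qed.

Lemma area2_box : area2 (box B) = ((2 * B%:R) ^+ 2)%:E.
Proof.
rewrite boxE area2X// lebesgue_measure_itv/= lte_fin.
case: ifPn => [_|]; first by rewrite -EFinD -EFinM; congr EFin; ring.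
by rewrite -subr_gt0 opprK -natrD ltr0n addnn double_gt0 -eqn0Ngt => /eqP ->; rewrite mule0 mulr0 expr0n.
Qed.

Lemma Rintegrable_box (k : R) : Rintegrable area2 (fun q => k * \1_(box B) q).
Proof.
apply: RintegrableZ; apply/integrableP; split.
  by apply/measurable_EFinP; apply: measurable_indic; exact: measurable_box.
under eq_integral do rewrite gee0_abs ?lee_fin//.
by rewrite integral_indic ?setIT//; [rewrite [ltLHS]area2_box ltry|exact: measurable_box].
Qed.

Lemma Rintegral_box (k : R) : \int[area2]_q (k * \1_(box B) q) = k * (2 * B%:R) ^+ 2.
Proof.
have h : Rintegrable area2 (\1_(box B)).
  by apply: (eq_Rintegrable _ (Rintegrable_box 1)) => q; rewrite mul1r.
rewrite (RintegralZl k measurableT h); congr (_ * _).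
rewrite /Rintegral integral_indic ?setIT//; last exact: measurable_box.
by rewrite [X in fine X]area2_box.
Qed.

Lemma cell_box m (l : gidx B m * gidx B m) q : cell l q -> box B q.
Proof.
have b1 (i : gidx B m) (x : R) : @cell1 B m i x -> - B%:R <= x < B%:R.
  move=> /cell1E/andP[h1 h2]; rewrite -[X in X <= _]sub0r lerBlDr -(pmulr_lge0 _ (ltr0Sn R m)) mulrC.
  rewrite mulrC (le_trans _ h1)//= -(ltrD2r B%:R) -(ltr_pM2r (ltr0Sn R m)) (lt_le_trans h2)//.
  rewrite -natrD -natrM ler_nat (leq_trans (ltn_ord i))//.
  by rewrite addnn -mul2n.
by move=> [/b1 h1 /b1 h2]; rewrite /box/= h1 h2.
Qed.

Lemma step_cvg (G : mR * mR -> R) q : box B q -> {for q, continuous (fun p : R * R => G p)} ->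
  step (fun l => G (gnode2 (B := B) (m := n) l)) q @[n --> \oo] --> G q.
Proof.
move=> bq cG; apply/cvgrPdist_lt => ep ep0.
have /cvgrPdist_lt/(_ _ ep0)/nbhs_ballP[d /= d0 dG] := cG.
near=> n; have [l lq] := box_cell n bq; rewrite (step_in _ lq); apply: dG.
have h := cell_dist lq.
have nd : 2 / n.+1%:R ^+ 2 < d ^+ 2.
  near: n; have c : (2 : R) / n.+1%:R ^+ 2 @[n --> \oo] --> (0 : R).
    rewrite -[X in _ --> X](_ : 2 * (0 * 0) = 0); last by ring.
    under eq_fun do rewrite -exprVn expr2.
    by apply: cvgMr; apply: cvgM; exact: cvg_harmonic.
  by apply: (cvgr_lt _ c); rewrite exprn_gt0.
have lt2 := le_lt_trans h nd; rewrite /dist2 in lt2.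
have sq (u : R) : u ^+ 2 < d ^+ 2 -> `|u| < d.
  by move=> ud; rewrite -(ltr_pXn2r (n := 2))// ?nnegrE ?(ltW d0)// real_normK// num_real.
split; apply: sq; apply: le_lt_trans lt2.
  by rewrite lerDl sqr_ge0.
by rewrite lerDr sqr_ge0.
Unshelve. all: by end_near. Qed.

Lemma step_le m (G : gidx B m * gidx B m -> R) (C : R) q : 0 <= C -> (forall l, `|G l| <= C) ->
  `|step G q| <= C * \1_(box B) q.
Proof.
move=> C0 GC; case: (pselect (exists l, @cell B m l q)) => [[l lq]|nq]; last first.
  by rewrite step_out// normr0 mulr_ge0// indicE.
by rewrite (step_in _ lq) indicE mem_set ?mulr1//; exact: cell_box lq.
Qed.

Section riemann_sums.
Variables (G : mR * mR -> R) (M : R).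
Hypotheses (mG : measurable_fun setT G) (cG : continuous (fun p : R * R => G p)).
Hypotheses (GM : forall q, `|G q| <= M) (G0 : forall q, ~ box B q -> G q = 0).

Let M0 : 0 <= M := le_trans (normr_ge0 _) (GM (0, 0)).

Lemma le_box q : `|G q| <= M * \1_(box B) q.
Proof.
case: (pselect (box B q)) => [bq|nq]; first by rewrite indicE mem_set// mulr1.
by rewrite G0// normr0 mulr_ge0// indicE.
Qed.

Lemma Rintegrable_supported : Rintegrable area2 G.
Proof. exact: (Rintegrable_le mG le_box (Rintegrable_box M)). Qed.

Lemma out_cell m q : ~ box B q -> ~ (exists l, @cell B m l q).
Proof. by move=> nq [l /cell_box]. Qed.

Variable k : R.
Hypothesis k_ge1 : 1 <= k.

Let k0 : 0 < k := lt_le_trans ltr01 k_ge1.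

Let ker p q := G p * G q * expR (- (k * dist2 p q)).

Let ker_le p q : `|ker p q| <= M * (M * \1_(box B) q).
Proof.
rewrite /ker 2!normrM (ger0_norm (expR_ge0 _)) -[leRHS]mulr1.
apply: ler_pM => //; rewrite ?mulr_ge0//.
  by apply: ler_pM => //; exact: le_box.
by rewrite -[leRHS]expR0 ler_expR oppr_le0 mulr_ge0 ?dist2_ge0// ltW.
Qed.

Let ker0 p q : ~ box B p -> ker p q = 0.
Proof. by move=> np; rewrite /ker G0// !mul0r. Qed.

Let mker p : measurable_fun setT (ker p).
Proof.
by apply: measurable_funM; [exact: measurable_funM|exact: measurable_gauss].
Qed.

Let int_ker_le (p : mR * mR) : `|\int[area2]_q ker p q| <= M * (M * (2 * B%:R) ^+ 2).
Proof.
have i1 : Rintegrable area2 (fun q => M * (M * \1_(box B) q)).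
  by apply: RintegrableZ; exact: Rintegrable_box.
have i2 := Rintegrable_le (mker p) (ker_le p) i1.
apply: (le_trans (Rintegral_le_norm i2 i1 (ker_le p))).
by rewrite (RintegralZl _ measurableT (Rintegrable_box M)) Rintegral_box.
Qed.

(** The sums are integrals of step functions, so dominated convergence applies to the inner and then
    to the outer integral. *)
Lemma double_riemann_sum :
  (m.+1%:R ^- 2 * \sum_(l : gidx B m * gidx B m) (m.+1%:R ^- 2 * \sum_(l' : gidx B m * gidx B m)
     ker (gnode2 l) (gnode2 l'))) @[m --> \oo] -->
  \int[area2]_p \int[area2]_q ker p q.
Proof.
pose D m p q := step (fun l => step (fun l' => ker (gnode2 (B := B) (m := m) l) (gnode2 (B := B) (m := m) l')) q) p.
pose I m p := step (fun l => \int[area2]_q step (fun l' => ker (gnode2 (B := B) (m := m) l) (gnode2 (B := B) (m := m) l')) q) p.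
have DI m p : I m p = \int[area2]_q D m p q.
  case: (pselect (exists l, @cell B m l p)) => [[l lp]|np].
    by rewrite /I (step_in _ lp); apply: eq_Rintegral => q _; rewrite /D (step_in _ lp).
  rewrite /I step_out//; under eq_Rintegral do rewrite /D step_out//.
  by rewrite Rintegral_cst ?mul0r.
rewrite (_ : (fun m => _) = fun m => \int[area2]_p I m p); last first.
  apply/funext => m; rewrite /I Rintegral_step; congr (_ * _); apply: eq_bigr => l _.
  by rewrite Rintegral_step.
have M2 : 0 <= M * (M * 1) by rewrite !mulr_ge0.
have kM p q : `|ker p q| <= M * (M * 1).
  apply: (le_trans (ker_le p q)); rewrite ler_wpM2l// ler_wpM2l// indicE.
have mD m p : measurable_fun setT (D m p).
  case: (pselect (exists l, @cell B m l p)) => [[l lp]|np].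
    have -> : D m p = step (fun l' => ker (gnode2 (B := B) (m := m) l) (gnode2 (B := B) (m := m) l')).
      by apply/funext => q; rewrite /D (step_in _ lp).
    exact: measurable_step.
  by rewrite (_ : D m p = cst 0)//; apply/funext => q; rewrite /D step_out.
have D_le m p q : `|D m p q| <= M * (M * 1) * \1_(box B) q.
  case: (pselect (exists l, @cell B m l p)) => [[l lp]|np].
    by rewrite /D (step_in _ lp); apply: step_le.
  by rewrite /D step_out// normr0 mulr_ge0// indicE.
have cvD p q : D m p q @[m --> \oo] --> ker p q.
  case: (pselect (box B p)) => [bp|np]; last first.
    rewrite (_ : (fun m => _) = (fun=> 0)); first by rewrite ker0//; exact: cvg_cst.
    by apply/funext => m; rewrite /D step_out//; exact: out_cell.
  case: (pselect (box B q)) => [bq|nq]; last first.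
    rewrite (_ : (fun m => _) = (fun=> 0)).
      by rewrite /ker [G q]G0// mulr0 mul0r; exact: cvg_cst.
    apply/funext => m; have [l lp] := box_cell m bp.
    by rewrite /D (step_in _ lp) step_out//; exact: out_cell.
  (* Expresses [D m p q] through step functions of [G] and of the two coordinates, each of which
     converges by [step_cvg]. *)
  pose s (F : mR * mR -> R) p m := step (fun l => F (gnode2 (B := B) (m := m) l)) p.
  have e m : D m p q = s G p m * s G q m * expR (- (k *
      ((s fst p m - s fst q m) ^+ 2 + (s snd p m - s snd q m) ^+ 2))).
    have [l lp] := box_cell m bp; have [l' lq] := box_cell m bq.
    by rewrite /D (step_in _ lp) (step_in _ lq) /s !(step_in _ lp) !(step_in _ lq).
  rewrite (funext e).
  have cfst : continuous (fun y : R * R => y.1) by move=> y; exact: cvg_fst.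
  have csnd : continuous (fun y : R * R => y.2) by move=> y; exact: cvg_snd.
  have cf x : box B x -> s fst x m @[m --> \oo] --> x.1.
    by move=> bx; exact: (@step_cvg (fun y => y.1) x bx (cfst x)).
  have cs x : box B x -> s snd x m @[m --> \oo] --> x.2.
    by move=> bx; exact: (@step_cvg (fun y => y.2) x bx (csnd x)).
  have cd : (s fst p m - s fst q m) ^+ 2 + (s snd p m - s snd q m) ^+ 2 @[m --> \oo] --> dist2 p q.
    have sq (u : nat -> R) (x : R) : u m @[m --> \oo] --> x -> u m ^+ 2 @[m --> \oo] --> x ^+ 2.
      by move=> ux; rewrite expr2 (_ : (fun m => _) = (fun m => u m * u m))//; exact: (cvgM ux ux).
    by apply: (@cvgD _ R^o); apply: sq; [exact: (cvgB (cf _ bp) (cf _ bq))|exact: (cvgB (cs _ bp) (cs _ bq))].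
  apply: cvgM; first by apply: cvgM; apply: step_cvg => //; exact: cG.
  have cd' : - (k * ((s fst p m - s fst q m) ^+ 2 + (s snd p m - s snd q m) ^+ 2)) @[m --> \oo] --> - (k * dist2 p q).
    by apply: (@cvgN _ R^o); exact: (cvgMr cd).
  exact: (cvg_comp _ (@expR R) cd' (@continuous_expR R _)).
have cvI p : I m p @[m --> \oo] --> \int[area2]_q ker p q.
  rewrite (funext (fun m => DI m p)).
  apply: (@Rdominated_cvg _ _ _ _ _ _ (fun q => M * (M * 1) * \1_(box B) q)) => //.
  exact: Rintegrable_box.
pose V : R := M * (M * (2 * B%:R) ^+ 2).
apply: (@Rdominated_cvg _ _ _ _ _ _ (fun q => V * \1_(box B) q)) => //.
- by move=> m; exact: measurable_step.
- exact: (measurable_fun_cvg (fun m => measurable_step _) (fun p _ => cvI p)).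
- move=> m p; apply: step_le => [|l]; first by rewrite !mulr_ge0// sqr_ge0.
  have i1 : Rintegrable area2 (fun q => M * (M * 1) * \1_(box B) q) by exact: Rintegrable_box.
  have i2 : Rintegrable area2 (step (fun l' => ker (gnode2 (B := B) (m := m) l) (gnode2 (B := B) (m := m) l'))).
    exact: Rintegrable_step.
  apply: (le_trans (Rintegral_le_norm i2 i1 _)); first by move=> q; exact: step_le.
  by rewrite Rintegral_box /V; lra.
- exact: Rintegrable_box.
Qed.

Variables (ep C : R).
Hypotheses (ep0 : 0 <= ep) (C0 : 0 <= C).
Hypothesis modG : forall p q, `|G p - G q| <= ep + C * dist2 p q.

(** The kernel has mass pi / k and absorbs the quadratic modulus: for k >= 1, d exp(-k d) <= 2
    exp(-k d / 2), and the latter has integral at most 4 pi. *)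
Lemma gauss_localization p :
  `|\int[area2]_q (G q * expR (- (k * dist2 p q))) - pi / k * G p| <= pi * (ep + 4 * C).
Proof.
have ig := Rintegrable_gauss p k0.
have k2 : 0 < k / 2 by rewrite divr_gt0.
have ig2 := Rintegrable_gauss p k2.
have i1 : Rintegrable area2 (fun q => G q * expR (- (k * dist2 p q))).
  apply: (@Rintegrable_le _ _ _ _ _ (fun q => M * expR (- (k * dist2 p q)))).
  - by apply: measurable_funM => //; exact: measurable_gauss.
  - by move=> q; rewrite normrM (ger0_norm (expR_ge0 _)) ler_wpM2r ?expR_ge0.
  - exact: RintegrableZ.
have -> : pi / k * G p = \int[area2]_q (G p * expR (- (k * dist2 p q))).
  by rewrite (RintegralZl _ measurableT ig) Rintegral_gauss// mulrC.
have i3 := RintegrableZ (G p) ig.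
rewrite -(RintegralB measurableT i1 i3).
have j1 := RintegrableZ ep ig; have j2 := RintegrableZ (2 * C) ig2.
apply: (le_trans (Rintegral_le_norm (RintegrableB i1 i3) (RintegrableD j1 j2) _)).
  move=> q; rewrite -mulrBl normrM (ger0_norm (expR_ge0 _)) distrC.
  apply: (le_trans (ler_wpM2r (expR_ge0 _) (modG p q))).
  rewrite mulrDl lerD2l.
  have e2 : expR (- (k * dist2 p q)) = expR (- (k / 2 * dist2 p q)) * expR (- (k / 2 * dist2 p q)).
    by rewrite -expRD; congr expR; field.
  rewrite e2 mulrA ler_wpM2r ?expR_ge0// (mulrC 2) -!mulrA ler_wpM2l//.
  rewrite expRN ler_pdivrMr ?expR_gt0//.
  have := expR_ge1Dx (k / 2 * dist2 p q); have d0 := dist2_ge0 p q.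
  have : dist2 p q <= k * dist2 p q by rewrite ler_peMl.
  by rewrite mulrAC (mulrA k); move: (dist2 p q) d0 => d d0; rewrite -(mulrA k) (mulrC 2^-1) (mulrA k); lra.
rewrite (RintegralD measurableT j1 j2) (RintegralZl _ measurableT ig) (RintegralZl _ measurableT ig2).
rewrite !Rintegral_gauss// mulrDr.
have P0 := pi_gt0 R.
have h1 : pi / k <= pi :> R by rewrite ler_pdivrMr// ler_peMr// ltW.
have h2 : pi / (k / 2) <= 2 * pi :> R by rewrite ler_pdivrMr//; have := ler_wpM2l (ltW P0) k_ge1; lra.
have := ler_wpM2l ep0 h1; have := ler_wpM2l (_ : 0 <= 2 * C) h2.
by rewrite mulr_ge0// => /(_ isT); lra.
Qed.

Lemma double_integral_localization :
  `|\int[area2]_p \int[area2]_q ker p q - pi / k * \int[area2]_p (G p ^+ 2)| <=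
  M * (2 * B%:R) ^+ 2 * (pi * (ep + 4 * C)).
Proof.
have mI : measurable_fun setT (fun p => \int[area2]_q ker p q).
  apply: measurableT_comp => //; apply: (measurable_integral_param (F := fun x => (ker x.1 x.2)%:E)).
  apply/measurable_EFinP; apply: measurable_funM.
    apply: measurable_funM; first exact: measurableT_comp mG measurable_fst.
    exact: measurableT_comp mG measurable_snd.
  apply: measurableT_comp => //; apply: measurable_funN; apply: measurable_funM => //.
  have m1 (f g : mR * mR -> mR) : measurable_fun setT f -> measurable_fun setT g ->
      measurable_fun setT (fun x : (mR * mR) * (mR * mR) => (f x.1 - g x.2) ^+ 2).
    move=> mf mg; apply: measurable_funX; apply: measurable_funB.
      exact: measurableT_comp mf measurable_fst.
    exact: measurableT_comp mg measurable_snd.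
  by apply: measurable_funD; apply: m1.
have i1 : Rintegrable area2 (fun p => \int[area2]_q ker p q).
  apply: (Rintegrable_le mI _ (Rintegrable_box (M * (M * (2 * B%:R) ^+ 2)))) => p.
  case: (pselect (box B p)) => [bp|np]; first by rewrite [in leRHS]indicE mem_set// mulr1.
  under eq_Rintegral do rewrite ker0//.
  by rewrite Rintegral_cst// mul0r normr0 mulr_ge0 ?indicE// !mulr_ge0// sqr_ge0.
have i2 : Rintegrable area2 (fun p => G p ^+ 2).
  apply: (Rintegrable_le (measurable_funX _ mG) _ (Rintegrable_box (M * M))) => p.
  rewrite expr2 normrM -mulrA; apply: ler_pM => //; exact: le_box.
have i3 := RintegrableZ (pi / k) i2.
rewrite -(RintegralZl _ measurableT i2) -(RintegralB measurableT i1 i3).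
have A0 : 0 <= pi * (ep + 4 * C) by rewrite mulr_ge0 ?pi_ge0// addr_ge0// mulr_ge0.
apply: (le_trans (Rintegral_le_norm (RintegrableB i1 i3) (Rintegrable_box (M * (pi * (ep + 4 * C)))) _)).
  move=> p; have e : \int[area2]_q ker p q = G p * \int[area2]_q (G q * expR (- (k * dist2 p q))).
    rewrite -(@RintegralZl _ _ _ area2 setT _ (G p) measurableT).
      by apply: eq_Rintegral => q _; rewrite /ker mulrA.
    apply: (@Rintegrable_le _ _ _ _ _ (fun q => M * expR (- (k * dist2 p q)))).
    - by apply: measurable_funM => //; exact: measurable_gauss.
    - by move=> q; rewrite normrM (ger0_norm (expR_ge0 _)) ler_wpM2r ?expR_ge0.
    - by apply: RintegrableZ; exact: Rintegrable_gauss.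
  rewrite e (_ : _ - _ = G p * (\int[area2]_q (G q * expR (- (k * dist2 p q))) - pi / k * G p)); last by ring.
  rewrite normrM [leRHS]mulrAC; apply: ler_pM => //; first exact: le_box.
  exact: gauss_localization.
by rewrite Rintegral_box; lra.
Qed.

End riemann_sums.

End box.

End plane_integrals.

(** * Riemann sums of the potential and dilations *)

Section grid_sums.
Context {R : realType}.
Local Notation mR := (measurableTypeR R).
Local Notation leb := (@lebesgue_measure R).
Local Notation area2 := (@area2 R).

Lemma nsq_toC (p q : mR * mR) : nsq ((toC p : R[i]) - toC q) = dist2 p q.
Proof. by []. Qed.

Section weights.
Variables (B : nat) (r : R) (G : mR * mR -> R) (M : R).
Hypothesis r0 : 0 < r.
Hypotheses (mG : measurable_fun setT G) (cG : continuous (fun p : R * R => G p)).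
Hypotheses (GM : forall q, `|G q| <= M) (G0 : forall q, ~ box B q -> G q = 0).

Let M0 : 0 <= M := le_trans (normr_ge0 _) (GM (0, 0)).

Definition wt (m : nat) (l : gidx B m * gidx B m) : R := r^-1 * (m.+1%:R ^- 2 * G (gnode2 l)).

Definition gpt (m : nat) (l : gidx B m * gidx B m) : R[i] := toC (gnode2 l : mR * mR).

Let wt_le m (l : gidx B m * gidx B m) : `|wt l| <= r^-1 * M * m.+1%:R ^- 2.
Proof.
have m0 : 0 <= m.+1%:R ^- 2 :> R by rewrite invr_ge0 exprn_ge0.
have ri0 : 0 <= r^-1 by rewrite invr_ge0 ltW.
rewrite /wt normrM (ger0_norm ri0) -[leRHS]mulrA.
apply: ler_wpM2l => //.
by rewrite normrM ger0_norm// mulrC; apply: ler_wpM2r.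
Qed.

Lemma sum_wt_le m : \sum_l `|@wt m l| <= r^-1 * M * (2 * B%:R) ^+ 2.
Proof.
apply: (le_trans (ler_sum _ (fun l _ => wt_le l))).
rewrite sumr_const card_prod !card_ord -[leLHS]mulr_natr -[leLHS]mulrA.
apply: ler_wpM2l; first by rewrite mulr_ge0// invr_ge0 ltW.
rewrite !natrM le_eqVlt; apply/orP; left; apply/eqP; move: (B%:R) => x; field.
by rewrite addrC natr1 pnatr_eq0.
Qed.

(** Unlike the total mass, a row sum against the kernel does not grow with the box; hence the row
    bound of order 1/r. *)
Lemma row_wt_le m p : \sum_l `|@wt m l| * expR (- (dist2 p (gnode2 l) / 2)) <= r^-1 * M * (expR 1 * (4 * pi)).
Proof.
have rM : 0 <= r^-1 * M by rewrite mulr_ge0// invr_ge0 ltW.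
apply: (@le_trans _ _ (r^-1 * M * (m.+1%:R ^- 2 * \sum_(l : gidx B m * gidx B m) expR (- (dist2 p (gnode2 l) / 2))))).
  rewrite mulrA mulr_sumr; apply: ler_sum => l _; apply: ler_wpM2r; first exact: expR_ge0.
  exact: wt_le.
by apply: ler_wpM2l => //; exact: lattice_bound.
Qed.

Definition pair_bound : R := r^-1 * M * (2 * B%:R) ^+ 2 * (r^-1 * M * (expR 1 * (4 * pi))).

Lemma pair_wt_le m : \sum_l \sum_l' `|@wt m l| * `|@wt m l'| * expR (- dist2 (gnode2 l) (gnode2 l')) <= pair_bound.
Proof.
have rM : 0 <= r^-1 * M by rewrite mulr_ge0// invr_ge0 ltW.
have P0 := pi_gt0 R.
apply: (@le_trans _ _ (\sum_(l : gidx B m * gidx B m) `|wt l| * (r^-1 * M * (expR 1 * (4 * pi))))).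
  apply: ler_sum => l _; apply: (@le_trans _ _ (`|wt l| * \sum_l' `|@wt m l'| * expR (- (dist2 (gnode2 l) (gnode2 l') / 2)))).
    rewrite mulr_sumr; apply: ler_sum => l' _; rewrite mulrA ler_wpM2l ?mulr_ge0// ler_expR lerN2.
    by rewrite ler_pdivrMr// ler_peMr ?dist2_ge0// ler1n.
  by rewrite ler_wpM2l//; exact: row_wt_le.
rewrite -mulr_suml /pair_bound ler_wpM2r//; last exact: sum_wt_le.
by rewrite mulr_ge0// mulr_ge0 ?expR_ge0// mulr_ge0// ltW.
Qed.

Lemma wt_double_cvg (k : R) : 1 <= k ->
  \sum_l \sum_l' @wt m l * @wt m l' * expR (- (k * dist2 (gnode2 l) (gnode2 l'))) @[m --> \oo] -->
  r ^- 2 * \int[area2]_p \int[area2]_q (G p * G q * expR (- (k * dist2 p q))).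
Proof.
move=> k1; have h := double_riemann_sum mG cG GM G0 k1.
have -> : (fun m => \sum_l \sum_l' @wt m l * @wt m l' * expR (- (k * dist2 (gnode2 l) (gnode2 l')))) =
  (fun m => r ^- 2 * (m.+1%:R ^- 2 * \sum_(l : gidx B m * gidx B m) (m.+1%:R ^- 2 * \sum_(l' : gidx B m * gidx B m)
     (G (gnode2 l) * G (gnode2 l') * expR (- (k * dist2 (gnode2 l) (gnode2 l'))))))).
  apply/funext => m; rewrite !mulr_sumr; apply: eq_bigr => l _.
  rewrite !mulr_sumr; apply: eq_bigr => l' _; rewrite /wt -[r ^- 2]exprVn.
  by move: (r^-1) (m.+1%:R ^- 2) (G _) (G _) (expR _) => x1 x2 x3 x4 x5; ring.
exact: cvgMr.
Qed.

End weights.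

Section second_moment.
Variable Q : probability (seqR R) R.
Hypothesis HQ : iid_normal Q.
Variables (a b c e : R).
Hypotheses (Hab : m2 * (a ^+ 2 + b ^+ 2) = 2^-1) (Hce : m2 * (c ^+ 2 + e ^+ 2) = 2^-1)
  (Hac : a * c + b * e = 0).
Variables (B : nat) (r : R) (G : mR * mR -> R) (M : R).
Hypothesis r0 : 0 < r.
Hypotheses (mG : measurable_fun setT G) (cG : continuous (fun p : R * R => G p)).
Hypotheses (GM : forall q, `|G q| <= M) (G0 : forall q, ~ box B q -> G q = 0).

Let M0 : 0 <= M := le_trans (normr_ge0 _) (GM (0, 0)).

Local Notation gs m n w := (gsum a b c e (@gpt B m) (@wt B r G m) n w).

(** Truncating the expansion in powers of exp(-|z - w|^2) costs 2/(K+1) times the pair bound. The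
    second error 1/(K+1) is a tolerance for the convergence of the K Riemann sums. *)
Lemma gsum_second_moment n (K : nat) : \forall m \near \oo,
  `|\int[Q]_w (gs m n w ^+ 2) - \sum_(k < K) 4^-1 * logcoef n k.+1 ^+ 2 *
     (r ^- 2 * \int[area2]_p \int[area2]_q (G p * G q * expR (- (k.+1%:R * dist2 p q))))| <=
  2 / K.+1%:R * pair_bound B r M + K.+1%:R^-1.
Proof.
pose S (m k : nat) := \sum_l \sum_l' @wt B r G m l * @wt B r G m l' * expR (- (k.+1%:R * dist2 (gnode2 l) (gnode2 l'))).
pose L (m : nat) : R := \sum_(k < K) 4^-1 * logcoef n k.+1 ^+ 2 * S m k.
have cL : L m @[m --> \oo] --> \sum_(k < K) 4^-1 * logcoef n k.+1 ^+ 2 *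
     (r ^- 2 * \int[area2]_p \int[area2]_q (G p * G q * expR (- (k.+1%:R * dist2 p q)))).
  apply: cvg_big => [|k _]; first by apply: add_continuous.
  by apply: cvgMr; apply: (wt_double_cvg (B := B) (M := M)) => //; rewrite ler1n.
have d0 : 0 < K.+1%:R^-1 :> R by rewrite invr_gt0.
near=> m.
have h1 : `|\sum_(k < K) 4^-1 * logcoef n k.+1 ^+ 2 *
     (r ^- 2 * \int[area2]_p \int[area2]_q (G p * G q * expR (- (k.+1%:R * dist2 p q)))) - L m| < K.+1%:R^-1.
  by near: m; move/cvgrPdist_lt : cL; apply.
rewrite distrC in h1.
suff h2 : `|\int[Q]_w (gs m n w ^+ 2) - L m| <= 2 / K.+1%:R * pair_bound B r M.
  rewrite (_ : _ - _ = (\int[Q]_w (gs m n w ^+ 2) - L m) + (L m - \sum_(k < K) 4^-1 * logcoef n k.+1 ^+ 2 *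
     (r ^- 2 * \int[area2]_p \int[area2]_q (G p * G q * expR (- (k.+1%:R * dist2 p q)))))); last by ring.
  by apply: (le_trans (ler_normD _ _)); exact: lerD h2 (ltW h1).
have -> : \int[Q]_w (gs m n w ^+ 2) = \int[Q]_w (gs m n w * gs m n w).
  by apply: eq_Rintegral => w _; rewrite expr2.
rewrite (gsumM HQ Hab Hce Hac).
have -> : L m = \sum_l \sum_l' @wt B r G m l * @wt B r G m l' *
    \sum_(k < K) 4^-1 * (logcoef n k.+1 ^+ 2 * expR (- dist2 (gnode2 l) (gnode2 l')) ^+ k.+1).
  rewrite /L; under eq_bigr => k _ do rewrite /S mulr_sumr.
  rewrite exchange_big/=; apply: eq_bigr => l _.
  under eq_bigr => k _ do rewrite mulr_sumr.
  rewrite exchange_big/=; apply: eq_bigr => l' _; rewrite mulr_sumr; apply: eq_bigr => k _.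
  rewrite -expRM_natl mulrN.
  by move: (wt _ _ _) (wt _ _ _) (logcoef _ _) (expR _) => x1 x2 x3 x4; ring.
rewrite -sumrB; apply: (@le_trans _ _ (2 / K.+1%:R * \sum_l \sum_l' `|@wt B r G m l| * `|@wt B r G m l'| * expR (- dist2 (gnode2 l) (gnode2 l')))).
  apply: (le_trans (ler_norm_sum _ _ _)); rewrite mulr_sumr; apply: ler_sum => l _.
  rewrite -sumrB; apply: (le_trans (ler_norm_sum _ _ _)); rewrite mulr_sumr; apply: ler_sum => l' _.
  rewrite -mulrBr !normrM [leRHS]mulrCA ler_wpM2l ?mulr_ge0//.
  rewrite /gpt nsq_toC; apply: logcov_trunc.
  by rewrite expR_ge0/= -[leRHS]expR0 ler_expR oppr_le0 dist2_ge0.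
apply: ler_wpM2l; first by rewrite divr_ge0.
by apply: pair_wt_le.
Unshelve. all: by end_near. Qed.

Variables (ep C : R).
Hypotheses (ep0 : 0 <= ep) (C0 : 0 <= C).
Hypothesis modG : forall p q, `|G p - G q| <= ep + C * dist2 p q.

(** Tonelli reduces the estimate to a fixed p, which is moved to the node of its cell. The terms are
    the error of the logarithm, the displacement of the potential, and the change of the weight
    [G]. *)
Lemma gsum_L1_dist (Y : seqR R -> R) n m (ep' : R) :
  (forall w, Y w = r^-1 * fine (\int[area2]_p ((G p)%:E * potat a b c e w p))%E) ->
  (forall n', (n <= n')%N -> forall K, \sum_(k < K) 4^-1 * (logcoef n k.+1 - logcoef n' k.+1) ^+ 2 <= ep') ->
  (\int[Q]_w (`|Y w - gs m n w|)%:E <= (r^-1 * ((M * (Num.sqrt ep' + Num.sqrt (2 * meshL n * (2 / m.+1%:R ^+ 2))) +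
     (ep + C * (2 / m.+1%:R ^+ 2)) * gbound n) * (2 * B%:R) ^+ 2))%:E)%E.
Proof.
move=> YE hep.
pose X := Xpot a b c e; pose ga z w := gapprox n (ysq a b c e z w).
pose st (w : seqR R) := step (fun l : gidx B m * gidx B m => G (gnode2 l) * ga (gpt l) w).
pose D (t : seqR R * (mR * mR)) : \bar R := (`|G t.2 * X (toC t.2) t.1 - st t.1 t.2|)%:E.
have mX2 : measurable_fun setT (fun t : seqR R * (mR * mR) => X (toC t.2) t.1).
  apply: measurable_funM => //; apply: measurable_funD => //.
  by apply: measurableT_comp => //; exact: measurable_ysq2.
have mst : measurable_fun setT (fun t : seqR R * (mR * mR) => st t.1 t.2).
  apply: measurable_sum => l; apply: measurable_funM.
    apply: measurable_funM => //.
    exact: measurableT_comp (bmeas_gapprox a b c e n (gpt l)).1 measurable_fst.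
  by apply: (measurableT_comp _ measurable_snd); apply: measurable_indic; exact: measurable_cell.
have mGX : measurable_fun setT (fun t : seqR R * (mR * mR) => G t.2 * X (toC t.2) t.1).
  by apply: measurable_funM => //; exact: measurableT_comp mG measurable_snd.
have mD : measurable_fun setT D.
  by apply/measurable_EFinP; apply: measurableT_comp => //; exact: measurable_funB.
have D0 t : (0 <= D t)%E by rewrite lee_fin.
(* [ae_ysq_gt0] holds for each point almost surely; Tonelli applied to the indicator of the zero set
   exchanges the two quantifiers. *)
have aepot : {ae Q, forall w, {ae area2, forall p, potat a b c e w p = (X (toC p) w)%:E}}.
  pose Z (t : seqR R * (mR * mR)) : \bar R := (if ysq a b c e (toC t.2) t.1 == 0 then 1 else 0)%:E.
  have mZ : measurable_fun setT Z.
    apply/measurable_EFinP; apply: measurable_fun_ifT => //.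
    exact: (measurable_fun_eqr (measurable_ysq2 a b c e) (measurable_cst _)).
  have Z0 t : (0 <= Z t)%E by rewrite lee_fin; case: ifP.
  have iZ : (\int[Q]_w \int[area2]_p Z (w, p) = 0)%E.
    rewrite (@fubini_tonelli _ _ _ _ _ Q area2 Z mZ Z0).
    rewrite integral0_eq// => p _; rewrite (ae_eq_integral (cst 0%E)) ?integral0//.
      exact: (measurableT_comp mZ (measurable_pair2 p)).
    apply: filterS (ae_ysq_gt0 HQ Hab Hce Hac (toC p)) => w y0 _.
    by rewrite /Z/= gt_eqF.
  have mZi := @measurable_fun_fubini_tonelli_F _ _ _ _ _ area2 Z mZ Z0.
  have := (ae_eq_integral_abs Q measurableT mZi).1; rewrite /fubini_F.
  under eq_integral do rewrite gee0_abs ?integral_ge0//.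
  move=> /(_ iZ); apply: filterS => w /(_ I) /= iw.
  have mZw := measurableT_comp mZ (measurable_pair1 w).
  have := (ae_eq_integral_abs area2 measurableT mZw).1.
  rewrite (_ : (\int[area2]_x `|(Z \o pair w) x|)%E = \int[area2]_p Z (w, p))%E; last first.
    by apply: eq_integral => p _; rewrite gee0_abs//; exact: Z0.
  move=> /(_ iw); apply: filterS => p /(_ I); rewrite /Z/=.
  case: ifP => [_ /eqP|/negbT y0 _]; first by rewrite eqe oner_eq0.
  have y1 : 0 < ysq a b c e (toC p) w by rewrite lt_neqAle eq_sym y0 ysq_ge0.
  set F := normc (GEF (gcoef a b c e w) (toC p)).
  have F0 : 0 <= F by rewrite /F; case: (GEF _ _) => u v; exact: sqrtr_ge0.
  have F1 : 0 < F.
    rewrite lt_neqAle F0 andbT eq_sym; apply/eqP => FE; move: y1.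
    by rewrite /ysq -/F FE expr0n mul0r ltxx.
  rewrite /potat /GEF_potential -/F lne_EFin// -EFinB -EFinD; congr EFin.
  rewrite /X /Xpot /ysq -/F lnM ?posrE ?exprn_gt0 ?expR_gt0// lnXn// expRK.
  rewrite normc_toC sqr_sqrtr ?addr_ge0 ?sqr_ge0// /nsq/= -mulr_natr; lra.
have isr : 0 <= r^-1 by rewrite invr_ge0 ltW.
have key : {ae Q, forall w, ((`|Y w - gs m n w|)%:E <= r^-1%:E * \int[area2]_p D (w, p))%E}.
  apply: filterS aepot => w aew.
  (* An infinite right-hand side is trivial. A finite one makes [G] times the potential integrable,
     so that [fine] returns its true integral. *)
  have [fin|] := boolP (\int[area2]_p D (w, p) < +oo)%E; last first.
    rewrite -leNgt leye_eq => /eqP ->; rewrite mulry gtr0_sg ?invr_gt0// mul1e; exact: leey.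
  have mGw : measurable_fun setT (fun p => G p * X (toC p) w) := measurableT_comp mGX (measurable_pair1 w).
  have ist : Rintegrable area2 (st w) by exact: Rintegrable_step.
  have id : Rintegrable area2 (fun p => G p * X (toC p) w - st w p).
    apply/integrableP; split.
      by apply/measurable_EFinP; apply: measurable_funB => //; exact: Rintegrable_measurable ist.
    by under eq_integral do rewrite abse_EFin.
  have iG : Rintegrable area2 (fun p => G p * X (toC p) w).
    by apply: (eq_Rintegrable _ (RintegrableD id ist)) => p; rewrite subrK.
  have -> : Y w - gs m n w = r^-1 * \int[area2]_p (G p * X (toC p) w - st w p).
    rewrite YE (RintegralB measurableT iG ist) mulrBr; congr (_ - _).
      congr (_ * fine _); apply: ae_eq_integral => //.
      - apply: emeasurable_funM; first exact/measurable_EFinP.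
        exact: measurableT_comp (measurable_potat a b c e) (measurable_pair1 w).
      - exact/measurable_EFinP.
      - by apply: filterS aew => p -> _; rewrite EFinM.
    rewrite /st Rintegral_step mulrA mulr_sumr /gsum; apply: eq_bigr => l _.
    by rewrite /wt /ga !mulrA.
  rewrite normrM (ger0_norm isr) EFinM lee_pmul2l ?lte_fin ?invr_gt0//.
  apply: (@le_trans _ _ (\int[area2]_p `|G p * X (toC p) w - st w p|)%:E).
    by rewrite lee_fin; apply: le_normr_Rintegral.
  rewrite /Rintegral fineK//; apply: integrable_fin_num => //; exact: Rintegrable_norm.
have mDi := @measurable_fun_fubini_tonelli_F _ _ _ _ _ area2 D mD D0.
have mgs : measurable_fun setT (fun w => gs m n w) by exact: (bmeas_gsum a b c e _ _ n).1.
have mYg : measurable_fun setT (fun w => `|Y w - gs m n w|).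
  apply: measurableT_comp => //; apply: measurable_funB => //; rewrite (funext YE).
  apply: measurable_funM => //; apply: measurableT_comp => //.
  apply: (measurable_integral_param (F := fun t => ((G t.2)%:E * potat a b c e t.1 t.2)%E)).
  apply: emeasurable_funM; last exact: measurable_potat.
  by apply/measurable_EFinP; exact: (measurableT_comp mG measurable_snd).
apply: (@le_trans _ _ (\int[Q]_w (r^-1%:E * \int[area2]_p D (w, p)))%E).
  apply: ae_ge0_le_integral => //.
  - exact/measurable_EFinP.
  - by move=> w _; rewrite mule_ge0 ?lee_fin// integral_ge0.
  - exact: emeasurable_funM.
  - by apply: filterS key => w.
rewrite ge0_integralZl// ?lee_fin//; last by move=> w _; exact: integral_ge0.
rewrite (@fubini_tonelli _ _ _ _ _ Q area2 D mD D0) EFinM lee_pmul2l ?lte_fin ?invr_gt0//.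
set A : R := M * _ + _.
have A0 : 0 <= A.
  rewrite addr_ge0// ?mulr_ge0 ?addr_ge0 ?sqrtr_ge0 ?mulr_ge0 ?divr_ge0 ?exprn_ge0//.
  by apply: sumr_ge0 => j _; rewrite mulr_ge0.
apply: (@le_trans _ _ (\int[area2]_p (A * \1_(box B) p)%:E)%E); last first.
  by rewrite -Rintegral_box /Rintegral fineK//; apply: integrable_fin_num => //; exact: Rintegrable_box.
apply: ge0_le_integral => //.
- by move=> p _; exact: integral_ge0.
- exact: (@measurable_fun_fubini_tonelli_G _ _ _ _ _ Q D mD D0).
- by apply/measurable_EFinP; apply: measurable_funM => //; apply: measurable_indic; exact: measurable_box.
move=> p _; case: (pselect (box B p)) => [bp|np]; last first.
  rewrite integral0_eq ?lee_fin ?mulr_ge0 ?indicE// => w _.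
  by rewrite /D/= G0// mul0r /st step_out ?subrr ?normr0//; exact: out_cell.
rewrite indicE mem_set// mulr1; have [l lp] := box_cell m bp.
set z := toC p; set zl := gpt l.
have mga z' : measurable_fun setT (fun w => ga z' w) := (bmeas_gapprox a b c e n z').1.
have mXz : measurable_fun setT (fun w => X z w) := measurable_Xpot a b c e z.
have dl := cell_dist lp.
have d1 : {in setT, forall w, (D (w, p) <= (M * `|X z w - ga z w| + (M * `|ga z w - ga zl w| + (ep + C * (2 / m.+1%:R ^+ 2)) * gbound n))%:E)%E}.
  move=> w _; rewrite /D/= lee_fin /st (step_in _ lp).
  rewrite (_ : _ - _ = G p * (X z w - ga z w) + (G p * (ga z w - ga zl w) + (G p - G (gnode2 l)) * ga zl w)); last by rewrite /z /zl; ring.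
  apply: (le_trans (ler_normD _ _)); apply: lerD; first by rewrite normrM; apply: ler_wpM2r.
  apply: (le_trans (ler_normD _ _)); apply: lerD; first by rewrite normrM; apply: ler_wpM2r.
  rewrite normrM; apply: ler_pM => //; last exact: gapprox_le.
  by apply: (le_trans (modG _ _)); rewrite lerD2l; apply: ler_wpM2l.
have mN1 : measurable_fun setT (fun w => (M * `|X z w - ga z w|)%:E).
  apply/measurable_EFinP; apply: measurable_funM => //; apply: measurableT_comp => //.
  exact: measurable_funB.
have mN2 : measurable_fun setT (fun w => M * `|ga z w - ga zl w| + (ep + C * (2 / m.+1%:R ^+ 2)) * gbound n).
  apply: measurable_funD => //; apply: measurable_funM => //; apply: measurableT_comp => //.
  exact: measurable_funB.
have gb0 : 0 <= (ep + C * (2 / m.+1%:R ^+ 2)) * gbound n.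
  apply: mulr_ge0; first by rewrite addr_ge0// mulr_ge0// divr_ge0// exprn_ge0.
  by apply: sumr_ge0 => j _; rewrite mulr_ge0.
apply: (@le_trans _ _ (\int[Q]_w ((M * `|X z w - ga z w|)%:E + (M * `|ga z w - ga zl w| + (ep + C * (2 / m.+1%:R ^+ 2)) * gbound n)%:E))%E).
  apply: ge0_le_integral => //.
  - exact: (measurableT_comp mD (measurable_pair2 p)).
  - by apply: emeasurable_funD => //; exact/measurable_EFinP.
  - by move=> w _; rewrite -EFinD; apply: d1; rewrite inE.
rewrite ge0_integralD//; last 3 first.
- by move=> w _; rewrite lee_fin mulr_ge0.
- by move=> w _; rewrite lee_fin addr_ge0// mulr_ge0.
- exact/measurable_EFinP.
have -> : (A%:E = (M * Num.sqrt ep')%:E + (M * Num.sqrt (2 * meshL n * (2 / m.+1%:R ^+ 2)) +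
    (ep + C * (2 / m.+1%:R ^+ 2)) * gbound n)%:E)%E by rewrite -EFinD /A mulrDr addrA.
apply: leeD.
  under eq_integral do rewrite EFinM.
  rewrite ge0_integralZl ?lee_fin//; last first.
    by apply/measurable_EFinP; apply: measurableT_comp => //; exact: measurable_funB.
  by rewrite EFinM lee_wpmul2l ?lee_fin//; exact: (Xpot_dist HQ Hab Hce Hac).
have ig : Rintegrable Q (fun w => `|ga z w - ga zl w|).
  by apply: Rintegrable_norm; apply: RintegrableB; apply: bmeas_int; exact: bmeas_gapprox.
have i2 : Rintegrable Q (fun w => M * `|ga z w - ga zl w| + (ep + C * (2 / m.+1%:R ^+ 2)) * gbound n).
  by apply: RintegrableD; [exact: RintegrableZ|exact: Rintegrable_cst].
have -> : (\int[Q]_w (M * `|ga z w - ga zl w| + (ep + C * (2 / m.+1%:R ^+ 2)) * gbound n)%:E =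
    (\int[Q]_w (M * `|ga z w - ga zl w| + (ep + C * (2 / m.+1%:R ^+ 2)) * gbound n))%:E)%E.
  by rewrite /Rintegral fineK//; exact: integrable_fin_num.
rewrite lee_fin (RintegralD measurableT (RintegrableZ M ig) (Rintegrable_cst Q _)) Rintegral_cst1 lerD2r.
rewrite (RintegralZl _ measurableT ig); apply: ler_wpM2l => //.
apply: (le_trans (gapprox_mesh HQ Hab Hce Hac n z zl)); apply: ler_wsqrtr.
rewrite /z /zl /gpt nsq_toC; apply: ler_wpM2l => //; apply: mulr_ge0 => //.
apply: mulr_ge0 => //; apply: sumr_ge0 => i _; apply: sumr_ge0 => j _.
by rewrite !mulr_ge0 ?invr_ge0// ltW// sgrid_gt0.
Qed.

End second_moment.

Section scaling.

Let ge0_scale1 (r : R) (f : mR -> \bar R) : 0 < r -> measurable_fun setT f -> (forall x, 0 <= f x)%E ->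
  (\int[leb]_x f (r^-1 * x)%R = r%:E * \int[leb]_x f x)%E.
Proof.
move=> r0 mf f0.
pose sh (x : mR) : measurableTypeR R := r^-1 * x.
have ms : measurable_fun setT sh by exact: measurable_funM.
pose rn : {nonneg R} := NngNum (ltW r0).
transitivity (\int[mscale rn leb]_x f x)%E; last by rewrite ge0_integral_mscale.
transitivity (\int[pushforward leb sh]_x f x)%E.
  by rewrite ge0_integral_pushforward// => y _; exact: f0.
apply: eq_measure_integral => A mA _.
have r'0 : 0 <= r^-1 by rewrite invr_ge0 ltW.
pose rv : {nonneg R} := NngNum r'0.
pose g : {mfun mR >-> mR} := mfun_Sub (mem_set ms).
have h : leb A = (r^-1%:E * pushforward leb g A)%E.
  apply: (@lebesgue_measure_unique _ (mscale rv (pushforward leb g))) => //= _ [[x y]] _ <-.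
  rewrite /mscale/= /pushforward /= (_ : _ @^-1` _ = `]r * x, r * y]%classic); last first.
    apply/seteqP; split => z /=; rewrite /sh !in_itv/=.
      by rewrite ltr_pdivlMl// ler_pdivrMl.
    by rewrite ltr_pdivlMl// ler_pdivrMl.
  rewrite !lebesgue_measure_itv/= !lte_fin ltr_pM2l//.
  case: ifP => _; last by rewrite mule0.
  by rewrite -!EFinD -EFinM; congr EFin; field; rewrite gt_eqF.
transitivity (r%:E * leb A)%E => //.
rewrite h muleA -EFinM divff ?gt_eqF// mul1e.
by [].
Qed.

Lemma ge0_integral_scale (r : R) (f : mR * mR -> \bar R) : 0 < r -> measurable_fun setT f -> (forall x, 0 <= f x)%E ->
  (\int[area2]_p f (r^-1 * p.1, r^-1 * p.2)%R = (r ^+ 2)%:E * \int[area2]_p f p)%E.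
Proof.
move=> r0 mf f0.
have mg : measurable_fun setT (fun p : mR * mR => f (r^-1 * p.1, r^-1 * p.2)).
  apply: (measurableT_comp mf); apply: measurable_fun_pair; exact: measurable_funM.
rewrite (@fubini_tonelli1 _ _ _ _ _ leb leb _ mg)// (@fubini_tonelli1 _ _ _ _ _ leb leb _ mf)// /fubini_F.
have mF := @measurable_fun_fubini_tonelli_F _ _ _ _ _ leb _ mf f0.
have F0 x : (0 <= fubini_F leb f x)%E by apply: integral_ge0.
rewrite expr2 EFinM -muleA -(ge0_scale1 r0 mF F0) -ge0_integralZl//; last 2 first.
- apply: (measurableT_comp mF); exact: measurable_funM.
- by rewrite lee_fin ltW.
apply: eq_integral => x _; rewrite /fubini_F -(ge0_scale1 (f := fun y => f (r^-1 * x, y)) r0)//.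
by apply: measurableT_comp => //; exact: measurable_fun_pair.
Qed.

End scaling.

End grid_sums.

(** * Coordinates of the coefficients *)

Section gaussian_coordinates.
Context {R : realType}.
Local Notation mR := (measurableTypeR R).
Local Notation N1 := (normal_prob (0 : R) 1).

(** A rotation aligns (al, be) with the first axis. *)
Lemma ge0_integral_normal2_quad (al be : R) :
  (\int[(N1 \x N1)%E]_p ((al * p.1 + be * p.2) ^+ 2)%:E = (m2 * (al ^+ 2 + be ^+ 2))%:E)%E.
Proof.
have base : (\int[(N1 \x N1)%E]_p (p.1 ^+ 2)%:E = (m2 : R)%:E)%E.
  have mf : measurable_fun setT (fun p : mR * mR => (p.1 ^+ 2)%:E).
    by apply/measurable_EFinP; exact: measurable_funX.
  rewrite fubini_tonelli1//; last by move=> p; rewrite lee_fin sqr_ge0.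
  rewrite /fubini_F/=; transitivity (\int[N1]_x (x ^+ 2)%:E)%E.
    by apply: eq_integral => x _; rewrite integral_cst// [X in (_ * X)%E](@probability_setT _ _ _ N1) mule1.
  by rewrite /m2 /Rintegral fineK//; apply: integrable_fin_num => //; exact: integrable_normal_sqr.
have [ab0|ab0] := eqVneq (al ^+ 2 + be ^+ 2) 0.
  have al0 : al = 0 by apply/eqP; rewrite -sqrf_eq0; have := sqr_ge0 al; have := sqr_ge0 be; rewrite eq_le; lra.
  have be0 : be = 0 by apply/eqP; rewrite -sqrf_eq0; have := sqr_ge0 al; have := sqr_ge0 be; rewrite eq_le; lra.
  by rewrite ab0 mulr0 integral0_eq// => p _; rewrite al0 be0 !mul0r addr0 expr0n.
have ab1 : 0 < al ^+ 2 + be ^+ 2 by rewrite lt_neqAle eq_sym ab0 addr_ge0// sqr_ge0.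
pose rho := Num.sqrt (al ^+ 2 + be ^+ 2).
have rho0 : 0 < rho by rewrite sqrtr_gt0.
have rho2 : rho ^+ 2 = al ^+ 2 + be ^+ 2 by rewrite sqr_sqrtr// ltW.
have mf : measurable_fun setT (fun p : mR * mR => ((rho * p.1) ^+ 2)%:E).
  by apply/measurable_EFinP; apply: measurable_funX; exact: measurable_funM.
have f0 (p : mR * mR) : (0 <= ((rho * p.1) ^+ 2)%:E)%E by rewrite lee_fin sqr_ge0.
have cs : (al / rho) ^+ 2 + (be / rho) ^+ 2 = 1.
  by rewrite !expr_div_n -mulrDl -rho2 divff// expf_neq0// gt_eqF.
transitivity (\int[(N1 \x N1)%E]_p ((rho * (rotation (al / rho) (be / rho) p).1) ^+ 2)%:E)%E.
  apply: eq_integral => p _; congr ((_ ^+ 2)%:E); rewrite /rotation/=; field.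
  by rewrite gt_eqF.
rewrite (ge0_integral_normal2_rotation cs mf f0).
under eq_integral do rewrite exprMn EFinM.
rewrite ge0_integralZl ?lee_fin ?sqr_ge0//; last 2 first.
- by apply/measurable_EFinP; exact: measurable_funX.
- by move=> p _; rewrite lee_fin sqr_ge0.
by rewrite base -EFinM -rho2 mulrC.
Qed.

Context d (T : measurableType d) (P : probability T R) (zeta : nat -> {RV P >-> borelC R}).
Hypotheses (zeta_iid : iid zeta) (zeta_normal : forall k, standard_normalC (zeta k)).

Let law := distribution P (zeta 0%N).

Let linC (a b c e : R) (p : mR * mR) : borelC R := toC (a * p.1 + b * p.2, c * p.1 + e * p.2).

Let measurable_linC a b c e : measurable_fun setT (linC a b c e).
Proof.
apply: measurableT_comp; first exact: measurable_toC.
by apply/measurable_fun_pairP; split; apply: measurable_funD; apply: measurable_funM.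
Qed.

Let quad (al be : R) (z : borelC R) : R := (al * (ofC z).1 + be * (ofC z).2) ^+ 2.

Let measurable_quad al be : measurable_fun setT (quad al be).
Proof.
have h1 := measurableT_comp measurable_fst (@measurable_ofC R).
have h2 := measurableT_comp measurable_snd (@measurable_ofC R).
by apply: measurable_funX; apply: measurable_funD; apply: measurable_funM.
Qed.

Let quad_ge0 al be z : (0 <= (quad al be z)%:E)%E. Proof. by rewrite lee_fin sqr_ge0. Qed.

Section coefficients.
Variables a b c e : R.
Hypothesis lawE : forall A : set (borelC R), measurable A ->
  law A = pushforward (N1 \x N1)%E (linC a b c e) A.

Let integral_quad al be :
  (\int[law]_z (quad al be z)%:E = (m2 * ((al * a + be * c) ^+ 2 + (al * b + be * e) ^+ 2))%:E)%E.
Proof.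
transitivity (\int[pushforward (N1 \x N1)%E (linC a b c e)]_z (quad al be z)%:E)%E.
  by apply: eq_measure_integral => A mA _; exact: lawE.
rewrite ge0_integral_pushforward//; last first.
  by apply/measurable_EFinP; exact: measurable_quad.
rewrite preimage_setT -ge0_integral_normal2_quad; apply: eq_integral => p _.
by congr ((_ ^+ 2)%:E) => /=; ring.
Qed.

(** Rotation invariance at u = i, which maps (x, y) to (-y, x). *)
Let quad_rot al be : (\int[law]_z (quad al be z)%:E = \int[law]_z (quad be (- al) z)%:E)%E.
Proof.
have [_ rot _] := zeta_normal 0%N.
have n1 : normc ('i : R[i]) = 1 by rewrite /normc/= expr0n add0r expr1n sqrtr1.
pose mi (z : borelC R) : borelC R := ('i * (z : R[i]) : R[i]).
have mmi : measurable_fun setT mi.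
  rewrite (_ : mi = fun z => toC (- (ofC z).2, (ofC z).1)); last first.
    by apply/funext => -[x y]; rewrite /mi /toC/=; simpc.
  apply: measurableT_comp; first exact: measurable_toC.
  apply/measurable_fun_pairP; split => /=.
    by apply: measurable_funN; exact: measurableT_comp measurable_snd (@measurable_ofC R).
  exact: measurableT_comp measurable_fst (@measurable_ofC R).
transitivity (\int[pushforward law mi]_z (quad al be z)%:E)%E.
  by apply: eq_measure_integral => A mA _; exact/esym/rot.
rewrite ge0_integral_pushforward//; last first.
  by apply/measurable_EFinP; exact: measurable_quad.
rewrite preimage_setT; apply: eq_integral => -[x y] _; congr ((_ ^+ 2)%:E).
by rewrite /mi /=; simpc => /=; ring.
Qed.

(** The quarter turn applied to x^2 equates the two variances and applied to (x + y)^2 kills the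
    covariance; the mean of |zeta|^2 fixes the value 1/2. *)
Lemma coefficient_relations :
  [/\ m2 * (a ^+ 2 + b ^+ 2) = 2^-1, m2 * (c ^+ 2 + e ^+ 2) = 2^-1 & a * c + b * e = 0].
Proof.
have q10 := quad_rot 1 0; have q11 := quad_rot 1 1.
rewrite !integral_quad in q10 q11; move: q10 q11 => [q10] [q11].
have [_ _ var] := zeta_normal 0%N.
have sum1 : (\int[law]_z (quad 1 0 z)%:E + \int[law]_z (quad 0 1 z)%:E = 1)%E.
  rewrite -ge0_integralD//; last 2 first.
  - by apply/measurable_EFinP; exact: measurable_quad.
  - by apply/measurable_EFinP; exact: measurable_quad.
  rewrite /law /distribution ge0_integral_pushforward//; last 2 first.
  - by apply: emeasurable_funD; apply/measurable_EFinP; exact: measurable_quad.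
  - by move=> z _; rewrite adde_ge0// quad_ge0.
  rewrite preimage_setT -var unlock; apply: eq_integral => w _ /=.
  rewrite -EFinD; congr EFin; case: (zeta 0%N w) => x y; rewrite /quad/=.
  by rewrite sqr_sqrtr ?addr_ge0 ?sqr_ge0// !mul1r !mul0r addr0 add0r.
rewrite !integral_quad -EFinD in sum1; case: sum1 => sum1.
have [h1 h2] : m2 * (a ^+ 2 + b ^+ 2) = 2^-1 :> R /\ m2 * (c ^+ 2 + e ^+ 2) = 2^-1 :> R.
  by move: q10 sum1; rewrite !(mul1r, mul0r, addr0, add0r, mulN1r, sqrrN); lra.
split=> //.
have m20 : (m2 : R) != 0.
  by apply/eqP => m20; move: h1; rewrite m20 mul0r => /esym/eqP; rewrite invr_eq0 pnatr_eq0.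
apply: (mulfI m20); rewrite mulr0; move: q11; rewrite !(mul1r, mulN1r).
by move: (m2 : R) => m; move: h1 h2 => _ _; lra.
Qed.

End coefficients.

(** The matrix of the law is invertible, so the real coordinates are recovered from the given
    variables themselves, and their joint law is computed from independence. *)
Lemma gaussian_coordinates : exists (a b c e : R) (Q : probability (seqR R) R) (coef : T -> seqR R),
  [/\ iid_normal Q,
      [/\ m2 * (a ^+ 2 + b ^+ 2) = 2^-1, m2 * (c ^+ 2 + e ^+ 2) = 2^-1 & a * c + b * e = 0],
      measurable_fun setT coef,
      forall A, measurable A -> Q A = P (coef @^-1` A) &
      forall w k, zeta k w = gcoef a b c e (coef w) k].
Proof.
have [[a [b [c [e lawE]]]] _ _] := zeta_normal 0%N.
have [h1 h2 h3] := coefficient_relations lawE.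
pose D := a * e - b * c.
(* Lagrange's identity for two orthogonal nonzero rows. *)
have D0 : D != 0.
  apply/eqP => D0; have : D ^+ 2 = (a ^+ 2 + b ^+ 2) * (c ^+ 2 + e ^+ 2) - (a * c + b * e) ^+ 2.
    by rewrite /D; ring.
  rewrite D0 h3 expr0n subr0 => /esym/eqP; rewrite mulf_eq0 => /orP[]/eqP z0.
    by move: h1; rewrite z0 mulr0 => /esym/eqP; rewrite invr_eq0 pnatr_eq0.
  by move: h2; rewrite z0 mulr0 => /esym/eqP; rewrite invr_eq0 pnatr_eq0.
pose pr (i : bool) (z : borelC R) : mR := if i then (a * (ofC z).2 - c * (ofC z).1) / D
  else (e * (ofC z).1 - b * (ofC z).2) / D.
have mpr i : measurable_fun setT (pr i).
  have m1 := measurableT_comp measurable_fst (@measurable_ofC R).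
  have m2' := measurableT_comp measurable_snd (@measurable_ofC R).
  by case: i; apply: measurable_funM => //; apply: measurable_funB; apply: measurable_funM.
have prE i p : pr i (linC a b c e p) = if i then p.2 else p.1.
  by case: i; rewrite /pr /linC /D/=; field.
pose coef (w : T) : seqR R := fun i => pr (odd i) (zeta i./2 w).
have mcoef : measurable_fun setT coef.
  by apply: measurable_to_seqR => i; exact: measurableT_comp (mpr (odd i)) _.
pose X : {mfun T >-> seqR R} := mfun_Sub (mem_set mcoef).
exists a, b, c, e, (distribution P X), coef; split=> //; last first.
  move=> w k; rewrite /gcoef /coef /= odd_double /= doubleK uphalf_double.
  case: (zeta k w) => x y; rewrite /pr/=; congr (_ +i* _); rewrite /D; field; exact: D0.
(* The variables [zeta k] with [k < n] carry [2 * n] coordinates; [B'] leaves those from [n] on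
   unconstrained. *)
move=> n B mB; pose B' i := if (i < n)%N then B i else setT.
have mB' i : measurable (B' i) by rewrite /B'; case: ifP.
pose A k : set (borelC R) := pr false @^-1` B' k.*2 `&` pr true @^-1` B' k.*2.+1.
have mA k : measurable (A k).
  by apply: measurableI; rewrite -[X in measurable X]setTI; exact: mpr.
have PA k : P (zeta k @^-1` A k) = (N1 (B' k.*2) * N1 (B' k.*2.+1))%E.
  transitivity (distribution P (zeta 0%N) (A k)); first exact: (zeta_iid.2 k 0%N (A k) (mA k)).
  rewrite lawE// /pushforward (_ : _ @^-1` A k = B' k.*2 `*` B' k.*2.+1); first exact: product_measure1E.
  apply/seteqP; split => p [h1' h2']; split.
  - have := (h1' : B' k.*2 (pr false (linC a b c e p))); by rewrite prE.
  - have := (h2' : B' k.*2.+1 (pr true (linC a b c e p))); by rewrite prE.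
  - by suff : B' k.*2 (pr false (linC a b c e p)) by []; rewrite prE.
  - by suff : B' k.*2.+1 (pr true (linC a b c e p)) by []; rewrite prE.
have cylE : coef @^-1` cylinder n B = \bigcap_(k in [set` seq_fset tt (iota 0 n)]) (zeta k @^-1` A k).
  apply/seteqP; split => w /= h.
    move=> k _; rewrite /A/=; split.
      by rewrite /B'; case: ifPn => // kn; have := h _ kn; rewrite /coef odd_double doubleK.
    by rewrite /B'; case: ifPn => // kn; have := h _ kn; rewrite /coef/= odd_double/= uphalf_double.
  move=> i ni.
  have hi : (i./2 < n)%N by apply: leq_ltn_trans ni; rewrite -divn2; exact: leq_div.
  have hm : i./2 \in seq_fset tt (iota 0 n) by rewrite seq_fsetE mem_iota add0n.
  have [ha hb] := h i./2 hm; rewrite /coef; case: (boolP (odd i)) => oi.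
    have ei : i = i./2.*2.+1 by rewrite -[LHS]odd_double_half oi.
    by move: hb; rewrite -ei /B' ni.
  have ei : i = i./2.*2 by rewrite -[LHS]odd_double_half (negPf oi).
  by move: ha; rewrite -ei /B' ni.
transitivity (P (coef @^-1` cylinder n B)) => //.
rewrite cylE zeta_iid.1//.
rewrite (perm_big (iota 0 n)); last first.
  by rewrite (perm_trans (seq_fset_perm _ _))// undup_id ?iota_uniq.
under eq_bigr do rewrite PA.
have dbl m : (\prod_(k <- iota 0 m) (N1 (B' k.*2) * N1 (B' k.*2.+1)) = \prod_(i <- iota 0 m.*2) N1 (B' i))%E.
  elim: m => [|m ih]; first by rewrite !big_nil.
  by rewrite doubleS -[m.+1]addn1 -[m.*2.+2]addn2 !iotaD !big_cat/= ih !big_cons !big_nil !add0n !mule1.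
rewrite dbl -addnn iotaD big_cat/= [X in (_ * X)%E]big1_seq ?mule1; last first.
  move=> i /=; rewrite mem_iota add0n => /andP[ni _].
  by rewrite /B' ltnNge ni/= [LHS](@probability_setT _ _ _ N1).
rewrite -[n in iota 0 n]subn0 -/(index_iota 0 n) big_mkord.
by apply: eq_bigr => i _; rewrite /B' ltn_ord.
Qed.

End gaussian_coordinates.

(** * Compactness *)

Section compactness.

(* The open sets [F < ep + n * D] increase to a cover of the compact. *)
Lemma compact_modulus (R : realType) (Z : topologicalType) (K : set Z) (F D : Z -> R) (ep : R) :
  compact K -> continuous F -> continuous D -> (forall z, 0 <= D z) ->
  (forall z, D z = 0 -> F z <= 0) -> 0 < ep ->
  exists2 C : R, 0 <= C & forall z, K z -> F z <= ep + C * D z.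
Proof.
move=> cK cF cD D0 DF ep0.
pose U (n : nat) : set Z := (fun z => ep + n%:R * D z - F z) @^-1` [set x | 0 < x].
have oU n : open (U n).
  apply: open_comp => [z _|]; last exact: open_gt.
  by apply: (@cvgB _ R^o); [apply: (@cvgD _ R^o); [exact: cvg_cst|apply: (@cvgM _ _ _ _ (cst n%:R)); [exact: cvg_cst|exact: cD]]|exact: cF].
have ncK : near_covering K by apply/compact_near_coveringP.
have [|n hn] := @filter_ex _ \oo _ _ (ncK nat \oo (fun n z => F z <= ep + n%:R * D z) _ _); last first.
  by exists n%:R => // z Kz; exact: hn.
move=> z _; have [n zn] : exists n, U n z.
  have [D0z|Dz] := eqVneq (D z) 0.
    by exists 0%N => //=; rewrite /U/= D0z mulr0 addr0 subr_gt0; exact: le_lt_trans (DF _ D0z) ep0.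
  have Dz0 : 0 < D z by rewrite lt_neqAle eq_sym Dz D0.
  exists (Num.truncn (`|F z| / D z)).+1 => //=; rewrite /U/= subr_gt0.
  have h : `|F z| < (Num.truncn (`|F z| / D z)).+1%:R * D z by rewrite -ltr_pdivrMr// truncnS_gt.
  by rewrite (le_lt_trans (ler_norm _))// (lt_le_trans h)// lerDr ltW.
exists (U n, [set k | (n <= k)%N]); first by split => /=; [apply: open_nbhs_nbhs; split; [exact: oU|exact: zn]|exists n].
move=> [y k] [/=]; rewrite /U/= subr_gt0 => /ltW yn nk; apply: (le_trans yn).
by rewrite lerD2l; apply: ler_wpM2r => //; rewrite ler_nat.
Qed.

(** A continuous function on the line may have no uniform modulus. For large x the quadratic term
    absorbs the oscillation, if only y is large then |x - y| >= 1, and the rest is compact. In the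
    application x has bounded second moment. *)
Lemma bounded_modulus (R : realType) (g : R -> R) (M : R) : continuous g -> (forall x, `|g x| <= M) ->
  forall ep, 0 < ep -> exists2 C : R, 0 <= C & forall x y, `|g x - g y| <= ep * (1 + x ^+ 2) + C * `|x - y|.
Proof.
move=> cg gM ep ep0; have M0 : 0 <= M := le_trans (normr_ge0 _) (gM 0).
(* Beyond [L] the term [ep * x ^+ 2] exceeds the oscillation [2 * M]. *)
pose L : R := 1 + 2 * M / ep.
have L1 : 1 <= L by rewrite lerDl divr_ge0 ?mulr_ge0// ltW.
pose F (z : R * R) := `|g z.1 - g z.2|; pose D (z : R * R) := `|z.1 - z.2|.
have cF : continuous F.
  move=> z; apply: cvg_norm; apply: cvgB.
    by apply: (cvg_comp _ g); [exact: cvg_fst|exact: cg].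
  by apply: (cvg_comp _ g); [exact: cvg_snd|exact: cg].
have cD : continuous D by move=> z; apply: cvg_norm; apply: cvgB; [exact: cvg_fst|exact: cvg_snd].
have cK := compact_setX (@segment_compact R (- (L + 1)) (L + 1)) (@segment_compact R (- (L + 1)) (L + 1)).
have [||C C0 hC] := compact_modulus cK cF cD _ _ ep0.
- by move=> z; rewrite /D.
- by move=> z /eqP; rewrite normr_eq0 subr_eq0 => /eqP e; rewrite /F e subrr normr0.
exists (C + 2 * M); first by rewrite addr_ge0// mulr_ge0.
move=> x y.
have gxy : `|g x - g y| <= 2 * M by have := ler_normB (g x) (g y); have := gM x; have := gM y; lra.
have [xL|xL] := leP `|x| L; last first.
  have e1 : 2 * M <= ep * x ^+ 2.
    have : 2 * M / ep <= x ^+ 2.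
      rewrite -real_normK ?num_real//; have : 2 * M / ep <= L by rewrite lerDr.
      by have := normr_ge0 x; nra.
    by rewrite ler_pdivrMr// [ep * _]mulrC.
  apply: (le_trans gxy); apply: (le_trans e1); rewrite mulrDr mulr1 -addrA addrC -addrA lerDl.
  by rewrite addr_ge0 ?mulr_ge0 ?addr_ge0 ?mulr_ge0// ltW.
have x20 : 0 <= ep * x ^+ 2 by rewrite mulr_ge0 ?sqr_ge0// ltW.
have d0 := normr_ge0 (x - y).
have [yL|yL] := leP `|y| (L + 1).
  have := hC (x, y); rewrite /F/D/= => h.
  have : `|g x - g y| <= ep + C * `|x - y|.
    apply: h; split; rewrite /= in_itv/= -ler_norml//.
    by rewrite (le_trans xL)// lerDl.
  have : 0 <= 2 * M * `|x - y| by rewrite mulr_ge0// mulr_ge0.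
  by lra.
have d1 : 1 <= `|x - y|.
  by have := ler_normD x (y - x); rewrite addrC subrK distrC; lra.
have : 2 * M * 1 <= 2 * M * `|x - y| by apply: ler_wpM2l => //; rewrite mulr_ge0.
have : 0 <= C * `|x - y| by rewrite mulr_ge0.
by lra.
Qed.

(** * Bounds for the test function *)

Section test_function.
Context {R : realType}.
Local Notation mR := (measurableTypeR R).
Variables (h : R[i]^o -> R).
Hypotheses (h_cont : continuous h) (h_supp : compactly_supported h).

Let H (p : R * R) : R := h (p.1 +i* p.2).

Lemma continuous_toC (r : R) : continuous (fun p : R * R => (r%:C * (p.1 +i* p.2) : R[i]^o)).
Proof.
move=> p; apply/cvgrPdist_lt => ep; rewrite ltcE/= => /andP[/eqP im0 re0].
set k := complex.Re ep in re0 *.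
have d0 : 0 < k / (2 * (`|r| + 1)) by rewrite divr_gt0// mulr_gt0// ltr_wpDl.
have c : \forall q \near p, `|p.1 - q.1| < k / (2 * (`|r| + 1)) /\ `|p.2 - q.2| < k / (2 * (`|r| + 1)).
  exists (ball p.1 (k / (2 * (`|r| + 1))), ball p.2 (k / (2 * (`|r| + 1)))).
    by split; exact: nbhsx_ballx.
  by move=> q [].
near=> q.
have [q1 q2] : `|p.1 - q.1| < k / (2 * (`|r| + 1)) /\ `|p.2 - q.2| < k / (2 * (`|r| + 1)) by near: q.
rewrite ltcE/= im0 eqxx/= -/k.
rewrite (_ : Num.sqrt _ = normc ((r * (p.1 - q.1)) +i* (r * (p.2 - q.2)))); last first.
  by rewrite /normc; congr (Num.sqrt (_ ^+ 2 + _ ^+ 2)); ring.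
apply: (le_lt_trans (normc_le_sum _)) => /=; rewrite !normrM -mulrDr.
have r0 : 0 < `|r| + 1 by rewrite ltr_wpDl.
have : `|r| * (`|p.1 - q.1| + `|p.2 - q.2|) <= (`|r| + 1) * (`|p.1 - q.1| + `|p.2 - q.2|).
  by apply: ler_wpM2r; rewrite ?addr_ge0// lerDl.
move=> /le_lt_trans; apply.
rewrite mulrC -ltr_pdivlMr//.
have -> : k / (`|r| + 1) = k / (2 * (`|r| + 1)) + k / (2 * (`|r| + 1)).
  by field; rewrite gt_eqF.
exact: ltrD.
Unshelve. all: by end_near. Qed.

Lemma continuous_hscaled (r : R) : continuous (fun p : R * R => h (r%:C * (p.1 +i* p.2))).
Proof. by move=> p; apply: (cvg_comp _ h); [exact: continuous_toC|exact: h_cont]. Qed.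

Let cH : continuous H.
Proof.
rewrite (_ : H = fun p => h (1%:C * (p.1 +i* p.2))); first exact: continuous_hscaled.
by apply/funext => p; rewrite mul1r.
Qed.

Lemma support_box : exists B : nat, forall p : R * R, H p != 0 -> `|p.1| <= B%:R /\ `|p.2| <= B%:R.
Proof.
pose F (z : R[i]^o) : R := normc (z : R[i]).
have cF : continuous F.
  move=> z A /nbhs_ballP [ep /= ep0 epA]; apply/nbhs_ballP; exists ep%:C; first by rewrite /= ltcR.
  have tri (u v : R[i]) : normc u - normc v <= normc (u - v).
    by have := le_normcD (u - v) v; rewrite subrK; lra.
  move=> w; rewrite /ball/= normc_def ltcR => zw; apply: epA.
  have {}zw : normc (z - w : R[i]) < ep by move: zw; case: (z - w : R[i]).
  rewrite /ball/=; apply: le_lt_trans zw; rewrite ler_norml; apply/andP; split; last exact: tri.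
  have -> : normc (z - w : R[i]) = normc (w - z : R[i]) by rewrite -[w - z]opprB normcN.
  by have := tri w z; rewrite /F; lra.
(* With a constant gauge the modulus is a plain upper bound on the compact support. *)
have [||C C0 hC] := compact_modulus (D := fun=> 1) h_supp cF (fun _ => cvg_cst _) _ _ ltr01.
- by [].
- by move=> z /eqP; rewrite oner_eq0.
exists (Num.truncn (1 + C)).+1 => p Hp.
have : F (p.1 +i* p.2) <= 1 + C * 1 by apply: hC; exact: subset_closure.
rewrite mulr1 => h1; have h2 := ltW (le_lt_trans h1 (truncnS_gt _)).
by split; apply: le_trans h2; [exact: (Re_le_normc (p.1 +i* p.2))|exact: (Im_le_normc (p.1 +i* p.2))].
Qed.

Lemma h_bounded : exists2 M : R, 0 <= M & forall p : R * R, `|H p| <= M.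
Proof.
have [B hB] := support_box.
have cK := compact_setX (@segment_compact R (- B%:R) B%:R) (@segment_compact R (- B%:R) B%:R).
have cF : continuous (fun p => `|H p|) by move=> p; apply: cvg_norm; exact: cH.
have [||C C0 hC] := compact_modulus (D := fun=> 1) cK cF (fun _ => cvg_cst _) _ _ ltr01.
- by [].
- by move=> z /eqP; rewrite oner_eq0.
exists (1 + C) => [|p]; first by rewrite addr_ge0.
have [->|/hB[h1 h2]] := eqVneq (H p) 0; first by rewrite normr0 addr_ge0.
by have := hC p; rewrite mulr1; apply; split; rewrite /= in_itv/= -ler_norml.
Qed.

(** [compact_modulus] covers pairs in a square one unit wider than the support. If one value is
    nonzero and the other point lies outside, their distance is at least 1 and [2 * M * dist2 p q]
    suffices. *)
Lemma h_modulus (ep : R) : 0 < ep -> exists2 C : R, 0 <= C &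
  forall p q : R * R, `|H p - H q| <= ep + C * dist2 p q.
Proof.
move=> ep0; have [B hB] := support_box; have [M M0 HM] := h_bounded.
pose I : set R := `[- (B.+1%:R), B.+1%:R]%classic.
have cI : compact I by exact: segment_compact.
have cK := compact_setX (compact_setX cI cI) (compact_setX cI cI).
pose F (z : (R * R) * (R * R)) := `|H z.1 - H z.2|; pose D (z : (R * R) * (R * R)) : R := dist2 z.1 z.2.
have cF : continuous F.
  move=> z; apply: cvg_norm; apply: cvgB.
    by apply: (cvg_comp _ H); [exact: cvg_fst|exact: cH].
  by apply: (cvg_comp _ H); [exact: cvg_snd|exact: cH].
have cD : continuous D.
  have sq (f : (R * R) * (R * R) -> R) : continuous f -> continuous (fun z => f z ^+ 2).
    by move=> cf z; rewrite (_ : (fun z => _) = (fun z => f z * f z))//; exact: (cvgM (cf z) (cf z)).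
  move=> z; apply: (@cvgD _ R^o); apply: (sq (fun z => _ - _)) => {}z; apply: (@cvgB _ R^o).
  - by apply: (cvg_comp (fun z : (R * R) * (R * R) => z.1) fst); exact: cvg_fst.
  - by apply: (cvg_comp (fun z : (R * R) * (R * R) => z.2) fst); [exact: cvg_snd|exact: cvg_fst].
  - by apply: (cvg_comp (fun z : (R * R) * (R * R) => z.1) snd); [exact: cvg_fst|exact: cvg_snd].
  - by apply: (cvg_comp (fun z : (R * R) * (R * R) => z.2) snd); exact: cvg_snd.
have [||C C0 hC] := compact_modulus cK cF cD _ _ ep0.
- by move=> z; exact: dist2_ge0.
- move=> [[x y] [x' y']]; rewrite /D /dist2 /F/= => /eqP; rewrite paddr_eq0 ?sqr_ge0//.
  by rewrite !sqrf_eq0 !subr_eq0 => /andP[/eqP -> /eqP ->]; rewrite subrr normr0.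
have out p : ~ (I p.1 /\ I p.2) -> H p = 0.
  move=> np; apply/eqP; apply: contrapT => /negP /hB [h1 h2]; apply: np.
  by rewrite /I /= !in_itv/= -!ler_norml !(le_trans h1, le_trans h2)// ler_nat.
have far p q : H p != 0 -> ~ (I q.1 /\ I q.2) -> 1 <= dist2 p q.
  move=> /hB[h1 h2] nq.
  have sq (u v : R) : `|u| <= B%:R -> ~ I v -> 1 <= (u - v) ^+ 2.
    move=> uB /negP; rewrite /I /= in_itv/= -ler_norml -ltNge => vB.
    have : 1 <= `|u - v|.
      by have := ler_normD u (v - u); rewrite addrC subrK distrC; move: vB; rewrite -natr1; lra.
    by rewrite -(real_normK (num_real (u - v))) => ?; rewrite exprn_ege1.
  rewrite /dist2; case: (pselect (I q.1)) => [i1|n1].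
    by have := sq _ _ h2 (fun i2 => nq (conj i1 i2)); have := sqr_ge0 (p.1 - q.1); lra.
  by have := sq _ _ h1 n1; have := sqr_ge0 (p.2 - q.2); lra.
exists (C + 2 * M); first by rewrite addr_ge0// mulr_ge0.
move=> p q; have d0 := dist2_ge0 p q.
have b1 : `|H p - H q| <= 2 * M by have := ler_normB (H p) (H q); have := HM p; have := HM q; lra.
have t1 : 0 <= C * dist2 p q by rewrite mulr_ge0.
have t2 : 0 <= 2 * M * dist2 p q by rewrite mulr_ge0// mulr_ge0.
case: (pselect (I p.1 /\ I p.2)) => [ip|np]; case: (pselect (I q.1 /\ I q.2)) => [iq|nq].
- by have := hC (p, q) (conj ip iq); rewrite /F/D/=; lra.
- have [p0|p0] := eqVneq (H p) 0; first by rewrite p0 (out q nq) subrr normr0; lra.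
  have : 2 * M * 1 <= 2 * M * dist2 p q by apply: ler_wpM2l; [rewrite mulr_ge0|exact: far].
  by lra.
- have [q0|q0] := eqVneq (H q) 0; first by rewrite q0 (out p np) subrr normr0; lra.
  have : 2 * M * 1 <= 2 * M * dist2 p q by apply: ler_wpM2l; [rewrite mulr_ge0|rewrite dist2C; exact: far].
  by lra.
- by rewrite !out// subrr normr0; lra.
Qed.

End test_function.

End compactness.

(** * Central limit theorem *)

Section central_limit.
Context {R : realType}.
Local Notation mR := (measurableTypeR R).
Local Notation area2 := (@area2 R).
Variable Q : probability (seqR R) R.
Hypothesis HQ : iid_normal Q.
Variables (a b c e : R).
Hypotheses (Hab : m2 * (a ^+ 2 + b ^+ 2) = 2^-1) (Hce : m2 * (c ^+ 2 + e ^+ 2) = 2^-1)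
  (Hac : a * c + b * e = 0).
Variables (H : mR * mR -> R) (M : R) (B0 : nat).
Hypotheses (mH : measurable_fun setT H) (cH : continuous (fun p : R * R => H p)).
Hypotheses (HM : forall p, `|H p| <= M) (HB : forall p, H p != 0 -> `|p.1| <= B0%:R /\ `|p.2| <= B0%:R).
Hypothesis modH : forall ep : R, 0 < ep -> exists2 C : R, 0 <= C & forall p q, `|H p - H q| <= ep + C * dist2 p q.

Let M0 : 0 <= M := le_trans (normr_ge0 _) (HM (0, 0)).

Definition dilate (r : R) (p : mR * mR) : R := H (r^-1 * p.1, r^-1 * p.2).

(** The successor makes the half-open box contain the dilated support together with its upper
    edge. *)
Definition hbox (r : R) : nat := (Num.truncn (B0%:R * r)).+1.

Let V0 : R := 4 * (B0%:R + 1) ^+ 2.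

Let V00 : 0 <= V0. Proof. by rewrite mulr_ge0// sqr_ge0. Qed.

Let scale_meas (r : R) : measurable_fun setT (fun p : mR * mR => (r^-1 * p.1, r^-1 * p.2) : mR * mR).
Proof. by apply/measurable_fun_pairP; split; apply: measurable_funM. Qed.

Lemma measurable_dilate r : measurable_fun setT (dilate r).
Proof. exact: (measurableT_comp mH (scale_meas r)). Qed.

Lemma continuous_dilate r : continuous (fun p : R * R => dilate r p).
Proof.
move=> p.
have c1 : r^-1 * q.1 @[q --> p] --> r^-1 * p.1 by apply: cvgMr; exact: cvg_fst.
have c2 : r^-1 * q.2 @[q --> p] --> r^-1 * p.2 by apply: cvgMr; exact: cvg_snd.
apply: (@continuous_comp _ _ _ (fun p : R * R => (r^-1 * p.1, r^-1 * p.2)) (H : R * R -> R) p).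
  exact: (cvg_pair c1 c2).
exact: cH.
Qed.

Let dilateM r q : `|dilate r q| <= M. Proof. exact: HM. Qed.

Let dilate_out r : 0 < r -> forall q, ~ box (hbox r) q -> dilate r q = 0.
Proof.
move=> r0 q nq; apply/eqP; apply: contrapT => /negP /HB/= [h1 h2]; apply: nq.
have lt1 (x : R) : `|r^-1 * x| <= B0%:R -> - (hbox r)%:R <= x < (hbox r)%:R.
  rewrite normrM ger0_norm ?invr_ge0 ?(ltW r0)// mulrC ler_pdivrMr// => hx.
  have h := le_lt_trans hx (truncnS_gt _); rewrite -/(hbox r) in h.
  by move: h; rewrite ltr_norml => /andP[/ltW -> ->].
by rewrite /box/=; apply/andP; split; apply: lt1.
Qed.

Let hbox_le r : 1 <= r -> (2 * (hbox r)%:R) ^+ 2 <= V0 * r ^+ 2.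
Proof.
move=> r1; have h : (hbox r)%:R <= (B0%:R + 1) * r.
  rewrite /hbox -natr1 mulrDl mul1r lerD// ?truncn_le//.
  by rewrite mulr_ge0// (le_trans _ r1).
have : (hbox r)%:R ^+ 2 <= ((B0%:R + 1) * r) ^+ 2.
  by rewrite lerXn2r// nnegrE// mulr_ge0 ?addr_ge0// (le_trans _ r1).
by rewrite /V0 !exprMn; lra.
Qed.

Let E0 : R := expR 1 * (4 * pi).
Let E00 : 0 <= E0. Proof. by rewrite mulr_ge0 ?expR_ge0// mulr_ge0// pi_ge0. Qed.

Let sum_le r m : 1 <= r -> \sum_l `|@wt R (hbox r) r (dilate r) m l| <= M * V0 * r.
Proof.
move=> r1; have r0 : 0 < r := lt_le_trans ltr01 r1.
apply: (@le_trans _ _ (r^-1 * M * (2 * (hbox r)%:R) ^+ 2)); first exact: sum_wt_le.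
have h := hbox_le r1; have rM : 0 <= r^-1 * M by rewrite mulr_ge0// invr_ge0 ltW.
apply: (le_trans (ler_wpM2l rM h)); rewrite le_eqVlt; apply/orP; left; apply/eqP.
by field; rewrite gt_eqF.
Qed.

Let row_le r m p : 1 <= r ->
  \sum_l `|@wt R (hbox r) r (dilate r) m l| * expR (- (dist2 p (gnode2 l) / 2)) <= M * E0 / r.
Proof.
move=> r1; have r0 : 0 < r := lt_le_trans ltr01 r1.
apply: (@le_trans _ _ (r^-1 * M * E0)); first exact: row_wt_le.
by rewrite -mulrA mulrC.
Qed.

(** Bounds the double sum over the grid independently of [r]: an area of order r^2 meets two factors
    1/r. *)
Let D : R := M * V0 * (M * E0).
Let D0 : 0 <= D. Proof. by rewrite mulr_ge0// mulr_ge0. Qed.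

Let pair_le r : 1 <= r -> pair_bound (hbox r) r M <= D.
Proof.
move=> r1; have r0 : 0 < r := lt_le_trans ltr01 r1.
have h := hbox_le r1; have rM : 0 <= r^-1 * M by rewrite mulr_ge0// invr_ge0 ltW.
rewrite /pair_bound -/E0.
have h2 : r^-1 * M * (2 * (hbox r)%:R) ^+ 2 <= r^-1 * M * (V0 * r ^+ 2) by apply: ler_wpM2l.
have rE : 0 <= r^-1 * M * E0 by rewrite mulr_ge0.
apply: (le_trans (ler_wpM2r rE h2)); rewrite le_eqVlt; apply/orP; left; apply/eqP.
by rewrite /D; field; rewrite gt_eqF.
Qed.

Definition normH : R := \int[area2]_p (H p ^+ 2).

Lemma Rintegrable_sqr_supported : Rintegrable area2 (fun p => H p ^+ 2).
Proof.
have h1 : measurable_fun setT (fun p => H p ^+ 2) by exact: measurable_funX.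
have h0 : forall q, ~ box B0.+1 q -> H q ^+ 2 = 0.
  move=> q nq; suff -> : H q = 0 by rewrite expr0n.
  apply/eqP; apply: contrapT => /negP /HB [k1 k2]; apply: nq.
  have lt1 (x : R) : `|x| <= B0%:R -> - B0.+1%:R <= x < B0.+1%:R.
    move=> hx; have h := le_lt_trans hx (_ : B0%:R < B0.+1%:R); rewrite ltr_nat in h.
    by move: (h (ltnSn _)); rewrite ltr_norml => /andP[/ltW -> ->].
  by rewrite /box/= !lt1.
apply: (@Rintegrable_supported R B0.+1 (fun p => H p ^+ 2) (M ^+ 2)) => // q.
by rewrite normrX lerXn2r// nnegrE.
Qed.

Lemma dilate_norm r : 0 < r -> \int[area2]_p (dilate r p ^+ 2) = r ^+ 2 * normH.
Proof.
move=> r0; rewrite /Rintegral.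
have mf : measurable_fun setT (fun p => (H p ^+ 2)%:E) by apply/measurable_EFinP; exact: measurable_funX.
rewrite (ge0_integral_scale r0 mf) ?fineM//; first by apply: integrable_fin_num => //; exact: Rintegrable_sqr_supported.
by move=> p; rewrite lee_fin sqr_ge0.
Qed.

Let mod_dilate r ep C : 0 < r -> (forall p q, `|H p - H q| <= ep + C * dist2 p q) ->
  forall p q, `|dilate r p - dilate r q| <= ep + C / r ^+ 2 * dist2 p q.
Proof.
move=> r0 h p q; apply: (le_trans (h _ _)); rewrite lerD2l le_eqVlt; apply/orP; left; apply/eqP.
rewrite /dist2/=; move: p.1 p.2 q.1 q.2 => x1 x2 x3 x4; field; by rewrite gt_eqF.
Qed.

Local Notation dbl r k := (\int[area2]_p \int[area2]_q (dilate r p * dilate r q * expR (- (k%:R * dist2 p q)))).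

(** Dilation turns the constant of the modulus into C / r^2, so at this scale the kernel acts like
    pi / k.+1 times a point mass. *)
Let dbl_cvg k (dl : R) : 0 < dl -> exists2 r0 : R, 1 <= r0 & forall r, r0 <= r ->
  `|r ^- 2 * dbl r k.+1 - pi / k.+1%:R * normH| <= dl.
Proof.
move=> dl0; have A0 : 0 <= M * V0 * pi by rewrite !mulr_ge0// pi_ge0.
(* The added 1 keeps the divisor positive when [M] is zero. *)
pose A1 := M * V0 * pi + 1; have A10 : 0 < A1 by rewrite ltr_wpDl.
pose ep := dl / (2 * A1); have ep0 : 0 < ep by rewrite divr_gt0// mulr_gt0.
have [C C0 hC] := modH ep0; exists (1 + 4 * C / ep); first by rewrite lerDl; apply: divr_ge0; [exact: mulr_ge0|exact: ltW].
move=> r hr; have C4 : 0 <= 4 * C / ep by apply: divr_ge0; [exact: mulr_ge0|exact: ltW].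
have r1 : 1 <= r by apply: le_trans hr; rewrite lerDl.
have r0 : 0 < r := lt_le_trans ltr01 r1.
have r2 : 0 < r ^+ 2 by rewrite exprn_gt0.
have k1 : 1 <= k.+1%:R :> R by rewrite ler1n.
have C2 : 0 <= C / r ^+ 2 by rewrite divr_ge0// ltW.
have h := double_integral_localization (measurable_dilate r) (dilateM r) (dilate_out r0) k1 (ltW ep0) C2 (mod_dilate r0 hC).
rewrite dilate_norm// in h.
have -> : r ^- 2 * dbl r k.+1 - pi / k.+1%:R * normH = r ^- 2 * (dbl r k.+1 - pi / k.+1%:R * (r ^+ 2 * normH)).
  rewrite mulrBr; congr (_ - _); rewrite mulrCA (mulrA (r ^- 2)) mulVf ?mul1r// gt_eqF//.
have ir0 : 0 <= r ^- 2 by rewrite invr_ge0 ltW.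
rewrite normrM (ger0_norm ir0).
have e1 : 4 * (C / r ^+ 2) <= ep.
  have h5 : 4 * C / ep <= r by apply: le_trans hr; rewrite lerDr.
  rewrite ler_pdivrMr// in h5.
  have h6 : r * ep <= r ^+ 2 * ep.
    by apply: ler_wpM2r; [exact: ltW|rewrite expr2 ler_peMr// ltW].
  by rewrite mulrA ler_pdivrMr//; lra.
have P0 := pi_ge0 R.
have e2 : pi * (ep + 4 * (C / r ^+ 2)) <= pi * (2 * ep) by apply: ler_wpM2l => //; lra.
have e3 : M * (2 * (hbox r)%:R) ^+ 2 <= M * (V0 * r ^+ 2) by apply: ler_wpM2l => //; exact: hbox_le.
have n1 : 0 <= M * (2 * (hbox r)%:R) ^+ 2 by rewrite mulr_ge0// sqr_ge0.
have n2 : 0 <= pi * (ep + 4 * (C / r ^+ 2)) by apply: mulr_ge0 => //; apply: addr_ge0; [exact: ltW|exact: mulr_ge0].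
apply: (le_trans (ler_wpM2l ir0 (le_trans h (ler_pM n1 n2 e3 e2)))).
have -> : r ^- 2 * (M * (V0 * r ^+ 2) * (pi * (2 * ep))) = M * V0 * pi * (2 * ep).
  by move: pi P0 => P _; field; rewrite gt_eqF.
have : 2 * ep * A1 = dl by rewrite /ep; field; rewrite gt_eqF.
have : M * V0 * pi * (2 * ep) <= A1 * (2 * ep) by apply: ler_wpM2r; [rewrite mulr_ge0// ltW|rewrite /A1 lerDl].
by lra.
Qed.

Definition clt_variance : R := normH * (4^-1 * (pi * riemann_zeta R 3)).

Local Notation gs r m n w := (gsum a b c e (@gpt R (hbox r) m) (@wt R (hbox r) r (dilate r) m) n w).

(** The truncation K is fixed first, then the level n, then the threshold for r, and last the
    mesh. *)
Lemma clt_second_moment (n0 : nat) (dl : R) : 0 < dl -> exists2 n : nat, (n0 <= n)%N & exists2 r0 : R, 1 <= r0 &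
  forall r, r0 <= r -> \forall m \near \oo, `|\int[Q]_w (gs r m n w ^+ 2) - clt_variance| <= dl.
Proof.
move=> dl0; have d4 : 0 < dl / 4 by rewrite divr_gt0.
pose lim K : R := \sum_(k < K) 4^-1 * k.+1%:R^-1 ^+ 2 * (pi / k.+1%:R * normH).
have cK : lim K @[K --> \oo] --> clt_variance.
  rewrite (_ : lim = fun K => normH * (4^-1 * (pi * \sum_(k < K) (k.+1%:R ^+ 3)^-1))).
    by apply: cvgMr; apply: cvgMr; apply: cvgMr; exact: zeta3_cvg.
  apply/funext => K; rewrite /lim !mulr_sumr; apply: eq_bigr => k _.
  move: (pi : R) (normH) => P N; field; by rewrite addrC natr1 pnatr_eq0.
have cT : 2 / K.+1%:R * D + K.+1%:R^-1 @[K --> \oo] --> (0 : R).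
  rewrite -[X in _ --> X](_ : (2 * 0) * D + 0 = 0); last by ring.
  by apply: (@cvgD _ R^o); [apply: cvgMl; apply: cvgMr|]; exact: cvg_harmonic.
have [K [hK1 hK2]] : exists K, `|clt_variance - lim K| < dl / 4 /\ 2 / K.+1%:R * D + K.+1%:R^-1 < dl / 4.
  have h1 : \forall K \near \oo, `|clt_variance - lim K| < dl / 4 by move/cvgrPdist_lt : cK; apply.
  have h2 : \forall K \near \oo, 2 / K.+1%:R * D + K.+1%:R^-1 < dl / 4 by apply: (cvgr_lt _ cT).
  have /filter_ex[K [? ?]] : \forall K \near \oo, `|clt_variance - lim K| < dl / 4 /\ 2 / K.+1%:R * D + K.+1%:R^-1 < dl / 4 by exact: filterI.
  by exists K.
pose S n : R := \sum_(k < K) 4^-1 * logcoef n k.+1 ^+ 2 * (pi / k.+1%:R * normH).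
have cS : S n @[n --> \oo] --> lim K.
  apply: cvg_big => [|k _]; first by apply: add_continuous.
  apply: cvgMl; apply: cvgMr; rewrite expr2 (_ : (fun n => _) = (fun n => logcoef n k.+1 * logcoef n k.+1))//.
  exact: (cvgM (@logcoef_cvg R k) (@logcoef_cvg R k)).
have [n [nn0 hn]] : exists n, (n0 <= n)%N /\ `|lim K - S n| < dl / 4.
  have h1 : \forall n \near \oo, `|lim K - S n| < dl / 4 by move/cvgrPdist_lt : cS; apply.
  have h2 : \forall n \near \oo, (n0 <= n)%N by exact: nbhs_infty_ge.
  have /filter_ex[n [? ?]] : \forall n \near \oo, (n0 <= n)%N /\ `|lim K - S n| < dl / 4 by exact: filterI.
  by exists n.
exists n => //.
have dK : 0 < dl / 4 / K.+1%:R by rewrite divr_gt0.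
have [r0 r01 hr0] : exists2 r0 : R, 1 <= r0 & forall r, r0 <= r -> forall k, (k < K)%N ->
    `|r ^- 2 * dbl r k.+1 - pi / k.+1%:R * normH| <= dl / 4 / K.+1%:R.
  move: (K.+1%:R) dK => KR dK.
  elim: K {hK1 hK2 S cS hn} => [|K' [r0 r01 hr0]]; first by exists 1.
  have [r0' r01' hr0'] := dbl_cvg K' dK.
  exists (r0 + r0') => [|r hr k]; first by lra.
  rewrite ltnS leq_eqVlt => /orP[/eqP ->|]; first by apply: hr0'; lra.
  by apply: hr0; lra.
exists r0 => // r hr; have r1 : 1 <= r := le_trans r01 hr.
have rp : 0 < r := lt_le_trans ltr01 r1.
have := gsum_second_moment HQ Hab Hce Hac rp (measurable_dilate r) (@continuous_dilate r) (dilateM r) (dilate_out rp) n K.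
apply: filterS => m; set X := \int[Q]_w _; set Z := \sum_(k < K) _ => hX.
have hZ : `|Z - S n| <= dl / 4.
  rewrite /Z /S -sumrB; apply: (le_trans (ler_norm_sum _ _ _)).
  apply: (@le_trans _ _ (\sum_(k < K) dl / 4 / K.+1%:R)).
    apply: ler_sum => k _; rewrite -mulrBr normrM -[leRHS]mul1r; apply: ler_pM => //; last exact: hr0.
    have l0 := @logcoef_ge0 R n k.+1; have l2 := @logcoef_le2 R n k.
    have l3 : 2 / k.+1%:R <= 2 :> R by rewrite ler_pdivrMr// ler_peMr// ler1n.
    rewrite ger0_norm ?mulr_ge0 ?sqr_ge0//; have := le_trans l2 l3.
    by move: (logcoef n k.+1) l0 => x x0 x2; rewrite expr2; nra.
  rewrite sumr_const card_ord -[leLHS]mulr_natr mulrAC ler_pdivrMr//.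
  by apply: ler_wpM2l; [exact: ltW|rewrite ler_nat].
have hD : 2 / K.+1%:R * pair_bound (hbox r) r M <= 2 / K.+1%:R * D.
  by apply: ler_wpM2l; [rewrite divr_ge0|exact: pair_le].
have hXZ : `|X - Z| < dl / 4.
  by apply: (le_lt_trans hX); apply: le_lt_trans hK2; rewrite lerD2r.
have -> : X - clt_variance = (X - Z) + ((Z - S n) + ((S n - lim K) + (lim K - clt_variance))) by ring.
have t1 := ler_normD (X - Z) ((Z - S n) + ((S n - lim K) + (lim K - clt_variance))).
have t2 := ler_normD (Z - S n) ((S n - lim K) + (lim K - clt_variance)).
have t3 := ler_normD (S n - lim K) (lim K - clt_variance).
have s1 : `|S n - lim K| = `|lim K - S n| by exact: distrC.
have s2 : `|lim K - clt_variance| = `|clt_variance - lim K| by exact: distrC.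
rewrite s1 in t3; rewrite s2 in t3.
apply: (le_trans t1); apply: (le_trans (lerD (ltW hXZ) t2)).
apply: (le_trans (lerD (lexx _) (lerD hZ t3))).
apply: (le_trans (lerD (lexx _) (lerD (lexx _) (lerD (ltW hn) (ltW hK1))))).
by rewrite le_eqVlt; apply/orP; left; apply/eqP; field.
Qed.

Let gbound_ge0 n : 0 <= gbound n :> R.
Proof. by apply: sumr_ge0 => j _; rewrite mulr_ge0. Qed.

Let meshL_ge0 n : 0 <= meshL n :> R.
Proof.
apply: mulr_ge0 => //; apply: sumr_ge0 => i _; apply: sumr_ge0 => j _.
by rewrite !mulr_ge0 ?invr_ge0// ltW// sgrid_gt0.
Qed.

Variable Y : R -> seqR R -> R.
Hypothesis YE : forall r w, Y r w = r^-1 * fine (\int[area2]_p ((dilate r p)%:E * potat a b c e w p))%E.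
Hypothesis mY : forall r, measurable_fun setT (Y r).

(** At fixed [r], the level [n] and the tolerance [ep] of the modulus make two error terms at most
    dl / 4; a fine mesh brings the sum of the others below dl / 2. *)
Lemma clt_L1_approx (r : R) (n0 : nat) (dl : R) : 1 <= r -> 0 < dl -> exists2 n : nat, (n0 <= n)%N &
  \forall m \near \oo, (\int[Q]_w (`|Y r w - gs r m n w|)%:E <= dl%:E)%E.
Proof.
move=> r1 dl0; have r0 : 0 < r := lt_le_trans ltr01 r1.
pose W : R := r^-1 * (2 * (hbox r)%:R) ^+ 2.
have W0 : 0 <= W by rewrite mulr_ge0 ?invr_ge0 ?sqr_ge0// ltW.
have WM0 : 0 <= W * M by rewrite mulr_ge0.
pose ep' := (dl / (4 * (W * M + 1))) ^+ 2.
have ep'1 : 0 < dl / (4 * (W * M + 1)) by rewrite divr_gt0// mulr_gt0// ltr_wpDl.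
have ep'0 : 0 < ep' by rewrite exprn_gt0.
have [n1 hn1] := logcoef_cauchy ep'0.
exists (maxn n0 n1); first exact: leq_maxl.
set n := maxn n0 n1.
have hep n' : (n <= n')%N -> forall K, \sum_(k < K) 4^-1 * (logcoef n k.+1 - logcoef n' k.+1) ^+ 2 <= ep'.
  by move=> nn'; apply: hn1; [exact: leq_maxr|exact: leq_trans (leq_maxr _ _) nn'].
have Wg0 : 0 <= W * gbound n by rewrite mulr_ge0.
pose ep : R := dl / (4 * (W * gbound n + 1)).
have ep0 : 0 < ep by rewrite divr_gt0// mulr_gt0// ltr_wpDl.
have [C C0 hC] := modH ep0.
have C2 : 0 <= C / r ^+ 2 by rewrite divr_ge0// sqr_ge0.
pose t m : R := 2 / m.+1%:R ^+ 2.
have ct : t m @[m --> \oo] --> (0 : R).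
  rewrite -[X in _ --> X](_ : 2 * (0 * 0) = 0); last by ring.
  rewrite (_ : t = fun m => 2 * (m.+1%:R^-1 * m.+1%:R^-1)).
    by apply: cvgMr; apply: cvgM; exact: cvg_harmonic.
  by apply/funext => m; rewrite /t -exprVn expr2.
have cs : W * M * Num.sqrt (2 * meshL n * t m) + W * (C / r ^+ 2) * gbound n * t m @[m --> \oo] --> (0 : R).
  rewrite -[X in _ --> X](_ : W * M * Num.sqrt (2 * meshL n * 0) + W * (C / r ^+ 2) * gbound n * 0 = 0); last first.
    by rewrite !mulr0 sqrtr0 mulr0 addr0.
  apply: (@cvgD _ R^o); last exact: (cvgMr ct).
  apply: cvgMr; have ct' : 2 * meshL n * t m @[m --> \oo] --> 2 * meshL n * 0 by exact: (cvgMr ct).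
  exact: (cvg_comp _ (@Num.sqrt R) ct' (@sqrt_continuous R _)).
have dl2 : 0 < dl / 2 by rewrite divr_gt0.
have near1 : \forall m \near \oo, W * M * Num.sqrt (2 * meshL n * t m) + W * (C / r ^+ 2) * gbound n * t m < dl / 2.
  by apply: (cvgr_lt _ cs).
apply: filterS near1 => m hm.
have h := gsum_L1_dist HQ Hab Hce Hac r0 (measurable_dilate r) (dilateM r) (dilate_out r0) (ltW ep0) C2 (mod_dilate r0 hC) m (YE r) hep.
apply: (le_trans h); rewrite lee_fin -/(t m).
have s1 : Num.sqrt ep' = dl / (4 * (W * M + 1)) by rewrite sqrtr_sqr ger0_norm// ltW.
have e1 : W * M * Num.sqrt ep' <= dl / 4.
  have -> : dl / 4 = (W * M + 1) * Num.sqrt ep' by rewrite s1; field; rewrite gt_eqF// ltr_wpDl.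
  by apply: ler_wpM2r; [exact: sqrtr_ge0|rewrite lerDl].
have e2 : W * gbound n * ep <= dl / 4.
  have -> : dl / 4 = (W * gbound n + 1) * ep by rewrite /ep; field; rewrite gt_eqF// ltr_wpDl.
  by apply: ler_wpM2r; [exact: ltW|rewrite lerDl].
have -> : r^-1 * ((M * (Num.sqrt ep' + Num.sqrt (2 * meshL n * t m)) + (ep + C / r ^+ 2 * t m) * gbound n) * (2 * (hbox r)%:R) ^+ 2) =
  W * M * Num.sqrt ep' + (W * gbound n * ep + (W * M * Num.sqrt (2 * meshL n * t m) + W * (C / r ^+ 2) * gbound n * t m)).
  by rewrite /W; move: (C / r ^+ 2) (Num.sqrt ep') (Num.sqrt _) (r^-1) ((2 * _) ^+ 2) => x1 x2 x3 x4 x5; ring.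
lra.
Qed.

(** At a fixed level the total weight is at most [Lt * r] and the row sums are at most [Et / r], so
    the Stein error is [A / r], uniformly in the mesh. *)
Lemma clt_stein n (g : R -> R) (Mg sd tau : R) : 0 < sd -> continuous g -> (forall x, `|g x| <= Mg) -> 0 < tau ->
  exists2 r0 : R, 1 <= r0 & forall r, r0 <= r -> forall m,
  `|\int[Q]_w g (gs r m n w) - \int[normal_prob 0 sd]_x g x| <=
  4 * Mg / sd ^+ 2 * `|\int[Q]_w (gs r m n w ^+ 2) - sd ^+ 2| + tau.
Proof.
move=> sd0 cg gM tau0; have Mg0 : 0 <= Mg := le_trans (normr_ge0 _) (gM 0).
pose Et : R := (gbound n * M + 1) * (E0 + 1); pose Lt : R := gbound n * (M * V0).
have gM0 : 0 <= gbound n * M by rewrite mulr_ge0.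
have Et0 : 0 < Et by rewrite mulr_gt0// ltr_wpDl.
have Lt0 : 0 <= Lt by rewrite mulr_ge0// mulr_ge0.
pose A : R := 2 * (4 * Mg / sd ^+ 2) * (16 * pi * n.+1%:R ^+ 2 * Num.sqrt (Lt * Et ^+ 3)).
have A0 : 0 <= A.
  apply: mulr_ge0; first by apply: mulr_ge0 => //; apply: divr_ge0; [exact: mulr_ge0|exact: sqr_ge0].
  apply: mulr_ge0; last exact: sqrtr_ge0.
  by apply: mulr_ge0; [apply: mulr_ge0 => //; exact: pi_ge0|exact: sqr_ge0].
exists (1 + A / tau); first by rewrite lerDl divr_ge0// ltW.
move=> r hr m; have At : 0 <= A / tau by rewrite divr_ge0// ltW.
have r1 : 1 <= r by apply: le_trans hr; rewrite lerDl.
have r0 : 0 < r := lt_le_trans ltr01 r1.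
have sE (i : (gidx (hbox r) m * gidx (hbox r) m) * 'I_(Jgrid n)) : 0 < (sgrid n i.2 : R) <= n.+1%:R.
  by rewrite sgrid_gt0 sgrid_le.
have gccE (F : gidx (hbox r) m * gidx (hbox r) m -> R) :
    \sum_l `|@gcc R _ (@wt R (hbox r) r (dilate r) m) n l| * F l.1 =
    gbound n * \sum_l `|@wt R (hbox r) r (dilate r) m l| * F l.
  rewrite mulrC mulr_suml -(pair_bigA _ (fun i (j : 'I_(Jgrid n)) => `|@gcc R _ (@wt R (hbox r) r (dilate r) m) n (i, j)| * F i))/=.
  apply: eq_bigr => i _; rewrite /gbound mulr_sumr; apply: eq_bigr => j _; rewrite /gcc/= !normrM normrN.
  rewrite (ger0_norm (_ : 0 <= 2^-1))// (ger0_norm (_ : 0 <= j.+1%:R^-1))//; ring.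
have eta_ge (i : (gidx (hbox r) m * gidx (hbox r) m) * 'I_(Jgrid n)) :
    \sum_j `|@gcc R _ (@wt R (hbox r) r (dilate r) m) n j| * expR (- (nsq (gpt i.1 - gpt j.1) / 2)) <= Et / r.
  rewrite (gccE (fun l => expR (- (nsq (gpt i.1 - gpt l) / 2)))).
  rewrite /gpt; under eq_bigr do rewrite nsq_toC.
  apply: (le_trans (ler_wpM2l (gbound_ge0 n) (row_le m _ r1))).
  have k1 : gbound n * M <= gbound n * M + 1 by rewrite lerDl.
  have k2 : E0 <= E0 + 1 by rewrite lerDl.
  have k3 := ler_pM gM0 E00 k1 k2.
  have -> : gbound n * (M * E0 / r) = gbound n * M * E0 / r by rewrite !mulrA.
  by apply: ler_wpM2r => //; rewrite invr_ge0 ltW.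
have Lam_ge : \sum_i `|@gcc R _ (@wt R (hbox r) r (dilate r) m) n i| <= Lt * r.
  have := gccE (fun=> 1); under eq_bigr do rewrite mulr1; move=> ->.
  under eq_bigr do rewrite mulr1.
  by rewrite /Lt -mulrA; apply: ler_wpM2l => //; exact: sum_le.
have Etr : 0 < Et / r by rewrite divr_gt0.
have := normal_approx_fsum HQ Hab Hce Hac sE Etr eta_ge Lam_ge sd0 cg gM.
have -> : \int[Q]_x g (fsum a b c e (fun l : (gidx (hbox r) m * gidx (hbox r) m) * 'I_(Jgrid n) => gpt l.1)
   (@gcc R _ (@wt R (hbox r) r (dilate r) m) n) (fun l => sgrid n l.2) x) = \int[Q]_w g (gs r m n w).
  by apply: eq_Rintegral => w _; rewrite gsumE.
have -> : \int[Q]_x (fsum a b c e (fun l : (gidx (hbox r) m * gidx (hbox r) m) * 'I_(Jgrid n) => gpt l.1)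
   (@gcc R _ (@wt R (hbox r) r (dilate r) m) n) (fun l => sgrid n l.2) x ^+ 2) = \int[Q]_w (gs r m n w ^+ 2).
  by apply: eq_Rintegral => w _; rewrite gsumE.
move=> /le_trans; apply; rewrite lerD2l /stein_err.
have -> : Num.sqrt (Lt * r * (Et / r) ^+ 3) = Num.sqrt (Lt * Et ^+ 3) / r.
  have -> : Lt * r * (Et / r) ^+ 3 = Lt * Et ^+ 3 * r^-1 ^+ 2 by field; rewrite gt_eqF.
  rewrite sqrtrM; last by rewrite mulr_ge0// exprn_ge0// ltW.
  by rewrite sqrtr_sqr ger0_norm// invr_ge0 ltW.
have -> : 2 * (4 * Mg / sd ^+ 2) * (16 * pi * n.+1%:R ^+ 2 * (Num.sqrt (Lt * Et ^+ 3) / r)) = A / r.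
  by rewrite /A !mulrA.
rewrite ler_pdivrMr// mulrC -ler_pdivrMr//; apply: le_trans hr; by rewrite lerDr.
Qed.

(** Level [n], fixed before [r], serves the variance and the Stein bound; level [n'], depending on
    [r], serves the L^1 distance to [Y r]. Both exceed [n0], so their distance is small uniformly in
    [r]. *)
Lemma central_limit (g : R -> R) (Mg : R) : 0 < clt_variance -> continuous g -> (forall x, `|g x| <= Mg) ->
  forall tau, 0 < tau -> exists r0 : R, forall r, r0 <= r ->
  `|\int[Q]_w g (Y r w) - \int[normal_prob 0 (Num.sqrt clt_variance)]_x g x| <= tau.
Proof.
move=> v0 cg gM tau tau0; set v := clt_variance in v0 *; set sd := Num.sqrt v.
have Mg0 : 0 <= Mg := le_trans (normr_ge0 _) (gM 0).
have sd0 : 0 < sd by rewrite sqrtr_gt0.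
have sd2 : sd ^+ 2 = v by rewrite sqr_sqrtr// ltW.
(* One share for the quadratic term of [bounded_modulus], two for the L^1 distances, one for the
   second moment and one for [clt_stein]. *)
have tau5 : 0 < tau / 5 by rewrite divr_gt0.
pose ee := tau / 5 / (2 + v); have ee0 : 0 < ee by rewrite divr_gt0// addr_gt0.
have [C C0 hC] := bounded_modulus cg gM ee0.
have C1 : 0 < C + 1 by rewrite ltr_wpDl.
pose dl1 := tau / 5 / (C + 1); have dl10 : 0 < dl1 by rewrite divr_gt0.
(* Makes the distance sqrt (ep D) between the two levels at most [dl1]. *)
pose ep := dl1 ^+ 2 / (D + 1).
have D1 : 0 < D + 1 by rewrite ltr_wpDl.
have ep0 : 0 < ep by rewrite divr_gt0// exprn_gt0.
have [n0 hn0] := logcoef_cauchy ep0.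
have Mg1 : 0 < Mg + 1 by rewrite ltr_wpDl.
(* The bound 1 keeps the second moment below 1 + v; the other bound makes the variance term of
   [clt_stein] at most tau / 5. *)
pose dl2 := Num.min 1 (v * (tau / 5) / (4 * (Mg + 1))).
have dl20 : 0 < dl2 by rewrite lt_min ltr01/=; apply: divr_gt0; exact: mulr_gt0.
have [n nn0 [r1 r11 hr1]] := clt_second_moment n0 dl20.
have [r2 r21 hr2] := clt_stein n sd0 cg gM tau5.
exists (r1 + r2) => r hr.
have rr1 : r1 <= r by apply: le_trans hr; rewrite lerDl (le_trans _ r21).
have rr2 : r2 <= r by apply: le_trans hr; rewrite lerDr (le_trans _ r11).
have r1' : 1 <= r := le_trans r11 rr1.
have [n' nn0' hL] := clt_L1_approx n0 r1' dl10.
have hr1' := hr1 _ rr1.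
have /filter_ex[m [h1 h2]] : \forall m \near \oo, (\int[Q]_w (`|Y r w - gs r m n' w|)%:E <= dl1%:E)%E /\
    `|\int[Q]_w (gs r m n w ^+ 2) - clt_variance| <= dl2 by exact: filterI.
pose f w := gs r m n w; pose f' w := gs r m n' w.
have bf : bmeas f by exact: bmeas_gsum.
have bf' : bmeas f' by exact: bmeas_gsum.
have iff : Rintegrable Q (fun w => `|f w - f' w|).
  by apply: Rintegrable_norm; apply: RintegrableB; exact: bmeas_int.
have mYf : measurable_fun setT (fun w => Y r w - f' w) by apply: measurable_funB => //; exact: bf'.1.
have iY : Rintegrable Q (fun w => `|Y r w - f' w|).
  apply: Rintegrable_norm; apply/integrableP; split; first exact/measurable_EFinP.
  under eq_integral do rewrite abse_EFin.
  exact: le_lt_trans h1 (ltry _).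
have hY : \int[Q]_w `|Y r w - f' w| <= dl1.
  by rewrite -lee_fin /Rintegral fineK//; exact: integrable_fin_num.
have hff : \int[Q]_w `|f w - f' w| <= dl1.
  have bd : bmeas (fun w => f w - f' w).
    have := bmeasD bf (bmeasM (bmeas_cst (-1)) bf').
    by rewrite (_ : (fun w => _) = (fun w => f w - f' w))//; apply/funext => w; rewrite mulN1r.
  apply: (le_trans (L1_le_L2 Q bd)).
  rewrite -[leRHS](ger0_norm (ltW dl10)) -sqrtr_sqr; apply: ler_wsqrtr.
  have hep : forall K, \sum_(k < K) 4^-1 * (logcoef n k.+1 - logcoef n' k.+1) ^+ 2 <= ep by exact: hn0.
  apply: (le_trans (gsum_dist_le HQ Hab Hce Hac _ _ hep)).
  apply: (@le_trans _ _ (ep * D)).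
    apply: ler_wpM2l; first exact: ltW.
    rewrite /gpt; under eq_bigr do under eq_bigr do rewrite nsq_toC.
    apply: (le_trans _ (pair_le r1')); apply: pair_wt_le; [exact: lt_le_trans r1'|exact: dilateM].
  rewrite /ep mulrAC ler_pdivrMr//; apply: ler_wpM2l; first exact: sqr_ge0.
  by rewrite lerDl.
have if2 : Rintegrable Q (fun w => f w ^+ 2).
  by apply: (eq_Rintegrable (f := fun w => f w * f w)) => //; apply: bmeas_int; exact: bmeasM.
have mgc : measurable_fun setT g by exact: continuous_measurable_fun.
have igY : Rintegrable Q (fun w => g (Y r w)).
  by apply: (@Rintegrable_bounded _ _ _ Q _ Mg) => //; exact: (measurableT_comp mgc (mY r)).
have igf : Rintegrable Q (fun w => g (f w)).
  by apply: (@Rintegrable_bounded _ _ _ Q _ Mg) => //; exact: (measurableT_comp mgc bf.1).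
have i1 : Rintegrable Q (fun w => ee * (1 + f w ^+ 2)).
  by apply: RintegrableZ; apply: RintegrableD => //; exact: Rintegrable_cst.
have i2 : Rintegrable Q (fun w => C * (`|f w - f' w| + `|Y r w - f' w|)).
  by apply: RintegrableZ; exact: RintegrableD.
have key : `|\int[Q]_w g (Y r w) - \int[Q]_w g (f w)| <= ee * (1 + \int[Q]_w (f w ^+ 2)) +
    C * (\int[Q]_w `|f w - f' w| + \int[Q]_w `|Y r w - f' w|).
  rewrite -(RintegralB measurableT igY igf).
  apply: (le_trans (Rintegral_le_norm (RintegrableB igY igf) (RintegrableD i1 i2) _)).
    move=> w; rewrite distrC; apply: (le_trans (hC _ _)); rewrite lerD2l; apply: ler_wpM2l => //.
    by rewrite (distrC (Y r w)); exact: ler_distD.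
  rewrite (RintegralD measurableT i1 i2).
  rewrite (RintegralZl _ measurableT (RintegrableD (Rintegrable_cst Q 1) if2)).
  rewrite (RintegralD measurableT (Rintegrable_cst Q 1) if2) Rintegral_cst1.
  by rewrite (RintegralZl _ measurableT (RintegrableD iff iY)) (RintegralD measurableT iff iY).
have st := hr2 _ rr2 m; rewrite sd2 -/(f _) in st.
have s2 : `|\int[Q]_w (f w ^+ 2) - v| <= dl2 := h2.
have dle1 : dl2 <= 1 by rewrite ge_min lexx.
have dle2 : 4 * Mg / v * dl2 <= tau / 5.
  have m0 : 0 <= 4 * Mg / v by apply: divr_ge0; [exact: mulr_ge0|exact: ltW].
  have : dl2 <= v * (tau / 5) / (4 * (Mg + 1)) by rewrite ge_min lexx orbT.
  move=> /(ler_wpM2l m0) /le_trans; apply.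
  have -> : 4 * Mg / v * (v * (tau / 5) / (4 * (Mg + 1))) = tau / 5 * (Mg / (Mg + 1)).
    by field; rewrite !gt_eqF.
  by rewrite ler_piMr ?(ltW tau5)// ler_pdivrMr// mul1r lerDl.
have m0 : 0 <= 4 * Mg / v by apply: divr_ge0; [exact: mulr_ge0|exact: ltW].
have st2 : 4 * Mg / v * `|\int[Q]_w (f w ^+ 2) - v| <= tau / 5 by apply: le_trans dle2; apply: ler_wpM2l.
have t1 : ee * (1 + \int[Q]_w (f w ^+ 2)) <= tau / 5.
  have -> : tau / 5 = ee * (2 + v) by rewrite /ee; field; rewrite gt_eqF// addr_gt0.
  apply: ler_wpM2l; first exact: ltW.
  move: (le_trans s2 dle1); rewrite ler_norml => /andP[_]; rewrite lerBlDr => h3.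
  by rewrite (_ : 2 + v = 1 + (1 + v)) ?lerD2l//; ring.
have Cd : C * dl1 <= tau / 5.
  have -> : tau / 5 = (C + 1) * dl1 by rewrite /dl1; field; rewrite gt_eqF.
  by apply: ler_wpM2r; [exact: ltW|rewrite lerDl].
have t2 : C * (\int[Q]_w `|f w - f' w| + \int[Q]_w `|Y r w - f' w|) <= C * (dl1 + dl1).
  by apply: ler_wpM2l => //; exact: lerD.
have := ler_normD (\int[Q]_w g (Y r w) - \int[Q]_w g (f w)) (\int[Q]_w g (f w) - \int[normal_prob 0 sd]_x g x).
rewrite subrKA => /le_trans; apply.
have k1 : C * (dl1 + dl1) <= tau / 5 + tau / 5 by rewrite mulrDr; exact: lerD.
have k2 := le_trans key (lerD t1 (le_trans t2 k1)).
apply: (le_trans (lerD k2 (le_trans st (lerD st2 (lexx _))))).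
by rewrite le_eqVlt; apply/orP; left; apply/eqP; field.
Qed.

End central_limit.

(** * Identification of the variance and the limit theorem *)

Lemma riemann_zeta3_gt0 (R : realType) : 0 < riemann_zeta R 3.
Proof.
apply: (@lt_le_trans _ _ 1) => //; have h := @zeta3_cvg R.
rewrite -(cvg_lim (@Rhausdorff R) h); apply: limr_ge; first by apply/cvg_ex; exists (riemann_zeta R 3).
exists 1%N => // -[//|K] _; rewrite big_ord_recl/= expr1n invr1 lerDl.
by apply: sumr_ge0 => k _; rewrite invr_ge0 exprn_ge0.
Qed.

Lemma sqnormL2E (R : realType) (h : R[i]^o -> R) : continuous h ->
  sqnormL2 h = normH (fun p => h (toC p)).
Proof.
move=> h_cont; rewrite /sqnormL2 /normH /Rintegral; congr fine.
rewrite -(integral_areaC (F := fun p => (h (toC p) ^+ 2)%:E)).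
  by apply: eq_integral => z _; rewrite ofCK.
apply/measurable_EFinP; apply: measurable_funX; have := measurable_hscaled h_cont 1.
by congr (measurable_fun _ _); apply/funext => p; rewrite invr1 mul1r.
Qed.

Lemma sigmaX_sqr (R : realType) : (sigmaX : R) ^+ 2 = 4^-1 * (pi * riemann_zeta R 3).
Proof.
rewrite /sigmaX exprMn sqr_sqrtr; last by rewrite mulr_ge0 ?pi_ge0// ltW// riemann_zeta3_gt0.
by congr (_ * _); field.
Qed.

Theorem mainTheorem6 (R : realType) (d : measure_display) (T : measurableType d)
  (P : probability T R) (zeta : nat -> {RV P >-> borelC R})
  (zeta_iid : iid zeta) (zeta_normal : forall k, standard_normalC (zeta k))
  (h : R[i]^o -> R) (h_cont : continuous h) (h_supp : compactly_supported h) :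
  let Y (r : R) : T -> measurableTypeR R :=
    fun w => linear_statistic h (fun k => zeta k w) r in
  (forall r : R, 0 < r -> measurable_fun setT (Y r)) /\
  cvg_weakly (fun r => pushforward P (Y r))
             (centered_normal (sqnormL2 h * sigmaX ^+ 2)).
Proof.
move=> Y.
have [a [b [c [e [Q [coef [HQ [Hab Hce Hac] mcoef QE zetaE]]]]]]] := gaussian_coordinates zeta_iid zeta_normal.
pose L r (w : seqR R) : measurableTypeR R := linear_statistic h (gcoef a b c e w) r.
have YL r : Y r = L r \o coef.
  by apply/funext => w; rewrite /Y /L/=; congr (linear_statistic h _ r); apply/funext => k; exact: zetaE.
have mL r : measurable_fun setT (L r) by exact: measurable_linear_statistic.
have mY r : measurable_fun setT (Y r) by rewrite YL; exact: measurableT_comp.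
split => [r _|g cg [Mg gM]]; first exact: mY.
pose H (p : measurableTypeR R * measurableTypeR R) : R := h (toC p).
have H1 : H = fun p => h (1%:C * (toC p : R[i])) by apply/funext => p; rewrite mul1r.
have mH : measurable_fun setT H.
  by have := measurable_hscaled h_cont 1; rewrite invr1 -H1.
have cH : continuous (fun p : R * R => H p).
  have := @continuous_hscaled R h h_cont 1.
  by rewrite (_ : (fun p => _) = (fun p : R * R => H p))//; apply/funext => p; rewrite /H mul1r.
have [M M0 HM] := h_bounded h_cont h_supp.
have [B HB] := support_box h_supp.
have modH := h_modulus h_cont h_supp.
have LE r w : L r w = r^-1 * fine (\int[area2]_p ((dilate H r p)%:E * potat a b c e w p))%E.
  rewrite /L linear_statisticE//; congr (_ * fine _); apply: eq_integral => -[x y] _.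
  by congr ((h _)%:E * _)%E; rewrite /toC/=; simpc.
have mg : measurable_fun setT (fun x : measurableTypeR R => (g x)%:E).
  by apply/measurable_EFinP; exact: continuous_measurable_fun.
have igP d' (T' : measurableType d') (P' : probability T' R) (f : T' -> measurableTypeR R) :
    measurable_fun setT f -> Rintegrable P' (fun x => g (f x)).
  move=> mf; apply: (@Rintegrable_bounded _ _ _ P' _ Mg) => //.
  by apply: measurableT_comp mf; exact: continuous_measurable_fun.
(* [Y r] factors through [coef], whose law is [Q]. *)
have intE r : (\int[pushforward P (Y r)]_x (g x)%:E = \int[Q]_w (g (L r w))%:E)%E.
  rewrite (integral_pushforward (mY r) mg)//; last exact: igP.
  rewrite preimage_setT; transitivity (\int[pushforward P coef]_w (g (L r w))%:E)%E.
    have mgL : measurable_fun setT (fun w => (g (L r w))%:E) by exact: (measurableT_comp mg (mL r)).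
    have iL := igP _ _ P _ (measurableT_comp (mL r) mcoef).
    have e1 := @integral_pushforward _ _ _ _ _ coef mcoef P setT (fun w => (g (L r w))%:E) mgL.
    rewrite preimage_setT in e1.
    have e2 := e1 iL measurableT.
    transitivity (\int[P]_w ((fun w => (g (L r w))%:E) \o coef) w)%E; last exact: esym e2.
    by apply: eq_integral => w _; rewrite YL.
  by apply: eq_measure_integral => A mA _; exact: esym (QE A mA).
have vE : sqnormL2 h * sigmaX ^+ 2 = clt_variance H by rewrite sqnormL2E// sigmaX_sqr.
(* A zero variance means that [h] vanishes almost everywhere; the statistic is then exactly 0 for r
   > 0 and its law is the point mass at 0. *)
rewrite /centered_normal vE; have [v0|v0] := eqVneq (clt_variance H) 0.
  have n0 : normH H = 0.
    move/eqP : v0; rewrite /clt_variance mulf_eq0 => /orP[/eqP //|].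
    by rewrite !mulf_eq0 invr_eq0 pnatr_eq0/= !gt_eqF ?pi_gt0 ?riemann_zeta3_gt0.
  have L0 r w : 0 < r -> L r w = 0.
    move=> r0; rewrite LE (ae_eq_integral (cst 0%E)) ?integral0 ?fine0 ?mulr0//.
      apply: emeasurable_funM; first by apply/measurable_EFinP; exact: measurable_dilate.
      exact: measurableT_comp (measurable_potat a b c e) (measurable_pair1 w).
    have md : measurable_fun setT (fun p => (dilate H r p ^+ 2)%:E).
      by apply/measurable_EFinP; apply: measurable_funX; exact: measurable_dilate.
    have iz : (\int[area2]_p `|(dilate H r p ^+ 2)%:E| = 0)%E.
      rewrite (eq_integral (fun p => (dilate H r p ^+ 2)%:E)); last first.
        by move=> p _; rewrite gee0_abs// lee_fin sqr_ge0.
      have mH2 : measurable_fun setT (fun p => (H p ^+ 2)%:E) by apply/measurable_EFinP; exact: measurable_funX.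
      rewrite (ge0_integral_scale r0 mH2); last by move=> p; rewrite lee_fin sqr_ge0.
      have fH : (\int[area2]_p (H p ^+ 2)%:E = (normH H)%:E)%E.
        by rewrite /normH /Rintegral fineK//; apply: integrable_fin_num => //; exact: (Rintegrable_sqr_supported mH HM HB).
      by rewrite fH n0 mule0.
    have := (ae_eq_integral_abs area2 measurableT md).1 iz.
    apply: filterS => p /(_ I) [] /eqP; rewrite sqrf_eq0 => /eqP -> _.
    by rewrite mul0e.
  rewrite integral_dirac// diracT mul1e.
  apply: (@cvg_trans _ ((fun=> (g 0)%:E) x @[x --> +oo])); last exact: cvg_cst.
  apply: near_eq_cvg; exists 0; split; first exact: num_real.
  move=> r r0 /=; rewrite intE; apply/esym.
  rewrite (eq_integral (fun=> (g 0)%:E)); last by move=> w _; rewrite L0.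
  by rewrite integral_cst// [X in (_ * X)%E](@probability_setT _ _ _ Q) mule1.
have z0 : 0 < riemann_zeta R 3 by exact: riemann_zeta3_gt0.
have vp : 0 < clt_variance H.
  rewrite lt_neqAle eq_sym v0/= /clt_variance mulr_ge0//; last by rewrite !mulr_ge0 ?pi_ge0// ltW.
  by apply: Rintegral_ge0 => p _; exact: sqr_ge0.
have clt := central_limit HQ Hab Hce Hac mH cH HM HB modH LE mL vp cg gM.
have fin d' (T' : measurableType d') (P' : probability T' R) (f : T' -> measurableTypeR R) :
    measurable_fun setT f -> (\int[P']_x (g (f x))%:E = (\int[P']_x g (f x))%:E)%E.
  by move=> mf; rewrite /Rintegral fineK//; apply: integrable_fin_num => //; exact: igP.
rewrite (fin _ _ (normal_prob 0 (Num.sqrt (clt_variance H))) id)//.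
rewrite (_ : (fun r => _) = fun r => (\int[Q]_w g (L r w))%:E); last first.
  by apply/funext => r; rewrite intE fin.
apply: cvg_EFin; first exact: nearW.
apply/cvgrPdist_le => tau tau0; have [r0 hr0] := clt _ tau0.
exists r0; split; first exact: num_real.
by move=> r /ltW /hr0; rewrite distrC.
Qed.
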